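(* Let $n\ge 3$ and let $S$ be a smooth, oriented, compact real submanifold of $\mathbb{C}^n$ of real codimension $2$, all of whose complex points are flat and either special elliptic or special $1$-hyperbolic. Then $$\sharp\{\text{special elliptic points of } S\}-\sharp\{\text{special } 1\text{-hyperbolic points of } S\}=\chi(S),$$ where $\chi(S)$ is the Euler–Poincaré characteristic of $S$. In particular, if $S$ is a sphere, this number is $2$.
   Context: Let $S\subset\mathbb{C}^n$ be a smooth real submanifold of dimension $2n-2$. A point $p\in S$ is a complex point if $T_pS$ is a complex hyperplane of $T_p\mathbb{C}^n$. In suitable local holomorphic coordinates $(z,w)\in\mathbb{C}^{n-1}\times\mathbb{C}$ vanishing at a complex point $p$, $S$ is given by $w=Q(z)+O(|z|^3)$, $Q(z)=\sum_{i,j}(a_{ij}z_iz_j+b_{ij}z_i\overline z_j+c_{ij}\overline z_i\overline z_j)$. The complex point $p$ is flat if there is $\lambda\in\mathbb{C}$ with $\sum b_{ij}z_i\overline z_j\in\lambda\mathbb{R}$ for all $z$. A flat complex point $p$ is special if in suitable holomorphic coordinates centered at $p$ one has $Q(z)=\sum_{j=1}^{n-1}(z_j\overline z_j+\lambda_j\,\mathrm{Re}\,z_j^2)$ with $\lambda_j\ge 0$. It is special elliptic if $0\le\lambda_j<1$ for all $j$, and special $1$-hyperbolic if $\lambda_j>1$ for exactly one $j$ and $0\le\lambda_j<1$ for the others. *)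

(* Defs.v *)
From HB Require Import structures.
From mathcomp Require Import all_boot all_order all_algebra finmap.
From mathcomp Require Export complex.
From mathcomp Require Import all_classical all_reals all_analysis.

Set Implicit Arguments.
Unset Strict Implicit.
Unset Printing Implicit Defensive.

Import Order.TTheory GRing.Theory Num.Theory.
Import numFieldNormedType.Exports.

Local Open Scope classical_set_scope.
Local Open Scope ring_scope.
Local Open Scope complex_scope.

(* The field R[i] with its topology and norm; the balls of the norm have radii
   in R[i], necessarily positive reals, so that this is the usual topology. *)
Notation C R := (R[i] : numFieldType).

Section Smooth.
Context {R : realType}.

Fixpoint Ck (V W : normedModType R) (k : nat) (U : set V) (f : V -> W) : Prop :=
  match k with
  | 0 => forall x, U x -> {for x, continuous f}
  | k'.+1 => (forall x, U x -> differentiable f x) /\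
             (forall v, Ck k' U (fun x => 'D_v f x))
  end.

Definition smooth (V W : normedModType R) (U : set V) (f : V -> W) : Prop :=
  forall k, Ck k U f.

End Smooth.

Section Submanifold.
Context {R : realType} {n : nat}.

(* The identification C^n = R^(2n), z |-> (Re z, Im z). *)
Definition realify (z : 'rV[C R]_n) : 'rV[R]_(n + n) :=
  row_mx (map_mx (@complex.Re R) z) (map_mx (@complex.Im R) z).

Implicit Types (S : set 'rV[C R]_n) (d : nat).

(* Only the restriction of phi to W matters.  The last clause says that phi is
   an open map from W to the topological subspace S. *)
Definition local_parametrization d S
    (W : set 'rV[R]_d) (phi : 'rV[R]_d -> 'rV[C R]_n) : Prop :=
  [/\ open W,
      smooth W (realify \o phi),
      (forall u, W u -> row_free (jacobian (realify \o phi) u)),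
      set_inj W phi &
      (forall W' : set 'rV[R]_d, open W' -> W' `<=` W ->
         exists2 U : set 'rV[C R]_n, open U & phi @` W' = S `&` U)].

Definition submanifold d S : Prop :=
  forall p, S p -> exists W phi,
    local_parametrization (d := d) S W phi /\ (phi @` W) p.

(* MathComp Jacobians act on row vectors: the rows of [jacobian f u] are the
   partial derivatives of f at u, and their span is the tangent space. *)
Definition tangent_space d S (p : 'rV[C R]_n) : set 'rV[C R]_n :=
  [set v | exists W phi u,
     [/\ local_parametrization (d := d) S W phi, W u, phi u = p &
         (realify v <= jacobian (realify \o phi) u)%MS]].

(* An orientation of S, as an atlas of parametrizations whose transition maps
   have positive Jacobian determinants; at phi u = psi v, the differential J of
   (psi^-1 \o phi) at u is characterized by d phi_u = d psi_v \o J. *)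
Definition orientation d S
    (A : set (set 'rV[R]_d * ('rV[R]_d -> 'rV[C R]_n))) : Prop :=
  [/\ (forall W phi, A (W, phi) -> local_parametrization S W phi),
      (forall p, S p -> exists W phi, A (W, phi) /\ (phi @` W) p) &
      (forall W phi W' psi u v, A (W, phi) -> A (W', psi) ->
         W u -> W' v -> phi u = psi v ->
         exists2 J : 'M[R]_d, 0 < \det J &
           jacobian (realify \o phi) u = J *m jacobian (realify \o psi) v)].

End Submanifold.

Section ComplexPoints.
Context {R : realType} {n : nat}.
Implicit Types (S : set 'rV[C R]_n) (p : 'rV[C R]_n).

Definition complex_hyperplane (H : set 'rV[C R]_n) : Prop :=
  exists2 l : 'cV[C R]_n, l != 0 & H = [set v | v *m l = 0].

Definition complex_point S p : Prop :=
  S p /\ complex_hyperplane (tangent_space (2 * n - 2) S p).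

(* Differentiability over R[i], i.e. complex differentiability. *)
Definition holomorphic (V W : normedModType (C R)) (U : set V) (f : V -> W) :=
  forall x, U x -> differentiable f x.

(* Phi = (z, w) are local holomorphic coordinates defined on the neighbourhood U
   of p and vanishing at p, with open range U' and inverse Psi. *)
Definition holomorphic_coordinates p (U : set 'rV[C R]_n)
    (U' : set ('rV[C R]_n.-1 * (C R))%type)
    (Phi : 'rV[C R]_n -> 'rV[C R]_n.-1 * (C R))
    (Psi : 'rV[C R]_n.-1 * (C R) -> 'rV[C R]_n) : Prop :=
  [/\ open U, U p, open U', Phi p = (0, 0) &
   [/\ holomorphic U Phi, holomorphic U' Psi,
       (forall x, U x -> U' (Phi x) /\ Psi (Phi x) = x) &
       (forall y, U' y -> U (Psi y) /\ Phi (Psi y) = y)]].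

(* In suitable holomorphic coordinates centered at p,
   S is given by w = q(z) + O(|z|^3). *)
Definition local_equation S p (q : 'rV[C R]_n.-1 -> (C R)) : Prop :=
  exists U U' Phi Psi (f : 'rV[C R]_n.-1 -> (C R)),
    [/\ holomorphic_coordinates p U U' Phi Psi,
        Phi @` (S `&` U) = U' `&` [set y | y.2 = f y.1] &
        (fun z => f z - q z) =O_ (nbhs (0 : 'rV[C R]_n.-1))
          (fun z => `|z| ^+ 3)].

Definition hermitian_part (b : 'M[C R]_n.-1) (z : 'rV[C R]_n.-1) : (C R) :=
  \sum_i \sum_j b i j * z 0 i * (z 0 j)^*.

Definition Qform (a b c : 'M[C R]_n.-1) (z : 'rV[C R]_n.-1) : (C R) :=
  \sum_i \sum_j (a i j * z 0 i * z 0 j + b i j * z 0 i * (z 0 j)^*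
                 + c i j * (z 0 i)^* * (z 0 j)^*).

Definition flat S p : Prop :=
  complex_point S p /\
  exists a b c : 'M[C R]_n.-1, local_equation S p (Qform a b c) /\
    exists lambda : C R, forall z, exists t : R,
      hermitian_part b z = lambda * t%:C.

Definition special_Q (lambda : 'I_n.-1 -> R) (z : 'rV[C R]_n.-1) : (C R) :=
  \sum_j (z 0 j * (z 0 j)^* + (lambda j * complex.Re (z 0 j ^+ 2))%:C).

Definition special S p (lambda : 'I_n.-1 -> R) : Prop :=
  [/\ flat S p, (forall j, 0 <= lambda j) & local_equation S p (special_Q lambda)].

Definition special_elliptic S p : Prop :=
  exists2 lambda, special S p lambda & forall j, lambda j < 1.

Definition special_1hyperbolic S p : Prop :=
  exists2 lambda, special S p lambda &
    exists2 j0, 1 < lambda j0 & forall j, j != j0 -> lambda j < 1.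

End ComplexPoints.

(* Euler-Poincare characteristic, from singular homology with rational
   coefficients. *)
Section SingularHomology.
Context (R : realType).

Definition simplex (k : nat) : set 'rV[R]_k.+1 :=
  [set x | (forall i, 0 <= x 0 i) /\ \sum_i x 0 i = 1].
Arguments simplex : clear implicits.

Definition insert0 (k : nat) (i : 'I_k.+2) (x : 'rV[R]_k.+1) : 'rV[R]_k.+2 :=
  \row_j oapp (x 0) 0 (unlift i j).

Lemma insert0_simplex (k : nat) (i : 'I_k.+2) (x : simplex k) :
  insert0 i (val x) \in simplex k.+1.
Proof.
case: x => x /= /set_mem[x0 x1]; apply/mem_set; split=> [j|].
  by rewrite mxE; case: unliftP => [l|] _ //=.
rewrite (bigD1_ord i) //= mxE unlift_none /= add0r -[RHS]x1.
by apply: eq_bigr => l _; rewrite mxE liftK.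
Qed.

Definition face (k : nat) (i : 'I_k.+2) (x : simplex k) : simplex k.+1 :=
  exist _ (insert0 i (val x)) (insert0_simplex i x).

Context (T : topologicalType).

(* A singular k-chain is a finitely supported function on the set of all maps
   from the simplex to T, whose support consists of continuous maps. *)
Definition chain (k : nat) (c : (simplex k -> T) -> rat) : Prop :=
  finite_set [set s | c s != 0] /\
  (forall s : simplex k -> T, c s != 0 -> continuous s).

Definition boundary (k : nat) (c : (simplex k.+1 -> T) -> rat)
    (t : simplex k -> T) : rat :=
  \sum_(i < k.+2) (-1) ^+ i *
    \sum_(s \in [set s : simplex k.+1 -> T | s \o face i = t]) c s.

Definition cycle (k : nat) : ((simplex k -> T) -> rat) -> Prop :=
  match k with
  | 0 => fun c => chain c
  | k'.+1 => fun c => chain c /\ forall t, boundary c t = 0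
  end.

Definition homologous (k : nat) (c c' : (simplex k -> T) -> rat) : Prop :=
  exists2 e : (simplex k.+1 -> T) -> rat, chain e &
    forall t, c t - c' t = boundary e t.

(* The classes of some b cycles form a basis of the k-th homology space. *)
Definition is_betti (k b : nat) : Prop :=
  exists z : 'I_b -> (simplex k -> T) -> rat,
    (forall i, cycle (z i)) /\
    (forall c, cycle c -> exists! a : 'I_b -> rat,
       homologous c (fun t => \sum_(i < b) a i * z i t)).

(* Default value 0 when the homology space is infinite-dimensional. *)
Definition betti (k : nat) : nat := xget 0%N [set b | is_betti k b].

(* A sum over all k, with value 0 when infinitely many terms are nonzero. *)
Definition euler_characteristic : int :=
  \sum_(k \in [set: nat]) (-1) ^+ k * (betti k)%:Z.

End SingularHomology.

Definition homeomorphic (X Y : topologicalType) : Prop :=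
  exists (f : X -> Y) (g : Y -> X),
    [/\ continuous f, continuous g, cancel f g & cancel g f].

Definition sphere (R : realType) (d : nat) : set 'rV[R]_d.+1 :=
  [set x | \sum_i x 0 i ^+ 2 = 1].
Arguments sphere : clear implicits.

(* Main.v *)
From HB Require Import structures.
Require Import Defs.
From mathcomp Require Import all_boot all_order all_algebra finmap ring lra zify.
From mathcomp Require Import complex.
From mathcomp Require Import all_classical all_reals all_analysis.
From mathcomp.multinomials Require Import freeg.
Set Implicit Arguments.
Unset Strict Implicit.
Unset Printing Implicit Defensive.
Import Order.TTheory GRing.Theory Num.Theory.
Import numFieldNormedType.Exports.
Local Open Scope classical_set_scope.
Local Open Scope ring_scope.

(** Proof idea.  Orientability of [S] and the codimension 2 give a nowhere
    vanishing normal field [nu] on [S]: near [S] the normal planes form an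
    oriented plane bundle, which the vector from the nearest point of [S]
    trivialises away from [S]; gluing it with a trivial plane yields a plane
    bundle over the whole space, and a vector is transported along the rays.
    The field [X = i nu] is orthogonal to [T_x S] exactly when [x] is a
    complex point.  Moving [x] a little in the direction of [X] and retracting
    to [S] gives a self-map of [S] close to the identity, whose fixed points
    are the complex points.  In the coordinates of a special point,
    [X] is, up to a rotation of [z], dual to the gradient of the quadratic form
    [|z_j|^2 + lam_j Re z_j^2]; so the map can be deformed near the point to be
    locally constant (elliptic points), or the doubling of an arc
    (1-hyperbolic points), in such a way that its trace on a finite
    Vietoris-Rips model of [S] is the number of elliptic points minus the
    number of hyperbolic points, whereas the trace of a map close to the
    identity is the Euler characteristic.  Only second order estimates are
    used; for holomorphic coordinates they follow from Goursat's lemma. *)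

(** * Free rational modules on lists *)

(** The finite model is not claimed to have the homology of [S]: at a fixed scale a Vietoris-Rips
    complex may carry spurious classes. Its self-map [e] passes through singular chains (realise,
    displace, subdivide, read off vertices). Let [W] be the cycles that [e] sends to boundaries. On
    cycles [e] is the identity modulo [W], and it kills [W] modulo boundaries, so in the alternating
    trace only the dimension of cycles modulo [W] survives, and this is a Betti number of [S]. The
    trace is computable because of the net: zeros are net points, and along each hyperbolic arc the
    net is a grid read by [floor], so doubling the arc doubles an integer. This leaves one fixed
    vertex and two fixed edges, hence 1 - 2 = -1. On the analytic side the obstacle is that the
    remainder of the local equation is bounded only in size, not in its derivatives; the cubic bound
    together with a quadratic remainder of the parametrization forces the derivative to be small
    compared with the distance to the point, which is enough for the sign of the displacement. *)

Notation free X := {freeg X / rat}.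
Notation gen x := (<< x >> : free _).

HB.lock Definition ext (X : choiceType) (M : lmodType rat) (f : X -> M) (c : free X) : M :=
  \sum_(x <- dom c) coeff x c *: f x.

Canonical ext_unlockable := Unlockable ext.unlock.

(** Different chains have different supports; evaluating them on a common duplicate-free list turns
    additivity of [ext] into a termwise identity. *)
Lemma ext_sub (X : choiceType) (M : lmodType rat) (f : X -> M) (c : free X) (s : seq X) :
  uniq s -> {subset dom c <= s} -> ext f c = \sum_(x <- s) coeff x c *: f x.
Proof.
move=> us cs; rewrite !ext.unlock [RHS](bigID (mem (dom c))) /=.
rewrite [X in _ + X]big1 ?addr0; last first.
  by move=> x xc; rewrite coeff_outdom // scale0r.
rewrite -[RHS]big_filter; apply: perm_big; apply: uniq_perm; rewrite ?filter_uniq ?uniq_dom //.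
by move=> x; rewrite mem_filter; case: (boolP (x \in dom c)) => //= /cs ->.
Qed.

Lemma ext_is_linear (X : choiceType) (M : lmodType rat) (f : X -> M) :
  linear (ext f).
Proof.
move=> a c c'.
pose s := undup (dom c ++ dom c' ++ dom (a *: c + c')).
have us : uniq s by rewrite undup_uniq.
have h d : d \in [:: c; c'; a *: c + c'] -> {subset dom d <= s}.
  by rewrite !inE => /or3P[]/eqP-> x; rewrite mem_undup !mem_cat => ->; rewrite ?orbT.
rewrite !(@ext_sub _ _ _ _ s) //; try by apply: h; rewrite !inE eqxx ?orbT.
rewrite scaler_sumr -big_split /=; apply: eq_bigr => x _.
by rewrite coeffD coeffZ scalerDl scalerA.
Qed.

HB.instance Definition _ (X : choiceType) (M : lmodType rat) (f : X -> M) :=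
  GRing.isLinear.Build rat (free X) M *:%R (ext f) (@ext_is_linear X M f).

Section Free.
Variables (X : choiceType).
Implicit Types (c : free X).

Lemma ext_gen (M : lmodType rat) (f : X -> M) x : ext f (gen x) = f x.
Proof. by rewrite !ext.unlock domU1 big_seq1 coeffU eqxx mulr1 scale1r. Qed.

Definition supp (P : X -> Prop) c := forall x, coeff x c != 0 -> P x.

Lemma suppT c : supp (fun=> True) c. Proof. by []. Qed.

Lemma supp_gen (P : X -> Prop) x : P x -> supp P (gen x).
Proof. by move=> Px y; rewrite coeffU mul1r; have [<-//|_] := eqVneq x y; rewrite eqxx. Qed.

Lemma supp0 (P : X -> Prop) : supp P 0.
Proof. by move=> x; rewrite coeff0 eqxx. Qed.

Lemma suppD (P : X -> Prop) c c' : supp P c -> supp P c' -> supp P (c + c').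
Proof.
move=> h h' x; rewrite coeffD; have [->|/h //] := eqVneq (coeff x c) 0.
by rewrite add0r => /h'.
Qed.

Lemma suppZ (P : X -> Prop) a c : supp P c -> supp P (a *: c).
Proof.
by move=> h x; rewrite coeffZ mulf_eq0 negb_or => /andP[_ /h].
Qed.

Lemma suppN (P : X -> Prop) c : supp P c -> supp P (- c).
Proof. by move=> h; rewrite -scaleN1r; apply: suppZ. Qed.

Lemma suppB (P : X -> Prop) c c' : supp P c -> supp P c' -> supp P (c - c').
Proof. by move=> h /suppN; apply: suppD. Qed.

Lemma supp_sum (I : Type) (r : seq I) (Q : pred I) (F : I -> free X) (P : X -> Prop) :
  (forall i, Q i -> supp P (F i)) -> supp P (\sum_(i <- r | Q i) F i).
Proof.
move=> h; elim/big_rec: _ => [|i c Qi IH]; first exact: supp0.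
by apply: suppD => //; apply: h.
Qed.

Lemma sub_supp (P Q : X -> Prop) c : (forall x, P x -> Q x) -> supp P c -> supp Q c.
Proof. by move=> PQ h x /h /PQ. Qed.

Lemma supp_dom (P : X -> Prop) c : supp P c -> forall x, x \in dom c -> P x.
Proof. by move=> h x; rewrite mem_dom => /h. Qed.

Lemma freeE c : c = \sum_(x <- dom c) coeff x c *: gen x.
Proof.
rewrite -[LHS]freeg_sumE; apply: eq_bigr => x _; apply/eqP/freeg_eqP => y.
by rewrite coeffZ !coeffU mul1r.
Qed.

Lemma eq_ext_supp (M : lmodType rat) (f g : X -> M) (P : X -> Prop) c :
  supp P c -> (forall x, P x -> f x = g x) -> ext f c = ext g c.
Proof.
move=> sc fg; rewrite !ext.unlock big_seq [RHS]big_seq; apply: eq_bigr => x xc.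
by rewrite fg //; exact: (supp_dom sc xc).
Qed.

Lemma eq_ext (M : lmodType rat) (f g : X -> M) c : f =1 g -> ext f c = ext g c.
Proof. by move=> fg; apply: (eq_ext_supp (@suppT c)) => x _; apply: fg. Qed.

(** Linearity is taken as a plain proposition, so that the lemma applies to composites with no
    declared linear structure. *)
Lemma eq_lin_supp (M : lmodType rat) (f g : free X -> M) (P : X -> Prop) c :
  linear f -> linear g -> supp P c ->
  (forall x, P x -> f (gen x) = g (gen x)) -> f c = g c.
Proof.
move=> lf lg sc fg.
pose F := GRing.isLinear.Build _ _ _ _ _ lf.
pose F' : {linear free X -> M} := HB.pack f F.
pose G := GRing.isLinear.Build _ _ _ _ _ lg.
pose G' : {linear free X -> M} := HB.pack g G.
rewrite -[f c]/(F' c) -[g c]/(G' c) [in LHS](freeE c) [in RHS](freeE c) !linear_sum /=.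
rewrite big_seq [RHS]big_seq; apply: eq_bigr => x xc.
rewrite -[LHS]/(F' (_ *: _)) -[RHS]/(G' (_ *: _)) !linearZ /= fg //.
exact: supp_dom xc.
Qed.

Lemma eq_lin (M : lmodType rat) (f g : {linear free X -> M}) c :
  (forall x, f (gen x) = g (gen x)) -> f c = g c.
Proof.
move=> fg; apply: (@eq_lin_supp _ f g (fun=> True)) (@suppT c) _ => [a x y|a x y|x _].
- by rewrite linearP.
- by rewrite linearP.
- exact: fg.
Qed.

Lemma ext_linE (M : lmodType rat) (f : {linear free X -> M}) c :
  f c = ext (fun x => f (gen x)) c.
Proof. by apply: eq_lin => x; apply/esym/ext_gen. Qed.

Lemma ext_genE c : ext (fun x => gen x) c = c.
Proof. by rewrite !ext.unlock -freeE. Qed.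

Lemma lin_ext (M N : lmodType rat) (f : X -> M) (g : {linear M -> N}) c :
  g (ext f c) = ext (g \o f) c.
Proof. by rewrite !ext.unlock linear_sum; apply: eq_bigr => x _; rewrite linearZ. Qed.

Lemma extB (M : lmodType rat) (f g : X -> M) c : ext (fun x => f x - g x) c = ext f c - ext g c.
Proof. by rewrite !ext.unlock -sumrB; apply: eq_bigr => x _; rewrite scalerBr. Qed.

End Free.

Lemma supp_ext (X Y : choiceType) (f : X -> free Y) (P : X -> Prop) (Q : Y -> Prop) c :
  supp P c -> (forall x, P x -> supp Q (f x)) -> supp Q (ext f c).
Proof.
move=> sc h; rewrite !ext.unlock big_seq; apply: supp_sum => x xc.
by apply: suppZ; apply: h; exact: (supp_dom sc xc).
Qed.

(** * Augmented ordered chains on lists of vertices *)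

Section ListChains.

Section Bd.
Variables (X : choiceType).
Implicit Types (l : seq X) (c : free (seq X)).

Definition cone x c := ext (fun l => gen (x :: l)) c.

Lemma cone_is_linear x : linear (cone x).
Proof. by move=> a c c'; rewrite /cone linearP. Qed.

HB.instance Definition _ x :=
  GRing.isLinear.Build rat (free (seq X)) (free (seq X)) *:%R (cone x) (@cone_is_linear x).

Lemma cone_gen x l : cone x (gen l) = gen (x :: l). Proof. exact: ext_gen. Qed.

(** The boundary is augmented: a one-vertex list has boundary [gen [::]]. Thanks to this the cone is
    a contraction in every degree, with no exception at vertices. *)
Fixpoint bd l : free (seq X) := if l is x :: l' then gen l' - cone x (bd l') else 0.

Lemma bd_nil : bd [::] = 0. Proof. by []. Qed.

Lemma bd_cons x l : bd (x :: l) = gen l - cone x (bd l). Proof. by []. Qed.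

Definition bdc := ext bd.
HB.instance Definition _ := GRing.Linear.on bdc.

Lemma bdc_gen l : bdc (gen l) = bd l. Proof. exact: ext_gen. Qed.

Lemma bdc_cone x c : bdc (cone x c) = c - cone x (bdc c).
Proof.
apply: (@eq_lin _ _ (bdc \o cone x) (idfun \- (cone x \o bdc))) => l /=.
by rewrite cone_gen !bdc_gen.
Qed.

Lemma bd_bd l : bdc (bd l) = 0.
Proof.
elim: l => [|x l IH] /=; first by rewrite linear0.
by rewrite linearB /= bdc_cone bdc_gen IH linear0 subr0 subrr.
Qed.

Lemma bdcK c : bdc (bdc c) = 0.
Proof.
apply: (@eq_lin _ _ (bdc \o bdc) \0) => l /=.
by rewrite bdc_gen bd_bd.
Qed.

Lemma supp_cone x (P Q : seq X -> Prop) c : supp P c ->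
  (forall l, P l -> Q (x :: l)) -> supp Q (cone x c).
Proof. by move=> sc h; apply: supp_ext sc _ => l /h Ql; apply: supp_gen. Qed.

Lemma bd_size l : supp (fun l' => size l = (size l').+1) (bd l).
Proof.
elim: l => [|x l IH] /=; first exact: supp0.
by apply: suppB; [exact: supp_gen|apply: supp_cone IH _ => l' /= ->].
Qed.

Lemma bd_sub l : supp (fun l' => subseq l' l) (bd l).
Proof.
elim: l => [|x l IH]; first exact: supp0.
rewrite [bd _]/=; apply: suppB; first by apply: supp_gen; apply: subseq_cons.
by apply: supp_cone IH _ => l' /=; rewrite eqxx.
Qed.

Definition del (i : nat) l := take i l ++ drop i.+1 l.

Lemma bdE l : bd l = \sum_(i < size l) (-1) ^+ i *: gen (del i l).
Proof.
elim: l => [|x l IH] /=; first by rewrite big_ord0.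
rewrite big_ord_recl /= expr0 scale1r /del /= drop0; congr (_ + _).
rewrite IH linear_sum -sumrN; apply: eq_bigr => i _ /=.
by rewrite linearZ /= cone_gen -scaleNr exprS mulN1r.
Qed.

End Bd.

#[local] Arguments bd : simpl never.

Section LMap.
Variables (X Y : choiceType) (h : X -> Y).

Definition lmap := ext (fun l => gen (map h l)).
HB.instance Definition _ := GRing.Linear.on lmap.

Lemma lmap_gen l : lmap (gen l) = gen (map h l). Proof. exact: ext_gen. Qed.

Lemma lmap_cone x c : lmap (cone x c) = cone (h x) (lmap c).
Proof.
apply: (@eq_lin _ _ (lmap \o cone x) (cone (h x) \o lmap)) => l /=.
by rewrite cone_gen !lmap_gen cone_gen.
Qed.

Lemma lmap_bd l : lmap (bd l) = bd (map h l).
Proof.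
elim: l => [|x l IH] /=; first by rewrite linear0.
by rewrite !bd_cons linearB /= lmap_gen lmap_cone IH.
Qed.

Lemma lmap_bdc c : lmap (bdc c) = bdc (lmap c).
Proof.
apply: (@eq_lin _ _ (lmap \o @bdc X) (@bdc Y \o lmap)) => l /=.
by rewrite lmap_gen !bdc_gen lmap_bd.
Qed.

Lemma supp_lmap (P : seq X -> Prop) (Q : seq Y -> Prop) c : supp P c ->
  (forall l, P l -> Q (map h l)) -> supp Q (lmap c).
Proof. by move=> sc PQ; apply: supp_ext sc _ => l /PQ Ql; apply: supp_gen. Qed.

End LMap.
End ListChains.
Arguments bd : simpl never.

Section MoreFree.
Variables (X Y : choiceType).

Lemma ext_ext (M : lmodType rat) (g : X -> free Y) (f : Y -> M) c :
  ext f (ext g c) = ext (fun x => ext f (g x)) c.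
Proof. exact: (lin_ext _ (ext f)). Qed.

Lemma bdc_ext (g : X -> free (seq Y)) c : bdc (ext g c) = ext (fun x => bdc (g x)) c.
Proof. exact: (lin_ext _ (@bdc Y)). Qed.

Lemma ext0f (M : lmodType rat) (c : free X) : ext (fun=> 0 : M) c = 0.
Proof. by rewrite ext.unlock big1 // => x _; rewrite scaler0. Qed.

Lemma supp_and (P Q : X -> Prop) c : supp P c -> supp Q c -> supp (fun x => P x /\ Q x) c.
Proof. by move=> sP sQ x cx; split; [exact: sP|exact: sQ]. Qed.

End MoreFree.

(** * Chain homotopies by coning *)

Section ConeHomotopy.
Variables (X Y : choiceType) (u v : seq X -> free (seq Y)) (b : seq X -> Y).

(** The recursion goes through the faces of [l], which are not subterms; [n] is fuel, and the size
    of the list is the right amount. *)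
Fixpoint chN n (l : seq X) : free (seq Y) :=
  if n is n'.+1 then cone (b l) (u l - v l - ext (chN n') (bd l)) else 0.

Definition ch l := chN (size l) l.

Lemma ch_nil : ch [::] = 0. Proof. by []. Qed.

Lemma ch_cons l : l != [::] -> ch l = cone (b l) (u l - v l - ext ch (bd l)).
Proof.
case: l => // x l _; rewrite /ch [LHS]/=; congr (cone _ (_ - _ - _)).
apply: (eq_ext_supp (@bd_size _ (x :: l))) => l' /= [->] //.
Qed.

Hypothesis bd_u : forall l, bdc (u l) = ext u (bd l).
Hypothesis bd_v : forall l, bdc (v l) = ext v (bd l).
Hypothesis uv0 : u [::] = v [::].

(** Coning a cycle bounds it, and the chain under the cone is a cycle by the induction hypothesis on
    faces and [bd_bd]. *)
Lemma bd_ch l : bdc (ch l) = u l - v l - ext ch (bd l).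
Proof.
have [n] := ubnP (size l); elim: n l => // n IH [|x l] sl.
  by rewrite ch_nil linear0 uv0 bd_nil linear0 subrr subr0.
rewrite ch_cons // bdc_cone -[RHS]subr0; congr (_ - _).
set L := x :: l.
have -> : bdc (u L - v L - ext ch (bd L)) = 0; last exact: linear0.
have chE : ext (fun l => bdc (ch l)) (bd L) = ext (fun l => u l - v l - ext ch (bd l)) (bd L).
  by apply: (eq_ext_supp (@bd_size _ L)) => l' [E]; apply: IH; rewrite -E.
rewrite 2!linearB /= bd_u bd_v bdc_ext chE !extB -ext_ext -/(bdc _) bd_bd linear0 subr0.
exact: subrr.
Qed.

(** Carrier argument: [K l y] can be any condition on the vertices allowed over [l] that passes from
    sublists to [l], such as lying in a cylinder or being a member of [l]. *)
Lemma supp_ch (K : seq X -> Y -> Prop) :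
  (forall l, l != [::] -> K l (b l)) ->
  (forall l l' y, subseq l' l -> K l' y -> K l y) ->
  (forall l, supp (fun m => size m = size l /\ forall y, y \in m -> K l y) (u l)) ->
  (forall l, supp (fun m => size m = size l /\ forall y, y \in m -> K l y) (v l)) ->
  forall l, supp (fun m => size m = (size l).+1 /\ forall y, y \in m -> K l y) (ch l).
Proof.
move=> Kb KS Ku Kv l; have [n] := ubnP (size l); elim: n l => // n IH [|x l] sl.
  exact: supp0.
rewrite ch_cons //.
apply: (@supp_cone _ _ (fun m => size m = size (x :: l) /\ forall y, y \in m -> K (x :: l) y)).
  apply: suppB; first exact: suppB.
  apply: (supp_ext (supp_and (@bd_size _ (x :: l)) (@bd_sub _ (x :: l)))) => l' [[E] sub].
  apply: (sub_supp _ (IH l' _)); last by rewrite -E.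
  by move=> m [-> h]; split=> [|y /h]; [rewrite /= E|exact: KS].
move=> m [/= -> h]; split => // y; rewrite inE => /predU1P[->|/h //]; exact: Kb.
Qed.

End ConeHomotopy.

(** Naturality will allow the boundary term of a homotopy to be recognised as the same operator
    applied to a singular boundary. *)
Lemma lmap_ch (X Y X' Y' : choiceType) (g : X -> X') (g' : Y -> Y')
  (u v : seq X -> free (seq Y)) (b : seq X -> Y)
  (u' v' : seq X' -> free (seq Y')) (b' : seq X' -> Y') :
  (forall l, lmap g' (u l) = u' (map g l)) ->
  (forall l, lmap g' (v l) = v' (map g l)) ->
  (forall l, l != [::] -> g' (b l) = b' (map g l)) ->
  forall l, lmap g' (ch u v b l) = ch u' v' b' (map g l).
Proof.
move=> hu hv hb l; have [n] := ubnP (size l); elim: n l => // n IH [|x l] sl.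
  by rewrite linear0.
rewrite !ch_cons // lmap_cone hb //; congr cone.
rewrite -lmap_bd 2!linearB -hu -hv; congr (_ - _).
rewrite (lin_ext _ (lmap g')) [RHS]ext_ext.
apply: (eq_ext_supp (@bd_size _ (x :: l))) => l' [E] /=.
by rewrite ext_gen IH // -E.
Qed.

(** * Subdivision of ordered chains *)

Section Subdivision.
Variables (X : choiceType) (b : seq X -> X).

Fixpoint sdN n (l : seq X) : free (seq X) :=
  if n is n'.+1 then cone (b l) (ext (sdN n') (bd l)) else gen l.

Definition sd l := sdN (size l) l.

Lemma sd_nil : sd [::] = gen [::]. Proof. by []. Qed.

Lemma sd_cons l : l != [::] -> sd l = cone (b l) (ext sd (bd l)).
Proof.
case: l => // x l _; rewrite /sd [LHS]/=; congr (cone _ _).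
by apply: (eq_ext_supp (@bd_size _ (x :: l))) => l' /= [->].
Qed.

Lemma bd_sd l : bdc (sd l) = ext sd (bd l).
Proof.
have [n] := ubnP (size l); elim: n l => // n IH [|x l] sl.
  by rewrite sd_nil bdc_gen bd_nil linear0.
rewrite sd_cons // bdc_cone -[RHS]subr0; congr (_ - _).
set L := x :: l.
have -> : bdc (ext sd (bd L)) = 0; last exact: linear0.
have sdE : ext (fun l => bdc (sd l)) (bd L) = ext (fun l => ext sd (bd l)) (bd L).
  by apply: (eq_ext_supp (@bd_size _ L)) => l' [E]; apply: IH; rewrite -E.
by rewrite bdc_ext sdE -ext_ext -/(bdc _) bd_bd linear0.
Qed.

Lemma supp_sd (K : seq X -> X -> Prop) :
  (forall l, l != [::] -> K l (b l)) ->
  (forall l l' y, subseq l' l -> K l' y -> K l y) ->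
  forall l, supp (fun m => size m = size l /\ forall y, y \in m -> K l y) (sd l).
Proof.
move=> Kb KS l; have [n] := ubnP (size l); elim: n l => // n IH [|x l] sl.
  exact: supp_gen.
rewrite sd_cons //.
apply: (@supp_cone _ _ (fun m => size m = size l /\ forall y, y \in m -> K (x :: l) y)).
  apply: (supp_ext (supp_and (@bd_size _ (x :: l)) (@bd_sub _ (x :: l)))) => l' [[E] sub].
  apply: (sub_supp _ (IH l' _)); last by rewrite -E.
  by move=> m [-> h]; split=> [|y /h]; [rewrite E|exact: KS].
move=> m [/= -> h]; split => // y; rewrite inE => /predU1P[->|/h //]; exact: Kb.
Qed.
End Subdivision.

Lemma lmap_sd (X Y : choiceType) (g : X -> Y) (b : seq X -> X) (b' : seq Y -> Y) :
  (forall l, l != [::] -> g (b l) = b' (map g l)) ->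
  forall l, lmap g (sd b l) = sd b' (map g l).
Proof.
move=> hb l; have [n] := ubnP (size l); elim: n l => // n IH [|x l] sl.
  by rewrite lmap_gen.
rewrite !sd_cons // lmap_cone hb //; congr cone.
rewrite (lin_ext _ (lmap g)) -lmap_bd [RHS]ext_ext.
apply: (eq_ext_supp (@bd_size _ (x :: l))) => l' [E] /=.
by rewrite ext_gen IH // -E.
Qed.

(** * From ordered to oriented chains *)

Section Alternation.
Variables (d : Order.disp_t) (X : orderType d).
Implicit Types (x y : X) (s l : seq X).

(** Strictly increasing lists stand for oriented simplices; on them this signed insertion is the
    exterior product with the vertex [x]. *)
Fixpoint ins x s : free (seq X) :=
  if s is y :: s' then
    if (x < y)%O then gen (x :: s) else if x == y then 0 else - cone y (ins x s')
  else gen [:: x].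

Definition insc x := ext (ins x).
HB.instance Definition _ x := GRing.Linear.on (insc x).

Lemma insc_gen x s : insc x (gen s) = ins x s. Proof. exact: ext_gen. Qed.

Lemma ins_lt x s : all (fun y => x < y)%O s -> ins x s = gen (x :: s).
Proof. by case: s => //= y s /andP[->]. Qed.

Lemma insc_cone_lt x y c : (y < x)%O -> insc x (cone y c) = - cone y (insc x c).
Proof.
move=> yx; apply: (@eq_lin _ _ (insc x \o cone y) (\- (cone y \o insc x))) => s /=.
by rewrite cone_gen !insc_gen /= ltNge ltW //= gt_eqF.
Qed.

Lemma supp_ins x s : sorted <%O s ->
  supp (fun m => sorted <%O m /\ perm_eq (x :: s) m) (ins x s).
Proof.
elim: s => [|y s IH] /= ss; first by apply: supp_gen.
case: ltgtP => [xy|yx|_]; last exact: supp0.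
  by apply: supp_gen; rewrite /= xy ss.
apply: suppN; apply: (supp_cone (IH (path_sorted ss))) => m [sm pm]; split.
  rewrite /= path_min_sorted // -(perm_all _ pm) /= yx /=.
  by move: ss; rewrite lt_path_sortedE => /andP[].
rewrite (permPl (_ : perm_eq _ (y :: x :: s))) ?perm_cons //.
by rewrite -[x :: y :: s]/([:: x] ++ [:: y] ++ s) perm_catCA.
Qed.

(** The same rule as for a cone: the boundary is an antiderivation of the exterior product. When [x]
    is the first vertex of [s], the left side is zero and the two terms on the right cancel. *)
Lemma bd_ins x s : sorted <%O s -> bdc (ins x s) = gen s - insc x (bd s).
Proof.
elim: s => [|y s IH] ss /=; first by rewrite bdc_gen bd_cons bd_nil !linear0.
have ys : all (fun z => y < z)%O s by move: ss => /=; rewrite lt_path_sortedE => /andP[].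
case: ltgtP => [xy|yx|->].
- rewrite bdc_gen bd_cons; congr (_ - _).
  have h z : supp (fun l => all (fun z => x < z)%O l) (gen (z :: s) - cone x (bd (z :: s))) -> True by [].
  apply: (@eq_lin_supp _ _ (cone x) (insc x) (fun l => all (fun z => x < z)%O l)).
  + by move=> a c c'; rewrite linearP.
  + by move=> a c c'; rewrite linearP.
  + apply: (sub_supp _ (@bd_sub _ (y :: s))) => l /mem_subseq ls.
    apply/allP => z /ls; rewrite inE => /predU1P[->//|zs].
    exact: lt_trans xy (allP ys _ zs).
  + by move=> l xl; rewrite cone_gen insc_gen ins_lt.
- rewrite linearN /= bdc_cone IH ?(path_sorted ss) //.
  rewrite bd_cons [in RHS]linearB /= insc_cone_lt // insc_gen [cone y (_ - _)]linearB /= cone_gen.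
  by rewrite opprB opprK opprD addrA addrAC.
- rewrite linear0 bd_cons linearB /= insc_gen ins_lt //.
  apply/esym/eqP; rewrite subr_eq0; apply/eqP; apply/esym.
  rewrite -[RHS]subr0; congr (_ - _).
  apply: (@eq_lin_supp _ _ (insc y \o cone y) \0 (fun=> True)) => //.
  + by move=> a c c' /=; rewrite !linearP.
  + by move=> a c c' /=; rewrite scaler0 addr0.
  + by move=> l _ /=; rewrite cone_gen insc_gen /= ltxx eqxx.
Qed.

Fixpoint alt l : free (seq X) := if l is x :: l' then insc x (alt l') else gen [::].

Lemma supp_alt l : supp (fun m => sorted <%O m /\ perm_eq l m) (alt l).
Proof.
elim: l => [|x l IH] /=; first exact: supp_gen.
rewrite /insc; apply: (supp_ext IH) => m [sm pm].
have := supp_ins (x := x) sm; apply: sub_supp => m' [sm' pm'].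
by split => //; apply: perm_trans pm'; rewrite perm_cons.
Qed.

Lemma bd_alt l : bdc (alt l) = ext alt (bd l).
Proof.
elim: l => [|x l IH] /=; first by rewrite bdc_gen bd_nil !linear0.
rewrite /insc bdc_ext (@eq_ext_supp _ _ _ (fun s => gen s - insc x (bd s)) _ _ (@supp_alt l)); last first.
  by move=> s [ss _]; apply: bd_ins.
rewrite extB ext_genE -ext_ext -/(bdc _) IH bd_cons linearB /= ext_gen; congr (_ - _).
rewrite /insc /cone !ext_ext; apply: eq_ext => s.
by rewrite ext_gen.
Qed.

Lemma alt_sorted l : sorted <%O l -> alt l = gen l.
Proof.
elim: l => [|x l IH] //= sl; rewrite IH ?(path_sorted sl) // insc_gen ins_lt //.
by move: sl; rewrite lt_path_sortedE => /andP[].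
Qed.

End Alternation.

(** * The Hopf trace formula *)

Section TraceOnSubspace.
Variables (n : nat).
Implicit Types (e : 'M[rat]_n).

Definition mxproj m (U : 'M[rat]_(m, n)) : 'M[rat]_n := pinvmx U *m U.

Definition is_mxproj m (U : 'M[rat]_(m, n)) (p : 'M[rat]_n) :=
  (p <= U)%MS /\ U *m p = U.

Lemma mxprojP m (U : 'M[rat]_(m, n)) : is_mxproj U (mxproj U).
Proof. by split; [exact: submxMl|rewrite /mxproj mulmxA mulmxKpV]. Qed.

Lemma mulmx_proj m1 m (U : 'M[rat]_(m, n)) p (A : 'M[rat]_(m1, n)) :
  is_mxproj U p -> (A <= U)%MS -> A *m p = A.
Proof. by move=> [_ Up] /submxP[B ->]; rewrite -mulmxA Up. Qed.

(** Two projections onto the same subspace agree on it; as [e] maps the subspace into itself,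
    cyclicity of the trace removes the choice of projection. *)
Lemma trace_stable m (U : 'M[rat]_(m, n)) p e : is_mxproj U p ->
  (U *m e <= U)%MS -> \tr (p *m e) = \tr (mxproj U *m e).
Proof.
move=> hp Ue; have hq := mxprojP U.
have pe : (p *m e <= U)%MS by apply: submx_trans Ue; apply: submxMr hp.1.
rewrite -(mulmx_proj hq pe) mxtrace_mulC mulmxA (mulmx_proj hp) //; exact: hq.1.
Qed.

Lemma mxtrace_proj m (U : 'M[rat]_(m, n)) p : is_mxproj U p -> \tr p = (\rank U)%:R.
Proof.
move=> [pU Up].
have pp : p *m p = p by apply: (@mulmx_proj _ _ U) => //; split.
have rp : \rank p = \rank U.
  by apply/eqP; rewrite eqn_leq mxrankS //= -{1}Up mxrankM_maxr.
rewrite -rp -{1}(mulmx_base p) mxtrace_mulC.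
suff -> : row_base p *m col_base p = 1%:M by rewrite mxtrace1.
apply: (row_free_inj (row_base_free p)).
have /row_fullP[B Bc] : row_full (col_base p) by exact: col_base_full.
have E : col_base p *m (row_base p *m col_base p *m row_base p) = col_base p *m row_base p.
  have H r (P : 'M[rat]_(n, r)) (Q : 'M[rat]_(r, n)) : P *m (Q *m P *m Q) = (P *m Q) *m (P *m Q).
    by rewrite !mulmxA.
  by rewrite H mulmx_base.
by rewrite mul1mx -[LHS]mul1mx -{1}Bc -mulmxA E mulmxA Bc mul1mx.
Qed.

(** Meant for boundaries [B], cycles [Z], and the cycles [W] that [e] sends to boundaries. Then [e]
    is zero on [W/B] and the identity on [Z/W], so the trace on [Z] exceeds that on [B] by the
    dimension of [Z/W]. *)
Lemma trace_quotient m1 m2 m3 (Z : 'M[rat]_(m1, n)) (W : 'M[rat]_(m2, n))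
    (B : 'M[rat]_(m3, n)) e :
  (B <= W)%MS -> (W <= Z)%MS -> (W *m e <= B)%MS -> (Z *m (e - 1%:M) <= W)%MS ->
  \tr (mxproj Z *m e) = \tr (mxproj B *m e) + (\rank Z)%:R - (\rank W)%:R.
Proof.
move=> BW WZ We Ze.
have hZ := mxprojP Z; have hW := mxprojP W; have hB := mxprojP B.
have WpZ : mxproj W *m mxproj Z = mxproj W.
  by apply: (mulmx_proj hZ); apply: submx_trans hW.1 WZ.
have h1 : \tr (mxproj Z *m (e - 1%:M)) = \tr (mxproj W *m (e - 1%:M)).
  rewrite -{1}(@mulmx_proj _ _ W (mxproj W) (mxproj Z *m (e - 1%:M)) hW); last first.
    by apply: submx_trans Ze; apply: submxMr hZ.1.
  by rewrite mxtrace_mulC mulmxA WpZ.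
have h2 : \tr (mxproj W *m e) = \tr (mxproj B *m e).
  rewrite -{1}(@mulmx_proj _ _ B (mxproj B) (mxproj W *m e) hB); last first.
    by apply: submx_trans We; apply: submxMr hW.1.
  rewrite mxtrace_mulC mulmxA; congr (\tr (_ *m _)).
  by apply: (mulmx_proj hW); apply: submx_trans hB.1 BW.
move: h1; rewrite !mulmxBr !mulmx1 !raddfB /= (mxtrace_proj hZ) (mxtrace_proj hW) h2.
by move=> /eqP; rewrite subr_eq => /eqP ->; rewrite addrAC.
Qed.
End TraceOnSubspace.

(** With [P] the pseudo-inverse, [1 - D P] projects onto the kernel of [D] and [P D] onto its image;
    the intertwining relation and cyclicity carry the remaining part of the trace of [f] across
    [D]. *)
Lemma trace_exact m n (D : 'M[rat]_(m, n)) (f : 'M[rat]_m) (e : 'M[rat]_n) :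
  f *m D = D *m e -> \tr f = \tr (mxproj (kermx D) *m f) + \tr (mxproj D *m e).
Proof.
move=> fD.
have hp : is_mxproj (kermx D) (1%:M - D *m pinvmx D).
  split; first by apply/sub_kermxP; rewrite mulmxBl mul1mx mulmxKpV // subrr.
  by rewrite mulmxBr mulmx1 mulmxA mulmx_ker mul0mx subr0.
rewrite -(trace_stable hp); last by apply/sub_kermxP; rewrite -mulmxA fD mulmxA mulmx_ker mul0mx.
rewrite mulmxBl mul1mx raddfB /= /mxproj; move: (pinvmx D) => P.
by rewrite -!mulmxA -fD [\tr (D *m _)]mxtrace_mulC -mulmxA subrK.
Qed.

Section HopfTrace.
Variables (c : nat -> nat) (D : forall k, 'M[rat]_(c k.+1, c k)) (e : forall k, 'M[rat]_(c k)).

Definition cycles k : 'M[rat]_(c k) := if k is k'.+1 then kermx (D k') else 1%:M.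

Hypothesis De : forall k, e k.+1 *m D k = D k *m e k.

(** [W k] may be larger than the boundaries, so the ranks on the right need not be those of the
    homology of the complex. The sum telescopes because the trace in degree [k+1] is a cycle part
    plus the boundary part of degree [k]. *)
Lemma hopf_trace K (W : forall k, 'M[rat]_(c k)) : c K = 0%N ->
  (forall k, D k <= W k)%MS -> (forall k, W k <= cycles k)%MS ->
  (forall k, W k *m e k <= D k)%MS ->
  (forall k, cycles k *m (e k - 1%:M) <= W k)%MS ->
  \sum_(k < K) (-1) ^+ k * \tr (e k) =
  \sum_(k < K) (-1) ^+ k * ((\rank (cycles k))%:R - (\rank (W k))%:R).
Proof.
move=> cK DW WZ We Ze.
pose tZ k := \tr (mxproj (cycles k) *m e k); pose tB k := \tr (mxproj (D k) *m e k).
have ZB k : (\rank (cycles k))%:R - (\rank (W k))%:R = tZ k - tB k.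
  by rewrite /tZ (trace_quotient (DW k) (WZ k) (We k) (Ze k)) -/(tB k); ring.
have tr0 : \tr (e 0) = tZ 0%N by rewrite /tZ /cycles /mxproj mulmx1 (_ : pinvmx _ = 1%:M) ?mul1mx // -[LHS]mulmx1 -[in LHS](mul1mx (pinvmx _)) mulmxKpV.
have trS k : \tr (e k.+1) = tZ k.+1 + tB k by exact: trace_exact.
have tele k : \sum_(i < k.+1) (-1) ^+ i * \tr (e i) =
    \sum_(i < k) (-1) ^+ i * (tZ i - tB i) + (-1) ^+ k * tZ k.
  elim: k => [|k IH]; first by rewrite big_ord1 big_ord0 tr0 add0r.
  rewrite big_ord_recr IH [in RHS]big_ord_recr /= trS exprS; ring.
case: K cK => [|K] cK; first by rewrite !big_ord0.
rewrite tele [RHS]big_ord_recr /= ZB; congr (_ + _ * _).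
  by apply: eq_bigr => i _; rewrite ZB.
(* The last boundary part belongs to a matrix without rows, as there are no chains one degree
   higher. *)
rewrite (_ : tB K = 0) ?subr0 // /tB /mxproj; move: (pinvmx _) => P.
have /eqP D0 : \rank (D K) == 0%N by rewrite -leqn0 -[X in (_ <= X)%N]cK rank_leq_row.
by move/eqP: D0; rewrite mxrank_eq0 => /eqP ->; rewrite mulmx0 mul0mx mxtrace0.
Qed.
End HopfTrace.

(** * Singular chains *)

Section Affine.
Context {R : realType}.

Definition aff (E : lmodType R) (l : seq E) k (t : 'rV[R]_k.+1) : E :=
  \sum_(i < k.+1) t 0 i *: nth 0 l i.

Lemma aff_map (E F : lmodType R) (h : {linear E -> F}) (l : seq E) k (t : 'rV[R]_k.+1) :
  aff (map h l) t = h (aff l t).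
Proof.
rewrite /aff linear_sum; apply: eq_bigr => i _; rewrite linearZ; congr (_ *: _).
have [il|il] := ltnP i (size l); first by rewrite (nth_map 0).
by rewrite !nth_default ?size_map // linear0.
Qed.

Lemma nth_del (X : choiceType) (x0 : X) i (l : seq X) j :
  nth x0 (del i l) j = nth x0 l (bump i j).
Proof.
rewrite /del nth_cat size_take_min /bump nth_drop.
case: ifP => h1; first by rewrite nth_take; [congr nth; lia|lia].
have [il|il] := ltnP i (size l); first by congr nth; lia.
by rewrite !nth_default //; lia.
Qed.

Lemma aff_insert0 (E : lmodType R) (l : seq E) k (i : 'I_k.+2) (t : 'rV[R]_k.+1) :
  aff l (insert0 i t) = aff (del i l) t.
Proof.
rewrite /aff (bigD1_ord i) //= mxE unlift_none /= scale0r add0r.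
by apply: eq_bigr => j _; rewrite mxE liftK /= nth_del.
Qed.

Lemma insert0_is_linear k (i : 'I_k.+2) : linear (@insert0 R k i).
Proof.
move=> a x y; apply/rowP => j; rewrite !mxE; case: unliftP => [j' _|_] /=.
  by rewrite !mxE.
by rewrite mulr0 addr0.
Qed.
HB.instance Definition _ k (i : 'I_k.+2) :=
  GRing.isLinear.Build R _ _ *:%R (@insert0 R k i) (insert0_is_linear i).

Definition verts k : seq 'rV[R]_k.+1 := [seq delta_mx 0 i | i <- enum 'I_k.+1].

Lemma size_verts k : size (verts k) = k.+1.
Proof. by rewrite size_map size_enum_ord. Qed.

Lemma nth_verts k (i : 'I_k.+1) : nth 0 (verts k) i = delta_mx 0 i.
Proof. by rewrite (nth_map i) ?size_enum_ord // nth_ord_enum. Qed.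

Lemma aff_verts k (t : 'rV[R]_k.+1) : aff (verts k) t = t.
Proof.
by rewrite [RHS]row_sum_delta; apply: eq_bigr => i _; rewrite nth_verts.
Qed.

Lemma del_verts k (i : 'I_k.+2) : del i (verts k.+1) = map (insert0 i) (verts k).
Proof.
have sd : size (del i (verts k.+1)) = k.+1.
  rewrite /del size_cat size_take size_drop size_verts ltn_ord subnS.
  by have := ltn_ord i; lia.
apply: (@eq_from_nth _ 0) => [|j]; first by rewrite sd [RHS]size_map size_verts.
rewrite sd => jk.
rewrite nth_del [RHS](nth_map 0) ?size_verts //.
rewrite (nth_verts (Ordinal jk)) (nth_verts (fintype.lift i (Ordinal jk))).
apply/rowP => l; rewrite !mxE /=; case: unliftP => [l' ->|->] /=.
  by rewrite mxE /= (inj_eq lift_inj).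
by rewrite (negbTE (neq_lift _ _)).
Qed.

Definition sing (E : lmodType R) (T : Type) k (G : E -> T) (l : seq E) : @simplex R k -> T :=
  fun x => G (aff l (val x)).

Lemma sing_face (E : lmodType R) (T : Type) k (G : E -> T) (l : seq E) (i : 'I_k.+2) :
  sing G l \o face i = sing G (del i l) :> (@simplex R k -> T).
Proof. by apply/funext => x; rewrite /sing /= aff_insert0. Qed.

Lemma simplex_aff k j (l : seq 'rV[R]_k.+1) (t : 'rV[R]_j.+1) : size l = j.+1 ->
  (forall x, x \in l -> simplex x) -> simplex t -> simplex (aff l t).
Proof.
move=> sl hl [t0 t1].
have hn (i : 'I_j.+1) : simplex (nth 0 l i) by apply/hl/mem_nth; rewrite sl.
split=> [i|].
  rewrite summxE; apply: sumr_ge0 => m _; rewrite mxE; apply: mulr_ge0 => //.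
  by case: (hn m).
rewrite -[RHS]t1 /aff; under eq_bigr do rewrite summxE.
rewrite exchange_big /=; apply: eq_bigr => m _.
under eq_bigr do rewrite mxE.
by rewrite -mulr_sumr; case: (hn m) => _ ->; rewrite mulr1.
Qed.

Lemma simplex_verts k x : x \in verts k -> simplex x.
Proof.
move=> /mapP[i _ ->]; split=> [j|]; first by rewrite mxE ler0n.
rewrite (bigD1 i) //= mxE !eqxx big1 ?addr0 // => j ji.
by rewrite mxE (negbTE ji) andbF.
Qed.

Lemma simplex0P k : @simplex R k (delta_mx 0 0).
Proof.
by apply/simplex_verts/mapP; exists ord0; rewrite ?mem_enum.
Qed.

Definition simplex0 k : @simplex R k := exist (fun x => x \in @simplex R k) _ (mem_set (simplex0P k)).

(** The values off the simplex are a mere default; a total map on the vector space can be composed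
    with affine maps. *)
Definition sext (T : Type) k (s : @simplex R k -> T) (x : 'rV[R]_k.+1) : T :=
  s (insubd (simplex0 k) x).

Lemma sext_val (T : Type) k (s : @simplex R k -> T) x : sext s (val x) = s x.
Proof. by rewrite /sext valKd. Qed.

Lemma sing_verts (T : Type) k (s : @simplex R k -> T) : sing (sext s) (verts k) = s.
Proof. by apply/funext => x; rewrite /sing aff_verts sext_val. Qed.

Lemma sext_face (T : Type) k (s : @simplex R k.+1 -> T) i x : simplex x ->
  sext s (insert0 i x) = sext (s \o face i) x.
Proof.
move=> sx; pose x' : @simplex R k := exist (fun x => x \in @simplex R k) x (mem_set sx).
by rewrite -[x]/(val x') sext_val -[insert0 i _]/(val (face i x')) sext_val.
Qed.

End Affine.

Section SingularChains.
Context {R : realType} (T : topologicalType).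

Definition schain k := free (@simplex R k -> T).

Definition bds k (s : @simplex R k.+1 -> T) : schain k :=
  \sum_(i < k.+2) (-1) ^+ i *: gen (s \o face i).

Definition bdS k : schain k.+1 -> schain k := ext (@bds k).
HB.instance Definition _ k := GRing.Linear.on (@bdS k).

Definition Sing (E : lmodType R) k (G : E -> T) : free (seq E) -> schain k :=
  ext (fun l => gen (sing G l)).
HB.instance Definition _ (E : lmodType R) k (G : E -> T) := GRing.Linear.on (@Sing E k G).

Lemma bds_sing (E : lmodType R) k (G : E -> T) (l : seq E) : size l = k.+2 ->
  bds (sing G l) = Sing k G (bd l).
Proof.
move=> sl; rewrite bdE /bds sl linear_sum; apply: eq_bigr => i _.
by rewrite linearZ /= /Sing ext_gen sing_face.
Qed.

Lemma bdS_Sing (E : lmodType R) k (G : E -> T) (c : free (seq E)) :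
  supp (fun l => size l = k.+2) c -> bdS (Sing k.+1 G c) = Sing k G (bdc c).
Proof.
move=> sc; apply: (@eq_lin_supp _ _ (@bdS k \o Sing k.+1 G) (Sing k G \o @bdc E)) sc _.
- by move=> a x y; rewrite linearP.
- by move=> a x y; rewrite linearP.
- by move=> l sl; rewrite /= bdc_gen /bdS /Sing !ext_gen bds_sing.
Qed.

End SingularChains.

(** * Natural homotopies of singular chains *)

Section NaturalHomotopy.
Context {R : realType} (T : topologicalType).
Local Notation F k := ('rV[R]_k.+1 * R)%type.

Definition cyl k : set (F k) := [set y | simplex y.1 /\ 0 <= y.2 <= 1].

Definition iota (t : R) k (x : 'rV[R]_k.+1) : F k := (x, t).

Definition ginsert k (i : 'I_k.+2) (y : F k) : F k.+1 := (insert0 i y.1, y.2).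

Lemma ginsert_is_linear k (i : 'I_k.+2) : linear (@ginsert k i).
Proof. by move=> a x y; rewrite /ginsert /= linearP. Qed.
HB.instance Definition _ k (i : 'I_k.+2) :=
  GRing.isLinear.Build R _ _ *:%R (@ginsert k i) (ginsert_is_linear i).

Lemma cyl_aff k j (l : seq (F k)) (t : 'rV[R]_j.+1) : size l = j.+1 ->
  (forall x, x \in l -> cyl x) -> simplex t -> cyl (aff l t).
Proof.
move=> sl hl st; split.
  rewrite -[(aff l t).1]/((GRing.Linear.clone _ _ _ _ (@fst 'rV[R]_k.+1 R) _) (aff l t)) -aff_map.
  apply: simplex_aff st; first by rewrite size_map.
  by move=> _ /mapP[y /hl[yS _] ->].
case: st => t0 t1.
have E : (aff l t).2 = \sum_(i < j.+1) t 0 i * (nth 0 l i).2.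
  by rewrite -[LHS]/((GRing.Linear.clone _ _ _ _ (@snd 'rV[R]_k.+1 R) _) (aff l t)) linear_sum.
have hn (i : 'I_j.+1) : 0 <= (nth 0 l i).2 <= 1.
  by case: (hl (nth 0 l i)) => //; apply/mem_nth; rewrite sl.
rewrite E; apply/andP; split.
  by apply: sumr_ge0 => i _; apply: mulr_ge0 => //; case/andP: (hn i).
by rewrite -t1; apply: ler_sum => i _; rewrite ler_piMr //; case/andP: (hn i).
Qed.

Variable v : forall k, seq 'rV[R]_k.+1 -> free (seq (F k)).
Hypothesis v_nil : forall k, @v k [::] = gen [::].
Hypothesis bd_v : forall k l, bdc (@v k l) = ext (@v k) (bd l).
Hypothesis v_nat : forall k (i : 'I_k.+2) l, lmap (ginsert i) (v l) = v (map (insert0 i) l).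
Hypothesis v_supp : forall k (l : seq 'rV[R]_k.+1),
  supp (fun m => size m = size l /\
    forall y, y \in m -> (forall x, x \in l -> simplex x) -> cyl y) (v l).

Definition hu k (l : seq 'rV[R]_k.+1) : free (seq (F k)) := gen (map (@iota 0 k) l).
Definition hb k (l : seq 'rV[R]_k.+1) : F k := iota 0 (head 0 l).
(** Homotopy inside the cylinder from its bottom [hu] to [v], coned from the first vertex. Two
    choices of [v] are made later: the subdivided bottom, and the top. *)
Definition hch k (l : seq 'rV[R]_k.+1) := ch (@hu k) (@v k) (@hb k) l.

Lemma bd_hu k (l : seq 'rV[R]_k.+1) : bdc (hu l) = ext (@hu k) (bd l).
Proof. by rewrite /hu bdc_gen -lmap_bd. Qed.

Lemma hu_nat k (i : 'I_k.+2) l : lmap (ginsert i) (hu l) = hu (map (insert0 i) l).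
Proof. by rewrite /hu lmap_gen -!map_comp. Qed.

Lemma hch_nat k (i : 'I_k.+2) l : lmap (ginsert i) (hch l) = hch (map (insert0 i) l).
Proof.
apply: lmap_ch; [exact: hu_nat|exact: v_nat|by case].
Qed.

Lemma hch_supp k (l : seq 'rV[R]_k.+1) :
  supp (fun m => size m = (size l).+1 /\
    forall y, y \in m -> (forall x, x \in l -> simplex x) -> cyl y) (hch l).
Proof.
apply: (supp_ch (K := fun l y => (forall x, x \in l -> simplex x) -> cyl y)).
- move=> [//|x l'] _ h; split; first by apply: h; rewrite mem_head.
  by rewrite /= lexx ler01.
- by move=> l1 l2 y /mem_subseq sub h h1; apply: h => x /sub; apply: h1.
- move=> l'; apply: supp_gen; split; first by rewrite size_map.
  move=> y /mapP[x xl ->] h; split; first exact: h.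
  by rewrite /= lexx ler01.
- exact: v_supp.
Qed.

Variable G : forall k, (@simplex R k -> T) -> F k -> T.
Hypothesis G_nat : forall k (s : @simplex R k.+1 -> T) i y, cyl y ->
  G s (ginsert i y) = G (s \o face i) y.

Definition nat_op j k (O : seq 'rV[R]_k.+1 -> free (seq (F k))) (s : @simplex R k -> T) :
  schain (R := R) T j := Sing j (G s) (O (verts k)).

Definition nat_opc j k (O : seq 'rV[R]_k.+1 -> free (seq (F k))) := ext (@nat_op j k O).
HB.instance Definition _ j k O := GRing.Linear.on (@nat_opc j k O).

Lemma sing_ginsert k j (s : @simplex R k.+1 -> T) (i : 'I_k.+2) (l : seq (F k)) :
  size l = j.+1 -> (forall y, y \in l -> cyl y) ->
  sing (G s) (map (ginsert i) l) = sing (G (s \o face i)) l :> (@simplex R j -> T).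
Proof.
move=> sl hl; apply/funext => x; rewrite /sing aff_map G_nat //.
by apply: cyl_aff => //; exact: set_mem (valP x).
Qed.

Lemma nat_op_face j k (O0 : seq 'rV[R]_k.+1 -> free (seq (F k)))
    (O : seq 'rV[R]_k.+2 -> free (seq (F k.+1))) (s : @simplex R k.+1 -> T) :
  (forall i, lmap (ginsert i) (O0 (verts k)) = O (map (insert0 i) (verts k))) ->
  supp (fun m => size m = j.+1 /\ forall y, y \in m -> cyl y) (O0 (verts k)) ->
  Sing j (G s) (ext O (bd (verts k.+1))) = nat_opc j O0 (bds s).
Proof.
move=> On Os; rewrite bdE size_verts !linear_sum; apply: eq_bigr => i _.
rewrite !linearZ /= ext_gen /nat_opc ext_gen del_verts -On; congr (_ *: _).
rewrite /Sing /lmap ext_ext; apply: (eq_ext_supp Os) => l [sl hl].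
by rewrite ext_gen sing_ginsert.
Qed.

Definition cycle_ k (c : schain (R := R) T k) : Prop :=
  match k return schain T k -> Prop with
  | 0 => fun=> True
  | k'.+1 => fun c => bdS c = 0
  end c.

Lemma supp_verts j k (O : free (seq (F k))) :
  supp (fun m => size m = j.+1 /\
    forall y, y \in m -> (forall x : 'rV[R]_k.+1, x \in verts k -> simplex x) -> cyl y) O ->
  supp (fun m => size m = j.+1 /\ forall y, y \in m -> cyl y) O.
Proof.
apply: sub_supp => m [sm hm]; split => // y /hm; apply; exact: simplex_verts.
Qed.

Lemma hch_supp_verts k : supp (fun m => size m = k.+2 /\ forall y, y \in m -> cyl y) (hch (verts k)).
Proof. by apply: supp_verts; have := @hch_supp k (verts k); rewrite size_verts. Qed.

Lemma v_supp_verts k : supp (fun m => size m = k.+1 /\ forall y, y \in m -> cyl y) (v (verts k)).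
Proof. by apply: supp_verts; have := @v_supp k (verts k); rewrite size_verts. Qed.

(** The extra term of the cone homotopy is, by naturality in the faces, the operator of one degree
    lower applied to the boundary of [c], hence zero on a cycle. *)
Lemma natural_homotopy k (c : schain T k) : cycle_ c ->
  bdS (nat_opc k.+1 (@hch k) c) = nat_opc k (@hu k) c - nat_opc k (@v k) c.
Proof.
move=> cc.
have H (s : @simplex R k -> T) : bdS (nat_op k.+1 (@hch k) s) =
    nat_op k (@hu k) s - nat_op k (@v k) s - Sing k (G s) (ext (@hch k) (bd (verts k))).
  rewrite /nat_op bdS_Sing; last by apply: sub_supp (@hch_supp_verts k) => m [].
  rewrite /hch bd_ch; [by rewrite !linearB|exact: bd_hu|exact: bd_v|by rewrite v_nil].
transitivity (nat_opc k (@hu k) c - nat_opc k (@v k) c -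
    ext (fun s => Sing k (G s) (ext (@hch k) (bd (verts k)))) c).
  rewrite /nat_opc (lin_ext _ (@bdS R T k)) -!extB; exact: eq_ext.
rewrite -[RHS]subr0; congr (_ - _).
(* In degree 0 the augmented boundary of a vertex is the empty list, on which the cone homotopy is
   zero. *)
case: k c cc H => [|k] c cc H.
  rewrite (eq_ext (g := fun=> 0)) ?ext0f // => s.
  have -> : verts 0 = [:: delta_mx 0 ord0] :> seq 'rV[R]_1.
    by apply: (@eq_from_nth _ 0); rewrite size_verts // => -[|//] _; rewrite (nth_verts ord0).
  rewrite bd_cons bd_nil linear0 subr0 ext_gen /hch ch_nil; exact: linear0.
rewrite (eq_ext (g := fun s => nat_opc k.+1 (@hch k) (bds s))); last first.
  move=> s; apply: (@nat_op_face _ _ (@hch k) (@hch k.+1)) => [i|]; [exact: hch_nat|exact: hch_supp_verts].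
rewrite /nat_opc -ext_ext -/(bdS _) cc; exact: linear0.
Qed.

Lemma natural_chain_map k (c : schain T k.+1) :
  bdS (nat_opc k.+1 (@v k.+1) c) = nat_opc k (@v k) (bdS c).
Proof.
rewrite /nat_opc (lin_ext _ (@bdS R T k)) /bdS ext_ext; apply: eq_ext => s /=.
rewrite -/(bdS _) /nat_op bdS_Sing; last by apply: sub_supp (@v_supp_verts k.+1) => m [].
rewrite bd_v; apply: nat_op_face => [i|]; [exact: v_nat|exact: v_supp_verts].
Qed.

End NaturalHomotopy.

Section UniformContinuity.
Context {R : realType}.

Lemma within_continuous_eps (V W : normedModType R) (K : set V) (f : V -> W) :
  {within K, continuous f} -> forall x, K x -> forall e, 0 < e ->
  exists2 d, 0 < d & forall y, K y -> `|x - y| < d -> `|f x - f y| < e.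
Proof.
move=> /subspace_continuousP cf x Kx e e0.
have /cvgrPdist_lt /(_ e e0) := cf x Kx.
rewrite near_withinE => /nbhs_normP[d /= d0 h]; exists d => // y Ky xy.
by apply: h.
Qed.

Lemma compact_uniform (V W : normedModType R) (K : set V) (f : V -> W) :
  compact K -> {within K, continuous f} -> forall e, 0 < e ->
  exists2 d, 0 < d & forall x y, K x -> K y -> `|x - y| < d -> `|f x - f y| < e.
Proof.
move=> cK cf e e0.
have /(_ R (0^'+) (fun d x => forall y, K y -> `|x - y| < d -> `|f x - f y| < e) _) := (near_covering_withinP K).2 ((compact_near_coveringP K).1 cK).
have H : forall x, K x -> \forall x' \near x & d \near (0:R)^'+, K x' ->
    forall y, K y -> `|x' - y| < d -> `|f x' - f y| < e.
  move=> x Kx.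
  have [d d0 h] := within_continuous_eps cf Kx (divr_gt0 e0 (ltr0Sn R 1)).
  have d20 : 0 < d / 2 by rewrite divr_gt0.
  exists (ball x (d / 2), [set t | t < d / 2]) => /=.
    by split; [exact: nbhsx_ballx|exact: nbhs_right_lt].
  move=> [x' t] [/= xx' td] Kx' y Ky x'y.
  rewrite -ball_normE /= in xx'.
  rewrite (splitr e) -(subrK (f x) (f x')) -addrA; apply: le_lt_trans (ler_normD _ _) _.
  rewrite ltrD // ?h //; first by rewrite distrC h //; apply: lt_trans xx' _; lra.
  rewrite -(subrK x' x) -addrA; apply: le_lt_trans (ler_normD _ _) _; lra.
move=> /(_ H) hn; have [d [d0 hd]] := filter_ex (filterI (nbhs_right_gt (0 : R)) hn).
by exists d => // x y Kx Ky; apply: hd.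
Qed.
End UniformContinuity.

(** * Barycentres and the mesh of a subdivision *)

Section Barycenter.
Context {R : realType}.

Definition bary (E : lmodType R) (l : seq E) : E := (size l)%:R^-1 *: \sum_(x <- l) x.

Lemma bary_map (E F : lmodType R) (h : {linear E -> F}) (l : seq E) :
  h (bary l) = bary (map h l).
Proof. by rewrite /bary linearZ size_map linear_sum big_map. Qed.

Lemma bary_simplex k (l : seq 'rV[R]_k.+1) : l != [::] ->
  (forall x, x \in l -> simplex x) -> simplex (bary l).
Proof.
move=> l0 hl; have sl : (size l)%:R != 0 :> R by rewrite pnatr_eq0 size_eq0.
split=> [i|].
  rewrite mxE summxE mulr_ge0 ?invr_ge0 ?ler0n // big_seq; apply: sumr_ge0 => x /hl[x0 _]; exact: x0.
under eq_bigr do rewrite mxE summxE.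
rewrite -mulr_sumr exchange_big /= big_seq.
under eq_bigr => x xl do rewrite (hl x xl).2.
rewrite -big_seq big_const_seq count_predT iter_addr addr0 -[in _ *+ _](mulr1 1) -mulrnAr.
by rewrite mul1r -[1 *+ _]/(_%:R) mulVf.
Qed.

Section Normed.
Variable E : normedModType R.
Implicit Types (l : seq E) (x z : E).

(** The intersection of all closed balls containing the list. It contains the convex combinations of
    the list and keeps its diameter bound, and it is expressed without weights. *)
Definition hull l y := forall z rho, (forall x, x \in l -> `|x - z| <= rho) -> `|y - z| <= rho.

Lemma hull_sub l l' y : subseq l' l -> hull l' y -> hull l y.
Proof. by move=> /mem_subseq sub h z rho hz; apply: h => x /sub /hz. Qed.

Lemma sum_norm_le l (f : E -> E) rho : (forall x, x \in l -> `|f x| <= rho) ->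
  `|\sum_(x <- l) f x| <= (size l)%:R * rho.
Proof.
elim: l => [|x l IH] h; first by rewrite big_nil normr0 mul0r.
rewrite big_cons /= -natr1 mulrDl mul1r [leRHS]addrC; apply: le_trans (ler_normD _ _) _.
apply: lerD; first by rewrite h ?mem_head.
by apply: IH => y yl; apply: h; rewrite inE yl orbT.
Qed.

Lemma bary_sub l z : l != [::] -> bary l - z = (size l)%:R^-1 *: \sum_(x <- l) (x - z).
Proof.
move=> l0; have sl : (size l)%:R != 0 :> R by rewrite pnatr_eq0 size_eq0.
rewrite sumrB scalerBr /bary; congr (_ - _).
have -> : \sum_(i <- l) z = (size l)%:R *: z.
  by rewrite big_const_seq count_predT iter_addr addr0 scaler_nat.
by rewrite scalerA mulVf // scale1r.
Qed.

Lemma hull_bary l : l != [::] -> hull l (bary l).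
Proof.
move=> l0 z rho h; have sl : 0 < (size l)%:R :> R by rewrite ltr0n lt0n size_eq0.
rewrite bary_sub // normrZ gtr0_norm ?invr_gt0 // mulrC ler_pdivrMr // mulrC.
exact: sum_norm_le.
Qed.

Lemma bary_dist l x d : x \in l -> (forall y z, y \in l -> z \in l -> `|y - z| <= d) ->
  `|bary l - x| <= ((size l).-1)%:R / (size l)%:R * d.
Proof.
move=> xl h; have l0 : l != [::] by case: (l) xl.
have sl : 0 < (size l)%:R :> R by rewrite ltr0n lt0n size_eq0.
rewrite bary_sub // normrZ gtr0_norm ?invr_gt0 // mulrAC mulrC ler_pM2r ?invr_gt0 //.
have -> : \sum_(y <- l) (y - x) = \sum_(y <- rem x l) (y - x).
  by rewrite (perm_big _ (perm_to_rem xl)) /= big_cons [x - x]subrr [LHS]add0r.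
rewrite -(size_rem xl).
by apply: sum_norm_le => y yl; apply: h => //; apply: mem_rem yl.
Qed.

Lemma hull_aff l k (t : 'rV[R]_k.+1) : size l = k.+1 -> simplex t -> hull l (aff l t).
Proof.
move=> sl [t0 t1] z rho h.
have -> : aff l t - z = \sum_(i < k.+1) t 0 i *: (nth 0 l i - z).
  under [RHS]eq_bigr do rewrite scalerBr.
  by rewrite sumrB -scaler_suml t1 scale1r.
apply: le_trans (ler_norm_sum _ _ _) _; rewrite -[rho]mul1r -t1 mulr_suml.
apply: ler_sum => i _; rewrite normrZ ger0_norm // ler_wpM2l // h //.
by rewrite mem_nth // sl.
Qed.

Definition mesh l d := forall x y, x \in l -> y \in l -> `|x - y| <= d.

Lemma hull_mesh l d x y : mesh l d -> hull l x -> hull l y -> `|x - y| <= d.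
Proof.
move=> ml hx hy; apply: hx => z zl; rewrite distrC; apply: hy => w wl.
exact: ml.
Qed.

(** The classical factor: the barycentre of [n+1] points is within [n/(n+1)] of the diameter from
    each of them, hence from every point of the hull. *)
Lemma sd_mesh n l d : (size l <= n.+1)%N -> 0 <= d -> mesh l d ->
  supp (fun m => mesh m (n%:R / n.+1%:R * d)) (sd (@bary E) l).
Proof.
move=> + d0; elim: n l => [|n IH] l sl ml.
  case: l sl ml => [|x [|//]] _ ml; first by apply: supp_gen => x y.
  apply: (@sub_supp _ (fun m => size m = 1%N /\ forall y, y \in m -> hull [:: x] y)).
    move=> m [sm _]; case: m sm => [|y [|//]] // _ z w; rewrite !inE => /eqP-> /eqP->.
    by rewrite subrr normr0 mulr_ge0 // mul0r.
  apply: (@supp_sd _ _ hull) => [l|]; [exact: hull_bary|exact: hull_sub].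
case: l sl ml => [|x l] sl ml; first by apply: supp_gen => x y.
set L := x :: l.
rewrite sd_cons //.
pose q : R := n.+1%:R / n.+2%:R.
have q0 : 0 <= q * d by rewrite mulr_ge0 // divr_ge0.
apply: (@supp_cone _ _ (fun m => mesh m (q * d) /\ forall y, y \in m -> hull L y)).
  apply: supp_and.
    apply: (supp_ext (supp_and (@bd_size _ L) (@bd_sub _ L))) => l' [[sE] sub].
    have h := IH l'; rewrite -sE in h; move/(_ sl) in h.
    have : mesh l' d by move=> y z /(mem_subseq sub) yl /(mem_subseq sub); apply: ml.
    move=> /h; apply: sub_supp => m hm y z ym zm; apply: le_trans (hm _ _ ym zm) _.
    rewrite ler_wpM2r // /q ler_pdivrMr ?ltr0n // mulrAC ler_pdivlMr ?ltr0n //.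
    by rewrite -!natrM ler_nat; lia.
  apply: (supp_ext (supp_and (@bd_size _ L) (@bd_sub _ L))) => l' [_ sub].
  have : supp (fun m => size m = size l' /\ forall y, y \in m -> hull l' y) (sd (@bary E) l').
    apply: (@supp_sd _ _ hull) => [l1|]; [exact: hull_bary|exact: hull_sub].
  by apply: sub_supp => m [_ h] y /h; apply: hull_sub.
move=> m [hm hh].
have hb y : y \in m -> `|bary L - y| <= q * d.
  move=> /hh hy; rewrite distrC; apply: hy => z zL; rewrite distrC.
  apply: le_trans (bary_dist zL ml) _; rewrite ler_wpM2r // /q /=.
  rewrite ler_pdivrMr ?ltr0n // mulrAC ler_pdivlMr ?ltr0n //.
  by rewrite -!natrM ler_nat; move: sl => /=; nia.
move=> y z; rewrite !inE => /predU1P[->|ym] /predU1P[->|zm].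
- by rewrite subrr normr0.
- exact: hb.
- by rewrite distrC; apply: hb.
- exact: hm.
Qed.
End Normed.
End Barycenter.

(** * Barycentric subdivision *)

Lemma within_continuous_comp (X Y Z : topologicalType) (f : X -> Y) (g : Y -> Z) (A : set Y) :
  continuous f -> (forall x, A (f x)) -> {within A, continuous g} -> continuous (g \o f).
Proof.
move=> cf Af /subspace_continuousP cg x U /= nU.
have := cg _ (Af x) U nU; rewrite /nbhs /= => /cf; rewrite /nbhs /=.
by apply: filterS => y; apply; exact: Af.
Qed.

Lemma lmap_comp (X Y Z : choiceType) (f : X -> Y) (g : Y -> Z) (c : free (seq X)) :
  lmap g (lmap f c) = lmap (g \o f) c.
Proof.
apply: (@eq_lin _ _ (lmap g \o lmap f) (lmap (g \o f))) => l /=.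
by rewrite !lmap_gen map_comp.
Qed.

Section AffineContinuity.
Context {R : realType}.

Lemma continuous_sumf (X : topologicalType) (E : normedModType R) (I : Type) (s : seq I)
    (f : I -> X -> E) x : (forall i, {for x, continuous (f i)}) ->
  {for x, continuous (fun x => \sum_(i <- s) f i x)}.
Proof.
move=> cf; elim: s => [|i s IH].
  by rewrite (_ : (fun x => _) = (fun=> 0)); [exact: cst_continuous|apply/funext => y; rewrite big_nil].
rewrite (_ : (fun x => _) = (f i \+ (fun x => \sum_(i <- s) f i x))); last first.
  by apply/funext => y; rewrite big_cons.
by apply: continuousD.
Qed.

Lemma continuous_aff (E : normedModType R) (l : seq E) k :
  continuous (fun t : 'rV[R]_k.+1 => aff l t).
Proof.
move=> t; rewrite /aff; apply: continuous_sumf => i.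
by apply: continuousZr_tmp; exact: coord_continuous.
Qed.

Lemma aff_is_linear (E : lmodType R) (l : seq E) k :
  linear (fun t : 'rV[R]_k.+1 => aff l t).
Proof.
move=> a x y; rewrite /aff scaler_sumr -big_split /=; apply: eq_bigr => i _.
by rewrite !mxE scalerDl scalerA.
Qed.

Definition afflin (E : lmodType R) (l : seq E) k (t : 'rV[R]_k.+1) := aff l t.
HB.instance Definition _ (E : lmodType R) (l : seq E) k :=
  GRing.isLinear.Build R _ _ *:%R (@afflin E l k) (@aff_is_linear E l k).

Lemma map_aff_verts (E : lmodType R) (l : seq E) k : size l = k.+1 ->
  map (@afflin E l k) (verts k) = l.
Proof.
move=> sl; apply: (@eq_from_nth _ 0); rewrite size_map size_verts ?sl // => i ik.
rewrite [LHS](nth_map 0) ?size_verts // (nth_verts (Ordinal ik)) /afflin /aff.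
rewrite (bigD1 (Ordinal ik)) //= mxE !eqxx scale1r big1 ?addr0 // => j ji.
by rewrite mxE (negbTE ji) andbF scale0r.
Qed.

Lemma continuous_val (X : topologicalType) (A : set X) : continuous (fun x : A => val x).
Proof. exact: initial_continuous. Qed.

Lemma continuous_sing (E : normedModType R) (T : topologicalType) j (G : E -> T) (A : set E)
    (l : seq E) : {within A, continuous G} ->
  (forall t : 'rV[R]_j.+1, simplex t -> A (aff l t)) -> continuous (sing G l : @simplex R j -> T).
Proof.
move=> cG hA; apply: (@within_continuous_comp _ _ _ (fun x : @simplex R j => aff l (val x)) G A) => //.
  by move=> x; apply: continuous_comp; [exact: continuous_val|exact: continuous_aff].
by move=> x; apply: hA; exact: set_mem (valP x).
Qed.

End AffineContinuity.

Section Homotopies.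
Context {R : realType} (T : topologicalType).
Local Notation F k := ('rV[R]_k.+1 * R)%type.
Local Notation schain := (@schain R T).

Lemma cyl_iota k (x : 'rV[R]_k.+1) t : simplex x -> 0 <= t <= 1 -> cyl (iota t x).
Proof. by []. Qed.

Lemma sext_continuous k (s : @simplex R k -> T) : continuous s ->
  {within @simplex R k, continuous (sext s)}.
Proof.
move=> cs; apply/subspace_sigL_continuousP; rewrite (_ : sigL _ _ = s) //.
apply/funext => x; rewrite /sigL /= -[set_val x]/(val x); exact: sext_val.
Qed.

Lemma nat_op_supp j k (G : F k -> T) (c : free (seq (F k))) :
  supp (fun m => size m = j.+1 /\ forall y, y \in m -> cyl y) c ->
  supp (fun t : @simplex R j -> T => (range t `<=` G @` @cyl R k) /\
     ({within @cyl R k, continuous G} -> continuous t)) (Sing j G c).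
Proof.
move=> sc; apply: (supp_ext sc) => m [sm hm]; apply: supp_gen; split.
  move=> _ [x _ <-]; exists (aff m (val x)) => //; apply: cyl_aff => //.
  exact: set_mem (valP x).
by move=> cG; apply: (continuous_sing cG) => t st; apply: cyl_aff.
Qed.

(** Subdivision placed on the bottom of the cylinder; combined with a map that ignores the height,
    it brings subdivision under [natural_homotopy]. *)
Definition v_sd k (l : seq 'rV[R]_k.+1) : free (seq (F k)) :=
  lmap (@iota R 0 k) (sd (@bary R _) l).

Lemma v_sd_nil k : @v_sd k [::] = gen [::].
Proof. by rewrite /v_sd sd_nil lmap_gen. Qed.

Lemma bd_v_sd k l : bdc (@v_sd k l) = ext (@v_sd k) (bd l).
Proof. by rewrite /v_sd -lmap_bdc bd_sd (lin_ext _ (lmap _)). Qed.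

Lemma v_sd_nat k (i : 'I_k.+2) l : lmap (ginsert i) (v_sd l) = v_sd (map (insert0 i) l).
Proof.
rewrite /v_sd -(lmap_sd (g := insert0 i) (b := @bary R _)); last first.
  by move=> l' _; rewrite bary_map.
by rewrite !lmap_comp.
Qed.

Lemma sd_simplex k (l : seq 'rV[R]_k.+1) :
  supp (fun m => size m = size l /\
    forall y, y \in m -> (forall x, x \in l -> simplex x) -> simplex y) (sd (@bary R _) l).
Proof.
apply: (@supp_sd _ _ (fun l y => (forall x, x \in l -> simplex x) -> simplex y)).
  by move=> l' l0; exact: bary_simplex.
by move=> l1 l2 y /mem_subseq sub h h1; apply: h => x /sub; apply: h1.
Qed.

Lemma v_sd_supp k (l : seq 'rV[R]_k.+1) :
  supp (fun m => size m = size l /\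
    forall y, y \in m -> (forall x, x \in l -> simplex x) -> cyl y) (v_sd l).
Proof.
apply: (supp_lmap (@sd_simplex k l)) => m [sm hm]; split; first by rewrite size_map.
move=> y /mapP[x xm ->] h; apply: cyl_iota; first exact: hm.
by rewrite lexx ler01.
Qed.

Definition g_sd k (s : @simplex R k -> T) (y : F k) : T := sext s y.1.

Lemma g_sd_nat k (s : @simplex R k.+1 -> T) i y : cyl y ->
  g_sd s (ginsert i y) = g_sd (s \o face i) y.
Proof. by move=> [y1 _]; rewrite /g_sd /= sext_face. Qed.

Lemma g_sd_continuous k (s : @simplex R k -> T) : continuous s ->
  {within @cyl R k, continuous (g_sd s)}.
Proof.
move=> cs; apply/subspace_continuousP => y cy U nU.
have /subspace_continuousP/(_ y.1 cy.1 U nU) := sext_continuous cs.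
rewrite /= !nbhs_filterE /within /= => h.
have : {for y, continuous (fun z : F k => z.1)} by exact: cvg_fst.
move=> /(_ _ h); rewrite /nbhs /=; apply: filterS => z hz [z1 _]; exact: hz.
Qed.

Lemma g_sd_range k (s : @simplex R k -> T) : g_sd s @` @cyl R k `<=` range s.
Proof. by move=> _ [y _ <-]; exists (insubd (simplex0 k) y.1). Qed.

Definition Sd k : schain k -> schain k := nat_opc g_sd k (@v_sd k).
HB.instance Definition _ k := GRing.Linear.on (@Sd k).
Definition Db k : schain k -> schain k.+1 := nat_opc g_sd k.+1 (@hch R v_sd k).
HB.instance Definition _ k := GRing.Linear.on (@Db k).

Lemma Sing_lmap (E E' : lmodType R) (h : E -> E') j (G : E' -> T) (P : seq E -> Prop) (c : free (seq E)) :
  supp P c -> (forall l, P l -> sing G (map h l) = sing (G \o h) l :> (@simplex R j -> T)) ->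
  Sing j G (lmap h c) = Sing j (G \o h) c.
Proof.
move=> sc hl; rewrite /Sing /lmap ext_ext; apply: (eq_ext_supp sc) => l Pl.
by rewrite ext_gen hl.
Qed.

Lemma eq_Sing (E : lmodType R) j (G G' : E -> T) (P : seq E -> Prop) (c : free (seq E)) :
  supp P c -> (forall l, P l -> sing G l = sing G' l :> (@simplex R j -> T)) ->
  Sing j G c = Sing j G' c.
Proof. by move=> sc h; apply: (eq_ext_supp sc) => l /h ->. Qed.

Lemma iota_linear k : linear (@iota R 0 k).
Proof. by move=> a x y; rewrite /iota /=; congr (_, _); rewrite /= scaler0 addr0. Qed.
HB.instance Definition _ k := GRing.isLinear.Build R _ _ *:%R (@iota R 0 k) (@iota_linear k).

Lemma SdE k (s : @simplex R k -> T) : Sd (gen s) = Sing k (sext s) (sd (@bary R _) (verts k)).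
Proof.
rewrite /Sd /nat_opc ext_gen /nat_op /v_sd.
apply: (Sing_lmap (@suppT _ _)) => l _; apply/funext => x; rewrite /sing.
by rewrite (aff_map (@iota R 0 k)).
Qed.

Lemma Sd_supp k (s : @simplex R k -> T) :
  supp (fun t : @simplex R k -> T => range t `<=` range s /\ (continuous s -> continuous t)) (Sd (gen s)).
Proof.
rewrite /Sd /nat_opc ext_gen /nat_op.
have := nat_op_supp (j := k) (G := g_sd s) (@v_supp_verts R v_sd v_sd_supp k).
apply: sub_supp => t [h1 h2]; split; first by apply: subset_trans h1 (@g_sd_range k s).
by move=> /g_sd_continuous.
Qed.

Lemma Db_supp k (s : @simplex R k -> T) :
  supp (fun t : @simplex R k.+1 -> T => range t `<=` range s /\ (continuous s -> continuous t)) (Db (gen s)).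
Proof.
rewrite /Db /nat_opc ext_gen /nat_op.
have := nat_op_supp (j := k.+1) (G := g_sd s) (@hch_supp_verts R v_sd v_sd_supp k).
apply: sub_supp => t [h1 h2]; split; first by apply: subset_trans h1 (@g_sd_range k s).
by move=> /g_sd_continuous.
Qed.

Lemma nat_op_hu k (G : forall k, (@simplex R k -> T) -> F k -> T) (s : @simplex R k -> T) :
  nat_op G k (@hu R k) s = gen (fun x : @simplex R k => G k s (iota 0 (val x))).
Proof.
rewrite /nat_op /hu /Sing ext_gen; congr (gen _); apply/funext => x.
by rewrite /sing (aff_map (@iota R 0 k)) aff_verts.
Qed.

Lemma bd_Db k (c : schain k) : cycle_ c -> bdS (Db c) = c - Sd c.
Proof.
move=> cc; rewrite /Db (natural_homotopy v_sd_nil bd_v_sd v_sd_nat v_sd_supp g_sd_nat cc).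
congr (_ - _); rewrite /nat_opc -[RHS]ext_genE; apply: eq_ext => s.
rewrite nat_op_hu; congr (gen _); apply/funext => x; exact: sext_val.
Qed.

Lemma bd_Sd k (c : schain k.+1) : bdS (Sd c) = Sd (bdS c).
Proof. exact: (natural_chain_map bd_v_sd v_sd_nat v_sd_supp g_sd_nat). Qed.

Lemma cycle_Sd k (c : schain k) : cycle_ c -> cycle_ (Sd c).
Proof. by case: k c => // k c /= cc; rewrite bd_Sd cc linear0. Qed.

Lemma cycle_iter_Sd k m (c : schain k) : cycle_ c -> cycle_ (iter m (@Sd k) c).
Proof. by move=> cc; elim: m => //= m; apply: cycle_Sd. Qed.

Section Support.
Variable A : set T -> Prop.
Hypothesis subA : forall B B', B `<=` B' -> A B' -> A B.

(** The condition on ranges is carried along so that homologies can be kept inside small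
    simplices. *)
Definition csupp k (s : @simplex R k -> T) := continuous s /\ A (range s).

Lemma supp_Sd k (c : schain k) : supp (@csupp k) c -> supp (@csupp k) (Sd c).
Proof.
move=> sc; rewrite (ext_linE (@Sd k)); apply: (supp_ext sc) => s [cs As].
by apply: sub_supp (@Sd_supp k s) => t [st ct]; split; [exact: ct|exact: subA As].
Qed.

Lemma supp_iter_Sd k m (c : schain k) : supp (@csupp k) c -> supp (@csupp k) (iter m (@Sd k) c).
Proof. by move=> sc; elim: m => //= m; apply: supp_Sd. Qed.

Lemma supp_Db k (c : schain k) : supp (@csupp k) c -> supp (@csupp k.+1) (Db c).
Proof.
move=> sc; rewrite (ext_linE (@Db k)); apply: (supp_ext sc) => s [cs As].
by apply: sub_supp (@Db_supp k s) => t [st ct]; split; [exact: ct|exact: subA As].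
Qed.

Definition hom k (c c' : schain k) := exists2 e : schain k.+1, supp (@csupp k.+1) e & bdS e = c - c'.

Lemma hom_refl k (c : schain k) : hom c c.
Proof. by exists 0; [exact: supp0|rewrite linear0 subrr]. Qed.

Lemma hom_sym k (c c' : schain k) : hom c c' -> hom c' c.
Proof.
by move=> [e se be]; exists (- e); [exact: suppN|rewrite linearN /= be opprB].
Qed.

Lemma hom_trans k (c1 c2 c3 : schain k) : hom c1 c2 -> hom c2 c3 -> hom c1 c3.
Proof.
move=> [e se be] [e' se' be']; exists (e + e'); first exact: suppD.
by rewrite linearD /= be be' addrA subrK.
Qed.

Lemma hom_Sd k m (c : schain k) : cycle_ c -> supp (@csupp k) c -> hom c (iter m (@Sd k) c).
Proof.
move=> cc sc; elim: m => [|m IH]; first exact: hom_refl.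
apply: (hom_trans IH); exists (Db (iter m (@Sd k) c)).
  by apply: supp_Db; apply: supp_iter_Sd.
by rewrite bd_Db //; apply: cycle_iter_Sd.
Qed.
End Support.
End Homotopies.

(** * Straight-line homotopies followed by a retraction *)

Section StraightHomotopy.
Context {R : realType} (T : topologicalType) (W : normedModType R) (r : W -> T).
Local Notation F k := ('rV[R]_k.+1 * R)%type.
Local Notation schain := (@schain R T).

Definition v_pr k (l : seq 'rV[R]_k.+1) : free (seq (F k)) := gen (map (@iota R 1 k) l).

Lemma bd_v_pr k l : bdc (@v_pr k l) = ext (@v_pr k) (bd l).
Proof. by rewrite /v_pr bdc_gen -lmap_bd. Qed.

Lemma v_pr_nat k (i : 'I_k.+2) l : lmap (ginsert i) (v_pr l) = v_pr (map (insert0 i) l).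
Proof. by rewrite /v_pr lmap_gen -!map_comp. Qed.

Lemma v_pr_supp k (l : seq 'rV[R]_k.+1) :
  supp (fun m => size m = size l /\
    forall y, y \in m -> (forall x, x \in l -> simplex x) -> cyl y) (v_pr l).
Proof.
apply: supp_gen; split; first by rewrite size_map.
by move=> y /mapP[x xl ->] h; apply: cyl_iota; [exact: h|rewrite lexx ler01].
Qed.

Variables (a b : forall k, (@simplex R k -> T) -> 'rV[R]_k.+1 -> W).
Hypothesis a_nat : forall k (s : @simplex R k.+1 -> T) i x, simplex x ->
  a s (insert0 i x) = a (s \o face i) x.
Hypothesis b_nat : forall k (s : @simplex R k.+1 -> T) i x, simplex x ->
  b s (insert0 i x) = b (s \o face i) x.

Definition g_pr k (s : @simplex R k -> T) (y : F k) : T :=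
  r ((1 - y.2) *: a s y.1 + y.2 *: b s y.1).

Lemma g_pr_nat k (s : @simplex R k.+1 -> T) i y : cyl y ->
  g_pr s (ginsert i y) = g_pr (s \o face i) y.
Proof. by move=> [y1 _]; rewrite /g_pr /= a_nat ?b_nat. Qed.

(** The ends [a] and [b] are vector-valued and compatible with faces; the segment between them is
    pushed back to [T] by [r], and continuity is asked only of the resulting homotopy. *)
Lemma straight_homotopy (A : set T -> Prop) (P : forall k, (@simplex R k -> T) -> Prop) k (c : schain k) :
  (forall k (s : @simplex R k -> T), P k s ->
     {within @cyl R k, continuous (g_pr s)} /\ A (g_pr s @` @cyl R k)) ->
  (forall B B', B `<=` B' -> A B' -> A B) ->
  cycle_ c -> supp (P k) c ->
  hom A (ext (fun s => gen (fun x : @simplex R k => r (a s (val x)))) c)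
        (ext (fun s => gen (fun x : @simplex R k => r (b s (val x)))) c).
Proof.
move=> hP subA cc sc.
have v_nil k' : @v_pr k' [::] = gen [::] by [].
exists (nat_opc g_pr k.+1 (@hch R v_pr k) c).
  apply: (supp_ext sc) => s /hP[cs As].
  have := nat_op_supp (j := k.+1) (G := g_pr s) (@hch_supp_verts R v_pr v_pr_supp k).
  by apply: sub_supp => t [st ct]; split; [exact: ct|exact: subA As].
rewrite (natural_homotopy v_nil bd_v_pr v_pr_nat v_pr_supp g_pr_nat cc).
congr (_ - _); apply: eq_ext => s.
  rewrite nat_op_hu; congr (gen _); apply/funext => x.
  by rewrite /g_pr /iota /= subr0 scale1r scale0r addr0.
rewrite /nat_op /v_pr /Sing ext_gen; congr (gen _); apply/funext => x; rewrite /sing.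
(* [iota 1] is affine but not linear, so the computation uses that the barycentric weights sum to
   one. *)
have -> : aff [seq iota 1 i | i <- verts k] (val x) = (val x, 1).
  have E (l : seq 'rV[R]_k.+1) : size l = k.+1 -> aff [seq iota 1 i | i <- l] (val x) = (aff l (val x), 1).
    move=> sl; rewrite /aff.
    have [_ x1] : simplex (val x) := set_mem (valP x).
    rewrite -[1 in RHS]x1 [RHS](_ : _ = \sum_(i < k.+1) ((val x) 0 i *: l`_i, (val x) 0 i)); last first.
      by elim/big_rec3: _ => // i y1 y2 y3 _ <-.
    apply: eq_bigr => i _; rewrite (nth_map 0) ?sl //.
    by rewrite /iota; congr (_, _); rewrite /= -[LHS]/(_ * 1) mulr1.
  by rewrite E ?size_verts // aff_verts.
by rewrite /g_pr /= subrr scale0r scale1r add0r.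
Qed.

End StraightHomotopy.

(** * Small singular chains *)

Section Small.
Context {R : realType} (T : topologicalType) (W : normedModType R) (iot : T -> W).
Hypothesis iot_cont : continuous iot.
Local Notation schain := (@schain R T).

Definition small (g : R) (B : set T) := forall x y, B x -> B y -> `|iot x - iot y| < g.

Lemma small_sub g B B' : B `<=` B' -> small g B' -> small g B.
Proof. by move=> BB h x y /BB Bx /BB By; apply: h. Qed.

Lemma compact_simplex k : compact (@simplex R k).
Proof.
have := @rV_compact R k.+1 (fun=> `[0 : R, 1]%classic) (fun=> @segment_compact R 0 1).
move=> cB; apply: (subclosed_compact _ cB) => [|x [x0 x1] i]; last first.
  rewrite /= in_itv /= x0 -x1 (bigD1 i) //= lerDl.
  by apply: sumr_ge0 => j _; exact: x0.
have -> : @simplex R k = \bigcap_(i in [set: 'I_k.+1]) (fun x : 'rV[R]_k.+1 => x 0 i) @^-1` [set t | 0 <= t]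
    `&` (fun x : 'rV[R]_k.+1 => \sum_i x 0 i) @^-1` [set t | t = 1].
  by apply/seteqP; split=> x [h1 h2]; split => // i *; [exact: h1|exact: h1].
apply: closedI.
  apply: closed_bigI => i _; apply: preimage_closed; last exact: closed_ge.
  by move=> x _; exact: coord_continuous.
apply: preimage_closed; last exact: closed_eq.
by move=> x _; apply: continuous_sumf => i; exact: coord_continuous.
Qed.

Lemma coeff_ext (X : choiceType) (c : free X) : supp (fun x => x \in dom c) c.
Proof. by move=> x; rewrite mem_dom. Qed.

(** Subdivision of an affine simplex stays affine; this reduces iterated subdivision to vertex
    lists, whose mesh is controlled. *)
Lemma Sd_Sing k (E : lmodType R) (G : E -> T) (l : seq E) : size l = k.+1 ->
  Sd (gen (sing G l : @simplex R k -> T)) = Sing k G (sd (@bary R _) l).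
Proof.
move=> sl; rewrite SdE.
transitivity (Sing k (G \o @afflin R E l k) (sd (@bary R _) (verts k))).
  apply: (eq_Sing (@sd_simplex R k (verts k))) => m [sm hm].
  apply/funext => x; rewrite /sing /=.
  have sa : simplex (aff m (val x)).
    apply: simplex_aff; [by rewrite sm size_verts| |exact: set_mem (valP x)].
    by move=> y /hm; apply; exact: simplex_verts.
  by rewrite -[aff m _]/(val (exist (fun x => x \in @simplex R k) _ (mem_set sa))) sext_val.
rewrite -{2}(map_aff_verts sl) -(lmap_sd (g := @afflin R E l k) (b := @bary R _)); last first.
  by move=> l' _; exact: bary_map.
apply/esym; apply: (Sing_lmap (@suppT _ _)) => m _; apply/funext => x.
by rewrite /sing (aff_map (@afflin R E l k)).
Qed.

Lemma iter_Sd k m (s : @simplex R k -> T) :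
  iter m (@Sd R T k) (gen s) = Sing k (sext s) (iter m (ext (sd (@bary R _))) (gen (verts k))).
Proof.
pose P (l : seq 'rV[R]_k.+1) := size l = k.+1.
have sP j : supp P (iter j (ext (sd (@bary R _))) (gen (verts k))).
  elim: j => [|j IH]; first by apply: supp_gen; exact: size_verts.
  by apply: (supp_ext IH) => l Pl; apply: sub_supp (@sd_simplex R k l) => l'; rewrite /P => -[-> _].
elim: m => [|m IH]; first by rewrite /Sing ext_gen sing_verts.
rewrite iterS IH [in RHS]iterS /Sing [RHS]ext_ext (lin_ext _ (@Sd R T k)).
by apply: (eq_ext_supp (sP m)) => l Pl /=; rewrite Sd_Sing.
Qed.

Lemma iter_sd_mesh k m (d : R) : 0 <= d -> mesh (verts k : seq 'rV[R]_k.+1) d ->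
  supp (fun l => [/\ size l = k.+1, (forall x, x \in l -> simplex x) &
                   mesh l ((k%:R / k.+1%:R) ^+ m * d)])
    (iter m (ext (sd (@bary R _))) (gen (verts k))).
Proof.
move=> d0 hd; have q0 : 0 <= k%:R / k.+1%:R :> R by rewrite divr_ge0.
elim: m => [|m IH].
  apply: supp_gen; split; [exact: size_verts|exact: simplex_verts|].
  by rewrite expr0 mul1r.
apply: (supp_ext IH) => l [sl hl ml] l' cl'.
have [sl' hl'] := @sd_simplex R k l l' cl'.
have qm0 : 0 <= (k%:R / k.+1%:R) ^+ m * d by rewrite mulr_ge0 // exprn_ge0.
have := @sd_mesh R _ k l _ _ qm0 ml; rewrite sl => /(_ (leqnn _) l' cl') ml'.
split; [by rewrite sl'|by move=> x xl'; apply: hl'|by rewrite exprS -mulrA].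
Qed.

(** Uniform continuity on the compact simplex turns small mesh into small image. All later iterates
    are covered because several chains will have to share one number of subdivisions. *)
Lemma small_Sd k (s : @simplex R k -> T) g : continuous s -> 0 < g ->
  exists m0, forall m, (m0 <= m)%N -> supp (@csupp R T (small g) k) (iter m (@Sd R T k) (gen s)).
Proof.
move=> cs g0.
have cf : {within @simplex R k, continuous (iot \o sext s)}.
  apply/subspace_continuousP => x kx.
  have /subspace_continuousP/(_ x kx) := sext_continuous cs.
  by move=> h; apply: cvg_comp h _; exact: iot_cont.
have [d d0 hd] := compact_uniform (@compact_simplex k) cf g0.
pose q : R := k%:R / k.+1%:R.
have q0 : 0 <= q by rewrite divr_ge0.
have q1 : `|q| < 1 by rewrite ger0_norm // ltr_pdivrMr // mul1r ltr_nat.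
pose D := \sum_(x <- (verts k : seq 'rV[R]_k.+1)) `|x| + \sum_(x <- (verts k : seq 'rV[R]_k.+1)) `|x|.
have D0 : 0 <= D by apply: addr_ge0; apply: sumr_ge0.
have hD : mesh (verts k : seq 'rV[R]_k.+1) D.
  have h x : x \in (verts k : seq 'rV[R]_k.+1) -> `|x| <= \sum_(x <- (verts k : seq 'rV[R]_k.+1)) `|x|.
    by move=> xv; rewrite (perm_big _ (perm_to_rem xv)) big_cons lerDl; apply: sumr_ge0.
  by move=> x y /h hx /h hy; apply: le_trans (ler_normB _ _) _; apply: lerD.
have /cvgrPdist_lt/(_ d d0) : (fun m => q ^+ m * D) @ \oo --> (0 : R).
  rewrite -[0](mul0r D); apply: cvgMr_tmp; exact: cvg_expr.
move=> [m0 _ hm0]; exists m0 => m m0m; rewrite iter_Sd.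
rewrite /Sing; apply: (supp_ext (@iter_sd_mesh k m D D0 hD)) => l [sl hl ml]; apply: supp_gen; split.
  by apply: (continuous_sing (sext_continuous cs)) => t st; apply: simplex_aff.
have := hm0 m m0m; rewrite /= sub0r normrN ger0_norm ?mulr_ge0 ?exprn_ge0 // => mqd.
move=> _ _ [x _ <-] [y _ <-]; rewrite /sing.
have sx : simplex (val x) := set_mem (valP x).
have sy : simplex (val y) := set_mem (valP y).
apply: hd; [exact: simplex_aff|exact: simplex_aff|apply: le_lt_trans mqd].
by apply: (hull_mesh ml); apply: hull_aff.
Qed.

Lemma small_Sdc k (c : schain k) g : supp (fun s => continuous s) c -> 0 < g ->
  exists m0, forall m, (m0 <= m)%N -> supp (@csupp R T (small g) k) (iter m (@Sd R T k) c).
Proof.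
move=> sc g0.
have /choice[f hf] : forall s : @simplex R k -> T, exists n, s \in dom c -> forall m, (n <= m)%N ->
    supp (@csupp R T (small g) k) (iter m (@Sd R T k) (gen s)).
  move=> s; have [sd|] := boolP (s \in dom c); last by exists 0%N.
  by have [m0 hm0] := small_Sd (supp_dom sc sd) g0; exists m0 => _.
exists (\max_(s <- dom c) f s) => m hm.
have itL : linear (iter m (@Sd R T k)).
  by elim: m {hm} => [|m IH] a x y //=; rewrite IH linearP.
pose itS := HB.pack_for {linear schain k -> schain k} (iter m (@Sd R T k)) (GRing.isLinear.Build _ _ _ _ _ itL).
rewrite -[iter m _ c]/(itS c) ext_linE.
apply: (supp_ext (@coeff_ext _ c)) => s sd; apply: (hf s sd).
by apply: leq_trans hm; apply: leq_bigmax_seq.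
Qed.

End Small.

(** * Betti numbers as differences of ranks *)

Section Betti.
Context {R : realType} (T : topologicalType).
Local Notation schain := (@schain R T).

Definition fchain k (c : schain k) : (@simplex R k -> T) -> rat := fun s => coeff s c.

Lemma fchain_inj k (c c' : schain k) : fchain c = fchain c' -> c = c'.
Proof.
by move=> h; apply/eqP/freeg_eqP => s; rewrite -[LHS]/(fchain c s) h.
Qed.

Lemma chain_fchain k (c : schain k) : supp (fun s => continuous s) c -> chain (fchain c).
Proof.
move=> sc; split; last exact: sc.
have -> : [set s | fchain c s != 0] = [set` dom c]; last exact: finite_seq.
by apply/seteqP; split => s /=; rewrite mem_dom.
Qed.

Lemma fchain_surj k (c : (@simplex R k -> T) -> rat) : chain c ->
  exists2 U : schain k, supp (fun s => continuous s) U & c = fchain U.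
Proof.
move=> [fc cc]; pose S := fset_set [set s | c s != 0].
have hS s : s \in S = (c s != 0).
  by rewrite in_fset_set //; apply/idP/idP => [/set_mem|/mem_set].
have E : c = fchain (\sum_(s <- S) c s *: gen s).
  apply/funext => s; rewrite /fchain.
  have -> : coeff s (\sum_(s <- S) c s *: gen s) = \sum_(u <- S) c u * (u == s)%:R.
    rewrite (big_morph (coeff s) (coeffD s) (coeff0 _ s)); apply: eq_bigr => u _.
    by rewrite coeffZ coeffU mul1r.
  have [sS|sS] := boolP (s \in S).
    rewrite (big_fsetD1 s) //= eqxx mulr1 big1_fset ?addr0 // => u.
    by rewrite in_fsetD1 => /andP[/negbTE -> _] _; rewrite mulr0.
  rewrite big1_fset; first by apply/eqP; move: sS; rewrite hS negbK.
  by move=> u uS _; have [us|] := eqVneq u s; [rewrite -us uS in sS|rewrite mulr0].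
by exists (\sum_(s <- S) c s *: gen s) => // s; rewrite -[coeff _ _]/(fchain _ s) -E; apply: cc.
Qed.

Lemma boundary_fchain k (U : schain k.+1) (t : @simplex R k -> T) :
  boundary (fchain U) t = coeff t (bdS U).
Proof.
have -> : coeff t (bdS U) = \sum_(s <- dom U) coeff s U * \sum_(i < k.+2) (-1) ^+ i * (s \o face i == t)%:R.
  rewrite /bdS ext.unlock (big_morph (coeff t) (coeffD t) (coeff0 _ t)); apply: eq_bigr => s _.
  rewrite coeffZ /bds (big_morph (coeff t) (coeffD t) (coeff0 _ t)); congr (_ * _).
  by apply: eq_bigr => i _; rewrite coeffZ coeffU mul1r.
rewrite /boundary; under [RHS]eq_bigr do rewrite mulr_sumr.
rewrite exchange_big /=; apply: eq_bigr => i _.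
rewrite -(@eq_fsbigl _ _ _ _ _ [set` (fun s : @simplex R k.+1 -> T => s \o face i == t)]); last first.
  by apply/seteqP; split => s /=; [move/eqP|move=> h; apply/eqP].
rewrite -(@bigfs _ _ _ _ (dom U)) ?uniq_dom //; last first.
  by move=> s _; exact: coeff_outdom.
rewrite big_mkcond mulr_sumr; apply: eq_bigr => s _ /=.
by case: ifP => _; rewrite ?mulr1 ?mulr0 // mulrC.
Qed.

Lemma boundary_bdS k (U : schain k.+1) (c : schain k) :
  (forall t, fchain c t = boundary (fchain U) t) <-> c = bdS U.
Proof.
split=> [h|-> t]; last by rewrite boundary_fchain.
by apply: fchain_inj; apply/funext => t; rewrite h boundary_fchain.
Qed.

Definition homT k := @hom R T (fun=> True) k.

Lemma homologousP k (c c' : schain k) : homologous (fchain c) (fchain c') <-> homT c c'.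
Proof.
split=> [[e /fchain_surj[E sE ->] h]|[E sE bE]].
  exists E; first by apply: sub_supp sE.
  apply/esym/boundary_bdS => t; rewrite -h /fchain.
  by rewrite coeffB.
exists (fchain E); first by apply/chain_fchain/(sub_supp _ sE) => s [].
by move=> t; rewrite boundary_fchain bE /fchain coeffB.
Qed.

Lemma cycleP k (c : schain k) : Defs.cycle (fchain c) <-> supp (fun s => continuous s) c /\ cycle_ c.
Proof.
have ch : chain (fchain c) <-> supp (fun s => continuous s) c.
  by split=> [[_ h]|/chain_fchain].
case: k c ch => [|k] c ch /=; first by split=> [/ch|[/ch]].
split=> [[/ch sc h]|[/ch sc bc]]; split=> //.
  by apply/esym/boundary_bdS => t; rewrite h /fchain coeff0.
by move=> t; rewrite boundary_fchain bc coeff0.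
Qed.

Lemma cycle_surj k (c : (@simplex R k -> T) -> rat) : Defs.cycle c ->
  exists2 U : schain k, supp (fun s => continuous s) U /\ cycle_ U & c = fchain U.
Proof.
move=> cc; have ch : chain c by case: k c cc => // k c [].
by have [U sC E] := fchain_surj ch; exists U => //; apply/cycleP; rewrite -E.
Qed.

Lemma fchain_sum k b (a : 'I_b -> rat) (z : 'I_b -> schain k) :
  (fun t => \sum_(i < b) a i * fchain (z i) t) = fchain (\sum_i a i *: z i).
Proof.
apply/funext => t; rewrite /fchain (big_morph (coeff t) (coeffD t) (coeff0 _ t)).
by apply: eq_bigr => i _; rewrite coeffZ.
Qed.

Definition betti_basis k b (z : 'I_b -> schain k) :=
  (forall i, supp (fun s => continuous s) (z i) /\ cycle_ (z i)) /\
  (forall c, supp (fun s => continuous s) c -> cycle_ c ->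
     exists! a : 'I_b -> rat, homT c (\sum_i a i *: z i)).

Lemma is_bettiP k b : @is_betti R T k b <-> exists z : 'I_b -> schain k, betti_basis z.
Proof.
split=> [[z [cz hz]]|[z [cz hz]]].
  have /choice[Z hZ] : forall i, exists U : schain k,
      (supp (fun s => continuous s) U /\ cycle_ U) /\ z i = fchain U.
    by move=> i; have [U] := cycle_surj (cz i); exists U.
  exists Z; split=> [i|c sc cc]; first by case: (hZ i).
  have /hz[a [ha ua]] : Defs.cycle (fchain c) by apply/cycleP.
  have E a' : (fun t => \sum_(i < b) a' i * z i t) = fchain (\sum_i a' i *: Z i).
    rewrite -fchain_sum; apply/funext => t; apply: eq_bigr => i _.
    by case: (hZ i) => _ ->.
  exists a; split; first by move: ha; rewrite E => /homologousP.
  by move=> a' /homologousP; rewrite -E => /ua.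
exists (fun i => fchain (z i)); split=> [i|c /cycle_surj[U [sC cC] ->]]; first exact/cycleP.
have [a [ha ua]] := hz U sC cC; exists a; split.
  by rewrite fchain_sum; apply/homologousP.
by move=> a'; rewrite fchain_sum => /homologousP /ua.
Qed.

Lemma homT_sum k b (a : 'I_b -> rat) (z z' : 'I_b -> schain k) :
  (forall i, homT (z i) (z' i)) -> homT (\sum_i a i *: z i) (\sum_i a i *: z' i).
Proof.
move=> h; have /choice[e he] : forall i, exists e : schain k.+1,
    supp (@csupp _ T (fun=> True) k.+1) e /\ bdS e = z i - z' i.
  by move=> i; have [e] := h i; exists e.
exists (\sum_i a i *: e i).
  by apply: supp_sum => i _; apply: suppZ; case: (he i).
rewrite linear_sum -sumrB; apply: eq_bigr => i _.
by rewrite linearZ /= (he i).2 scalerBr.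
Qed.

(** Uniqueness of coordinates makes the product of the two change-of-basis matrices the identity,
    and ranks then compare the sizes. *)
Lemma betti_unique k b b' : @is_betti R T k b -> @is_betti R T k b' -> b = b'.
Proof.
suff H b1 b2 (z : 'I_b1 -> schain k) (z' : 'I_b2 -> schain k) :
    betti_basis z -> betti_basis z' -> (b1 <= b2)%N.
  by move=> /is_bettiP[z hz] /is_bettiP[z' hz']; apply/eqP; rewrite eqn_leq !(H _ _ _ _ hz hz', H _ _ _ _ hz' hz).
move=> [cz hz] [cz' hz'].
have /choice[A hA] : forall i, exists a : 'I_b2 -> rat, homT (z i) (\sum_j a j *: z' j).
  by move=> i; have [s c] := cz i; have [a [ha _]] := hz' _ s c; exists a.
have /choice[B hB] : forall j, exists a : 'I_b1 -> rat, homT (z' j) (\sum_i a i *: z i).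
  by move=> j; have [s c] := cz' j; have [a [ha _]] := hz _ s c; exists a.
pose mA := \matrix_(i, j) A i j; pose mB := \matrix_(j, i) B j i.
suff AB : mA *m mB = 1%:M.
  have /= := mxrankM_maxl mA mB; rewrite AB mxrank1 => /leq_trans; apply; exact: rank_leq_col.
apply/matrixP => i l.
have [s c] := cz i; have [a [_ ua]] := hz _ s c.
have h1 : a = (fun l => (mA *m mB) i l).
  apply: ua; apply: (hom_trans (hA i)); apply: (hom_trans (homT_sum _ hB)).
  have -> : \sum_i0 A i i0 *: (\sum_i1 B i0 i1 *: z i1) = \sum_l (mA *m mB) i l *: z l.
    under eq_bigr do rewrite scaler_sumr.
    rewrite exchange_big; apply: eq_bigr => l' _; rewrite mxE scaler_suml.
    by apply: eq_bigr => j _; rewrite !mxE scalerA.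
  exact: hom_refl.
have h2 : a = (fun l => (1%:M : 'M[rat]_b1) i l).
  apply: ua; have -> : \sum_l (1%:M : 'M[rat]_b1) i l *: z l = z i.
    rewrite (bigD1 i) //= mxE eqxx scale1r big1 ?addr0 // => j ji.
    by rewrite mxE eq_sym (negbTE ji) scale0r.
  exact: hom_refl.
by rewrite -[LHS]/((fun l => (mA *m mB) i l) l) -h1 h2.
Qed.

Lemma bettiE k b : @is_betti R T k b -> betti R T k = b.
Proof.
move=> hb; rewrite /betti; case: xgetP => [b' _ hb'|/(_ b)//].
exact: betti_unique hb' hb.
Qed.

(** [Phi] presents the homology of [T] as [Z/W]; the rows of a basis of a complement of [W] in [Z]
    give the required cycles. *)
Lemma betti_rank k m (Z W : 'M[rat]_m) (Phi : {linear 'rV[rat]_m -> schain k}) :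
  (W <= Z)%MS ->
  (forall z, (z <= Z)%MS -> supp (fun s => continuous s) (Phi z) /\ cycle_ (Phi z)) ->
  (forall c, supp (fun s => continuous s) c -> cycle_ c -> exists2 z, (z <= Z)%MS & homT c (Phi z)) ->
  (forall z, (z <= Z)%MS -> (homT (Phi z) 0 <-> (z <= W)%MS)) ->
  (betti R T k)%:R = (\rank Z)%:R - (\rank W)%:R :> rat.
Proof.
move=> WZ hc hs hW.
pose V := (Z :\: W)%MS.
have rV : (\rank V + \rank W)%N = \rank Z.
  by rewrite -(mxrank_cap_compl Z W) addnC; congr addn; rewrite (capmx_idPr WZ).
have VW : (V :&: W)%MS = 0 := capmx_diff Z W.
have VZ : (V <= Z)%MS by exact: diffmxSl.
have rbV : (row_base V <= V)%MS by rewrite eq_row_base.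
have rB i : (row i (row_base V) <= Z)%MS.
  by apply: submx_trans VZ; apply: submx_trans rbV; exact: row_sub.
have sumE (a : 'I_(\rank V) -> rat) :
    \sum_i a i *: Phi (row i (row_base V)) = Phi ((\row_i a i) *m row_base V).
  rewrite mulmx_sum_row linear_sum; apply: eq_bigr => i _.
  by rewrite linearZ mxE.
have homB z z' : homT (Phi z) (Phi z') <-> homT (Phi (z - z')) 0.
  by split=> -[e se be]; exists e => //; move: be; rewrite linearB /= subr0.
rewrite -rV natrD addrK; congr (_%:R); apply: bettiE; apply/is_bettiP.
exists (fun i => Phi (row i (row_base V))); split=> [i|c sc cc]; first exact: hc.
have [z zZ cz] := hs c sc cc.
have /sub_addsmxP[[u1 u2] zE] : (z <= V + W)%MS.
  apply: submx_trans (addsmxS (submx_refl V) (capmxSr Z W)).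
  by rewrite addsmx_diff_cap_eq.
have /submxP[a aE] : (u1 *m V <= row_base V)%MS by rewrite eq_row_base submxMl.
exists (fun i => a 0 i); split.
  rewrite sumE (_ : \row_i a 0 i = a); last by apply/rowP => i; rewrite mxE.
  apply: (hom_trans cz); apply/homB/hW.
    by rewrite addmx_sub // eqmx_opp -aE; apply: submx_trans (submxMl _ _) VZ.
  by rewrite zE /= -aE addrC addKr submxMl.
move=> a' ha'; apply/funext => i.
have E0 : ((a - \row_i a' i) *m row_base V <= W)%MS.
  apply/hW; first by apply: submx_trans VZ; apply: submx_trans rbV; exact: submxMl.
  rewrite mulmxBl; apply/homB; rewrite -sumE.
  apply: hom_trans ha'; apply: hom_sym; apply: (hom_trans cz); apply/homB/hW.
    by rewrite addmx_sub // eqmx_opp -aE; apply: submx_trans (submxMl _ _) VZ.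
  by rewrite zE /= -aE addrC addKr submxMl.
have E1 : (a - \row_i a' i) *m row_base V = 0.
  apply/eqP; rewrite -submx0 -VW sub_capmx E0 andbT.
  by apply: submx_trans rbV; exact: submxMl.
have : a - \row_i a' i = 0 by apply: (row_free_inj (row_base_free V)); rewrite E1 mul0mx.
by move=> /rowP/(_ i); rewrite !mxE => /eqP; rewrite subr_eq0 => /eqP.
Qed.

End Betti.

(** * Finite models and the localisation of the trace *)

Lemma floor_close (R : realType) (u v : R) : `|u - v| < 1 -> `|Num.floor u - Num.floor v| <= 1.
Proof.
rewrite ltr_norml => /andP[h1 h2].
have /andP[u1 u2] := floor_itv u; have /andP[v1 v2] := floor_itv v.
rewrite !intrD in u2 v2.
have h3 : Num.floor u < Num.floor v + 2 by rewrite -(ltr_int R) intrD; lra.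
have h4 : Num.floor v < Num.floor u + 2 by rewrite -(ltr_int R) intrD; lra.
by rewrite ler_norml; move: (Num.floor u) (Num.floor v) h3 h4 => m n; clear; lia.
Qed.

(** An edge with ends at distance one is the edge between [j] and [j+1] exactly when it crosses the
    threshold [j+1], and the right side counts crossings with sign. The reversed edge is excluded,
    as it would give -1 instead of 0. *)
Lemma cross_count (X Y U V j : int) : `|X - Y| <= 1 -> X != Y ->
  (U = j /\ V = j + 1) \/ (V = j /\ U = j + 1) -> ~~ ((X == V) && (Y == U)) ->
  ((X == U) && (Y == V))%:R = (V - U)%:~R * ((j + 1 <= Y)%R%:R - (j + 1 <= X)%R%:R) :> rat.
Proof.
move=> XY nXY juv nr.
have E : ((X == U) && (Y == V) : nat)%:Z =
    (V - U) * (((j + 1 <= Y)%R : nat)%:Z - ((j + 1 <= X)%R : nat)%:Z).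
  by case: juv nr => -[-> ->] nr; lia.
move: (V - U) E => d /(congr1 (fun z : int => z%:~R : rat)); rewrite intrM intrB => E.
exact: E.
Qed.

(** After doubling, the edge from [j] to [j+1] covers itself once when [j] is -1 or 0, and not at
    all otherwise. *)
Lemma cross_end (U V j : int) : (U = j /\ V = j + 1) \/ (V = j /\ U = j + 1) ->
  (V - U)%:~R * ((j + 1 <= V + V)%R%:R - (j + 1 <= U + U)%R%:R) =
  (- 1 <= j)%R%:R - (1 <= j)%R%:R :> rat.
Proof.
move=> juv.
have E : (V - U) * (((j + 1 <= V + V)%R : nat)%:Z - ((j + 1 <= U + U)%R : nat)%:Z)
    = ((- 1 <= j)%R : nat)%:Z - ((1 <= j)%R : nat)%:Z.
  by case: juv => -[-> ->]; lia.
move: (V - U) E => d /(congr1 (fun z : int => z%:~R : rat)); rewrite intrM !intrB => E.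
exact: E.
Qed.

Lemma no_three (x y z : int) : `|x - y| <= 1 -> `|x - z| <= 1 -> `|y - z| <= 1 ->
  x != y -> x != z -> y != z -> False.
Proof. by lia. Qed.

Section Retract.
Context {R : realType} (T : topologicalType) (W : normedModType R).
Variables (iot : T -> W) (r : W -> T) (eta : R).
Hypothesis iot_cont : continuous iot.
Hypothesis eta0 : 0 < eta.
Hypothesis r_iot : forall x, r (iot x) = x.
Hypothesis r_cont : forall x y, `|y - iot x| < eta -> {for y, continuous r}.
Local Notation schain := (@schain R T).

Let contT (A : set T) := True.
Let subT : forall B B', B `<=` B' -> contT B' -> contT B. Proof. by []. Qed.

(** Both ends are within [eta] of one point of the image of [iot], hence so is the segment, and [r]
    is continuous along it. *)
Lemma g_pr_continuous k (u v : 'rV[R]_k.+1 -> W) :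
  {within @simplex R k, continuous u} -> {within @simplex R k, continuous v} ->
  (forall x, simplex x -> exists2 y, `|u x - iot y| < eta & `|v x - iot y| < eta) ->
  {within @cyl R k, continuous (fun y => r ((1 - y.2) *: u y.1 + y.2 *: v y.1))}.
Proof.
move=> cu cv huv; apply/subspace_continuousP => y cy.
have fstw : y0.1 @[y0 --> within (@cyl R k) (nbhs y)] --> within (@simplex R k) (nbhs y.1).
  move=> U; rewrite /= !nbhs_filterE /within /= => hU.
  have : {for y, continuous (fun z : 'rV[R]_k.+1 * R => z.1)} by exact: cvg_fst.
  by move=> /(_ _ hU); rewrite /nbhs /=; apply: filterS => z hz [z1 _]; exact: hz.
have sndw : y0.2 @[y0 --> within (@cyl R k) (nbhs y)] --> y.2.
  apply: cvg_within_filter; exact: cvg_snd.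
move/subspace_continuousP : cu => /(_ _ cy.1) cu.
move/subspace_continuousP : cv => /(_ _ cy.1) cv.
have c1 : u y0.1 @[y0 --> within (@cyl R k) (nbhs y)] --> u y.1 := cvg_comp _ _ fstw cu.
have c2 : v y0.1 @[y0 --> within (@cyl R k) (nbhs y)] --> v y.1 := cvg_comp _ _ fstw cv.
have : (1 - y0.2) *: u y0.1 + y0.2 *: v y0.1 @[y0 --> within (@cyl R k) (nbhs y)] -->
   (1 - y.2) *: u y.1 + y.2 *: v y.1.
  by apply: cvgD; apply: cvgZ => //; apply: cvgB => //; exact: cvg_cst.
move=> h; apply: cvg_comp h _.
have [z uz vz] := huv _ cy.1; apply: (@r_cont z).
have -> : (1 - y.2) *: u y.1 + y.2 *: v y.1 - iot z = (1 - y.2) *: (u y.1 - iot z) + y.2 *: (v y.1 - iot z).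
  rewrite !scalerBr addrACA -opprD -scalerDl subrK scale1r //.
have /andP[y0 y1] := cy.2.
apply: le_lt_trans (ler_normD _ _) _; rewrite !normrZ !ger0_norm ?subr_ge0 //.
have [y20|y20] := eqVneq y.2 0; first by rewrite y20 subr0 mul1r mul0r addr0.
have t0 : 0 < y.2 by rewrite lt_neqAle eq_sym y20.
have h1 : 0 < y.2 * (eta - `|v y.1 - iot z|) by rewrite mulr_gt0 // subr_gt0.
have h2 : 0 <= (1 - y.2) * (eta - `|u y.1 - iot z|) by rewrite mulr_ge0 // subr_ge0 // ltW.
move: (`|v y.1 - iot z|) (`|u y.1 - iot z|) h1 h2 => A B h1 h2; lra.
Qed.

Lemma within_cst_comp k (s : @simplex R k -> T) (h : T -> W) : continuous h -> continuous s ->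
  {within @simplex R k, continuous (h \o sext s)}.
Proof.
move=> ch cs; apply/subspace_continuousP => x kx.
have /subspace_continuousP/(_ x kx) hx := sext_continuous cs.
by apply: cvg_comp hx _; exact: ch.
Qed.

Section Map.
Variable f : T -> T.
Hypothesis f_cont : continuous f.
Hypothesis f_near : forall x, `|iot (f x) - iot x| < eta.

Definition fS k : schain k -> schain k := ext (fun s => gen (f \o s)).
HB.instance Definition _ k := GRing.Linear.on (@fS k).

Lemma bdS_fS k (c : schain k.+1) : bdS (fS c) = fS (bdS c).
Proof.
apply: (@eq_lin _ _ (@bdS R T k \o @fS k.+1) (@fS k \o @bdS R T k)) => s.
rewrite /= /fS ext_gen /bdS !ext_gen /bds linear_sum; apply: eq_bigr => i _.
by rewrite linearZ /= ext_gen.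
Qed.

Lemma cycle_fS k (c : schain k) : cycle_ c -> cycle_ (fS c).
Proof. by case: k c => // k c /= cc; rewrite bdS_fS cc linear0. Qed.

Lemma supp_fS k (c : schain k) : supp (fun s => continuous s) c -> supp (fun s => continuous s) (fS c).
Proof.
move=> sc; apply: (supp_ext sc) => s cs; apply: supp_gen => x.
by apply: continuous_comp; [exact: cs|exact: f_cont].
Qed.

(** The segment from a point to its image stays in the tube, so [f] is homotopic to the identity. *)
Lemma hom_fS k (c : schain k) : cycle_ c -> supp (fun s => continuous s) c -> homT c (fS c).
Proof.
move=> cc sc.
have := @straight_homotopy R T W r (fun k s => iot \o sext s) (fun k s => iot \o f \o sext s)
  _ _ contT (fun k s => continuous s) k c _ subT cc sc.
have E1 : ext (fun s : @simplex R k -> T => gen (fun x : @simplex R k => r ((iot \o sext s) (val x)))) c = c.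
  rewrite -[RHS]ext_genE; apply: eq_ext => s; congr (gen _); apply/funext => x.
  by rewrite /= r_iot sext_val.
have E2 : ext (fun s : @simplex R k -> T => gen (fun x : @simplex R k => r ((iot \o f \o sext s) (val x)))) c = fS c.
  apply: eq_ext => s; congr (gen _); apply/funext => x.
  by rewrite /= r_iot sext_val.
rewrite E1 E2; apply.
- by move=> j s i x sx; rewrite /= sext_face.
- by move=> j s i x sx; rewrite /= sext_face.
move=> j s cs; split=> //; apply: g_pr_continuous.
- exact: within_cst_comp.
- apply: (@within_cst_comp j s (iot \o f)) => // x.
  by apply: continuous_comp; [exact: f_cont|exact: iot_cont].
- by move=> x sx; exists (sext s x); rewrite /= ?subrr ?normr0.
Qed.
End Map.

(** * The Vietoris-Rips model of a net *)

Section Net.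
Variables (M : nat) (q : 'I_M -> T) (net : T -> 'I_M) (gm g dl : R).
Hypothesis netP : forall x, `|iot (q (net x)) - iot x| < gm.
Hypothesis g0 : 0 < g.
Hypothesis gdl : g + gm + gm <= dl.
Hypothesis dle : dl < eta.

(** The simplices of the Vietoris-Rips complex at scale [dl]. *)
Definition good (l : seq 'I_M) :=
  all (fun i => all (fun j => `|iot (q i) - iot (q j)| <= dl) l) l.

Lemma goodP l : reflect (forall i j, i \in l -> j \in l -> `|iot (q i) - iot (q j)| <= dl) (good l).
Proof.
apply: (iffP allP) => [h i j il jl|h i il]; first by have /allP := h i il; apply.
by apply/allP => j; apply: h.
Qed.

Lemma good_sub l l' : {subset l' <= l} -> good l -> good l'.
Proof. by move=> sub /goodP h; apply/goodP => i j /sub il /sub jl; apply: h. Qed.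

Definition phi k (c : free (seq 'I_M)) : schain k := Sing k r (lmap (iot \o q) c).
Lemma phi_is_linear k : linear (@phi k).
Proof. by move=> a x y; rewrite /phi !linearP. Qed.
HB.instance Definition _ k := GRing.isLinear.Build rat (free (seq 'I_M)) (schain k) *:%R (@phi k)
  (@phi_is_linear k).

Lemma phi_gen k l : phi k (gen l) = gen (sing r (map (iot \o q) l)) :> schain k.
Proof. by rewrite /phi lmap_gen /Sing ext_gen. Qed.

Lemma r_within (A : set W) : (forall y, A y -> exists x, `|y - iot x| < eta) -> {within A, continuous r}.
Proof.
move=> hA; apply/subspace_continuousP => y /hA[x yx].
by apply: cvg_within_filter; exact: (r_cont yx).
Qed.

Lemma phi_cont k l : good l -> size l = k.+1 ->
  continuous (sing r (map (iot \o q) l) : @simplex R k -> T).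
Proof.
move=> /goodP gl sl.
apply: (@continuous_sing _ _ _ _ _ [set y | exists x, `|y - iot x| < eta]).
  by apply: r_within.
case: l gl sl => // i l gl sl t st; exists (q i); apply: le_lt_trans dle.
have : hull (map (iot \o q) (i :: l)) (aff (map (iot \o q) (i :: l)) t).
  by apply: hull_aff => //; rewrite size_map.
by apply => _ /mapP[j jl ->]; apply: gl => //; rewrite mem_head.
Qed.

Lemma supp_phi k c : supp (fun l => size l = k.+1 /\ good l) c ->
  supp (fun s => continuous s) (phi k c).
Proof.
move=> sc; rewrite (ext_linE (@phi k)); apply: (supp_ext sc) => l [sl gl].
by rewrite /= phi_gen; apply: supp_gen; exact: phi_cont.
Qed.

Lemma bdS_phi k c : supp (fun l => size l = k.+2) c -> bdS (phi k.+1 c) = phi k (bdc c).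
Proof.
move=> sc; rewrite /phi bdS_Sing ?lmap_bdc //.
by apply: (supp_lmap sc) => l; rewrite size_map.
Qed.

Definition nv k (s : @simplex R k -> T) : seq 'I_M := map (net \o sext s) (verts k).

Lemma size_nv k (s : @simplex R k -> T) : size (nv s) = k.+1.
Proof. by rewrite size_map size_verts. Qed.

Lemma del_nv k (s : @simplex R k.+1 -> T) (i : 'I_k.+2) : del i (nv s) = nv (s \o face i).
Proof.
rewrite /nv {1}/del -map_take -map_drop -map_cat -/(del _ _) del_verts -map_comp.
by apply/eq_in_map => x /simplex_verts sx /=; rewrite sext_face.
Qed.

Definition nvc k : schain k -> free (seq 'I_M) := ext (fun s => gen (nv s)).
HB.instance Definition _ k := GRing.Linear.on (@nvc k).

Lemma bdc_nvc k (c : schain k.+1) : bdc (nvc c) = nvc (bdS c).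
Proof.
apply: (@eq_lin _ _ (@bdc _ \o @nvc k.+1) (@nvc k \o @bdS R T k)) => s.
rewrite /= /nvc ext_gen bdc_gen /bdS !ext_gen bdE size_nv /bds linear_sum.
by apply: eq_bigr => i _; rewrite linearZ /= ext_gen del_nv.
Qed.

Definition psi k (c : schain k) : free (seq 'I_M) := ext (@alt _ _) (nvc c).
Lemma psi_is_linear k : linear (@psi k).
Proof. by move=> a x y; rewrite /psi !linearP. Qed.
HB.instance Definition _ k := GRing.isLinear.Build rat (schain k) (free (seq 'I_M)) *:%R (@psi k)
  (@psi_is_linear k).

Lemma bdc_psi k (c : schain k.+1) : bdc (psi c) = psi (bdS c).
Proof.
rewrite /psi -bdc_nvc.
transitivity (ext (fun l => bdc (alt l)) (nvc c)); first exact: bdc_ext.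
transitivity (ext (fun l => ext (@alt _ _) (bd l)) (nvc c)); last by rewrite -ext_ext.
by apply: eq_ext => l; exact: bd_alt.
Qed.

(** Origin of the condition [g + gm + gm <= dl]: two vertices of a [g]-small simplex are each moved
    by less than [gm] to the net. *)
Lemma good_nv k (s : @simplex R k -> T) : small iot g (range s) -> good (nv s).
Proof.
move=> ss; apply/goodP => _ _ /mapP[x xv ->] /mapP[y yv ->] /=.
have h z : range s (sext s z) by exists (insubd (simplex0 k) z).
have := ss _ _ (h x) (h y); have := netP (sext s x); have := netP (sext s y).
set a := iot (q _); set b := iot (sext s y); set a' := iot (q _); set b' := iot (sext s x).
move=> h1 h2 h3.
have -> : a' - a = (a' - b') + (b' - b) + (b - a) by rewrite (addrA (a' - b')) subrK addrA subrK.
apply: le_trans gdl; apply: le_trans (ler_normD _ _) _.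
rewrite addrC [leRHS]addrC; apply: lerD; first by rewrite distrC ltW.
apply: le_trans (ler_normD _ _) _; rewrite addrC; apply: lerD; exact: ltW.
Qed.

Definition sgood k (l : seq 'I_M) := [/\ size l = k.+1, sorted <%O l & good l].

Lemma supp_nvc k (c : schain k) : supp (@csupp R T (small iot g) k) c ->
  supp (fun l => size l = k.+1 /\ good l) (nvc c).
Proof.
move=> sc; apply: (supp_ext sc) => s [_ ss]; apply: supp_gen; split; first exact: size_nv.
exact: good_nv.
Qed.

Lemma supp_altc k (c : free (seq 'I_M)) : supp (fun l => size l = k.+1 /\ good l) c ->
  supp (sgood k) (ext (@alt _ _) c).
Proof.
move=> sc; apply: (supp_ext sc) => l [sl gl]; apply: sub_supp (@supp_alt _ _ l) => m [sm pm].
split=> //; first by rewrite -sl; apply/esym/perm_size.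
by apply: good_sub gl => i; rewrite (perm_mem pm).
Qed.

Lemma supp_psi k (c : schain k) : supp (@csupp R T (small iot g) k) c -> supp (sgood k) (psi c).
Proof. by move=> /supp_nvc; apply: supp_altc. Qed.

(** A small simplex and the realisation of its net vertices are joined by straight segments inside
    the tube. *)
Lemma hom_nvc k (c : schain k) : cycle_ c -> supp (@csupp R T (small iot g) k) c ->
  homT c (phi k (nvc c)).
Proof.
move=> cc sc.
have := @straight_homotopy R T W r (fun k s => iot \o sext s)
  (fun k s x => aff (map (iot \o q) (nv s)) x)
  _ _ contT (@csupp R T (small iot g)) k c _ subT cc sc.
have E1 : ext (fun s : @simplex R k -> T => gen (fun x : @simplex R k => r ((iot \o sext s) (val x)))) c = c.
  rewrite -[RHS]ext_genE; apply: eq_ext => s; congr (gen _); apply/funext => x.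
  by rewrite /= r_iot sext_val.
have E2 : ext (fun s : @simplex R k -> T => gen (fun x : @simplex R k => r (aff (map (iot \o q) (nv s)) (val x)))) c = phi k (nvc c).
  by rewrite /nvc (lin_ext _ (@phi k)); apply: eq_ext => s /=; rewrite phi_gen.
rewrite E1 E2; apply.
- by move=> j s i x sx; rewrite /= sext_face.
- by move=> j s i x sx; rewrite /= aff_insert0 -del_nv /del map_cat map_take map_drop.
move=> j s [cs ss]; split=> //; apply: g_pr_continuous.
- exact: within_cst_comp.
- by apply: continuous_subspaceT => x; exact: continuous_aff.
- move=> x sx; exists (sext s x); rewrite /= ?subrr ?normr0 //.
  apply: le_lt_trans dle; apply: le_trans gdl.
  have gmp : 0 < gm by apply: le_lt_trans (netP (sext s x)).
  have : hull (map (iot \o q) (nv s)) (aff (map (iot \o q) (nv s)) x).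
    by apply: hull_aff => //; rewrite size_map size_nv.
  apply => _ /mapP[_ /mapP[y yv ->] ->] /=.
  have h z : range s (sext s z) by exists (insubd (simplex0 j) z).
  have h1 := ss _ _ (h y) (h x); have h2 := netP (sext s y).
  rewrite -(subrK (iot (sext s y)) (iot (q _))) -addrA; apply: le_trans (ler_normD _ _) _.
  by move: (`|_ - _|) (`|iot (sext s y) - _|) h1 h2 gmp => u v h1 h2 gmp; lra.
Qed.

Variable i0 : 'I_M.

(** Homotopy from alternation to the identity. Coning from the first vertex of the list itself
    introduces no new vertex; [i0] is only the default value of [head]. *)
Definition altH := ch (@alt _ _) (fun l => gen l) (head i0).

Lemma bd_altH l : bdc (altH l) = alt l - gen l - ext altH (bd l).
Proof.
apply: bd_ch => // [l'|l']; first exact: bd_alt.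
by rewrite bdc_gen ext_genE.
Qed.

Lemma supp_altH l : supp (fun m => size m = (size l).+1 /\ forall i, i \in m -> i \in l) (altH l).
Proof.
apply: (supp_ch (K := fun l i => i \in l)) => //.
- by move=> [//|i l'] _; rewrite mem_head.
- by move=> l1 l2 i /mem_subseq sub /sub.
- move=> l'; apply: sub_supp (@supp_alt _ _ l') => m [_ pm].
  by split=> [|i]; [exact/esym/perm_size|rewrite (perm_mem pm)].
- by move=> l'; apply: supp_gen.
Qed.

Lemma hom_alt k (c : free (seq 'I_M)) : supp (fun l => size l = k.+1 /\ good l) c ->
  ext altH (bdc c) = 0 -> homT (phi k c) (phi k (ext (@alt _ _) c)).
Proof.
move=> sc hc; apply: hom_sym; exists (phi k.+1 (ext altH c)).
  have : supp (fun l => size l = k.+2 /\ good l) (ext altH c).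
    apply: (supp_ext sc) => l [sl gl]; apply: sub_supp (@supp_altH l) => m [-> sub].
    by rewrite sl; split=> //; apply: good_sub gl.
  by move=> /supp_phi; apply: sub_supp.
rewrite bdS_phi; last first.
  apply: (supp_ext sc) => l [sl gl]; apply: sub_supp (@supp_altH l) => m [-> _].
  by rewrite sl.
rewrite bdc_ext (eq_ext _ bd_altH) !extB ext_genE -ext_ext -/(bdc _) hc subr0.
exact: linearB.
Qed.

Lemma hom_phi_psi k (c : schain k) : cycle_ c -> supp (@csupp R T (small iot g) k) c ->
  homT c (phi k (psi c)).
Proof.
move=> cc sc; apply: (hom_trans (hom_nvc cc sc)); apply: hom_alt; first exact: supp_nvc.
(* In degree 0 the augmented boundary is a multiple of the empty list rather than zero, but [altH]
   vanishes on the empty list. *)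
case: k c cc sc => [|k] c cc sc; last by rewrite bdc_nvc cc !linear0.
have : supp (fun l => l = [::]) (bdc (nvc c)).
  apply: (supp_ext (supp_nvc sc)) => l [sl _]; apply: sub_supp (@bd_size _ l) => m.
  by rewrite sl => -[] /esym /size0nil.
move=> h; rewrite (eq_ext_supp (g := fun=> 0) h) ?ext0f // => l ->.
by rewrite /altH ch_nil.
Qed.

(** * The Euler characteristic as an alternating trace *)

Section Trace.
Variable f : T -> T.
Hypothesis f_cont : continuous f.
Hypothesis f_near : forall x, `|iot (f x) - iot x| < eta.
Variable m : nat.
Hypothesis m_small : forall k l, sgood k l ->
  supp (@csupp R T (small iot g) k) (iter m (@Sd R T k) (fS f (phi k (gen l)))).

Lemma iter_linear k j : linear (iter j (@Sd R T k)).
Proof. by elim: j => [|j IH] a x y //=; rewrite IH linearP. Qed.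

(** The self-map of the model whose trace is taken: realise, apply [f], subdivide [m] times to
    become small, read off oriented vertex lists. *)
Definition tE k (c : free (seq 'I_M)) : free (seq 'I_M) :=
  psi (iter m (@Sd R T k) (fS f (phi k c))).

Lemma tE_is_linear k : linear (@tE k).
Proof. by move=> a x y; rewrite /tE !linearP iter_linear linearP. Qed.
HB.instance Definition _ k := GRing.isLinear.Build rat (free (seq 'I_M)) (free (seq 'I_M)) *:%R
  (@tE k) (@tE_is_linear k).

Lemma bdS_iter_Sd k j (c : schain k.+1) : bdS (iter j (@Sd R T k.+1) c) = iter j (@Sd R T k) (bdS c).
Proof. by elim: j => //= j <-; rewrite bd_Sd. Qed.

Lemma bdc_tE k c : supp (fun l => size l = k.+2) c -> bdc (tE k.+1 c) = tE k (bdc c).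
Proof. by move=> sc; rewrite /tE bdc_psi bdS_iter_Sd bdS_fS bdS_phi. Qed.

Lemma supp_small k c : supp (sgood k) c ->
  supp (@csupp R T (small iot g) k) (iter m (@Sd R T k) (fS f (phi k c))).
Proof.
pose F := fun c => iter m (@Sd R T k) (fS f (phi k c)).
have lF : linear F by move=> a x y; rewrite /F !linearP iter_linear.
pose F' := HB.pack_for {linear free (seq 'I_M) -> schain k} F (GRing.isLinear.Build _ _ _ _ _ lF).
move=> sc; rewrite -[iter _ _ _]/(F' c) ext_linE; apply: (supp_ext sc) => l; exact: m_small.
Qed.

Lemma supp_tE k c : supp (sgood k) c -> supp (sgood k) (tE k c).
Proof. by move=> /supp_small /supp_psi. Qed.

Definition Lk k : seq (seq 'I_M) :=
  [seq val t | t <- enum {: k.+1.-tuple 'I_M} & sorted <%O (val t) && good (val t)].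

Lemma mem_Lk k l : l \in Lk k <-> sgood k l.
Proof.
split=> [/mapP[t]|[sl ol gl]].
  by rewrite mem_filter => /andP[/andP[h1 h2] _] ->; split=> //; rewrite size_tuple.
have sl' : size l == k.+1 by rewrite sl.
apply/mapP; exists (Tuple sl') => //.
by rewrite mem_filter mem_enum andbT /= ol.
Qed.

Lemma uniq_Lk k : uniq (Lk k).
Proof. rewrite map_inj_uniq => [|t t' /val_inj //].
by rewrite filter_uniq // enum_uniq. Qed.

Lemma Lk_large k : (M <= k)%N -> Lk k = [::].
Proof.
move=> Mk; case E : (Lk k) => [//|l s].
have /mem_Lk[sl ol _] : l \in Lk k by rewrite E mem_head.
have : uniq l := sorted_uniq (@lt_trans _ _) (@ltxx _ _) ol.
move=> /card_uniqP; rewrite sl => h; have := max_card (mem l); rewrite h card_ord; lia.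
Qed.

Definition nL k := size (Lk k).
Definition lk k (i : 'I_(nL k)) : seq 'I_M := nth [::] (Lk k) i.

Lemma lkP k (i : 'I_(nL k)) : sgood k (lk i).
Proof. by apply/mem_Lk/mem_nth. Qed.

Lemma lk_inj k : injective (@lk k).
Proof.
move=> i j /eqP; rewrite nth_uniq ?uniq_Lk //; first by move=> /eqP /val_inj.
Qed.

Lemma lk_surj k l : sgood k l -> exists i : 'I_(nL k), l = lk i.
Proof.
by move=> /mem_Lk lL; exists (Ordinal (etrans (index_mem _ _) lL)); rewrite /lk /= nth_index.
Qed.

Definition ofrow k (z : 'rV[rat]_(nL k)) : free (seq 'I_M) := \sum_i z 0 i *: gen (lk i).
Definition torow k (c : free (seq 'I_M)) : 'rV[rat]_(nL k) := \row_i coeff (lk i) c.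

Lemma ofrow_is_linear k : linear (@ofrow k).
Proof.
move=> a x y; rewrite /ofrow scaler_sumr -big_split /=; apply: eq_bigr => i _.
by rewrite !mxE scalerDl scalerA.
Qed.
HB.instance Definition _ k := GRing.isLinear.Build rat _ _ *:%R (@ofrow k) (@ofrow_is_linear k).

Lemma torow_is_linear k : linear (@torow k).
Proof. by move=> a x y; apply/rowP => i; rewrite !mxE coeffD coeffZ. Qed.
HB.instance Definition _ k := GRing.isLinear.Build rat _ _ *:%R (@torow k) (@torow_is_linear k).

Lemma coeff_ofrow k (z : 'rV_(nL k)) i : coeff (lk i) (ofrow z) = z 0 i.
Proof.
rewrite /ofrow (big_morph (coeff (lk i)) (coeffD _) (coeff0 _ _)) (bigD1 i) //=.
rewrite coeffZ coeffU mul1r eqxx mulr1 big1 ?addr0 // => j ji.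
by rewrite coeffZ coeffU (inj_eq (@lk_inj k)) (negbTE ji) !mulr0.
Qed.

Lemma ofrowK k : cancel (@ofrow k) (@torow k).
Proof. by move=> z; apply/rowP => i; rewrite mxE coeff_ofrow. Qed.

Lemma supp_ofrow k (z : 'rV_(nL k)) : supp (sgood k) (ofrow z).
Proof. by apply: supp_sum => i _; apply: suppZ; apply: supp_gen; exact: lkP. Qed.

Lemma torowK k c : supp (sgood k) c -> ofrow (torow k c) = c.
Proof.
move=> sc; apply/eqP/freeg_eqP => l.
have [/mem_Lk/lk_surj[i ->]|lL] := boolP (l \in Lk k); first by rewrite coeff_ofrow mxE.
have h d : supp (sgood k) d -> coeff l d = 0.
  by move=> sd; apply/eqP; apply: contraNT lL => /sd /mem_Lk.
by rewrite !h //; exact: supp_ofrow.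
Qed.

Definition mD k : 'M[rat]_(nL k.+1, nL k) := \matrix_(i < nL k.+1) torow k (bd (lk i)).
Definition mE k : 'M[rat]_(nL k) := \matrix_(i < nL k) torow k (tE k (gen (lk i))).

Lemma supp_bd k c : supp (sgood k.+1) c -> supp (sgood k) (bdc c).
Proof.
move=> sc; apply: (supp_ext sc) => l [sl ol gl].
apply: (sub_supp _ (supp_and (@bd_size _ l) (@bd_sub _ l))) => l' [sl' sub].
split; first by move: sl'; rewrite sl => -[].
  exact: (subseq_sorted (@lt_trans _ _) sub ol).
by apply: good_sub gl; exact: mem_subseq.
Qed.

Lemma mul_mD k (z : 'rV_(nL k.+1)) : z *m mD k = torow k (bdc (ofrow z)).
Proof.
rewrite mulmx_sum_row /ofrow !linear_sum; apply: eq_bigr => i _.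
by rewrite !linearZ rowK /= bdc_gen.
Qed.

Lemma mul_mE k (z : 'rV_(nL k)) : z *m mE k = torow k (tE k (ofrow z)).
Proof.
rewrite mulmx_sum_row [X in tE k X]/ofrow !linear_sum; apply: eq_bigr => i _.
by rewrite !linearZ rowK.
Qed.

Lemma ofrow_mD k (z : 'rV_(nL k.+1)) : ofrow (z *m mD k) = bdc (ofrow z).
Proof. by rewrite mul_mD torowK //; apply: supp_bd; exact: supp_ofrow. Qed.

Lemma ofrow_mE k (z : 'rV_(nL k)) : ofrow (z *m mE k) = tE k (ofrow z).
Proof. by rewrite mul_mE torowK //; apply: supp_tE; exact: supp_ofrow. Qed.

Lemma ofrow_size k (z : 'rV_(nL k)) : supp (fun l => size l = k.+1) (ofrow z).
Proof. by apply: sub_supp (@supp_ofrow k z) => l []. Qed.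

Lemma ofrow_good k (z : 'rV_(nL k)) : supp (fun l => size l = k.+1 /\ good l) (ofrow z).
Proof. by apply: sub_supp (@supp_ofrow k z) => l []. Qed.

Lemma mE_mD k : mE k.+1 *m mD k = mD k *m mE k.
Proof.
apply/row_matrixP => i; rewrite !rowE; apply: (can_inj (@ofrowK k)).
rewrite !mulmxA ofrow_mD !ofrow_mE ofrow_mD bdc_tE //; exact: ofrow_size.
Qed.

(** The cycles that the self-map sends to boundaries; by [phi_hom0] they are those that die in the
    homology of [T]. *)
Definition mW k : 'M[rat]_(nL k) := (cycles mD k :&: kermx (mE k *m cokermx (mD k)))%MS.

Lemma mWP k (z : 'rV_(nL k)) : (z <= mW k)%MS = (z <= cycles mD k)%MS && (z *m mE k <= mD k)%MS.
Proof.
rewrite sub_capmx; congr andb; apply/sub_kermxP/idP => [|h].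
  by rewrite mulmxA => /eqP; rewrite -submxE.
by apply/eqP; rewrite mulmxA -submxE.
Qed.

Lemma mcycleP k (z : 'rV_(nL k.+1)) : (z <= cycles mD k.+1)%MS <-> bdc (ofrow z) = 0.
Proof.
split=> [/sub_kermxP h|h]; first by rewrite -ofrow_mD h linear0.
by apply/sub_kermxP/(can_inj (@ofrowK k)); rewrite ofrow_mD h linear0.
Qed.

Lemma cycle_phi k (z : 'rV_(nL k)) : (z <= cycles mD k)%MS -> cycle_ (phi k (ofrow z)).
Proof.
case: k z => // k z /mcycleP h /=; rewrite bdS_phi ?h ?linear0 //; exact: ofrow_size.
Qed.

Lemma contT_supp k (c : schain k) : supp (fun s => continuous s) c -> supp (@csupp R T contT k) c.
Proof. exact: sub_supp. Qed.

Lemma cont_phi k (z : 'rV_(nL k)) : supp (fun s => continuous s) (phi k (ofrow z)).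
Proof. by apply: supp_phi; exact: ofrow_good. Qed.

Lemma cycle_main k (z : 'rV_(nL k)) : (z <= cycles mD k)%MS ->
  cycle_ (iter m (@Sd R T k) (fS f (phi k (ofrow z)))).
Proof. by move=> /cycle_phi h; apply/cycle_iter_Sd/cycle_fS. Qed.

Lemma hom_phi_mE k (z : 'rV_(nL k)) : (z <= cycles mD k)%MS ->
  homT (phi k (ofrow z)) (phi k (ofrow (z *m mE k))).
Proof.
move=> zZ; rewrite ofrow_mE; have cz := cycle_phi zZ; have sz := @cont_phi k z.
apply: (hom_trans (hom_fS f_cont f_near cz sz)).
apply: (hom_trans (hom_Sd subT m (cycle_fS f cz) (contT_supp (supp_fS f_cont sz)))).
by apply: hom_phi_psi; [exact: cycle_main|apply: supp_small; exact: supp_ofrow].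
Qed.

Lemma cycle_psi k (c : schain k) : cycle_ c -> supp (@csupp R T (small iot g) k) c ->
  (torow k (psi c) <= cycles mD k)%MS.
Proof.
case: k c => [|k] c cc sc; first by rewrite /cycles submx1.
by apply/mcycleP; rewrite torowK ?bdc_psi ?cc ?linear0 //; exact: supp_psi.
Qed.

(** After enough subdivision a singular cycle is small, and then it is homologous to the realisation
    of its own vertex chain. *)
Lemma phi_surj k (c : schain k) : supp (fun s => continuous s) c -> cycle_ c ->
  exists2 z : 'rV_(nL k), (z <= cycles mD k)%MS & homT c (phi k (ofrow z)).
Proof.
move=> sc cc; have [j /(_ j (leqnn _)) hj] := small_Sdc iot_cont sc g0.
have cj := @cycle_iter_Sd R T k j c cc.
exists (torow k (psi (iter j (@Sd R T k) c))); first exact: cycle_psi.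
rewrite torowK; last exact: supp_psi.
by apply: (hom_trans (hom_Sd subT j cc (contT_supp sc))); apply: hom_phi_psi.
Qed.

(** In one direction, a bounding singular chain [w] must become small before the model can see it,
    which may take more than the [m] subdivisions of [tE]. In the other, the realisation of a cycle
    is homologous to that of its image under the self-map. *)
Lemma phi_hom0 k (z : 'rV_(nL k)) : (z <= cycles mD k)%MS ->
  homT (phi k (ofrow z)) 0 <-> (z <= mW k)%MS.
Proof.
move=> zZ; rewrite mWP zZ /=; split; last first.
  move=> /submxP[y yE]; apply: (hom_trans (hom_phi_mE zZ)).
  exists (phi k.+1 (ofrow y)); first by apply/contT_supp/cont_phi.
  by rewrite bdS_phi ?subr0 ?yE ?ofrow_mD //; exact: ofrow_size.
move=> [w sw]; rewrite subr0 => bw.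
have sw' : supp (fun s => continuous s) (fS f w) by apply: supp_fS => //; apply: sub_supp sw => s [].
have [j0 hj0] := small_Sdc iot_cont sw' g0.
pose j := maxn j0 m; have sj := hj0 j (leq_maxl _ _).
set X := iter m (@Sd R T k) (fS f (phi k (ofrow z))).
have sX : supp (@csupp R T (small iot g) k) X by apply: supp_small; exact: supp_ofrow.
(* A homology through small simplices from [m] to [j] subdivisions, so that [psi] may be applied to
   the whole bounding chain. *)
have [E sE bE] := hom_Sd (@small_sub R T W iot g) (j - m) (cycle_main zZ) sX.
have XE : X = bdS (E + iter j (@Sd R T k.+1) (fS f w)).
  rewrite linearD /= bE bdS_iter_Sd bdS_fS bw -iterD subnK ?leq_maxr //.
  by rewrite subrK.
apply/submxP; exists (torow k.+1 (psi (E + iter j (@Sd R T k.+1) (fS f w)))).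
apply: (can_inj (@ofrowK k)); rewrite ofrow_mE ofrow_mD torowK; last first.
  by apply: supp_psi; apply: suppD.
by rewrite /tE -/X {1}XE bdc_psi.
Qed.

Lemma betti_mW k : (betti R T k)%:R = (\rank (cycles mD k))%:R - (\rank (mW k))%:R :> rat.
Proof.
apply: (@betti_rank R T k _ _ _ (@phi k \o @ofrow k)).
- exact: capmxSl.
- by move=> z zZ; split; [exact: cont_phi|exact: cycle_phi].
- by move=> c sc cc; have [z] := phi_surj sc cc; exists z.
- by move=> z; exact: phi_hom0.
Qed.

(** From degree [M] on there is no strictly increasing list long enough, so the Betti numbers vanish
    and all sums are finite; below, [betti_mW] matches the Hopf formula with the Betti numbers. *)
Lemma euler_trace : (euler_characteristic R T)%:~R =
  \sum_(k < M) (-1) ^+ k * \sum_(l <- Lk k) coeff l (tE k (gen l)) :> rat.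
Proof.
have betti_large k : (M <= k)%N -> betti R T k = 0%N.
  move=> Mk; apply/eqP; rewrite -(eqr_nat rat) betti_mW.
  have n0 : nL k = 0%N by rewrite /nL Lk_large.
  have rk0 (A : 'M[rat]_(nL k)) : \rank A = 0%N.
    by apply/eqP; rewrite -leqn0 -n0 rank_leq_row.
  by rewrite !rk0 subrr.
have -> : euler_characteristic R T = \sum_(k < M) (-1) ^+ k * (betti R T k)%:Z.
  rewrite /euler_characteristic -(big_mkord xpredT (fun k => (-1) ^+ k * (betti R T k)%:Z)).
  rewrite /index_iota subn0 (fsbigE (seq.iota 0 M)) ?iota_uniq //.
    by rewrite big_mkcond; apply: eq_bigr => i _; rewrite in_setT.
  move=> k _; rewrite mem_iota /= add0n -leqNgt => /betti_large ->.
  by rewrite mulr0.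
rewrite rmorph_sum /=; transitivity (\sum_(k < M) (-1) ^+ k * \tr (mE k)); last first.
  apply: eq_bigr => k _; congr (_ * _); rewrite /mxtrace (big_nth [::]) big_mkord.
  by apply: eq_bigr => i _; rewrite !mxE.
rewrite (hopf_trace mE_mD (W := mW)).
- by apply: eq_bigr => k _; rewrite rmorphM rmorphXn rmorphN1 /= -betti_mW.
- by rewrite /nL Lk_large.
- move=> k; apply/row_subP => i; rewrite mWP; set y := row i _.
  have yE : y = delta_mx 0 i *m mD k by rewrite /y rowE.
  apply/andP; split.
    case: k i y yE => [|k] i y yE; first by rewrite /cycles submx1.
    by apply/mcycleP; rewrite yE ofrow_mD bdcK.
  by rewrite yE -mulmxA -mE_mD mulmxA submxMl.
- by move=> k; exact: capmxSl.
- move=> k; apply/row_subP => i; rewrite row_mul.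
  by have := row_sub i (mW k); rewrite mWP => /andP[].
move=> k; apply/row_subP => i; rewrite row_mul mulmxBr mulmx1.
set z := row i _; have zZ : (z <= cycles mD k)%MS by exact: row_sub.
have zEZ : (z *m mE k <= cycles mD k)%MS.
  case: k i z zZ => [|k] i z zZ; first by rewrite /cycles submx1.
  apply/mcycleP; rewrite ofrow_mE bdc_tE; last exact: ofrow_size.
  by move/mcycleP: zZ => ->; rewrite linear0.
apply/phi_hom0; first by rewrite addmx_sub // eqmx_opp.
have [e se be] := hom_phi_mE zZ.
by exists (- e); [exact: suppN|rewrite linearN /= be opprB subr0 2!linearB].
Qed.

(** * The trace near the fixed points *)

Section Localization.
Local Notation dT x y := `|iot x - iot y|.
Variables (Pe Ph : seq T) (a : T -> R -> T) (chi : T -> T -> R) (rho rho' c et t1 : R).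
Hypothesis uniqP : uniq (Pe ++ Ph).
Hypothesis q_inj : injective q.
Hypothesis rho'0 : 0 < rho'.
Hypothesis rho'le : rho' <= rho / 2.
Hypothesis sep : forall p p', p \in Pe ++ Ph -> p' \in Pe ++ Ph -> p != p' -> 4 * rho <= dT p p'.
Hypothesis he : forall p x, p \in Pe -> dT x p < rho -> f x = p.
Hypothesis hh : forall p x, p \in Ph -> dT x p < rho -> f x = a p (2 * chi p x).
Hypothesis a0 : forall p, p \in Ph -> a p 0 = p.
Hypothesis hat : forall p t, p \in Ph -> `|t| <= 2 * t1 -> chi p (a p t) = t /\ dT (a p t) p < rho / 2.
Hypothesis hchi : forall p x, p \in Ph -> dT x p < rho' -> `|2 * chi p x| <= t1.
Hypothesis disp : forall x, (forall p, p \in Pe ++ Ph -> rho' / 2 <= dT x p) -> c <= dT (f x) x.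
Hypothesis uc : forall x y, `|y - iot x| <= dl -> dT (f (r y)) (f x) < c / 2 /\ dT (r y) x < rho' / 2.
Hypothesis gmc : gm <= c / 2.
Hypothesis et0 : 0 < et.
Hypothesis ett1 : et <= t1.
Hypothesis ga : forall p t s, p \in Ph -> `|t| <= t1 -> `|s| <= t1 -> dT (a p t) (a p s) < g -> `|t - s| < et.
Hypothesis ha : forall p t, p \in Ph -> `|t| <= et -> dT (a p t) p < rho' / 2 /\ dT (a p t) p <= dl.
Hypothesis netE : forall p, p \in Pe -> q (net p) = p.
Hypothesis netH : forall p t, p \in Ph -> `|t| <= t1 -> q (net (a p t)) = a p (et * (Num.floor (t / et))%:~R).

Definition tX k l : schain k := iter m (@Sd R T k) (fS f (phi k (gen l))).

Lemma coeff_ext_neq0 (X Y : choiceType) (h : X -> free Y) (d : free X) y :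
  coeff y (ext h d) != 0 -> exists2 x, coeff x d != 0 & coeff y (h x) != 0.
Proof.
have : supp (fun y => exists2 x, coeff x d != 0 & coeff y (h x) != 0) (ext h d).
  by apply: (@supp_ext _ _ h (fun x => coeff x d != 0)) => // x xd y' hy; exists x.
exact.
Qed.

Lemma tX_range k l : sgood k l ->
  supp (fun s : @simplex R k -> T => small iot g (range s) /\ forall x, exists2 y,
     (forall i, i \in l -> `|y - iot (q i)| <= dl) & s x = f (r y)) (tX k l).
Proof.
move=> gl; pose A (B : set T) := forall z, B z -> exists2 y,
  (forall i, i \in l -> `|y - iot (q i)| <= dl) & z = f (r y).
have sA : supp (@csupp R T A k) (tX k l).
  apply: supp_iter_Sd => [B B' BB hB z /BB /hB //|].
  rewrite phi_gen /fS ext_gen; apply: supp_gen; case: gl => sl ol /[dup] gl /goodP gl'; split.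
    move=> x; apply: continuous_comp; [exact: phi_cont|exact: f_cont].
  move=> _ [x _ <-]; exists (aff (map (iot \o q) l) (val x)) => // i il.
  have : hull (map (iot \o q) l) (aff (map (iot \o q) l) (val x)).
    by apply: hull_aff; [rewrite size_map|exact: set_mem (valP x)].
  by apply => _ /mapP[j jl ->]; apply: gl'.
move=> s sX; split; first by case: (m_small gl sX).
by move=> x; case: (sA s sX) => _; apply; exists x.
Qed.

Lemma tE_witness k l : coeff l (tE k (gen l)) != 0 -> exists2 s : @simplex R k -> T,
  coeff s (tX k l) != 0 & perm_eq (nv s) l /\ sorted <%O l.
Proof.
move=> /coeff_ext_neq0[l' /coeff_ext_neq0[s hs hl'] hl].
have : l' = nv s.
  by move: hl'; rewrite coeffU mul1r; have [<-|] := eqVneq (nv s) l'; rewrite ?eqxx.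
move=> E; rewrite E in hl; exists s => //; have [sl pl] := supp_alt hl.
by split.
Qed.

Lemma nv_mem k (s : @simplex R k -> T) i : i \in nv s -> exists x, i = net (s x).
Proof. by move=> /mapP[x _ ->]; exists (insubd (simplex0 k) x). Qed.

(** If a simplex occurs in its own image, each of its vertices is near the image under [f] of a
    point close to it, so it is displaced by less than [c], which happens only near the given
    points. *)
Lemma tE_near k l i : sgood k l -> coeff l (tE k (gen l)) != 0 -> i \in l ->
  exists2 p, p \in Pe ++ Ph & dT (q i) p < rho' / 2.
Proof.
move=> gl hl il; have [s hs [pl _]] := tE_witness hl.
have [_ hr] := tX_range gl hs.
have dc : dT (f (q i)) (q i) < c.
  move: (il); rewrite -(perm_mem pl) => /nv_mem[x ix].
  have [y hy sy] := hr x; have [u1 _] := uc (hy i il).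
  have := netP (s x); rewrite -ix sy => u2.
  rewrite -(subrK (iot (f (r y))) (iot (f (q i)))) -addrA; apply: le_lt_trans (ler_normD _ _) _.
  rewrite [X in X + _]distrC [X in _ + X]distrC.
  by move: (`|iot (q i) - _|) (`|_ - _|) u1 u2 => A B u1 u2; have := gmc; lra.
have [//|h] := pselect (exists2 p, p \in Pe ++ Ph & dT (q i) p < rho' / 2).
exfalso; have : c <= dT (f (q i)) (q i).
  by apply: disp => p pP; rewrite leNgt; apply/negP => hp; apply: h; exists p.
by rewrite leNgt dc.
Qed.

Lemma tX_loc k l i p : sgood k l -> i \in l -> dT (q i) p < rho' / 2 ->
  supp (fun s : @simplex R k -> T => small iot g (range s) /\ forall x, exists2 z, s x = f z & dT z p < rho') (tX k l).
Proof.
move=> gl il ip; apply: sub_supp (tX_range gl) => s [gs hs]; split=> // x.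
have [y hy ->] := hs x; exists (r y) => //; have [_ u] := uc (hy i il).
rewrite -(subrK (iot (q i)) (iot (r y))) -addrA; apply: le_lt_trans (ler_normD _ _) _; lra.
Qed.

Definition jx p i : int := Num.floor (chi p (q i) / et).

(** Grid points of step [et] on the arc; the bound keeps them where [chi p] inverts the
    parametrization of the arc. *)
Definition on_arc p i := q i = a p (et * (jx p i)%:~R) /\ `|et * (jx p i)%:~R| <= 2 * t1.

Lemma net_arc p t : p \in Ph -> `|t| <= t1 ->
  on_arc p (net (a p t)) /\ jx p (net (a p t)) = Num.floor (t / et).
Proof.
move=> pH tt; set J := Num.floor _.
have qE := netH pH tt; rewrite -/J in qE.
have Jt : `|et * J%:~R| <= 2 * t1.
  have /andP[h1 h2] := floor_itv (t / et); rewrite -/J in h1 h2.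
  rewrite ler_pdivlMr // in h1; rewrite ltr_pdivrMr // in h2.
  rewrite intrD mulrDl mul1r in h2; move: tt; rewrite !ler_norml => /andP[t0 t2].
  by apply/andP; split; rewrite mulrC; have := ett1; lra.
have [cE _] := hat pH Jt.
have jE : jx p (net (a p t)) = J.
  by rewrite /jx qE cE mulrAC divff ?gt_eqF // mul1r intrKfloor.
by rewrite /on_arc jE qE.
Qed.

Lemma jx_inj p i i' : p \in Ph -> on_arc p i -> on_arc p i' -> (i == i') = (jx p i == jx p i').
Proof.
move=> pH [qi bi] [qi' bi']; apply/eqP/eqP => [->//|E].
by apply: q_inj; rewrite qi qi' E.
Qed.

(** Near a hyperbolic point [f] takes its values on the arc, so the vertices read off are grid
    points. Smallness makes their parameters differ by less than [et], hence their indices by at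
    most one. *)
Lemma nv_arc k (s : @simplex R k -> T) p : p \in Ph -> small iot g (range s) ->
  (forall x, exists2 z, s x = f z & dT z p < rho') ->
  (forall i, i \in nv s -> on_arc p i) /\
  (forall i i', i \in nv s -> i' \in nv s -> `|jx p i - jx p i'| <= 1).
Proof.
move=> pH gs hs.
have st x : exists2 t, `|t| <= t1 & s x = a p t.
  have [z sz zp] := hs x; exists (2 * chi p z); first exact: hchi.
  rewrite sz; apply: hh => //; apply: lt_le_trans zp _.
  have := rho'le; have := rho'0; lra.
split=> [i /nv_mem[x ->]|i i' /nv_mem[x ->] /nv_mem[x' ->]].
  by have [t tt ->] := st x; case: (net_arc pH tt).
have [t tt E] := st x; have [t' tt' E'] := st x'; rewrite E E'.
have [_ ->] := net_arc pH tt; have [_ ->] := net_arc pH tt'.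
apply: floor_close; rewrite -mulrBl normrM (gtr0_norm (x := et^-1)) ?invr_gt0 //.
rewrite ltr_pdivrMr // mul1r; apply: (ga pH) => //; rewrite -E -E'.
by apply: gs; [exists x|exists x'].
Qed.

Lemma nv_ell k (s : @simplex R k -> T) p : p \in Pe ->
  (forall x, exists2 z, s x = f z & dT z p < rho') -> forall i, i \in nv s -> i = net p.
Proof.
move=> pE hs i /nv_mem[x ->]; have [z -> zp] := hs x; rewrite (he pE) //.
by apply: lt_le_trans zp _; have := rho'le; have := rho'0; lra.
Qed.

(** Near an elliptic point all vertices read off coincide; near a hyperbolic one their indices are
    pairwise at distance at most one, so three distinct vertices never occur. *)
Lemma tE_large k l : sgood k.+2 l -> coeff l (tE k.+2 (gen l)) = 0.
Proof.
move=> gl; apply/eqP; apply: contraT => hl.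
have sl : size l = k.+3 by case: gl.
have ul : uniq l by case: gl => _ ol _; exact: (sorted_uniq (@lt_trans _ _) (@ltxx _ _)) ol.
have hin j : (j < k.+3)%N -> nth i0 l j \in l by move=> jk; rewrite mem_nth // sl.
have [p] := tE_near gl hl (hin 0%N isT); rewrite mem_cat => pP ip.
have [s hs [pl _]] := tE_witness hl.
have [gs hz] := tX_loc gl (hin 0%N isT) ip hs.
have mem j : (j < k.+3)%N -> nth i0 l j \in nv s by move=> /hin; rewrite (perm_mem pl).
have nne j j' : (j < k.+3)%N -> (j' < k.+3)%N -> (nth i0 l j == nth i0 l j') = (j == j').
  by move=> h1 h2; rewrite nth_uniq ?sl.
case/orP: pP => pP.
  have E := nv_ell pP hz; have := nne 0%N 1%N isT isT.
  by rewrite (E _ (mem 0%N isT)) (E _ (mem 1%N isT)) eqxx.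
have [on cl] := nv_arc pP gs hz.
have m0 := mem 0%N isT; have m1 := mem 1%N isT; have m2 := mem 2%N isT.
have n01 := nne 0%N 1%N isT isT; have n02 := nne 0%N 2%N isT isT; have n12 := nne 1%N 2%N isT isT.
rewrite (jx_inj pP (on _ m0) (on _ m1)) in n01; rewrite (jx_inj pP (on _ m0) (on _ m2)) in n02.
rewrite (jx_inj pP (on _ m1) (on _ m2)) in n12.
by case: (no_three (cl _ _ m0 m1) (cl _ _ m0 m2) (cl _ _ m1 m2)); rewrite ?n01 ?n02 ?n12.
Qed.

Lemma Sd_const (y : T) : Sd (gen (fun=> y) : schain 0) = gen (fun=> y).
Proof.
rewrite SdE; have -> : verts 0 = [:: delta_mx 0 ord0] :> seq 'rV[R]_1.
  by apply: (@eq_from_nth _ 0); rewrite size_verts // => -[|//] _; rewrite (nth_verts ord0).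
rewrite sd_cons // bd_cons bd_nil linear0 subr0 ext_gen sd_nil cone_gen /Sing ext_gen.
by congr (gen _); apply/funext.
Qed.

Lemma tE0 i : tE 0 (gen [:: i]) = gen [:: net (f (q i))].
Proof.
rewrite /tE phi_gen; have -> : sing r (map (iot \o q) [:: i]) = (fun=> q i) :> (@simplex R 0 -> T).
  apply/funext => x; rewrite /sing /aff big_ord1 /=.
  by have [_] := set_mem (valP x); rewrite big_ord1 => ->; rewrite scale1r r_iot.
rewrite /fS ext_gen (_ : f \o _ = fun=> f (q i)) //.
have -> : iter m (@Sd R T 0) (gen (fun=> f (q i))) = gen (fun=> f (q i)).
  by elim: (m) => //= j ->; exact: Sd_const.
rewrite /psi /nvc !ext_gen (_ : nv _ = [:: net (f (q i))]) ?alt_sorted //.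
rewrite /nv; have -> : verts 0 = [:: delta_mx 0 ord0] :> seq 'rV[R]_1 => //.
by apply: (@eq_from_nth _ 0); rewrite size_verts // => -[|//] _; rewrite (nth_verts ord0).
Qed.

(** The subdivided image of the edge is never described. By [cross_count] the coefficient is a
    linear function of the boundary of the image chain, namely a count [H] of vertices beyond the
    threshold, and this boundary is given by the images of the two ends, whose indices are
    doubled. *)
Lemma coeff1 p u v (j : int) : p \in Ph -> sgood 1 [:: u; v] ->
  dT (q u) p < rho' / 2 -> dT (q v) p < rho' / 2 -> on_arc p u -> on_arc p v ->
  (jx p u = j /\ jx p v = j + 1) \/ (jx p v = j /\ jx p u = j + 1) ->
  coeff [:: u; v] (tE 1 (gen [:: u; v])) = (- 1 <= j)%R%:R - (1 <= j)%R%:R.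
Proof.
move=> pH gl up vp ou ov juv.
have uv : (u < v)%O by case: gl => _ /=; rewrite andbT.
pose s : rat := (jx p v - jx p u)%:~R.
pose h i : rat := (j + 1 <= jx p i)%R%:R.
pose H : free (seq 'I_M) -> rat^o := ext (fun l => if l is [:: i] then h i else 0 : rat^o).
have H1 i : H (gen [:: i]) = h i by rewrite /H ext_gen.
have HB x y : H (x - y) = H x - H y by rewrite /H linearB.
have supX := tX_loc gl (mem_head u [:: v]) up.
have linL : linear (fun d : schain 1 => coeff [:: u; v] (psi d) : rat^o).
  by move=> b d d'; rewrite linearP coeffD coeffZ.
have linR : linear (fun d : schain 1 => s *: H (bdc (psi d)) : rat^o).
  by move=> b d d'; rewrite !linearP /H linearP scalerDr scalerA mulrC -scalerA.
rewrite /tE -/(tX 1 [:: u; v]) (eq_lin_supp linL linR supX); last first.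
  move=> tau [gt ht]; have [on cl] := nv_arc pH gt ht.
  have : size (nv tau) = 2%N by rewrite size_nv.
  rewrite /psi /nvc !ext_gen; case: (nv tau) on cl => [|x [|y [|]]] // on cl _.
  have ox : on_arc p x by apply: on; rewrite mem_head.
  have oy : on_arc p y by apply: on; rewrite !inE eqxx orbT.
  have xy := cl x y; rewrite !inE !eqxx orbT /= in xy; move/(_ isT isT) in xy.
  rewrite bd_alt !bd_cons bd_nil linear0 subr0 cone_gen linearB /= !ext_gen.
  rewrite !alt_sorted // HB !H1.
  have Ec (x' y' : 'I_M) : coeff [:: u; v] (gen [:: x'; y']) = ((x' == u) && (y' == v))%:R.
    by rewrite coeffU mul1r eqseq_cons eqseq_cons eqxx andbT.
  have /= -> : alt [:: x; y] = ins x [:: y] by rewrite /= insc_gen /insc !ext_gen.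
  rewrite /= /s /h.
  have Exu := jx_inj pH ox ou; have Exv := jx_inj pH ox ov.
  have Eyu := jx_inj pH oy ou; have Eyv := jx_inj pH oy ov.
  have Exy := jx_inj pH ox oy.
  case: ltgtP => [xy'|yx'|E].
  - rewrite Ec Exu Eyv; apply: cross_count => //; first by rewrite -Exy lt_eqF.
    (* Both edges are increasing lists, which rules out the reversed edge. *)
    apply/negP => /andP[]; rewrite -Exv -Eyu => /eqP xv /eqP yu.
    by move: xy'; rewrite xv yu ltNge ltW.
  - have yxE : alt [:: y; x] = gen [:: y; x] by rewrite alt_sorted //= yx'.
    rewrite cone_gen coeffN Ec Eyu Exv.
    rewrite -[RHS]opprK; congr (- _); rewrite -scalerN opprB.
    apply: cross_count => //; [by rewrite distrC|by rewrite eq_sym -Exy gt_eqF|].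
    apply/negP => /andP[]; rewrite -Exu -Eyv => /eqP xu /eqP yv.
    by move: yx'; rewrite xu yv ltNge ltW.
  - by rewrite coeff0 E subrr scaler0.
rewrite bdc_psi -/(tX _ _).
have -> : psi (bdS (tX 1 [:: u; v])) = tE 0 (bd [:: u; v]).
  rewrite -bdc_psi -[psi _]/(tE 1 (gen [:: u; v])) bdc_tE ?bdc_gen //.
  by apply: supp_gen; case: gl.
rewrite !bd_cons bd_nil linear0 subr0 cone_gen linearB /= !tE0 HB !H1.
have jf w : on_arc p w -> dT (q w) p < rho' / 2 -> jx p (net (f (q w))) = jx p w + jx p w.
  move=> [qw bw] wp; have wp' : dT (q w) p < rho' by apply: lt_trans wp _; have := rho'0; lra.
  have wr : dT (q w) p < rho by apply: lt_le_trans wp' _; have := rho'le; have := rho'0; lra.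
  rewrite (hh pH wr); have [_ ->] := net_arc pH (hchi pH wp').
  have chE : chi p (q w) = et * (jx p w)%:~R by rewrite {1}qw (hat pH bw).1.
  have -> : 2 * chi p (q w) / et = 2 * (jx p w)%:~R.
    by rewrite chE [et * _]mulrC mulrA mulfK // gt_eqF.
  by rewrite mulr_natl -[_ *+ 2]/(_ + _) -intrD intrKfloor.
rewrite /h !jf // /s.
exact: cross_end.
Qed.

Lemma sum_mem (X : eqType) (L E : seq X) : uniq L -> uniq E -> {subset E <= L} ->
  \sum_(l <- L) (l \in E)%:R = (size E)%:R :> rat.
Proof.
move=> uL uE EL; rewrite -natr_sum; congr (_%:R).
rewrite -[RHS]sum1_size; transitivity (\sum_(l <- L | l \in E) 1)%N.
  by rewrite [RHS]big_mkcond; apply: eq_bigr => l _; case: (l \in E).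
rewrite -big_filter; apply: perm_big; apply: uniq_perm; rewrite ?filter_uniq // => l.
by rewrite mem_filter; case: (boolP (l \in E)) => //= /EL ->.
Qed.

Lemma q_net p : p \in Pe ++ Ph -> q (net p) = p.
Proof.
rewrite mem_cat => /orP[/netE //|pH].
have t10 : 0 <= t1 by apply: le_trans ett1; exact: ltW.
have := @netH p 0 pH; rewrite normr0 => /(_ t10).
by rewrite a0 // mul0r floor0 mulr0 a0.
Qed.

Lemma sepE p p' x : p \in Pe ++ Ph -> p' \in Pe ++ Ph -> dT x p < rho -> dT x p' < rho -> p = p'.
Proof.
move=> pP p'P xp xp'; apply/eqP; apply: contraT => /(sep pP p'P).
have : dT p p' <= dT x p + dT x p'.
  by rewrite [dT x p]distrC; exact: ler_distD.
have : 0 <= dT x p by [].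
move: (dT x p) (dT x p') (dT p p') xp xp' => A B D; lra.
Qed.

Lemma rho'rho x p : dT x p < rho' / 2 -> dT x p < rho.
Proof.
move=> h; apply: lt_le_trans h _; have := rho'le; have := rho'0; lra.
Qed.

Lemma fix_p p : p \in Pe ++ Ph -> f p = p.
Proof.
have r0 : 0 < rho by have := rho'le; have := rho'0; lra.
have t10 : 0 <= t1 by apply: le_trans ett1; exact: ltW.
rewrite mem_cat => /orP[pE|pH]; first by apply: he; rewrite // subrr normr0.
rewrite (hh pH) ?subrr ?normr0 //; have := @hat p 0 pH.
by rewrite normr0 a0 // => /(_ (mulr_ge0 (ler0n _ _) t10))[-> _]; rewrite mulr0 a0.
Qed.

Definition E0 := [seq [:: net p] | p <- Pe ++ Ph].

(** A fixed grid vertex has an index equal to its double, hence 0: each point contributes one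
    vertex, itself. *)
Lemma coeff0E i : coeff [:: i] (tE 0 (gen [:: i])) = ([:: i] \in E0)%:R.
Proof.
rewrite tE0 coeffU mul1r eqseq_cons eqxx andbT; congr (_%:R); congr nat_of_bool.
apply/eqP/mapP => [iE|[p pP [->]]]; last by rewrite q_net // fix_p.
have [p pP ip] : exists2 p, p \in Pe ++ Ph & dT (q i) p < rho' / 2.
  have [//|h] := pselect (exists2 p, p \in Pe ++ Ph & dT (q i) p < rho' / 2).
  have h1 : c <= dT (f (q i)) (q i).
    by apply: disp => p pP; rewrite leNgt; apply/negP => hp; apply: h; exists p.
  have := netP (f (q i)); rewrite iE distrC => h2.
  have : 0 <= dT (f (q i)) (q i) by [].
  by move=> h4; exfalso; move: (dT (f (q i)) (q i)) h1 h2 h4 gmc => A; lra.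
exists p => //; congr [:: _]; have ir := rho'rho ip.
move: (pP); rewrite mem_cat => /orP[pE|pH]; first by rewrite -iE (he pE ir).
have ir' : dT (q i) p < rho' by apply: lt_trans ip _; have := rho'0; lra.
have ft := hchi pH ir'.
have [[oi _] jE] := net_arc pH ft; rewrite -(hh pH ir) iE in oi jE.
have [bi chE] : `|et * (jx p i)%:~R| <= 2 * t1 /\ chi p (q i) = et * (jx p i)%:~R.
  have [[_ b] _] := net_arc pH ft; rewrite -(hh pH ir) iE in b; split=> //.
  by rewrite {1}oi (hat pH b).1.
have : jx p i = jx p i + jx p i.
  rewrite {1}jE chE mulrCA [et * _]mulrC mulfK ?gt_eqF //.
  by rewrite mulr_natl -[_ *+ 2]/(_ + _) -intrD intrKfloor.
move=> /eqP; rewrite -subr_eq0 opprD addrA subrr add0r oppr_eq0 => /eqP j0.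
by apply: q_inj; rewrite q_net // oi j0 mulr0 a0.
Qed.

Lemma sum0 : \sum_(l <- Lk 0) coeff l (tE 0 (gen l)) = (size Pe + size Ph)%:R.
Proof.
rewrite -size_cat -(size_map (fun p => [:: net p])) -/E0 -(sum_mem (uniq_Lk 0)).
- rewrite big_seq [RHS]big_seq; apply: eq_bigr => l /mem_Lk[sl _ _].
  by case: l sl => [|i [|]] // _; exact: coeff0E.
- rewrite map_inj_in_uniq // => p p' pP p'P [E].
  by rewrite -(q_net pP) E q_net.
move=> _ /mapP[p pP ->]; apply/mem_Lk; split=> //.
rewrite /good /= subrr normr0 !andbT.
by have := gdl; have := g0; have := le_lt_trans (normr_ge0 _) (netP p); lra.
Qed.

Definition cI p (j : int) := net (a p (et * j%:~R)).

Lemma cIP p j : p \in Ph -> `|j| <= 1 ->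
  [/\ on_arc p (cI p j), jx p (cI p j) = j, q (cI p j) = a p (et * j%:~R),
      dT (q (cI p j)) p < rho' / 2 & dT (q (cI p j)) p <= dl].
Proof.
move=> pH j1; have ej : `|et * j%:~R| <= et.
  have jR : `|j%:~R| <= 1 :> R by rewrite -intr_norm (_ : 1 = 1%:~R :> R) // ler_int.
  by rewrite normrM (gtr0_norm et0) ler_piMr // ltW.
have [on jE] := net_arc pH (le_trans ej ett1).
have fE : Num.floor (et * j%:~R / et) = j by rewrite mulrAC divff ?gt_eqF // mul1r intrKfloor.
have qE : q (cI p j) = a p (et * j%:~R) by rewrite /cI (netH pH (le_trans ej ett1)) fE.
have [h1 h2] := ha pH ej.
by split; rewrite ?qE // /cI jE fE.
Qed.

Definition sPair p (j : int) : seq 'I_M :=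
  if (cI p j < cI p (j + 1))%O then [:: cI p j; cI p (j + 1)] else [:: cI p (j + 1); cI p j].

Lemma mem_sPair p j i : (i \in sPair p j) = (i == cI p j) || (i == cI p (j + 1)).
Proof. by rewrite /sPair; case: ifP => _; rewrite !inE // orbC. Qed.

Lemma jbounds (j : int) : j \in [:: -1; 0] -> `|j| <= 1 /\ `|j + 1| <= 1.
Proof. by rewrite !inE => /orP[] /eqP ->. Qed.

Lemma sPair_good p j : p \in Ph -> j \in [:: -1; 0] -> sgood 1 (sPair p j).
Proof.
move=> pH jj; have [b1 b2] := jbounds jj.
have [_ j1 _ _ d1] := cIP pH b1; have [_ j2 _ _ d2] := cIP pH b2.
have dl0 : 0 <= dl by apply: le_trans d1.
have ne : cI p j != cI p (j + 1).
  apply/eqP => /(congr1 (jx p)); rewrite j1 j2.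
  by move: jj; rewrite !inE => /orP[] /eqP ->.
have q0 : q (cI p 0) = p.
  by have [_ _ -> _ _] := @cIP p 0 pH isT; rewrite mulr0 a0.
split; first by rewrite /sPair; case: ifP.
  by rewrite /sPair; case: ltgtP ne => //= h _; rewrite h.
apply/goodP => i i'; rewrite !mem_sPair.
have dd : dT (q (cI p j)) (q (cI p (j + 1))) <= dl.
  move: jj; rewrite !inE => /orP[] /eqP jE.
    by move: d1; rewrite jE addNr q0.
  by move: d2; rewrite jE add0r q0 distrC.
by move=> /orP[] /eqP -> /orP[] /eqP ->; rewrite ?subrr ?normr0 // distrC.
Qed.

Lemma coeff_sPair p j : p \in Ph -> j \in [:: -1; 0] -> coeff (sPair p j) (tE 1 (gen (sPair p j))) = 1.
Proof.
move=> pH jj; have [b1 b2] := jbounds jj.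
have [arc1 j1 _ d1 _] := cIP pH b1; have [arc2 j2 _ d2 _] := cIP pH b2.
have gs := sPair_good pH jj; rewrite /sPair in gs *.
transitivity ((- 1 <= j)%R%:R - (1 <= j)%R%:R : rat); last by move: jj; rewrite !inE => /orP[] /eqP ->.
by case: ifP gs => _ gs; rewrite (coeff1 (j := j) pH gs) //; [left|right].
Qed.

Lemma coeff1_neq0 l : sgood 1 l -> coeff l (tE 1 (gen l)) != 0 ->
  exists p j, [/\ p \in Ph, j \in [:: -1; 0] & l = sPair p j].
Proof.
move=> gl hl; have sl : size l = 2%N by case: gl.
have ol : sorted <%O l by case: gl.
case: l sl ol gl hl => [|u [|v [|]]] // _ /=; rewrite andbT => uv gl hl.
have um : u \in [:: u; v] by rewrite mem_head.
have vm : v \in [:: u; v] by rewrite !inE eqxx orbT.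
have [p] := tE_near gl hl um; rewrite mem_cat => pP up.
have [s hs [pl _]] := tE_witness hl.
have [gs hz] := tX_loc gl um up hs.
have um' := um; have vm' := vm; rewrite -(perm_mem pl) in um'; rewrite -(perm_mem pl) in vm'.
case/orP: pP => pP.
  by move: uv; rewrite (nv_ell pP hz um') (nv_ell pP hz vm') ltxx.
have [on cl] := nv_arc pP gs hz.
have ou := on _ um'; have ov := on _ vm'; have cuv := cl _ _ um' vm'.
have nuv : jx p u != jx p v by rewrite -(jx_inj pP ou ov) lt_eqF.
have [j juv] : exists j, (jx p u = j /\ jx p v = j + 1) \/ (jx p v = j /\ jx p u = j + 1).
  move: (jx p u) (jx p v) cuv nuv => x y; clear => cuv nuv.
  by have [xy|xy] := ltP x y; [exists x; left; lia|exists y; right; lia].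
have pPP : p \in Pe ++ Ph by rewrite mem_cat pP orbT.
have vp : dT (q v) p < rho' / 2.
  have [p' p'P vp'] := tE_near gl hl vm.
  have [qv bv] := ov; have [_ vr] := hat pP bv; rewrite -qv in vr.
  suff -> : p = p' by [].
  apply: (@sepE _ _ (q v)) => //; last exact: rho'rho.
  apply: lt_le_trans vr _; have := rho'le; have := rho'0; lra.
have jj : j \in [:: -1; 0].
  move: hl; rewrite (coeff1 pP gl up vp ou ov juv); move: (j); clear => j.
  case: j => -[|[|j]] //=; rewrite ?subrr ?eqxx //.
exists p, j; split=> //; have [b1 b2] := jbounds jj.
have [arc1 j1 _ d1 _] := cIP pP b1; have [arc2 j2 _ d2 _] := cIP pP b2.
rewrite /sPair; case: juv => -[ju jv].
  have -> : cI p j = u by apply/eqP; rewrite (jx_inj pP arc1 ou) j1 ju.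
  have -> : cI p (j + 1) = v by apply/eqP; rewrite (jx_inj pP arc2 ov) j2 jv.
  by rewrite uv.
have -> : cI p j = v by apply/eqP; rewrite (jx_inj pP arc1 ov) j1 ju.
have -> : cI p (j + 1) = u by apply/eqP; rewrite (jx_inj pP arc2 ou) j2 jv.
by rewrite ltNge ltW.
Qed.

Definition E1 := [seq sPair pj.1 pj.2 | pj <- [seq (p, j) | p <- Ph, j <- [:: -1; 0 : int]]].

(** Two edges for each hyperbolic point, from index -1 to 0 and from 0 to 1. Those of different
    points are distinct because the points are far apart. *)
Lemma sum1 : \sum_(l <- Lk 1) coeff l (tE 1 (gen l)) = (size Ph * 2)%:R.
Proof.
have sE : size E1 = (size Ph * 2)%N by rewrite size_map size_allpairs.
have inE1 l : reflect (exists p j, [/\ p \in Ph, j \in [:: -1; 0] & l = sPair p j]) (l \in E1).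
  apply: (iffP mapP) => [[_ /allpairsP[[p j] /= [pH jj ->]] ->]|[p [j [pH jj ->]]]]; first by exists p, j.
  by exists (p, j) => //; apply/allpairsP; exists (p, j).
rewrite -sE -(sum_mem (uniq_Lk 1)).
- rewrite big_seq [RHS]big_seq; apply: eq_bigr => l /mem_Lk gl.
  case: inE1 => [[p [j [pH jj ->]]]|h]; first by rewrite coeff_sPair.
  by apply/eqP; apply: contraT => /(coeff1_neq0 gl).
- rewrite map_inj_in_uniq; first by rewrite allpairs_uniq //; [move: uniqP; rewrite cat_uniq => /and3P[]|move=> [? ?] [? ?] _ _ [-> ->]].
  move=> x x' hx hx'; move/allpairsP: hx => [[p j] /= [pH jj ->]].
  move/allpairsP: hx' => [[p' j'] /= [pH' jj' ->]] /= E.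
  have pp : p = p'.
    have m0 : cI p 0 \in sPair p j.
      by rewrite mem_sPair; move: jj; rewrite !inE => /orP[] /eqP ->; rewrite ?addNr ?eqxx ?orbT.
    have pP : p \in Pe ++ Ph by rewrite mem_cat pH orbT.
    have p'P : p' \in Pe ++ Ph by rewrite mem_cat pH' orbT.
    have [_ _ _ h1 _] := @cIP p 0 pH isT.
    have [b1 b2] := jbounds jj'.
    apply: (@sepE _ _ (q (cI p 0))) => //; first exact: rho'rho.
    move: m0; rewrite E mem_sPair => /orP[] /eqP ->; apply: rho'rho.
      by have [] := cIP pH' b1.
    by have [] := cIP pH' b2.
  rewrite -pp in E *; have jj1 := jj'.
  have jset j0 j1 : j0 \in [:: -1; 0] -> j1 \in [:: -1; 0] -> sPair p j0 = sPair p j1 -> j0 = j1 \/ j0 = j1 + 1.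
    move=> jj0 jj2 E01; have [b1 b2] := jbounds jj0; have [b1' b2'] := jbounds jj2.
    have : cI p j0 \in sPair p j1 by rewrite -E01 mem_sPair eqxx.
    have [_ j0E _ _ _] := cIP pH b1; have [_ j1E _ _ _] := cIP pH b1'; have [_ j2E _ _ _] := cIP pH b2'.
    by rewrite mem_sPair => /orP[] /eqP h; rewrite -j0E h ?j1E ?j2E; [left|right].
  congr (_, _); case: (jset _ _ jj jj1 E) => [//|h1].
  by case: (jset _ _ jj1 jj (esym E)) => [//|h2]; move: h1; rewrite h2 -addrA => /eqP; rewrite addrC -subr_eq subrr.
move=> l /inE1[p [j [pH jj ->]]]; apply/mem_Lk; exact: sPair_good.
Qed.

Lemma local_trace : \sum_(k < M) (-1) ^+ k * (\sum_(l <- Lk k) coeff l (tE k (gen l))) =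
  (size Pe)%:R - (size Ph)%:R :> rat.
Proof.
have large k : \sum_(l <- Lk k.+2) coeff l (tE k.+2 (gen l)) = 0.
  by rewrite big_seq big1 // => l /mem_Lk; exact: tE_large.
(* For a net with a single point the alternating sum stops at degree 0, and the edge sum is empty,
   so the formula with two terms still holds. *)
have S1 : M = 1%N -> \sum_(l <- Lk 1) coeff l (tE 1 (gen l)) = 0.
  by move=> M1; rewrite Lk_large ?M1 // big_nil.
have E : (size Pe)%:R - (size Ph)%:R = (size Pe + size Ph)%:R - (size Ph * 2)%:R :> rat.
  by rewrite natrD natrM; ring.
have M0 : (0 < M)%N by apply: leq_ltn_trans (ltn_ord i0).
rewrite E -sum0 -sum1 -(big_mkord xpredT (fun k => (-1) ^+ k * (\sum_(l <- Lk k) coeff l (tE k (gen l))))).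
pose F k := \sum_(l <- Lk k) coeff l (tE k (gen l)).
rewrite -[RHS]/(F 0%N - F 1%N) (eq_bigr (fun k => (-1) ^+ k * F k)) //.
move: (S1 : _ -> F 1%N = 0) (large : forall k, F k.+2 = 0) M0; move: F (M); clear => F n F1 Fk.
case: n F1 => [|[|n]] // F1 _; first by rewrite big_nat1 expr0 mul1r F1 ?subr0.
rewrite big_nat_recl // big_nat_recl // big1 => [|k _]; last by rewrite Fk mulr0.
by rewrite expr0 expr1 mul1r mulN1r addr0.
Qed.
End Localization.

End Trace.
End Net.
End Retract.

(** Lebesgue number argument: for a property that persists when the radius shrinks, a radius valid
    near each point yields one valid on the whole compact set. *)
Lemma compact_uniform_pos (R : realType) (X : topologicalType) (K : set X) (Q : X -> R -> Prop) :
  compact K -> (forall x e e', Q x e -> 0 < e' -> e' <= e -> Q x e') ->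
  (forall x, K x -> exists2 e, 0 < e & \forall y \near x, K y -> Q y e) ->
  exists2 e, 0 < e & forall x, K x -> Q x e.
Proof.
move=> cK Qmono Qloc.
have /(_ R (0^'+) (fun d x => Q x d) _) := (near_covering_withinP K).2 ((compact_near_coveringP K).1 cK).
have H : forall x, K x -> \forall x' \near x & d \near (0:R)^'+, K x' -> Q x' d.
  move=> x /Qloc[e e0 hV].
  exists (([set y | K y -> Q y e]), [set t | 0 < t < e]) => /=.
    split=> //; near=> t; apply/andP; split; near: t; [exact: nbhs_right_gt|exact: nbhs_right_lt].
  by move=> [y t] [/= h /andP[t0 te]] /h Qy; apply: Qmono Qy _ _ => //; exact: ltW.
move=> /(_ H) hn; have [d [d0 hd]] := filter_ex (filterI (nbhs_right_gt (0 : R)) hn).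
by exists d.
Unshelve. all: by end_near.
Qed.

Lemma seq_uniform_pos (R : realType) (X : eqType) (s : seq X) (Q : X -> R -> Prop) :
  (forall x e e', Q x e -> 0 < e' -> e' <= e -> Q x e') ->
  (forall x, x \in s -> exists2 e, 0 < e & Q x e) ->
  exists2 e, 0 < e & forall x, x \in s -> Q x e.
Proof.
move=> Qmono; elim: s => [|x s IH] h; first by exists 1.
have [e e0 he] : exists2 e, 0 < e & forall y, y \in s -> Q y e.
  by apply: IH => y ys; apply: h; rewrite inE ys orbT.
have [e' e'0 he'] := h x (mem_head _ _).
exists (Num.min e e'); first by rewrite lt_min e0.
move=> y; rewrite inE => /orP[/eqP ->|/he hy]; first by apply: Qmono he' _ _; rewrite ?lt_min ?e0 // ge_min lexx orbT.
by apply: Qmono hy _ _; rewrite ?lt_min ?e0 // ge_min lexx.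
Qed.

Lemma seq_uniform_nat (X : eqType) (s : seq X) (Q : X -> nat -> Prop) :
  (forall x, x \in s -> exists n0, forall n, (n0 <= n)%N -> Q x n) ->
  exists n, forall x, x \in s -> Q x n.
Proof.
move=> h; have /choice[N hN] : forall x, exists n0, x \in s -> forall n, (n0 <= n)%N -> Q x n.
  by move=> x; have [/h[n ?]|] := boolP (x \in s); [exists n|exists 0%N].
exists (\max_(x <- s) N x)%N => x xs; apply: hN => //.
by rewrite (big_rem x) //= leq_maxl.
Qed.

Lemma euler_empty (R : realType) (T : topologicalType) : (T -> False) -> euler_characteristic R T = 0.
Proof.
move=> T0; rewrite /euler_characteristic fsbig1 // => k _.
suff -> : betti R T k = 0%N by rewrite mulr0.
have noS j (s : @simplex R j -> T) : False.
  exact: (T0 (s (simplex0 j))).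
apply: bettiE; exists (fun=> fun=> 0); split=> [[]|c _]; first by [].
exists (fun=> 0); split=> [|a' _]; last by apply/funext => -[].
exists (fun=> 0); last by move=> t; case: (noS _ t).
by split=> [|s]; [apply: (sub_finite_set (B := set0)) => // s; case: (noS _ s)|case: (noS _ s)].
Qed.

(** * The Euler characteristic from the fixed points of a displacement *)

Section Core.
Context {R : realType} {T : topologicalType} {W : normedModType R}.
Variables (iot : T -> W) (r : W -> T) (eta : R).
Hypothesis T_compact : compact [set: T].
Hypothesis iot_cont : continuous iot.
Hypothesis eta0 : 0 < eta.
Hypothesis r_iot : forall x, r (iot x) = x.
Hypothesis r_cont : forall x y, `|y - iot x| < eta -> {for y, continuous r}.
Local Notation dT x y := `|iot x - iot y|.

Lemma iot_inj : injective iot. Proof. by move=> x y /(congr1 r); rewrite !r_iot. Qed.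

Lemma dT_pos x y : x != y -> 0 < dT x y.
Proof. by move=> xy; rewrite normr_gt0 subr_eq0 (inj_eq iot_inj). Qed.

(** Continuity of [r] at [iot p] makes [iot] a topological embedding, so ambient distance detects
    the neighbourhoods of [T]. *)
Lemma near_dist (p : T) (Q : T -> Prop) : (\forall x \near p, Q x) ->
  exists2 e, 0 < e & forall x, dT x p < e -> Q x.
Proof.
move=> hQ; have rp : {for iot p, continuous r} by apply: (@r_cont p); rewrite subrr normr0.
have : \forall y \near iot p, Q (r y) by apply: rp; rewrite r_iot.
move=> /nbhs_normP[e /= e0 h]; exists e => // x xp.
by rewrite -(r_iot x); apply: h; rewrite /= distrC.
Qed.

Lemma dist_near (p : T) e : 0 < e -> \forall x \near p, dT x p < e.
Proof.
move=> e0; have /cvgrPdist_lt/(_ e e0) := @iot_cont p.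
by apply: filterS => x; rewrite distrC.
Qed.

Lemma dist_near_fun (X : topologicalType) (F : X -> T) (x0 : X) e : {for x0, continuous F} -> 0 < e ->
  \forall x \near x0, dT (F x) (F x0) < e.
Proof. by move=> cF e0; exact: (cF _ (dist_near (F x0) e0)). Qed.

Lemma dT_tri x y z : dT x z <= dT x y + dT y z.
Proof. exact: ler_distD. Qed.

(** Near-covering form of compactness, with the filter of finite lists ordered by inclusion. *)
Lemma finite_net e : 0 < e -> exists s : seq T, forall x, exists2 y, y \in s & dT y x < e.
Proof.
move=> e0.
pose F : set_system (seq T) := fun P => exists s0 : seq T, forall s : seq T, {subset s0 <= s} -> P s.
have FF : Filter F.
  split; first by exists [::].
    move=> P Q [s hs] [s' hs']; exists (s ++ s') => u su; split.
      by apply: hs => x xs; apply: su; rewrite mem_cat xs.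
    by apply: hs' => x xs; apply: su; rewrite mem_cat xs orbT.
  by move=> P Q PQ [s hs]; exists s => u /hs; exact: PQ.
have := (compact_near_coveringP _).1 T_compact (seq T) F (fun s x => exists2 y, y \in s & dT y x < e) FF.
case=> [x _|s hs]; last by exists s => x; exact: (hs s (fun _ h => h)).
exists ([set x' | dT x' x < e], [set s : seq T | x \in s]); last first.
  by move=> [x' s] [/= xx' xs]; exists x; rewrite // distrC.
split; first exact: dist_near.
by exists [:: x] => s; apply; rewrite mem_head.
Qed.

Section Displacement.
Variable f : T -> T.
Hypothesis f_cont : continuous f.
Hypothesis f_near : forall x, `|iot (f x) - iot x| < eta.
Variables (Pe Ph : seq T) (a : T -> R -> T) (chi : T -> T -> R).
Hypothesis uniqP : uniq (Pe ++ Ph).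
Hypothesis fixP : forall x, f x = x -> x \in Pe ++ Ph.
Hypothesis he : forall p, p \in Pe -> \forall x \near p, f x = p.
Hypothesis a0 : forall p, p \in Ph -> a p 0 = p.
Hypothesis a_cont : forall p, p \in Ph -> \forall t \near (0 : R), {for t, continuous (a p)}.
Hypothesis chi_cont : forall p, p \in Ph -> \forall x \near p, {for x, continuous (chi p)}.
Hypothesis chi_a : forall p, p \in Ph -> \forall t \near (0 : R), chi p (a p t) = t.
Hypothesis hh : forall p, p \in Ph -> \forall x \near p, f x = a p (2 * chi p x).

Lemma ex_rho : exists2 rho, 0 < rho &
 [/\ forall p p', p \in Pe ++ Ph -> p' \in Pe ++ Ph -> p != p' -> 4 * rho <= dT p p',
   forall p x, p \in Pe -> dT x p < rho -> f x = p &
   forall p x, p \in Ph -> dT x p < rho -> f x = a p (2 * chi p x) /\ {for x, continuous (chi p)}].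
Proof.
have [p pP|e1 e10 h1] := @seq_uniform_pos R _ (Pe ++ Ph)
  (fun p e => forall p', p' \in Pe ++ Ph -> p != p' -> 4 * e <= dT p p')
  (fun p e e' h _ ee' p' p'P pp' => le_trans (ler_wpM2l (ler0n _ 4) ee') (h p' p'P pp')).
  apply: (@seq_uniform_pos R _ _ (fun p' e => p != p' -> 4 * e <= dT p p')).
    by move=> p' e e' h _ ee' /h; apply: le_trans; rewrite ler_wpM2l.
  move=> p' _; have [->|pp'] := eqVneq p p'; first by exists 1.
  exists (dT p p' / 4) => [|_]; first by rewrite divr_gt0 ?dT_pos.
  by rewrite mulrCA divff ?mulr1.
have [e2 e20 h2] := @seq_uniform_pos R _ Pe (fun p e => forall x, dT x p < e -> f x = p)
  (fun p e e' h _ ee' x xp => h x (lt_le_trans xp ee')) (fun p pE => near_dist (he pE)).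
have [e3 e30 h3] := @seq_uniform_pos R _ Ph
  (fun p e => forall x, dT x p < e -> f x = a p (2 * chi p x) /\ {for x, continuous (chi p)})
  (fun p e e' h _ ee' x xp => h x (lt_le_trans xp ee'))
  (fun p pE => near_dist (filterI (hh pE) (chi_cont pE))).
exists (Num.min e1 (Num.min e2 e3)); first by rewrite !lt_min e10 e20 e30.
split=> [p p' pP p'P pp'|p x pE|p x pH].
- apply: le_trans (h1 p pP p' p'P pp'); rewrite ler_wpM2l // ge_min lexx //.
- by rewrite !lt_min => /and3P[_ xp _]; exact: h2 xp.
- by rewrite !lt_min => /and3P[_ _ xp]; exact: h3 xp.
Qed.

Lemma ex_t1 rho : 0 < rho -> exists2 t1, 0 < t1 &
  forall p, p \in Ph -> forall t, `|t| <= 2 * t1 ->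
    [/\ chi p (a p t) = t, dT (a p t) p < rho / 2 & {for t, continuous (a p)}].
Proof.
move=> rho0; apply: seq_uniform_pos.
  move=> p e e' h _ ee' t te; apply: h; apply: le_trans te _; lra.
move=> p pH; have : \forall t \near (0 : R), [/\ chi p (a p t) = t, dT (a p t) p < rho / 2 & {for t, continuous (a p)}].
  have h : \forall t \near (0 : R), dT (a p t) p < rho / 2.
    have := dist_near_fun (nbhs_singleton (a_cont pH)) (divr_gt0 rho0 (ltr0Sn _ 1)).
    by apply: filterS => t; rewrite a0.
  near=> t; split; [near: t; exact: chi_a|near: t; exact: h|near: t; exact: a_cont].
move=> /nbhs_normP[e /= e0 h]; exists (e / 4); first by rewrite divr_gt0.
move=> t te; apply: h; rewrite /= sub0r normrN; apply: le_lt_trans te _; lra.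
Unshelve. all: by end_near.
Qed.

Lemma ex_rho' rho t1 : 0 < rho -> 0 < t1 -> exists2 rho', 0 < rho' &
  rho' <= rho / 2 /\ forall p x, p \in Ph -> dT x p < rho' -> `|2 * chi p x| <= t1.
Proof.
move=> rho0 t10.
have [p pH|e e0 h] := @seq_uniform_pos R _ Ph (fun p e => forall x, dT x p < e -> `|2 * chi p x| <= t1)
  (fun p e e' h _ ee' x xp => h x (lt_le_trans xp ee')).
  apply: near_dist.
  have c0 : chi p p = 0 by have := nbhs_singleton (chi_a pH); rewrite a0.
  have := nbhs_singleton (chi_cont pH).
  move=> /cvgrPdist_lt/(_ (t1 / 2) (divr_gt0 t10 (ltr0Sn _ 1))); apply: filterS => x.
  rewrite c0 sub0r normrN normrM ger0_norm //; lra.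
exists (Num.min e (rho / 2)); first by rewrite lt_min e0 divr_gt0.
split=> [|p x pH]; first by rewrite ge_min lexx orbT.
by rewrite lt_min => /andP[xp _]; exact: h xp.
Qed.

(** Away from the fixed points the displacement is positive, and compactness bounds it below. *)
Lemma ex_c e : 0 < e -> exists2 c, 0 < c &
  forall x, (forall p, p \in Pe ++ Ph -> e <= dT x p) -> c <= dT (f x) x.
Proof.
move=> e0; have [|x _|c c0 h] := @compact_uniform_pos R T setT
  (fun x c => (forall p, p \in Pe ++ Ph -> e <= dT x p) -> c <= dT (f x) x) T_compact.
- by move=> x d d' h _ dd' /h; exact: le_trans.
- have [fx|fx] := eqVneq (f x) x.
    exists 1 => //; have := dist_near x e0; apply: filterS => y yx _ hy.
    by have := hy x (fixP fx); rewrite leNgt yx.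
  have d0 := dT_pos fx; exists (dT (f x) x / 2); first by rewrite divr_gt0.
  have d4 : 0 < dT (f x) x / 4 by rewrite divr_gt0.
  apply: filterS (filterI (dist_near x d4) (dist_near_fun (@f_cont x) d4)) => y [h1 h2] _ _.
  have := dT_tri (f x) (f y) x; have := dT_tri (f y) y x; rewrite [dT (f x) (f y)]distrC; lra.
by exists c => // x hx; exact: h.
Qed.

Lemma ex_delta e : 0 < e -> exists2 d, 0 < d &
  forall x y, `|y - iot x| <= d -> dT (f (r y)) (f x) < e /\ dT (r y) x < e.
Proof.
move=> e0; have [|x _|d d0 h] := @compact_uniform_pos R T setT
  (fun x d => forall y, `|y - iot x| <= d -> dT (f (r y)) (f x) < e /\ dT (r y) x < e) T_compact.
- by move=> x d d' h _ dd' y yx; apply: h; exact: le_trans yx dd'.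
- have rx : {for iot x, continuous r} by apply: (@r_cont x); rewrite subrr normr0.
  have e2 : 0 < e / 2 by rewrite divr_gt0.
  have frx : {for iot x, continuous (f \o r)} by apply: continuous_comp => //; exact: f_cont.
  have /nbhs_normP : nbhs (iot x) ((fun y => dT (f (r y)) (f x) < e / 2) `&` (fun y => dT (r y) x < e / 2)).
    by have := filterI (dist_near_fun frx e2) (dist_near_fun rx e2); rewrite /= r_iot; apply.
  move=> [d /= d0 hd].
  have d2 : 0 < d / 2 by rewrite divr_gt0.
  exists (d / 2) => //.
  apply: filterS (filterI (dist_near x d2) (filterI (dist_near_fun (@f_cont x) e2) (dist_near x e2))) => x' [h1 [h2 h3]] _ y yx'.
  have [h4 h5] : dT (f (r y)) (f x) < e / 2 /\ dT (r y) x < e / 2.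
    apply: hd; rewrite /= distrC; apply: le_lt_trans (ler_distD (iot x') _ _) _; lra.
  have := dT_tri (f (r y)) (f x) (f x'); have := dT_tri (r y) x x'.
  rewrite [dT (f x) (f x')]distrC [dT x x']distrC; split; lra.
by exists d => // x y; exact: h.
Qed.

Section Arc.
Variables (rho t1 : R).
Hypothesis t10 : 0 < t1.
Hypothesis arc : forall p, p \in Ph -> forall t, `|t| <= 2 * t1 ->
    [/\ chi p (a p t) = t, dT (a p t) p < rho / 2 & {for t, continuous (a p)}].
Hypothesis chic : forall p x, p \in Ph -> dT x p < rho -> {for x, continuous (chi p)}.

Let K : set R := `[- (2 * t1), 2 * t1]%classic.
Let KP t : K t <-> `|t| <= 2 * t1.
Proof. by rewrite /K /= in_itv /= ler_norml. Qed.
Let cK : compact K. Proof. exact: segment_compact. Qed.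

Lemma ex_et e : 0 < e -> exists2 et, 0 < et & forall p, p \in Ph ->
  forall t s, `|t| <= 2 * t1 -> `|s| <= 2 * t1 -> `|t - s| <= et -> dT (a p t) (a p s) < e.
Proof.
move=> e0; apply: seq_uniform_pos => [p d d' h _ dd' t s tt st ts|p pH].
  by apply: h => //; exact: le_trans ts dd'.
have [|t /KP tt|d d0 h] := @compact_uniform_pos R R K
  (fun t d => forall s, `|s| <= 2 * t1 -> `|t - s| <= d -> dT (a p t) (a p s) < e) cK.
- by move=> t d d' h _ dd' s st ts; apply: h => //; exact: le_trans ts dd'.
- have [_ _ at_] := arc pH tt.
  have := dist_near_fun at_ (divr_gt0 e0 (ltr0Sn R 1)) => /nbhs_normP[d /= d0 hd].
  have d2 : 0 < d / 2 by rewrite divr_gt0.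
  exists (d / 2) => //; apply/nbhs_normP; exists (d / 2) => // t' /= tt' _ s _ ts.
  have h1 : dT (a p t') (a p t) < e / 2 by apply: hd => /=; apply: lt_trans tt' _; lra.
  have h2 : dT (a p s) (a p t) < e / 2.
    apply: hd => /=; apply: le_lt_trans (ler_distD t' _ _) _; lra.
  have := dT_tri (a p t') (a p t) (a p s); rewrite [dT (a p t) (a p s)]distrC; lra.
by exists d => // t s tt; apply: h; apply/KP.
Qed.

(** Counterpart of [ex_et]: the parameter is recovered continuously by [chi p], so nearby points of
    an arc have nearby parameters. *)
Lemma ex_g et : 0 < et -> exists2 g, 0 < g & forall p, p \in Ph ->
  forall t s, `|t| <= 2 * t1 -> `|s| <= 2 * t1 -> dT (a p t) (a p s) < g -> `|t - s| < et.
Proof.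
move=> et0; apply: seq_uniform_pos => [p d d' h _ dd' t s tt st ts|p pH].
  by apply: h => //; exact: lt_le_trans ts dd'.
have [|t /KP tt|d d0 h] := @compact_uniform_pos R R K
  (fun t d => forall s, `|s| <= 2 * t1 -> dT (a p t) (a p s) < d -> `|t - s| < et) cK.
- by move=> t d d' h _ dd' s st ts; apply: h => //; exact: lt_le_trans ts dd'.
- have [ct nt at_] := arc pH tt.
  have et2 : 0 < et / 2 by rewrite divr_gt0.
  have ar : dT (a p t) p < rho by have := normr_ge0 (iot (a p t) - iot p); lra.
  have /cvgrPdist_lt/(_ _ et2)/near_dist[d d0 hd] := chic pH ar.
  have d2 : 0 < d / 2 by rewrite divr_gt0.
  exists (d / 2) => //.
  have ht : \forall t' \near t, `|t - t'| < et / 2 by exact: (@cvgr_dist_lt _ _ _ (nbhs t) _ id t).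
  apply: filterS (filterI ht (dist_near_fun at_ d2)) => t' [tt' h1] _ s st h2.
  have [cs _ _] := arc pH st.
  have : `|chi p (a p t) - chi p (a p s)| < et / 2.
    apply: hd; have := dT_tri (a p s) (a p t') (a p t); rewrite [dT (a p s) (a p t')]distrC; lra.
  rewrite ct cs => h3; apply: le_lt_trans (ler_distD t _ _) _; rewrite [X in X + _]distrC; lra.
by exists d => // t s tt; apply: h; apply/KP.
Qed.

End Arc.

Lemma floor_range (t et t1 : R) : 0 < et -> `|t| <= t1 ->
  `|Num.floor (t / et)| <= `|Num.floor (t1 / et)| + 2.
Proof.
move=> et0 tt; set u := t / et; set v := t1 / et.
have uv : `|u| <= v by rewrite normrM (gtr0_norm (x := et^-1)) ?invr_gt0 // ler_pM2r ?invr_gt0.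
have /andP[u1 u2] := floor_itv u; have /andP[v1 v2] := floor_itv v.
rewrite !intrD in u2 v2; move: uv; rewrite ler_norml => /andP[uv1 uv2].
have h1 : Num.floor u < Num.floor v + 2 by rewrite -(ltr_int R) intrD; lra.
have h2 : - Num.floor u < Num.floor v + 3 by rewrite -(ltr_int R) intrD rmorphN /=; lra.
move: (Num.floor u) (Num.floor v) h1 h2 => i j; clear => h1 h2.
by have := ler_norm j; rewrite ler_norml; move: (`|j|) => J; lia.
Qed.

Definition int_range (K : nat) : seq int := [seq i%:Z - K%:Z | i <- seq.iota 0 (K + K).+1].

Lemma mem_int_range K (j : int) : `|j| <= K%:Z -> j \in int_range K.
Proof.
rewrite ler_norml => /andP[j1 j2]; apply/mapP.
exists (absz (j + K%:Z)%R); first by rewrite mem_iota; lia.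
by rewrite gez0_abs ?addrK //; lia.
Qed.

(** Order of the constants: the radius [rho] and arc length [t1], then [rho'], the displacement
    bound [c], the scale [dl], the accuracy [gm], the grid step [et], and finally the smallness [g];
    each depends only on earlier ones. *)
Theorem euler_of_displacement : euler_characteristic R T = (size Pe)%:Z - (size Ph)%:Z.
Proof.
have [[x0 _]|T0] := pselect (exists x : T, True); last first.
  have E (s : seq T) : s = [::] by case: s => // x s; exfalso; apply: T0; exists x.
  rewrite (E Pe) (E Ph) subrr euler_empty // => x; apply: T0; by exists x.
have [rho rho0 [sep he' hh']] := ex_rho.
have [t1 t10 arc] := ex_t1 rho0.
have [rho' rho'0 [rho'le hchi]] := ex_rho' rho0 t10.
have r20 : 0 < rho' / 2 by rewrite divr_gt0.
have [c c0 disp] := ex_c r20.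
have [dlt dlt0 uc] : exists2 d, 0 < d & forall x y, `|y - iot x| <= d ->
    dT (f (r y)) (f x) < c / 2 /\ dT (r y) x < rho' / 2.
  have e0 : 0 < Num.min (c / 2) (rho' / 2) by rewrite lt_min divr_gt0.
  have [d d0 h] := ex_delta e0; exists d => // x y /h.
  by rewrite !lt_min => -[/andP[-> _] /andP[_ ->]].
(* Halved because [dl < eta] has to be strict. *)
pose dl := Num.min eta dlt / 2.
have m0 : 0 < Num.min eta dlt by rewrite lt_min eta0.
have dl0 : 0 < dl by rewrite divr_gt0.
have dle : dl < eta.
  by apply: (@lt_le_trans _ _ (Num.min eta dlt)); [rewrite /dl; lra|rewrite ge_min lexx].
have dldlt : dl <= dlt.
  by apply: (@le_trans _ _ (Num.min eta dlt)); [rewrite /dl; lra|rewrite ge_min lexx orbT].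
(* A quarter of [dl] leaves room for [g <= dl / 2] in [g + gm + gm <= dl]. *)
pose gm := Num.min (dl / 4) (c / 2).
have gm0 : 0 < gm by rewrite lt_min !divr_gt0.
have gmc : gm <= c / 2 by rewrite ge_min lexx orbT.
have gmdl : gm <= dl / 4 by rewrite ge_min lexx.
have [et1 et10 het] : exists2 et, 0 < et & forall p, p \in Ph ->
    forall t s, `|t| <= 2 * t1 -> `|s| <= 2 * t1 -> `|t - s| <= et -> dT (a p t) (a p s) < Num.min gm (rho' / 2).
  by apply: (ex_et arc); rewrite lt_min gm0.
pose et := Num.min et1 t1.
have et0 : 0 < et by rewrite lt_min et10.
have ett1 : et <= t1 by rewrite ge_min lexx orbT.
have etle : et <= et1 by rewrite ge_min lexx.
have [g1 g10 hg] := ex_g arc (fun p x pH xp => (hh' p x pH xp).2) et0.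
pose g := Num.min g1 (dl / 2).
have g0 : 0 < g by rewrite lt_min g10 divr_gt0.
have gdl : g + gm + gm <= dl.
  have : g <= dl / 2 by rewrite ge_min lexx orbT.
  lra.
have tt2 (t : R) : `|t| <= t1 -> `|t| <= 2 * t1 by lra.
have z2 : `|0 : R| <= 2 * t1 by rewrite normr0; lra.
have [Fs0 hFs0] := finite_net gm0.
pose K := `|Num.floor (t1 / et)|%N.+2.
pose Fs := undup (Pe ++ [seq a p (et * j%:~R) | p <- Ph, j <- int_range K] ++ Fs0).
(* A point on an arc is rounded down to the grid, an elliptic point goes to itself, any other point
   to some nearby net point. The rules are compatible because different arcs are disjoint and miss
   the elliptic points. *)
have /choice[N hN] : forall x, exists y, [/\ y \in Fs, dT y x < gm, x \in Pe -> y = x &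
    forall p t, p \in Ph -> `|t| <= t1 -> x = a p t -> y = a p (et * (Num.floor (t / et))%:~R)].
  move=> x.
  have [[p [t [pH tt ->]]]|nH] := pselect (exists p t, [/\ p \in Ph, `|t| <= t1 & x = a p t]).
    have pP : p \in Pe ++ Ph by rewrite mem_cat pH orbT.
    have [ct rt _] := arc p pH t (tt2 _ tt).
    have uniqueP p' : p' \in Pe ++ Ph -> dT (a p t) p' < rho / 2 -> p = p'.
      move=> p'P h; apply/eqP; apply: contraT => /(sep _ _ pP p'P).
      have := dT_tri p (a p t) p'; rewrite [dT p (a p t)]distrC; lra.
    exists (a p (et * (Num.floor (t / et))%:~R)); split.
    - rewrite mem_undup !mem_cat; apply/or3P; apply: Or32; apply/allpairsP.
      exists (p, Num.floor (t / et)); split=> //=; apply: mem_int_range.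
      by have := floor_range et0 tt; rewrite /K; move: (Num.floor _) (Num.floor _) => i j; clear; lia.
    - have /andP[f1 f2] := floor_itv (t / et).
      rewrite ler_pdivlMr // in f1; rewrite ltr_pdivrMr // intrD mulrDl mul1r in f2.
      move: (_%:~R) f1 f2 => J f1 f2; have := het p pH (et * J) t; rewrite lt_min => h.
      apply: (andP (h _ (tt2 _ tt) _)).1.
        by move: tt; rewrite !ler_norml mulrC => /andP[]; lra.
      by rewrite ler_norml mulrC; lra.
    - move=> pE; have pEP : a p t \in Pe ++ Ph by rewrite mem_cat pE.
      have := uniqueP _ pEP; rewrite subrr normr0 => /(_ (divr_gt0 rho0 (ltr0Sn _ 1))) pa.
      by move: uniqP; rewrite cat_uniq => /and3P[_ /hasPn/(_ p pH)]; rewrite /= {1}pa pE.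
    move=> p' t' p'H tt' E; have [ct' rt' _] := arc p' p'H t' (tt2 _ tt').
    have pp : p = p' by apply: uniqueP; rewrite ?E // mem_cat p'H orbT.
    by rewrite -pp in ct' E *; rewrite -ct' -E ct.
  have [xE|xE] := boolP (x \in Pe).
    exists x; split=> //; first by rewrite mem_undup mem_cat xE.
      by rewrite subrr normr0.
    by move=> p t pH tt xa; exfalso; apply: nH; exists p, t.
  have [y ys yx] := hFs0 x; exists y; split=> //.
    by rewrite mem_undup !mem_cat ys !orbT.
  by move=> p t pH tt xa; exfalso; apply: nH; exists p, t.
pose M := size Fs; pose q (i : 'I_M) := nth x0 Fs i.
have netlt x : (index (N x) Fs < M)%N by rewrite index_mem; case: (hN x).
pose net x : 'I_M := Ordinal (netlt x).
have qnet x : q (net x) = N x by rewrite /q nth_index //; case: (hN x).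
have q_inj : injective q.
  by move=> i j /eqP; rewrite nth_uniq ?undup_uniq // => /eqP /val_inj.
have netP x : dT (q (net x)) x < gm by rewrite qnet; case: (hN x).
pose i0 := net x0.
(* The model has finitely many simplices, so one number of subdivisions serves them all. *)
have [m m_small] : exists m, forall kl : nat * seq 'I_M, kl \in [seq (k, l) | k <- seq.iota 0 M, l <- Lk iot q dl k] ->
    supp (@csupp R T (small iot g) kl.1) (iter m (@Sd R T kl.1) (fS f (phi iot r q kl.1 (gen kl.2)))).
  apply: (seq_uniform_nat (Q := fun (kl : nat * seq 'I_M) m =>
    supp (@csupp R T (small iot g) kl.1) (iter m (@Sd R T kl.1) (fS f (phi iot r q kl.1 (gen kl.2)))))).
  move=> [k l] /allpairsPdep[k' [l' [_ lL [-> ->]]]] /=.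
  apply: small_Sdc => //; apply: supp_fS => //.
  apply: (supp_phi r_cont dle); apply: supp_gen.
  by have [] := (mem_Lk iot q dl k' l').1 lL.
have m_small' k l : sgood iot q dl k l ->
    supp (@csupp R T (small iot g) k) (iter m (@Sd R T k) (fS f (phi iot r q k (gen l)))).
  move=> /mem_Lk lL; apply: (m_small (k, l)); apply/allpairsPdep; exists k, l; split=> //.
  rewrite mem_iota /= add0n ltnNge; apply/negP => Mk.
  by have E := @Lk_large R T W iot eta eta0 M q gm g dl g0 gdl dle k Mk; rewrite E in lL.
have TR := euler_trace iot_cont eta0 r_iot r_cont netP g0 gdl dle i0 f_cont f_near m_small'.
have E := local_trace eta0 r_iot r_cont netP g0 gdl dle i0 f_cont m_small' uniqP q_inj rho'0
  rho'le sep he' (fun p x pH xp => (hh' p x pH xp).1) a0 _ hchi disp _ gmc et0 ett1 _ _ _ _.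
apply/eqP; rewrite -(eqr_int rat) intrB; apply/eqP; rewrite TR.
apply: E.
- by move=> p t pH tt; have [-> ->] := arc p pH t tt.
- by move=> x y xy; apply: uc; exact: le_trans xy dldlt.
- move=> p t s pH tt ts h; apply: (hg p pH t s (tt2 _ tt) (tt2 _ ts)).
  by apply: lt_le_trans h _; rewrite ge_min lexx.
- move=> p t pH tt; have := het p pH t 0 _ z2; rewrite subr0 a0 // lt_min => h.
  have /andP[h1 ->] : (dT (a p t) p < gm) && (dT (a p t) p < rho' / 2).
    by apply: h; lra.
  by split=> //; apply: ltW; apply: lt_le_trans h1 _; lra.
- by move=> p pE; rewrite qnet; have [_ _ ->] := hN p.
- by move=> p t pH tt; rewrite qnet; have [_ _ _] := hN (a p t); apply.
Qed.
End Displacement.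
End Core.

(** * Nearest point retraction *)

Lemma near_normP (R : realType) (V : normedModType R) (y : V) (P : V -> Prop) :
  (\forall z \near y, P z) <-> (exists2 d, 0 < d & forall z, `|z - y| < d -> P z).
Proof.
split=> [/nbhs_normP[d /= d0 h]|[d d0 h]].
  by exists d => // z zy; apply: h; rewrite /= distrC.
by apply/nbhs_normP; exists d => // z /= zy; apply: h; rewrite distrC.
Qed.

Section MatrixNorm.
Context {R : realType}.

Lemma norm_mx_entry m n (A : 'M[R]_(m, n)) i j : `|A i j| <= `|A|.
Proof.
rewrite -[X in _ <= X]/(mx_norm A) mx_normrE.
exact: (le_bigmax _ (fun ij : 'I_m * 'I_n => `|A ij.1 ij.2|) (i, j)).
Qed.

Lemma norm_mx_le m n (A : 'M[R]_(m, n)) c : 0 <= c -> (forall i j, `|A i j| <= c) -> `|A| <= c.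
Proof.
move=> c0 h; rewrite -[X in X <= _]/(mx_norm A) mx_normrE.
by apply: bigmax_le => // -[i j] _; exact: h.
Qed.

Lemma norm_sum_le (I : Type) (s : seq I) (F : I -> R) c : (forall i, `|F i| <= c) ->
  `|\sum_(i <- s) F i| <= c *+ size s.
Proof.
move=> h; apply: le_trans (ler_norm_sum _ _ _) _.
elim: s => [|i s IH]; first by rewrite big_nil.
by rewrite big_cons mulrS lerD.
Qed.

Lemma size_index_ord n : size (index_enum 'I_n) = n.
Proof. by rewrite -sum1_size sum1_card card_ord. Qed.

Lemma norm_mulmx m n p (A : 'M[R]_(m, n)) (B : 'M[R]_(n, p)) : `|A *m B| <= n%:R * (`|A| * `|B|).
Proof.
apply: norm_mx_le => [|i j]; first by rewrite !mulr_ge0.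
rewrite mxE; apply: le_trans (norm_sum_le _ (c := `|A| * `|B|) _) _.
  by move=> k; rewrite normrM ler_pM // norm_mx_entry.
by rewrite size_index_ord mulr_natl.
Qed.

Context {N : nat}.
Implicit Types u v w : 'rV[R]_N.

Definition dot u v : R := \sum_i u 0 i * v 0 i.

Lemma dotC u v : dot u v = dot v u.
Proof. by apply: eq_bigr => i _; rewrite mulrC. Qed.
Lemma dotDl u v w : dot (u + v) w = dot u w + dot v w.
Proof. by rewrite -big_split; apply: eq_bigr => i _; rewrite mxE mulrDl. Qed.
Lemma dotZl a u w : dot (a *: u) w = a * dot u w.
Proof. by rewrite /dot mulr_sumr; apply: eq_bigr => i _; rewrite mxE mulrA. Qed.
Lemma dotNl u w : dot (- u) w = - dot u w.
Proof. by rewrite -scaleN1r dotZl mulN1r. Qed.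
Lemma dotDr u v w : dot w (u + v) = dot w u + dot w v.
Proof. by rewrite dotC dotDl !(dotC w). Qed.
Lemma dotZr a u w : dot w (a *: u) = a * dot w u.
Proof. by rewrite dotC dotZl dotC. Qed.
Lemma dotNr u w : dot w (- u) = - dot w u.
Proof. by rewrite dotC dotNl dotC. Qed.
Lemma dot0l u : dot 0 u = 0.
Proof. by rewrite -[0](subrr u) dotDl dotNl subrr. Qed.
Lemma dot0r u : dot u 0 = 0.
Proof. by rewrite dotC dot0l. Qed.
Lemma dot_sub u v : dot (u - v) (u - v) = dot u u - 2 * dot u v + dot v v.
Proof. by rewrite dotDl !dotDr !dotNl !dotNr (dotC v u); ring. Qed.
Lemma dot_ge0 u : 0 <= dot u u.
Proof. by apply: sumr_ge0 => i _; rewrite -expr2 sqr_ge0. Qed.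

Lemma dot_norm u v : `|dot u v| <= N%:R * (`|u| * `|v|).
Proof.
apply: le_trans (norm_sum_le _ (c := `|u| * `|v|) _) _.
  by move=> k; rewrite normrM ler_pM // norm_mx_entry.
by rewrite size_index_ord mulr_natl.
Qed.

Lemma norm_dot u : `|u| ^+ 2 <= dot u u.
Proof.
rewrite -[leRHS]sqr_sqrtr ?dot_ge0 // lerXn2r ?nnegrE ?sqrtr_ge0 //.
apply: norm_mx_le => [|i j]; first exact: sqrtr_ge0.
rewrite ord1 -[leLHS]sqrtr_sqr ler_sqrt ?dot_ge0 // /dot (bigD1 j) //= -expr2.
by rewrite lerDl sumr_ge0 // => k _; rewrite -expr2 sqr_ge0.
Qed.

Lemma dot_eq0 u : (dot u u == 0) = (u == 0).
Proof.
apply/eqP/eqP => [h|->]; last exact: dot0l.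
have := norm_dot u; rewrite h => h1; apply/eqP; rewrite -normr_eq0 -sqrf_eq0.
by rewrite eq_le h1 sqr_ge0.
Qed.

Lemma dot_gt0 u : u != 0 -> 0 < dot u u.
Proof. by rewrite lt_def dot_eq0 dot_ge0 andbT. Qed.

Lemma dot_continuous (X : topologicalType) (F G : X -> 'rV[R]_N) x :
  {for x, continuous F} -> {for x, continuous G} -> {for x, continuous (fun y => dot (F y) (G y))}.
Proof.
move=> cF cG; rewrite /dot; apply: continuous_sumf => i.
have cc (H : X -> 'rV[R]_N) : {for x, continuous H} -> {for x, continuous (fun y => H y 0 i)}.
  move=> cH; exact: (@continuous_comp _ _ _ H (fun v : 'rV[R]_N => v 0 i) x cH (@coord_continuous _ _ _ _ _ _)).
exact: (@continuousM _ _ (fun y => F y 0 i) (fun y => G y 0 i) x (cc _ cF) (cc _ cG)).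
Qed.

End MatrixNorm.

Section Quadratic.
Context {R : realType}.

(** The inequality is available for both signs of [t]; with the sign of [a] it fails for [t] small
    against [|a| / K]. *)
Lemma linear_le_quadratic (a K : R) : (\forall t \near (0 : R), t * a <= K * t ^+ 2) -> a = 0.
Proof.
move=> /nbhs_normP[e /= e0 h]; apply/eqP; apply: contraT => a0.
have K1 : 0 < `|K| + 1 by rewrite ltr_wpDl.
pose s := Num.min (e / 2) (`|a| / (2 * (`|K| + 1))).
have s0 : 0 < s by rewrite lt_min divr_gt0 //= divr_gt0 ?mulr_gt0 ?normr_gt0.
have se : s < e by rewrite gt_min; apply/orP; left; lra.
have sa : s * (`|K| + 1) <= `|a| / 2.
  rewrite -ler_pdivlMr // -mulrA -invfM ge_min; apply/orP; by right.
have /h : ball_ Num.norm 0 e (Num.sg a * s).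
  by rewrite /= sub0r normrN normrM normr_sg a0 mul1r gtr0_norm.
rewrite mulrAC -normrEsg exprMn sqr_sg a0 mul1r => h1.
have : K * s ^+ 2 <= s * (s * (`|K| + 1)) .
  rewrite mulrA -expr2 mulrC ler_pM2l ?exprn_gt0 //; have := ler_norm K; lra.
have : s * (s * (`|K| + 1)) <= s * (`|a| / 2) by rewrite ler_pM2l.
have : 0 < `|a| * s by rewrite mulr_gt0 ?normr_gt0.
by move: h1; move: (K * _) (s * (s * _)) => x y; lra.
Qed.
End Quadratic.

(** * Tangent vectors with second order contact *)

Section Tangent.
Context {R : realType} {T : topologicalType} {N : nat}.
Variable iot : T -> 'rV[R]_N.

(** Only the quadratic error of the curve matters: it is what a chart provides and what tests of
    orthogonality use. *)
Definition tanv (x : T) (tau : 'rV[R]_N) : Prop := exists (g : R -> T) (c : R),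
  \forall t \near (0 : R), `|iot (g t) - iot x - t *: tau| <= c * t ^+ 2.

(** A one-sided quadratic bound is enough, as the curve can be followed in both directions. *)
Lemma tanv_quad x tau n K e : tanv x tau -> 0 <= K -> 0 < e ->
  (forall y, `|iot y - iot x| < e -> dot n (iot y - iot x) <= K * `|iot y - iot x| ^+ 2) -> dot n tau = 0.
Proof.
move=> [g [c hg]] K0 e0 hn.
pose c1 : R := `|c|; have c10 : 0 <= c1 by exact: normr_ge0.
have tau0 : 0 <= `|tau| by [].
apply: (@linear_le_quadratic R _ (K * (`|tau| + c1) ^+ 2 + N%:R * (`|n| * c1))).
have M0 : 0 < `|tau| + c1 + 1 by lra.
pose d : R := Num.min 1 (e / (`|tau| + c1 + 1)).

have h1 : \forall t \near (0:R), `|t| < d.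
  apply/nbhs_normP; exists d => /= [|t /=]; first by rewrite lt_min ltr01 divr_gt0.
  by rewrite sub0r normrN.
apply: filterS (filterI hg h1) => t [ht]; rewrite lt_min ltr_pdivlMr // => /andP[t1 te].
set w := iot (g t) - iot x in ht; pose rr := w - t *: tau.
have he : `|rr| <= c1 * t ^+ 2.
  by apply: le_trans ht _; rewrite ler_wpM2r ?sqr_ge0 ?ler_norm.
have -> : t * dot n tau = dot n w - dot n rr by rewrite /rr dotDr dotNr dotZr opprB addrC subrK.
have hw : `|w| <= (`|tau| + c1) * `|t|.
  rewrite -(subrK (t *: tau) w) -/rr; apply: le_trans (ler_normD _ _) _.
  rewrite normrZ mulrDl addrC mulrC lerD2l; apply: le_trans he _.
  rewrite ler_wpM2l // -(@real_normK _ t) ?num_real // expr2 ler_piMl //; exact: ltW.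
have h2 : dot n w <= K * (`|tau| + c1) ^+ 2 * t ^+ 2.
  apply: le_trans (hn (g t) _) _.
    apply: le_lt_trans hw _; apply: le_lt_trans te; rewrite mulrC ler_wpM2l //.
    by rewrite lerDl.
  rewrite -mulrA ler_wpM2l // -[t ^+ 2]ger0_norm ?sqr_ge0 // normrX -exprMn.
  by rewrite lerXn2r // nnegrE ?mulr_ge0 // addr_ge0.
have h3 : - dot n rr <= N%:R * (`|n| * c1) * t ^+ 2.
  apply: le_trans (ler_norm _) _; rewrite normrN; apply: le_trans (dot_norm _ _) _.
  by rewrite -!mulrA !ler_wpM2l // mulrA.
by rewrite mulrDl; lra.
Qed.
End Tangent.

Section Nearest.
Context {R : realType} {T : topologicalType} {N : nat}.
Variable iot : T -> 'rV[R]_N.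
Hypothesis T_compact : compact [set: T].
Hypothesis iot_cont : continuous iot.
Hypothesis iot_emb : forall (p : T) (Q : T -> Prop), (\forall x \near p, Q x) ->
  exists2 e, 0 < e & forall x, `|iot x - iot p| < e -> Q x.
Hypothesis iot_inj : injective iot.
Hypothesis tan_approx : forall p : T, exists2 e, 0 < e & \forall x \near p, forall x', `|iot x' - iot x| < e ->
  exists2 tau, tanv iot x tau & `|iot x' - iot x - tau| <= e^-1 * `|iot x' - iot x| ^+ 2.
Variable x0 : T.

(** The ambient norm is the supremum norm, while nearest points are taken for the Euclidean
    distance; each comparison costs a factor depending on [N]. *)
Definition dist2 (y : 'rV[R]_N) (x : T) := dot (y - iot x) (y - iot x).

Lemma nearest_exists : exists r : 'rV[R]_N -> T, forall y x, dist2 y (r y) <= dist2 y x.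
Proof.
have h y : exists z, forall x, dist2 y z <= dist2 y x.
  have [|||z _ hz] := @compact_EVT_min T R (dist2 y) setT.
  - by exists x0.
  - exact: T_compact.
  - apply: continuous_subspaceT => x.
    have c : {for x, continuous (fun x => y - iot x)}.
      exact: (@continuousB _ _ _ (fun=> y) iot x (@cst_continuous _ _ _ _) (@iot_cont x)).
    exact: (dot_continuous c c).
  by exists z => x; apply: hz; rewrite in_setT.
by have [r hr] := choice h; exists r.
Qed.

Lemma nearest_norm (r : 'rV[R]_N -> T) : (forall y x, dist2 y (r y) <= dist2 y x) ->
  forall y x, `|y - iot (r y)| <= N%:R * `|y - iot x|.
Proof.
move=> hr y x.
have [N0|N0] := posnP N.
  rewrite (_ : y - iot (r y) = 0) ?normr0 ?mulr_ge0 //; apply/rowP => -[i ii].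
  by exfalso; move: ii; rewrite N0.
have N1 : 1 <= N%:R :> R by rewrite ler1n.
rewrite -(@ler_pXn2r _ 2) ?nnegrE ?mulr_ge0 //; apply: le_trans (norm_dot _) _.
apply: le_trans (hr y x) _; apply: le_trans (ler_norm _) _; apply: le_trans (dot_norm _ _) _.
rewrite exprMn -expr2 ler_wpM2r ?sqr_ge0 // expr2 ler_peMr //; lra.
Qed.

(** A minimiser is chosen arbitrarily; in a thin tube the choice is Lipschitz. The reason is that
    the normals at two nearby feet pair with the difference of the feet only to second order. *)
Theorem nearest_point_retraction : exists (r : 'rV[R]_N -> T) (eta : R),
  [/\ 0 < eta, forall x, r (iot x) = x,
      forall x (y : 'rV[R]_N), `|y - iot x| < eta -> {for y, continuous r},
      forall y tau, tanv iot (r y) tau -> dot (y - iot (r y)) tau = 0 &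
      forall y x, dist2 y (r y) <= dist2 y x].
Proof.
have [r hr] := nearest_exists.
have orth y tau : tanv iot (r y) tau -> dot (y - iot (r y)) tau = 0.
  move=> ht; apply: (tanv_quad ht (K := N%:R) (e := 1)) => // z _.
  set n := y - iot (r y); set w := iot z - _.
  have := hr y z; rewrite /dist2 -/n.
  have -> : y - iot z = n - w by rewrite /n /w opprB addrA subrK.
  rewrite dot_sub => h.
  have : dot w w <= N%:R * `|w| ^+ 2 by apply: le_trans (ler_norm _) _; rewrite expr2; exact: dot_norm.
  have := dot_ge0 w; have : 0 <= N%:R * `|w| ^+ 2 by rewrite mulr_ge0 ?sqr_ge0.
  lra.
have dist := nearest_norm hr.
have [e e0 he] : exists2 e, 0 < e & forall x, forall x', `|iot x' - iot x| < e ->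
    exists2 tau, tanv iot x tau & `|iot x' - iot x - tau| <= e^-1 * `|iot x' - iot x| ^+ 2.
  have [|x _|e e0 h] := @compact_uniform_pos R T setT (fun x e => forall x', `|iot x' - iot x| < e ->
    exists2 tau, tanv iot x tau & `|iot x' - iot x - tau| <= e^-1 * `|iot x' - iot x| ^+ 2) T_compact.
  - move=> x d d' h d'0 dd' x' xx'; have [|tau ht h'] := h x'; first exact: lt_le_trans xx' dd'.
    exists tau => //; apply: le_trans h' _; rewrite ler_wpM2r ?sqr_ge0 // lef_pV2 ?posrE //.
    exact: lt_le_trans dd'.
  - have [e e0 h] := tan_approx x; exists e => //; apply: filterS h => y hy _; exact: hy.
  by exists e => // x; exact: h.
have rK x : r (iot x) = x.
  apply: iot_inj; apply/eqP; rewrite eq_sym -subr_eq0 -dot_eq0 eq_le dot_ge0 andbT.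
  by have := hr (iot x) x; rewrite /dist2 subrr dot0l.
pose N' : R := N%:R + 1.
have N'0 : 0 < N' by rewrite ltr_wpDl.
have NN' : N%:R <= N' by rewrite lerDl.
have N'1 : 1 <= N' by rewrite lerDr.
(* The first bound brings two feet within [e], where [tan_approx] applies; the second makes the
   normals so short that each quadratic term is at most a quarter of [|w|^2]. *)
pose eta := Num.min (e / (8 * N')) (e / (4 * N' * N')).
have eta0 : 0 < eta by rewrite lt_min !divr_gt0 // !mulr_gt0.
have eta1 : N' * eta <= e / 8.
  have : eta <= e / (8 * N') by rewrite ge_min lexx.
  by rewrite ler_pdivlMr ?mulr_gt0 // ler_pdivlMr //; lra.
have eta2 : N' * (N' * eta) <= e / 4.
  have : eta <= e / (4 * N' * N') by rewrite ge_min lexx orbT.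
  by rewrite ler_pdivlMr ?mulr_gt0 // ler_pdivlMr //; lra.
have lip x y y' : `|y - iot x| < eta -> `|y' - iot x| < eta ->
    `|iot (r y') - iot (r y)| <= 2 * N' * `|y' - y|.
  move=> yx y'x; set w := iot (r y') - iot (r y); set n := y - iot (r y); set n' := y' - iot (r y').
  have hn : `|n| <= N' * eta.
    apply: le_trans (dist y x) _; apply: ler_pM => //; exact: ltW.
  have hn' : `|n'| <= N' * eta.
    apply: le_trans (dist y' x) _; apply: ler_pM => //; exact: ltW.
  have yy' : `|y' - y| < 2 * eta.
    rewrite -(subrK (iot x) y') -addrA; apply: le_lt_trans (ler_normD _ _) _.
    rewrite [X in _ + X]distrC; lra.
  have wE : w = (y' - y) + (n - n') by apply/rowP => i; rewrite /w /n /n' !mxE; ring.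
  have eta3 : eta <= N' * eta by rewrite ler_peMl // ltW.
  have we : `|w| < e.
    rewrite wE; apply: le_lt_trans (ler_normD _ _) _.
    have := ler_normB n n'; lra.
  have [tau ht htau] := he _ _ we.
  have we' : `|iot (r y) - iot (r y')| < e by rewrite distrC.
  have [tau' ht' htau'] := he _ _ we'.
  have q1 : dot n w <= `|w| ^+ 2 / 4.
    have -> : dot n w = dot n (w - tau) by rewrite dotDr dotNr (orth _ _ ht) subr0.
    apply: le_trans (ler_norm _) _; apply: le_trans (dot_norm _ _) _.
    have h1 : N%:R * `|n| <= e / 4.
      by apply: le_trans eta2; apply: ler_pM.
    rewrite mulrA; apply: (@le_trans _ _ (e / 4 * (e^-1 * `|w| ^+ 2))); first exact: ler_pM.
    by have -> : e / 4 * (e^-1 * `|w| ^+ 2) = `|w| ^+ 2 / 4 by field; rewrite gt_eqF.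
  have q2 : dot n' (- w) <= `|w| ^+ 2 / 4.
    have wE' : iot (r y) - iot (r y') = - w by rewrite opprB.
    rewrite wE' normrN in htau'.
    have -> : dot n' (- w) = dot n' (- w - tau') by rewrite [RHS]dotDr (dotNr tau') (orth _ _ ht') subr0.
    apply: le_trans (ler_norm _) _; apply: le_trans (dot_norm _ _) _.
    have h1 : N%:R * `|n'| <= e / 4.
      by apply: le_trans eta2; apply: ler_pM.
    rewrite mulrA; apply: (@le_trans _ _ (e / 4 * (e^-1 * `|w| ^+ 2))); first exact: ler_pM.
    by have -> : e / 4 * (e^-1 * `|w| ^+ 2) = `|w| ^+ 2 / 4 by field; rewrite gt_eqF.
  (* The difference of the feet is that of the points plus that of the normals; the two normal terms
     absorb half of the left side. *)
  have q3 : dot w w = dot (y' - y) w + dot n w + dot n' (- w).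
    rewrite [in RHS]dotNr -[- dot n' w]dotNl -!dotDl; congr dot.
    by rewrite -addrA.
  have q4 : dot (y' - y) w <= N' * `|y' - y| * `|w|.
    apply: le_trans (ler_norm _) _; apply: le_trans (dot_norm _ _) _.
    by rewrite -mulrA ler_wpM2r // mulr_ge0.
  have q5 : `|w| ^+ 2 / 2 <= N' * `|y' - y| * `|w|.
    have := norm_dot w; move: (`|w| ^+ 2) (dot w w) (dot _ w) (dot _ w) (dot _ _) q1 q2 q3 q4 => s a b c d.
    by move=> *; lra.
  have [w0|w0] := eqVneq `|w| 0; first by rewrite w0 !mulr_ge0 // ltW.
  have wp : 0 < `|w| by rewrite lt_def w0 /=.
  rewrite -(@ler_pM2r _ `|w|) //; move: q5; rewrite expr2; lra.
exists r, eta; split=> // x y yx Q.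
move=> /iot_emb[d d0 hQ].
pose d' := Num.min (eta - `|y - iot x|) (d / (2 * N')).
have d'0 : 0 < d' by rewrite lt_min subr_gt0 yx divr_gt0 ?mulr_gt0.
change (nbhs (y : 'rV[R]_N) (fun z => Q (r z))).
apply: (proj2 (@near_normP R 'rV[R]_N y (fun z => Q (r z)))); exists d' => // y'.
rewrite lt_min => /andP[h1 h2].
apply: hQ; apply: le_lt_trans (lip x y y' yx _) _.
  rewrite -(subrK y y') -addrA; apply: le_lt_trans (ler_normD _ _) _; lra.
by rewrite mulrC -ltr_pdivlMr ?mulr_gt0.
Qed.

End Nearest.

(** * Charts *)

Section UniformQuadraticRemainder.
Context {R : realType}.

(** A Taylor bound uniform in both points, in effect a map with Lipschitz derivative. It is the
    common regularity notion for smooth parametrizations and for holomorphic coordinates. *)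
Definition uqr d N (phi : 'rV[R]_d -> 'rV[R]_N) (D : 'rV[R]_d -> 'M[R]_(d, N)) (u0 : 'rV[R]_d) : Prop :=
  exists c e, [/\ 0 <= c, 0 < e & forall u u' : 'rV[R]_d, `|u - u0| < e -> `|u' - u0| < e ->
    `|phi u' - phi u - (u' - u) *m D u| <= c * `|u' - u| ^+ 2].

Variables (d N : nat).
Variables (phi : 'rV[R]_d -> 'rV[R]_N) (D : 'rV[R]_d -> 'M[R]_(d, N)) (u0 : 'rV[R]_d).
Hypothesis phiD : uqr phi D u0.

(** The remainders along the triangle [u], [u'], [u' + k] combine into [k *m (D u' - D u)]. With [k]
    of the size of [u' - u] they add up to the factor 6 = 1 + 4 + 1. *)
Lemma uqr_lipschitz_diff : exists c e, [/\ 0 <= c, 0 < e & forall u u' : 'rV[R]_d, `|u - u0| < e -> `|u' - u0| < e ->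
    `|D u' - D u| <= c * `|u' - u|].
Proof.
have [c [e [c0 e0 h]]] := phiD; exists (6 * c), (e / 3); split; [lra|lra|move=> u u' ue ue'].
have [->|uu'] := eqVneq u' u; first by rewrite !subrr !normr0 mulr0.
set s := `|u' - u|; have s0 : 0 < s by rewrite normr_gt0 subr_eq0.
have se : s < e * (2 / 3).
  rewrite /s -(subrK u0 u') -addrA; apply: le_lt_trans (ler_normD _ _) _.
  by rewrite [X in _ + X]distrC; lra.
apply: norm_mx_le => [|i j]; first by rewrite !mulr_ge0 // ltW.
apply: le_trans (_ : `|row i (D u' - D u)| <= _).
  by apply: le_trans (norm_mx_entry _ 0 j); rewrite !mxE.
rewrite rowE.
pose k : 'rV[R]_d := s *: delta_mx 0 i.
have ks : `|k| <= s.
  apply: norm_mx_le => [|a b]; first exact: ltW.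
  rewrite !mxE; case: (_ && _); rewrite /= ?mulr1 ?mulr0 ?normr0; last exact: ltW.
  by rewrite gtr0_norm.
have uk : `|u' + k - u0| < e.
  by rewrite addrAC; apply: le_lt_trans (ler_normD _ _) _; lra.
have h1 := h u' (u' + k) _ uk; have h2 := h u (u' + k) _ uk; have h3 := h u u'.
have {}h1 := h1 ltac:(lra); have {}h2 := h2 ltac:(lra); have {}h3 := h3 ltac:(lra) ltac:(lra).
rewrite -(@ler_pM2l _ s) // -[X in X * `|_|](gtr0_norm s0) -normrZ scalemxAl -/k.
have -> : k *m (D u' - D u) = - (phi (u' + k) - phi u' - (u' + k - u') *m D u')
    + (phi (u' + k) - phi u - (u' + k - u) *m D u) - (phi u' - phi u - (u' - u) *m D u).
  have -> : u' + k - u' = k by rewrite addrC addKr.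
  have -> : u' + k - u = k + (u' - u) by rewrite addrAC addrC.
  rewrite mulmxBr mulmxDl.
  have gen (P Q S F G H : 'rV[R]_N) : P - Q = - (F - G - P) + (F - H - (Q + S)) - (G - H - S).
    by apply/rowP => l; rewrite !mxE; ring.
  exact: gen.
apply: le_trans (ler_normB _ _) _.
apply: le_trans (lerD (ler_normD _ _) (lexx _)) _; rewrite normrN.
have k2 : `|u' + k - u'| ^+ 2 <= s ^+ 2.
  by rewrite (addrC u') addrK lerXn2r ?nnegrE // ltW.
have k3 : `|u' + k - u| ^+ 2 <= 4 * s ^+ 2.
  have -> : 4 * s ^+ 2 = (2 * s) ^+ 2 by rewrite exprMn; ring.
  rewrite lerXn2r ?nnegrE //; first lra.
  by rewrite addrAC; apply: le_trans (ler_normD _ _) _; rewrite -/s; lra.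
have k4 := ler_wpM2l c0 k2; have k5 := ler_wpM2l c0 k3.
have -> : s * (6 * c * s) = c * s ^+ 2 + c * (4 * s ^+ 2) + c * s ^+ 2 by ring.
by apply: lerD; [apply: lerD; [exact: le_trans h1 k4|exact: le_trans h2 k5]|exact: h3].
Qed.

Lemma uqr_lipschitz : exists c e, [/\ 0 <= c, 0 < e & forall u u' : 'rV[R]_d, `|u - u0| < e -> `|u' - u0| < e ->
    `|phi u' - phi u| <= c * `|u' - u| /\ `|D u| <= c].
Proof.
have [c [e [c0 e0 h]]] := phiD; have [c' [e' [c'0 e'0 h']]] := uqr_lipschitz_diff.
have [K [K0 KE]] : exists K, 0 <= K /\ `|D u0| + c' * 1 <= K.
  by exists (`|D u0| + c' * 1); rewrite lexx addr_ge0 // mulr1.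
have md : Num.min e (Num.min e' 1) <= e /\ Num.min e (Num.min e' 1) <= e' /\ Num.min e (Num.min e' 1) <= 1.
  by rewrite !ge_min !lexx !orbT.
exists (c * 2 + d%:R * K + K), (Num.min e (Num.min e' 1)); split.
- by rewrite !addr_ge0 // mulr_ge0.
- by rewrite !lt_min e0 e'0 ltr01.
case: md => m1 [m2 m3] u u' hu hu'.
have Du : `|D u| <= K.
  rewrite -(subrK (D u0) (D u)) addrC; apply: le_trans (ler_normD _ _) _.
  apply: le_trans KE; rewrite lerD2l; apply: le_trans (h' _ _ _ _) _; rewrite ?subrr ?normr0 //; first lra.
  by apply: ler_wpM2l => //; lra.
split; last by apply: le_trans Du _; rewrite lerDr addr_ge0 // mulr_ge0.
have s2 : `|u' - u| <= 2.
  rewrite -(subrK u0 u') -addrA; apply: le_trans (ler_normD _ _) _.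
  by rewrite [X in _ + X]distrC; lra.
have hh := h u u' ltac:(lra) ltac:(lra).
rewrite -(subrK ((u' - u) *m D u) (phi u' - phi u)); apply: le_trans (ler_normD _ _) _.
have b1 : `|(u' - u) *m D u| <= d%:R * K * `|u' - u|.
  apply: le_trans (norm_mulmx _ _) _; rewrite -mulrA ler_wpM2l // mulrC ler_wpM2r //.
have b2 : c * `|u' - u| ^+ 2 <= c * 2 * `|u' - u|.
  by rewrite -mulrA ler_wpM2l // expr2 ler_wpM2r.
have b3 : 0 <= K * `|u' - u| by rewrite mulr_ge0.
by rewrite !mulrDl; apply: le_trans (lerD (le_trans hh b2) b1) _; rewrite lerDl.
Qed.

(** A right inverse of [D u0] bounds [k] by its image, at [u0] and then nearby since [D] is
    Lipschitz; close to [u0] the quadratic remainder is absorbed. *)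
Lemma uqr_immersion : row_free (D u0) -> exists c e, [/\ 0 <= c, 0 < e & forall (u u' k : 'rV[R]_d), `|u - u0| < e -> `|u' - u0| < e ->
    `|u' - u| <= c * `|phi u' - phi u| /\ `|k| <= c * `|k *m D u|].
Proof.
move=> /row_freeP[K DK].
have [c [e [c0 e0 h]]] := phiD; have [c' [e' [c'0 e'0 h']]] := uqr_lipschitz_diff.
pose a : R := N%:R * `|K|; have a0 : 0 <= a by rewrite mulr_ge0.
pose b : R := d%:R * c' ; have b0 : 0 <= b by rewrite mulr_ge0.
have aE (x : R) : N%:R * (x * `|K|) = a * x by rewrite /a; ring.
have bE (x y : R) : d%:R * (x * (c' * y)) = b * y * x by rewrite /b; ring.
clearbody a b.
pose e1 := Num.min e (Num.min e' (Num.min (1 / (2 * (a * b + 1))) (1 / (8 * (a * c + 1))))).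
have ab0 : 0 < a * b + 1 by rewrite ltr_wpDl // mulr_ge0.
have ac0 : 0 < a * c + 1 by rewrite ltr_wpDl // mulr_ge0.
have m1 : e1 <= e by rewrite !ge_min lexx.
have m2 : e1 <= e' by rewrite !ge_min lexx !orbT.
have m3 : (a * b + 1) * e1 <= 1 / 2.
  have : e1 <= 1 / (2 * (a * b + 1)) by rewrite !ge_min lexx !orbT.
  by rewrite ler_pdivlMr ?mulr_gt0 //; lra.
have m4 : (a * c + 1) * e1 <= 1 / 8.
  have : e1 <= 1 / (8 * (a * c + 1)) by rewrite !ge_min lexx !orbT.
  by rewrite ler_pdivlMr ?mulr_gt0 //; lra.
have e10 : 0 < e1 by rewrite !lt_min e0 e'0 !divr_gt0 // mulr_gt0.
have low (u k : 'rV[R]_d) : `|u - u0| < e1 -> `|k| <= 2 * a * `|k *m D u|.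
  move=> hu.
  have k1 : `|k| <= a * `|k *m D u0|.
    by rewrite -{1}(mulmx1 k) -DK mulmxA; apply: le_trans (norm_mulmx _ _) _; rewrite aE.
  have k2 : `|k *m D u0| <= `|k *m D u| + b * e1 * `|k|.
    have -> : k *m D u0 = k *m D u + k *m (D u0 - D u) by rewrite -mulmxDr addrC subrK.
    apply: le_trans (ler_normD _ _) _; rewrite lerD2l; apply: le_trans (norm_mulmx _ _) _.
    rewrite -bE ler_wpM2l // ler_wpM2l //.
    apply: le_trans (h' _ _ _ _) _; rewrite ?subrr ?normr0 //; first lra.
    by apply: ler_wpM2l => //; rewrite distrC ltW.
  have k3 : a * (b * e1 * `|k|) <= 1 / 2 * `|k|.
    rewrite !mulrA ler_wpM2r //; move: m3; rewrite mulrDl mul1r; lra.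
  have := ler_wpM2l a0 k2; rewrite mulrDr; lra.
exists (4 * a), e1; split=> [||u u' k hu hu']; [lra|done|].
have kk := low u k hu; split; last first.
  apply: le_trans kk _; rewrite ler_wpM2r //; lra.
have l1 := low u (u' - u) hu; have h1 := h u u' ltac:(lra) ltac:(lra).
set w := u' - u in l1 h1 *.
have ws : `|w| <= 2 * e1.
  rewrite /w -(subrK u0 u') -addrA; apply: le_trans (ler_normD _ _) _.
  by rewrite [X in _ + X]distrC; lra.
have l2 : `|w *m D u| <= `|phi u' - phi u| + c * `|w| ^+ 2.
  rewrite -[w *m D u](subrK (phi u' - phi u)) addrC; apply: le_trans (ler_normD _ _) _.
  by rewrite lerD2l distrC.
have l3 : a * (c * `|w| ^+ 2) <= 1 / 4 * `|w|.
  rewrite expr2 !mulrA ler_wpM2r //; apply: le_trans (_ : a * c * (2 * e1) <= _).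
    by apply: ler_wpM2l => //; rewrite mulr_ge0.
  by move: m4; rewrite mulrDl; lra.
have := ler_wpM2l a0 l2; rewrite mulrDr; lra.
Qed.

End UniformQuadraticRemainder.

Lemma uqr_comp (R : realType) d N M (phi : 'rV[R]_d -> 'rV[R]_N) D (psi : 'rV[R]_N -> 'rV[R]_M) D' u0 :
  uqr phi D u0 -> uqr psi D' (phi u0) -> uqr (psi \o phi) (fun u => D u *m D' (phi u)) u0.
Proof.
move=> hphi hpsi.
have [c [e [c0 e0 h]]] := hphi; have [c' [e' [c'0 e'0 h']]] := hpsi.
have [l [e1 [l0 e10 hl]]] := uqr_lipschitz hphi; have [l' [e1' [l'0 e1'0 hl']]] := uqr_lipschitz hpsi.
pose m' := Num.min e' e1'.
pose m := Num.min (m' / (l + 1)) (Num.min e e1).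
have m'0 : 0 < m' by rewrite lt_min e'0.
have l10 : 0 < l + 1 by lra.
have m0 : 0 < m by rewrite !lt_min divr_gt0 // e0.
have me : m <= e by rewrite !ge_min lexx !orbT.
have me1 : m <= e1 by rewrite !ge_min lexx !orbT.
have m'e : m' <= e' by rewrite !ge_min lexx.
have m'e1 : m' <= e1' by rewrite !ge_min lexx !orbT.
have mm : l * m <= m'.
  have : m <= m' / (l + 1) by rewrite !ge_min lexx.
  by rewrite ler_pdivlMr //; lra.
have close u : `|u - u0| < m -> `|phi u - phi u0| < m'.
  move=> hu; have [|| h1 _] := hl u0 u; [by rewrite subrr normr0|lra|].
  apply: le_lt_trans h1 _; have [->|ln] := eqVneq l 0; first by rewrite mul0r.
  apply: lt_le_trans mm; rewrite ltr_pM2l // lt_def ln //.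
exists (c' * l ^+ 2 + N%:R * (c * l')), m; split=> // [|u u' hu hu'].
  by rewrite addr_ge0 // !mulr_ge0 // ?sqr_ge0.
have cu := close u hu; have cu' := close u' hu'.
have k1 := h' (phi u) (phi u') ltac:(lra) ltac:(lra).
have k2 := h u u' ltac:(lra) ltac:(lra).
have [k3 _] := hl u u' ltac:(lra) ltac:(lra).
have [_ k4] := hl' (phi u) (phi u') ltac:(lra) ltac:(lra).
rewrite /= mulmxA.
have -> : psi (phi u') - psi (phi u) - (u' - u) *m D u *m D' (phi u) =
  (psi (phi u') - psi (phi u) - (phi u' - phi u) *m D' (phi u)) +
  (phi u' - phi u - (u' - u) *m D u) *m D' (phi u).
  rewrite (mulmxBl (phi u' - phi u)); move: (_ *m _) (_ *m _) => A B.
  by rewrite addrA subrK.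
apply: le_trans (ler_normD _ _) _; rewrite mulrDl; apply: lerD.
  apply: le_trans k1 _; rewrite -mulrA -exprMn ler_wpM2l // lerXn2r // nnegrE ?mulr_ge0 //.
apply: le_trans (norm_mulmx _ _) _; rewrite -!mulrA ler_wpM2l //.
by rewrite [l' * _]mulrC mulrA; apply: ler_pM.
Qed.

Section Charts.
Context {R : realType} {T : topologicalType} {N d : nat}.
Variable iot : T -> 'rV[R]_N.
Hypothesis iot_emb : forall (p : T) (Q : T -> Prop), (\forall x \near p, Q x) ->
  exists2 e, 0 < e & forall x, `|iot x - iot p| < e -> Q x.
Hypothesis iot_cont : continuous iot.

Definition chart (p : T) (eta : 'rV[R]_d -> T) (theta : T -> 'rV[R]_d) (u0 : 'rV[R]_d)
    (D : 'rV[R]_d -> 'M[R]_(d, N)) : Prop :=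
  [/\ theta p = u0,
      \forall x \near p, eta (theta x) = x /\ {for x, continuous theta},
      \forall u \near u0, theta (eta u) = u /\ {for u, continuous eta},
      uqr (iot \o eta) D u0 & row_free (D u0)].

Variables (p : T) (eta : 'rV[R]_d -> T) (theta : T -> 'rV[R]_d) (u0 : 'rV[R]_d)
  (D : 'rV[R]_d -> 'M[R]_(d, N)).
Hypothesis C : chart p eta theta u0 D.

Lemma chart_eta0 : eta u0 = p.
Proof. by case: C => <- h _ _ _; have [] := nbhs_singleton h. Qed.

Lemma chart_tanv : exists2 e, 0 < e & forall u k, `|u - u0| < e -> tanv iot (eta u) (k *m D u).
Proof.
case: C => _ _ _ [c [e [c0 e0 h]]] _; exists (e / 2) => [|u k ue]; first lra.
exists (fun t => eta (u + t *: k)), (c * `|k| ^+ 2).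
pose s : R := e / 2 / (`|k| + 1); have k1 : 0 < `|k| + 1 by rewrite ltr_wpDl.
apply/near_normP; exists s => [|t]; first by rewrite !divr_gt0.
rewrite subr0 /s ltr_pdivlMr // => ts.
have tk : `|t *: k| < e / 2.
  rewrite normrZ; apply: le_lt_trans ts; rewrite ler_wpM2l // lerDl //.
have := h u (u + t *: k) ltac:(lra); rewrite (addrC u) addrK -scalemxAl.
rewrite normrZ exprMn real_normK ?num_real // mulrA mulrAC; apply.
by rewrite -addrA; apply: le_lt_trans (ler_normD _ _) _; lra.
Qed.

Lemma chart_near (Q : 'rV[R]_d -> Prop) : (\forall u \near u0, Q u) -> \forall x \near p, Q (theta x).
Proof.
case: C => tp h _ _ _ hQ; have [_ ct] := nbhs_singleton h.
by apply: ct; rewrite tp.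
Qed.

Lemma chart_tan_approx : exists2 e, 0 < e & \forall x \near p, forall x', `|iot x' - iot x| < e ->
  exists2 tau, tanv iot x tau & `|iot x' - iot x - tau| <= e^-1 * `|iot x' - iot x| ^+ 2.
Proof.
have [tp hx hu hq hf] := C.
have [c [e1 [c0 e10 h]]] := hq; have [l [e2 [l0 e20 hl]]] := uqr_immersion hq hf.
have [e3 e30 ht] := chart_tanv.
have e12 : 0 < Num.min (Num.min e1 e2) e3 by rewrite !lt_min e10 e20.
have near1 : \forall u \near u0, `|u - u0| < Num.min (Num.min e1 e2) e3.
  by apply: (proj2 (@near_normP R 'rV[R]_d u0 _)); exists (Num.min (Num.min e1 e2) e3).
have [d0 d00 hd] := iot_emb (filterI hx (chart_near near1)).
pose M := c * l ^+ 2 + 1; have M0 : 0 < M by rewrite ltr_wpDl // mulr_ge0 // sqr_ge0.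
pose e := Num.min (d0 / 2) M^-1.
have e0 : 0 < e by rewrite lt_min invr_gt0 M0 divr_gt0.
exists e => //.
have near2 : \forall x \near p, `|iot x - iot p| < d0 / 2.
  have /cvgrPdist_lt/(_ (d0 / 2) (divr_gt0 d00 (ltr0Sn _ 1))) := @iot_cont p.
  by apply: filterS => x; rewrite distrC.
apply: filterS near2 => x xp x' xx'.
have ed : e <= d0 / 2 by rewrite ge_min lexx.
have [[xE _] xu] : (eta (theta x) = x /\ {for x, continuous theta}) /\ `|theta x - u0| < Num.min (Num.min e1 e2) e3.
  by apply: hd; lra.
have [[x'E _] x'u] : (eta (theta x') = x' /\ {for x', continuous theta}) /\ `|theta x' - u0| < Num.min (Num.min e1 e2) e3.
  apply: hd; rewrite -(subrK (iot x) (iot x')) -addrA; apply: le_lt_trans (ler_normD _ _) _; lra.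
move: xu x'u; rewrite !lt_min -!andbA => /and3P[xu1 xu2 xu3] /and3P[x'u1 x'u2 x'u3].
exists ((theta x' - theta x) *m D (theta x)); first by rewrite -{1}xE; exact: ht.
have := h _ _ xu1 x'u1; rewrite /= xE x'E => h1; apply: le_trans h1 _.
have [h2 _] := hl _ _ 0 xu2 x'u2; rewrite /= xE x'E in h2.
apply: (@le_trans _ _ (M * `|iot x' - iot x| ^+ 2)); last first.
  by rewrite ler_wpM2r ?sqr_ge0 // -[M]invrK lef_pV2 ?posrE ?invr_gt0 // ge_min lexx orbT.
apply: (@le_trans _ _ (c * (l * `|iot x' - iot x|) ^+ 2)).
  by rewrite ler_wpM2l // lerXn2r ?nnegrE ?mulr_ge0.
by rewrite exprMn mulrA ler_wpM2r ?sqr_ge0 // /M lerDl.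
Qed.

(** Displacements on [T] have the form [k *m D u] up to a quadratic error, so [tanv_quad] applies to
    a vector orthogonal to all of these. *)
Lemma chart_perp_tanv : exists2 e, 0 < e & forall u n tau, `|u - u0| < e ->
  (forall k, dot n (k *m D u) = 0) -> tanv iot (eta u) tau -> dot n tau = 0.
Proof.
have [tp hx hu hq hf] := C.
have [c [e1 [c0 e10 h]]] := hq; have [l [e2 [l0 e20 hl]]] := uqr_immersion hq hf.
have e12 : 0 < Num.min e1 e2 by rewrite !lt_min e10 e20.
have near1 : \forall u \near u0, `|u - u0| < Num.min e1 e2.
  by apply: (proj2 (@near_normP R 'rV[R]_d u0 _)); exists (Num.min e1 e2).
have [d0 d00 hd] := iot_emb (filterI hx (chart_near near1)).
have near2 : \forall u \near u0, `|iot (eta u) - iot p| < d0 / 2.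
  have c1 : {for u0, continuous (iot \o eta)}.
    apply: continuous_comp; last exact: iot_cont.
    by have [] := nbhs_singleton hu.
  have /cvgrPdist_lt/(_ (d0 / 2) (divr_gt0 d00 (ltr0Sn _ 1))) := c1.
  by apply: filterS => u; rewrite /= chart_eta0 distrC.
have near3 : \forall u \near u0, theta (eta u) = u by apply: filterS hu => u [].
have [e e0 he] := proj1 (@near_normP R 'rV[R]_d u0 _) (filterI near2 (filterI near3 near1)).
exists e => // u n tau /he[h1 [h2 h3]] hn htau.
apply: (tanv_quad htau (K := N%:R * (`|n| * (c * l ^+ 2))) (e := d0 / 2)); last first.
- move=> y yu; have [[yE _] yu1] : (eta (theta y) = y /\ {for y, continuous theta}) /\ `|theta y - u0| < Num.min e1 e2.
    apply: hd; rewrite -(subrK (iot (eta u)) (iot y)) -addrA; apply: le_lt_trans (ler_normD _ _) _; lra.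
  move: h3 yu1; rewrite !lt_min => /andP[u1 u2] /andP[y1 y2].
  have q1 := h _ _ u1 y1; rewrite /= yE in q1.
  have [q2 _] := hl _ _ 0 u2 y2; rewrite /= yE in q2.
  rewrite -[X in dot n X](subrK ((theta y - u) *m D u)) dotDr hn addr0.
  apply: le_trans (ler_norm _) _; apply: le_trans (dot_norm _ _) _.
  have -> : forall x, N%:R * (`|n| * (c * l ^+ 2)) * x ^+ 2 = N%:R * (`|n| * (c * (l * x) ^+ 2)).
    by move=> x; ring.
  rewrite ler_wpM2l // ler_wpM2l //; apply: le_trans q1 _; rewrite ler_wpM2l //.
  by rewrite lerXn2r ?nnegrE ?mulr_ge0.
- by rewrite divr_gt0.
- by rewrite !mulr_ge0 // sqr_ge0.
Qed.
End Charts.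

(** * The Poincare-Hopf formula *)

Section ContinuityRules.
Context {R : realType} {X : topologicalType} {V : normedModType R}.
Implicit Types (f g : X -> V) (x : X).

Lemma cont_cst (Y : topologicalType) (c : Y) x : continuous_at x (fun _ : X => c).
Proof. exact: cst_continuous. Qed.
Lemma cont_id x : continuous_at x (fun y : X => y).
Proof. exact: cvg_id. Qed.
Lemma cont_add f g x : continuous_at x f -> continuous_at x g ->
  continuous_at x (fun y => f y + g y).
Proof. by move=> cf cg; exact: (@continuousD _ _ _ f g x cf cg). Qed.
Lemma cont_sub f g x : continuous_at x f -> continuous_at x g ->
  continuous_at x (fun y => f y - g y).
Proof. by move=> cf cg; exact: (@continuousB _ _ _ f g x cf cg). Qed.
Lemma cont_scale (k : X -> R) f x : continuous_at x k -> continuous_at x f ->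
  continuous_at x (fun y => k y *: f y).
Proof. by move=> ck cf; exact: (@continuousZ _ _ _ k f x ck cf). Qed.
Lemma cont_mul (k l : X -> R) x : continuous_at x k -> continuous_at x l ->
  continuous_at x (fun y => k y * l y).
Proof. by move=> ck cl; exact: (@continuousM _ _ k l x ck cl). Qed.
Lemma cont_norm f x : continuous_at x f -> continuous_at x (fun y => `|f y|).
Proof. by move=> cf; apply: (@continuous_comp _ _ _ f (fun v => `|v|)) => //; exact: norm_continuous. Qed.
Lemma cont_comp (Y Z : topologicalType) (f : X -> Y) (g : Y -> Z) x :
  continuous_at x f -> continuous_at (f x) g -> continuous_at x (fun y => g (f y)).
Proof. by move=> cf cg; exact: (@continuous_comp _ _ _ f g x cf cg). Qed.
Lemma cont_entry m n (f : X -> 'M[R]_(m, n)) i j x : continuous_at x f ->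
  continuous_at x (fun y => f y i j).
Proof. by move=> cf; apply: (@cont_comp _ _ f (fun M : 'M[R]_(m, n) => M i j)) => //; exact: coord_continuous. Qed.
End ContinuityRules.

Lemma near_cont (X Y : topologicalType) (F : X -> Y) x (Q : Y -> Prop) :
  continuous_at x F -> (\forall y \near F x, Q y) -> \forall z \near x, Q (F z).
Proof. by move=> cF; exact: cF. Qed.

Section Clamp.
Context {R : realType}.

Definition clamp (a : R) : R := Num.max 0 (Num.min 1 a).

Lemma clamp_ge0 a : 0 <= clamp a. Proof. by rewrite le_max lexx. Qed.
Lemma clamp_le1 a : clamp a <= 1. Proof. by rewrite ge_max ler01 ge_min lexx. Qed.
Lemma clamp1 a : 1 <= a -> clamp a = 1.
Proof. by move=> h; rewrite /clamp min_l // max_r. Qed.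
Lemma clamp0 a : a <= 0 -> clamp a = 0.
Proof. by move=> h; rewrite /clamp max_l // ge_min h orbT. Qed.

Lemma clamp_continuous : continuous clamp.
Proof.
move=> a; apply/cvgrPdist_lt => e e0; have h : \forall b \near a, `|a - b| < e by exact: (@cvgr_dist_lt _ _ _ (nbhs a) _ id a).
apply: filterS h => b; apply: le_lt_trans; rewrite /clamp.
have [h1|h1] := leP 1 a; have [h2|h2] := leP 1 b; rewrite /Num.max ?ltr01.
- by rewrite subrr normr0.
- have [h3|h3] := ltP 0 b; rewrite ?subr0 !ger0_norm; lra.
- have [h3|h3] := ltP 0 a; rewrite ?sub0r ?normrN ?normr1 ler0_norm ?ler0_norm; lra.
have [h3|h3] := ltP 0 a; have [h4|h4] := ltP 0 b => //.
- by rewrite subr0 !ger0_norm; lra.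
- by rewrite sub0r normrN gtr0_norm // ler0_norm; lra.
- by rewrite subrr normr0.
Qed.
End Clamp.

Lemma convex_neg (R : realType) (L a b : R) : 0 <= L -> L <= 1 -> a < 0 -> b < 0 -> (1 - L) * a + L * b < 0.
Proof.
move=> l0 l1 a0 b0.
have h1 : (1 - L) * a <= 0 by rewrite mulr_ge0_le0 ?subr_ge0 // ltW.
move: l0; rewrite le_eqVlt => /orP[/eqP L0|L0]; first by rewrite -L0; lra.
have h2 : L * b < 0 by rewrite pmulr_rlt0.
lra.
Qed.

Section PoincareHopf.
Context {R : realType} {T : topologicalType} {N d : nat}.
Variable iot : T -> 'rV[R]_N.
Hypothesis T_compact : compact [set: T].
Hypothesis iot_cont : continuous iot.
Hypothesis iot_emb : forall (p : T) (Q : T -> Prop), (\forall x \near p, Q x) ->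
  exists2 e, 0 < e & forall x, `|iot x - iot p| < e -> Q x.
Hypothesis iot_inj : injective iot.
Hypothesis charts : forall p : T, exists eta theta u0 (D : 'rV[R]_d -> 'M[R]_(d, N)), chart iot p eta theta u0 D.
Variable X : T -> 'rV[R]_N.
Hypothesis X_cont : continuous X.
Local Notation dT x y := `|iot x - iot y|.

Lemma mulmx_continuous (Y : topologicalType) m n k (F : Y -> 'M[R]_(m, n)) (G : Y -> 'M[R]_(n, k)) y :
  continuous_at y F -> continuous_at y G -> continuous_at y (fun z => F z *m G z).
Proof.
move=> cF cG; have cN : 0 < n%:R + 1 :> R by rewrite ltr_wpDl.
apply/cvgrPdist_lt => e e0; pose M := n%:R * (`|F y| + `|G y| + 1) + 1.
have M0 : 0 < M by rewrite ltr_wpDl // mulr_ge0 // !addr_ge0.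
pose d0 := Num.min 1 (e / M); have d00 : 0 < d0 by rewrite lt_min ltr01 divr_gt0.
have /cvgrPdist_lt/(_ d0 d00) h1 := cF; have /cvgrPdist_lt/(_ d0 d00) h2 := cG.
apply: filterS (filterI h1 h2) => z [z1 z2].
have -> : F y *m G y - F z *m G z = (F y - F z) *m G y + F y *m (G y - G z) - (F y - F z) *m (G y - G z).
  have gen (A B : 'M[R]_(m, n)) (P Q : 'M[R]_(n, k)) : A *m P - B *m Q = (A - B) *m P + A *m (P - Q) - (A - B) *m (P - Q).
    rewrite -addrA -mulmxBl opprB addrCA subrr addr0 mulmxBl mulmxBr.
    by rewrite addrA subrK.
  exact: gen.
apply: le_lt_trans (ler_normB _ _) _; apply: le_lt_trans (lerD (ler_normD _ _) (lexx _)) _.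
have d01 : d0 <= 1 by rewrite ge_min lexx.
have d0M : d0 * M <= e.
  have : d0 <= e / M by rewrite ge_min lexx orbT.
  by rewrite ler_pdivlMr.
apply: lt_le_trans d0M; rewrite /M.
have b1 := norm_mulmx (F y - F z) (G y); have b2 := norm_mulmx (F y) (G y - G z).
have b3 := norm_mulmx (F y - F z) (G y - G z).
have n0 : 0 <= n%:R :> R by [].
have c1 : `|F y - F z| * `|G y| <= d0 * `|G y| by rewrite ler_wpM2r // ltW.
have c2 : `|F y| * `|G y - G z| <= d0 * `|F y| by rewrite mulrC ler_wpM2r // ltW.
have c3 : `|F y - F z| * `|G y - G z| <= d0 * 1 by apply: ler_pM => //; [exact: ltW|lra].
have := ler_wpM2l n0 c1; have := ler_wpM2l n0 c2; have := ler_wpM2l n0 c3.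
have -> : d0 * (n%:R * (`|F y| + `|G y| + 1) + 1) = n%:R * (d0 * `|F y|) + n%:R * (d0 * `|G y|) + n%:R * (d0 * 1) + d0 by ring.
lra.
Qed.

(** The linear map [1 - G s] about [u0], in the chart. For [G s = 1] it collapses to the centre; for
    [G s = 1 - 2 l v] with [v l = 1] it doubles the direction [v] and kills the kernel of [l]. *)
Definition wpt (theta : T -> 'rV[R]_d) (u0 : 'rV[R]_d) (G : R -> 'M[R]_d) x s : 'rV[R]_d :=
  theta x - (theta x - u0) *m G s.

(** The same [tau] is negative on the field and on the model displacement, so no convex combination
    of the two is normal to [T]. *)
Definition loc p eta theta u0 (D : 'rV[R]_d -> 'M[R]_(d, N)) (G : R -> 'M[R]_d) (k de : R) : Prop :=
  forall x, dT x p < de -> [/\ eta (theta x) = x, {for x, continuous theta},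
    forall s, 0 <= s <= 1 -> [/\ theta (eta (wpt theta u0 G x s)) = wpt theta u0 G x s,
       {for wpt theta u0 G x s, continuous eta} & dT (eta (wpt theta u0 G x s)) x < k] &
    x <> p -> exists tau, [/\ tanv iot x tau, dot (X x) tau < 0 & dot (iot (eta (wpt theta u0 G x 1)) - iot x) tau < 0]].

(** For [s = 1] the displacement is, to first order, the opposite of [tau = (u - u0) *m G 1 *m D u],
    so its product with [tau] is close to [- dot tau tau]; the radius makes the quadratic remainder
    harmless. *)
Lemma loc_exists p eta theta u0 D (G : R -> 'M[R]_d) k : chart iot p eta theta u0 D -> 0 < k ->
  continuous G -> (forall s, 0 <= s <= 1 -> row_free (G s)) ->
  (\forall u \near u0, u <> u0 -> dot (X (eta u)) ((u - u0) *m G 1 *m D u) < 0) ->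
  exists2 de, 0 < de & loc p eta theta u0 D G k de.
Proof.
move=> C k0 cG fG hs; have [tp hx hu hq hf] := C.
have [c [e1 [c0 e10 h]]] := hq; have [l [e2 [l0 e20 hl]]] := uqr_immersion hq hf.
have [e3 e30 ht] := chart_tanv C.
have [L [e4 [L0 e40 hL]]] := uqr_lipschitz hq.
have [e5 e50 he5] := proj1 (@near_normP R 'rV[R]_d u0 _) (filterI hu hs).
have [g [g0 hg]] : exists g : R, 0 <= g /\ forall s, 0 <= s <= 1 -> `|G s| <= g.
  have cN : {within `[0, 1]%classic, continuous (fun s => `|G s|)}.
    by apply: continuous_subspaceT => s; apply: continuous_comp; [exact: cG|exact: norm_continuous].
  have [s0 _ hmax] := EVT_max ler01 cN; exists `|G s0|; split=> // s s01; apply: hmax.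
pose e := Num.min (Num.min e1 e2) (Num.min e3 (Num.min e4 e5)).
have e0 : 0 < e by rewrite !lt_min e10 e20 e30 e40.
have m1 : e <= e1 by rewrite !ge_min lexx.
have m2 : e <= e2 by rewrite !ge_min lexx !orbT.
have m3 : e <= e3 by rewrite !ge_min lexx !orbT.
have m4 : e <= e4 by rewrite !ge_min lexx !orbT.
have m5 : e <= e5 by rewrite !ge_min lexx !orbT.
clearbody e.
pose K : R := 1 + d%:R * g; have K1 : 1 <= K by rewrite lerDl mulr_ge0.
have Kb s k' : 0 <= s <= 1 -> `|k' *m G s| <= d%:R * g * `|k'|.
  move=> /hg Gs; apply: le_trans (norm_mulmx _ _) _; rewrite -mulrA ler_wpM2l // mulrC ler_wpM2r //.
pose M : R := N%:R * c * l * (d%:R * g) + 1; have M0 : 0 < M by rewrite ltr_wpDl // !mulr_ge0.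
pose L' : R := L * (d%:R * g) + 1; have L'0 : 0 < L' by rewrite ltr_wpDl // !mulr_ge0.
have K0 : 0 < K by lra.
pose e' := Num.min (e / (2 * K)) (Num.min (1 / M) (k / L')).
have e'0 : 0 < e' by rewrite !lt_min !divr_gt0 // mulr_gt0.
have n1 : e' * (2 * K) <= e by rewrite -ler_pdivlMr ?mulr_gt0 // !ge_min lexx.
have n2 : e' * M <= 1 by rewrite -ler_pdivlMr // !ge_min lexx !orbT.
have n3 : e' * L' <= k by rewrite -ler_pdivlMr // !ge_min lexx !orbT.
clearbody e'.
have near1 : \forall u \near u0, `|u - u0| < e'.
  by apply: (proj2 (@near_normP R 'rV[R]_d u0 _)); exists e'.
have [de de0 hde] := iot_emb (filterI hx (chart_near C near1)).
exists de => // x /hde[[xE ct] ux]; set u := theta x in ux *.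
have ue : `|u - u0| < e by have := normr_ge0 (u - u0); nra.
have hb s : 0 <= s <= 1 -> `|(u - u0) *m G s| <= d%:R * g * `|u - u0| by exact: Kb.
have we s : 0 <= s <= 1 -> `|wpt theta u0 G x s - u0| < e.
  move=> /hb hs'; rewrite /wpt -/u addrAC; apply: le_lt_trans (ler_normB _ _) _.
  have q0 : `|u - u0| + `|(u - u0) *m G s| <= K * `|u - u0| by rewrite /K mulrDl mul1r lerD2l.
  apply: le_lt_trans q0 _; apply: (@lt_le_trans _ _ (K * e')); first by rewrite ltr_pM2l.
  have : 0 < e' * K by rewrite mulr_gt0.
  rewrite mulrC; lra.
split=> // [s s01|xp].
  have w5 : `|wpt theta u0 G x s - u0| < e5 by apply: lt_le_trans (we s s01) _.
  have [[h1 h2] _] := he5 _ w5; split=> //.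
  have [h3 _] := hL u (wpt theta u0 G x s) ltac:(lra) ltac:(have := we s s01; lra).
  rewrite /= -/u xE in h3; apply: le_lt_trans h3 _.
  rewrite /wpt -/u addrAC subrr add0r normrN.
  apply: le_lt_trans (ler_wpM2l L0 (hb s s01)) _; rewrite mulrA.
  apply: lt_le_trans n3; rewrite [e' * _]mulrC; apply: le_lt_trans (_ : L * (d%:R * g) * e' < _).
    by rewrite ler_wpM2l ?mulr_ge0 // ltW.
  by rewrite ltr_pM2r // /L'; lra.
have uu : u <> u0 by move=> uE; apply: xp; rewrite -xE -/u uE (chart_eta0 C).
have i01 : 0 <= (1 : R) <= 1 by rewrite ler01 lexx.
set hh := (u - u0) *m G 1; exists (hh *m D u).
have hne : hh != 0.
  apply/eqP => hh0; apply: uu; apply/eqP; rewrite -subr_eq0; apply/eqP.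
  by apply: (row_free_inj (fG 1 i01)); rewrite -/hh hh0 mul0mx.
have [_ sg] := he5 u ltac:(lra).
split; first by rewrite -xE; apply: ht; rewrite -/u; lra.
  by rewrite -xE; exact: sg uu.
have h1 := h u (wpt theta u0 G x 1) ltac:(lra) ltac:(have := we 1 i01; lra).
rewrite /= -/u xE in h1; set w := iot (eta _) - iot x in h1 *.
have wu : wpt theta u0 G x 1 - u = - hh by rewrite /wpt -/u addrAC subrr add0r.
rewrite wu mulNmx opprK normrN in h1.
have [_ h2] := hl u u hh ltac:(lra) ltac:(lra).
set tau := hh *m D u in h1 h2 *.
have tau0 : tau != 0.
  rewrite -normr_gt0; have : 0 < `|hh| by rewrite normr_gt0.
  have := normr_ge0 tau; rewrite le_eqVlt => /orP[/eqP t0|//]; rewrite -t0 mulr0 in h2.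
  by move=> h3; move: h2; rewrite leNgt h3.
rewrite -[w](addrK tau) dotDl dotNl.
have h3 : dot (w + tau) tau <= N%:R * (c * `|hh| ^+ 2 * `|tau|).
  apply: le_trans (ler_norm _) _; apply: le_trans (dot_norm _ _) _.
  by rewrite ler_wpM2l // ler_wpM2r.
have tp0 : 0 < `|tau| ^+ 2 by rewrite exprn_gt0 // normr_gt0.
have h4 : N%:R * (c * `|hh| ^+ 2 * `|tau|) <= (N%:R * c * l * `|hh|) * `|tau| ^+ 2.
  have -> : N%:R * (c * `|hh| ^+ 2 * `|tau|) = (N%:R * c * `|hh| * `|tau|) * `|hh| by ring.
  have -> : N%:R * c * l * `|hh| * `|tau| ^+ 2 = (N%:R * c * `|hh| * `|tau|) * (l * `|tau|) by ring.
  by rewrite ler_wpM2l // !mulr_ge0.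
have h5 : N%:R * c * l * `|hh| < 1.
  apply: (@le_lt_trans _ _ (N%:R * c * l * (d%:R * g) * e')).
    rewrite -[leRHS]mulrA ler_wpM2l ?mulr_ge0 //; apply: le_trans (hb 1 i01) _.
    by rewrite ler_wpM2l ?mulr_ge0 // ltW.
  by move: n2; rewrite /M mulrDr mulr1 mulrC; lra.
have h6 : (N%:R * c * l * `|hh|) * `|tau| ^+ 2 < `|tau| ^+ 2 by rewrite -[ltRHS]mul1r ltr_pM2r.
have := norm_dot tau; lra.
Qed.

Record locdata := LocData {
  ld_eta : 'rV[R]_d -> T; ld_theta : T -> 'rV[R]_d; ld_u0 : 'rV[R]_d;
  ld_D : 'rV[R]_d -> 'M[R]_(d, N); ld_G : R -> 'M[R]_d; ld_l : 'cV[R]_d; ld_v : 'rV[R]_d }.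

Definition model p (q : locdata) : Prop := [/\ chart iot p (ld_eta q) (ld_theta q) (ld_u0 q) (ld_D q),
  continuous (ld_G q), forall s, 0 <= s <= 1 -> row_free (ld_G q s) &
  \forall u \near ld_u0 q, u <> ld_u0 q -> dot (X (ld_eta q u)) ((u - ld_u0 q) *m ld_G q 1 *m ld_D q u) < 0].

Variables Pe Ph : seq T.
Hypothesis uniqP : uniq (Pe ++ Ph).
Hypothesis hX : forall x, x \notin Pe ++ Ph -> exists2 tau, tanv iot x tau & dot (X x) tau <> 0.
Hypothesis hE : forall p, p \in Pe -> exists2 q, model p q & ld_G q 0 = 1%:M.
Hypothesis hH : forall p, p \in Ph -> exists q, [/\ model p q, ld_v q *m ld_l q = 1%:M &
  ld_G q 0 = 1%:M - 2 *: (ld_l q *m ld_v q)].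

(** Concentric zones around each zero: up to [rho/16] the model of [G 0], up to [rho/8] the path
    [G], up to [rho/4] the model of [G 1], up to [rho/2] a linear passage to the displacement along
    [X]. Fixed points are excluded by invertibility of [G] inside [rho/8] and by the common [tau]
    beyond. *)
Theorem poincare_hopf : euler_characteristic R T = (size Pe)%:Z - (size Ph)%:Z.
Proof.
have [[x0 _]|T0] := pselect (exists x : T, True); last first.
  have E (s : seq T) : s = [::] by case: s => // x s; exfalso; apply: T0; exists x.
  rewrite (E Pe) (E Ph) subrr euler_empty // => x; apply: T0; by exists x.
have [r [et [et0 rK rc orth hmin]]] := nearest_point_retraction T_compact iot_cont iot_emb iot_inj
  (fun p => let: ex_intro eta (ex_intro theta (ex_intro u0 (ex_intro D C))) := charts p in
     chart_tan_approx iot_emb iot_cont C) x0.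
have near := nearest_norm hmin.
pose q0 : locdata := LocData (fun=> x0) (fun=> 0) 0 (fun=> 0) (fun=> 0) 0 0.
have /choice[ld hld] : forall p, exists q, [/\ p \in Pe ++ Ph -> model p q, p \in Pe -> ld_G q 0 = 1%:M &
    p \in Ph -> ld_v q *m ld_l q = 1%:M /\ ld_G q 0 = 1%:M - 2 *: (ld_l q *m ld_v q)].
  move=> p; have [pE|pE] := boolP (p \in Pe).
    have [q mq qG] := hE pE; exists q; split=> // pH.
    by move: uniqP; rewrite cat_uniq => /and3P[_ /hasPn/(_ p pH)]; rewrite /= pE.
  have [pH|pH] := boolP (p \in Ph); last by exists q0; rewrite mem_cat (negbTE pE) (negbTE pH); split.
  by have [q [mq vl qG]] := hH pH; exists q; split.
have mod p (pP : p \in Pe ++ Ph) : model p (ld p) by case: (hld p) => /(_ pP).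
have modc p (pP : p \in Pe ++ Ph) : chart iot p (ld_eta (ld p)) (ld_theta (ld p)) (ld_u0 (ld p)) (ld_D (ld p)) by case: (mod p pP).
(* Before retraction a point moves by at most [2 k]; retraction adds at most [N] times as much, so
   the total is at most [et / 2]. *)
pose k : R := et / (4 * (N%:R + 1)).
have N1 : 0 < N%:R + 1 :> R by rewrite ltr_wpDl.
have k0 : 0 < k by rewrite divr_gt0 // mulr_gt0.
have kN : (N%:R + 1) * (2 * k) = et / 2 by rewrite /k; field; rewrite gt_eqF.
have [rho rho0 [sep hloc]] : exists2 rho, 0 < rho & (forall p p', p \in Pe ++ Ph -> p' \in Pe ++ Ph -> p != p' -> 4 * rho <= dT p p') /\
   forall p, p \in Pe ++ Ph -> loc p (ld_eta (ld p)) (ld_theta (ld p)) (ld_u0 (ld p)) (ld_D (ld p)) (ld_G (ld p)) k rho.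
  have [p pP|e1 e10 h1] := @seq_uniform_pos R _ (Pe ++ Ph)
    (fun p e => forall p', p' \in Pe ++ Ph -> p != p' -> 4 * e <= dT p p')
    (fun p e e' h _ ee' p' p'P pp' => le_trans (ler_wpM2l (ler0n _ 4) ee') (h p' p'P pp')).
    apply: (@seq_uniform_pos R _ _ (fun p' e => p != p' -> 4 * e <= dT p p')).
      by move=> p' e e' h _ ee' /h; apply: le_trans; rewrite ler_wpM2l.
    move=> p' _; have [->|pp'] := eqVneq p p'; first by exists 1.
    exists (dT p p' / 4) => [|_]; last by rewrite mulrCA divff ?mulr1.
    by rewrite divr_gt0 // normr_gt0 subr_eq0 (inj_eq iot_inj).
  have [p pP|e2 e20 h2] := @seq_uniform_pos R _ (Pe ++ Ph)
    (fun p e => loc p (ld_eta (ld p)) (ld_theta (ld p)) (ld_u0 (ld p)) (ld_D (ld p)) (ld_G (ld p)) k e)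
    (fun p e e' h _ ee' x xp => h x (lt_le_trans xp ee')).
    by have [g1 g2 g3 g4] := mod p pP; exact: loc_exists.
  exists (Num.min e1 e2); first by rewrite lt_min e10.
  split=> [p p' pP p'P pp'|p pP x xp].
    by apply: le_trans (h1 p pP p' p'P pp'); rewrite ler_wpM2l // ge_min lexx.
  by apply: h2 => //; apply: lt_le_trans xp _; rewrite ge_min lexx orbT.
have [M M0 hM] : exists2 M : R, 0 < M & forall x, `|X x| <= M.
  have cN : {within [set: T], continuous (fun x => `|X x|)}.
    by apply: continuous_subspaceT => x; apply: continuous_comp; [exact: X_cont|exact: norm_continuous].
  have [|c _ hc] := compact_EVT_max _ T_compact cN; first by exists x0.
  exists (`|X c| + 1) => [|x]; first by rewrite ltr_wpDl.
  by apply: le_trans (hc x _) _; rewrite ?in_setT // lerDl.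
pose eps : R := k / M; have eps0 : 0 < eps by rewrite divr_gt0.
have epsX x : `|eps *: X x| <= k.
  by rewrite normrZ gtr0_norm // /eps mulrAC ler_pdivrMr // ler_wpM2l // ltW.
pose sc (t : R) := clamp ((t - rho / 16) * (16 / rho)).
pose lam (t : R) := clamp ((rho / 2 - t) * (4 / rho)).
have rV : rho * rho^-1 = 1 by rewrite divff ?gt_eqF.
have sc0 t : t <= rho / 16 -> sc t = 0.
  by move=> h; apply: clamp0; rewrite mulr_le0_ge0 ?divr_ge0 ?(ltW rho0) // ?subr_le0.
have sc1 t : rho / 8 <= t -> sc t = 1.
  move=> h; apply: clamp1; apply: (@le_trans _ _ ((rho / 16) * (16 / rho))).
    by have -> : (rho / 16) * (16 / rho) = 1 :> R by field; rewrite gt_eqF.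
  by rewrite ler_wpM2r ?divr_ge0 ?(ltW rho0) //; lra.
have lam0 t : rho / 2 <= t -> lam t = 0.
  by move=> h; apply: clamp0; rewrite mulr_le0_ge0 ?divr_ge0 ?(ltW rho0) // ?subr_le0.
have lam1 t : t <= rho / 4 -> lam t = 1.
  move=> h; apply: clamp1; apply: (@le_trans _ _ ((rho / 4) * (4 / rho))).
    by have -> : (rho / 4) * (4 / rho) = 1 :> R by field; rewrite gt_eqF.
  by rewrite ler_wpM2r ?divr_ge0 ?(ltW rho0) //; lra.
have cclamp (F : R -> R) : continuous F -> continuous (fun t => clamp (F t)).
  by move=> cF t; apply: continuous_comp; [exact: cF|exact: clamp_continuous].
have csc : continuous sc.
  by apply: cclamp => t; apply: cont_mul; [apply: cont_sub; [exact: cont_id|exact: cont_cst]|exact: cont_cst].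
have clam : continuous lam.
  by apply: cclamp => t; apply: cont_mul; [apply: cont_sub; [exact: cont_cst|exact: cont_id]|exact: cont_cst].
have cdT p : continuous (fun x => dT x p).
  by move=> x; apply: cont_norm; apply: cont_sub; [exact: iot_cont|exact: cont_cst].
pose w p x := wpt (ld_theta (ld p)) (ld_u0 (ld p)) (ld_G (ld p)) x (sc (dT x p)).
pose Z p x := iot (ld_eta (ld p) (w p x)).
pose B x := iot x + eps *: X x.
pose Y x := B x + \sum_(p <- Pe ++ Ph) lam (dT x p) *: (Z p x - B x).
have sc01 t : 0 <= sc t <= 1 by rewrite clamp_ge0 clamp_le1.
have cB : continuous B.
  move=> x; apply: cont_add; first exact: iot_cont.
  by apply: cont_scale; [exact: cont_cst|exact: X_cont].
have Yout x : (forall p, p \in Pe ++ Ph -> rho / 2 <= dT x p) -> Y x = B x.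
  by move=> h; rewrite /Y big_seq big1 ?addr0 // => p /h/lam0 ->; rewrite scale0r.
have Yin p x : p \in Pe ++ Ph -> dT x p < rho -> Y x = B x + lam (dT x p) *: (Z p x - B x).
  move=> pP xp; rewrite /Y (bigD1_seq p) //= big_seq_cond big1 ?addr0 // => p' /andP[p'P pp'].
  rewrite lam0 ?scale0r //; have := sep _ _ p'P pP pp'.
  have := ler_distD (iot x) (iot p') (iot p); rewrite [dT p' x]distrC; lra.
have cY : continuous Y.
  move=> x; have [[p pP xp]|nx] := pselect (exists2 p, p \in Pe ++ Ph & dT x p < rho).
    have ct : {for x, continuous (fun x => B x + lam (dT x p) *: (Z p x - B x))}.
      have [tx cth hs _] := hloc p pP x xp; have [h1 h2 _] := hs _ (sc01 (dT x p)).
      have [_ cG _ _] := mod p pP.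
      have cs : {for x, continuous (fun x => sc (dT x p))}.
        by apply: (@cont_comp _ _ _ (fun x => dT x p) sc); [exact: cdT|exact: csc].
      have cl : {for x, continuous (fun x => lam (dT x p))}.
        by apply: (@cont_comp _ _ _ (fun x => dT x p) lam); [exact: cdT|exact: clam].
      have cw : {for x, continuous (w p)}.
        apply: cont_sub => //; apply: mulmx_continuous.
          by apply: cont_sub => //; exact: cont_cst.
        by apply: (@cont_comp _ _ _ (fun x => sc (dT x p)) (ld_G (ld p))) => //; exact: cG.
      apply: cont_add; first exact: cB.
      apply: cont_scale => //; apply: cont_sub; last exact: cB.
      apply: (@cont_comp _ _ _ (fun x => ld_eta (ld p) (w p x)) iot); last exact: iot_cont.
      exact: (@cont_comp _ _ _ (w p) (ld_eta (ld p))).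
    have e : \forall y \near x, B y + lam (dT y p) *: (Z p y - B y) = Y y.
      have : \forall y \near x, dT y p < rho.
        by apply: (@cdT p x (fun t => t < rho)); apply: open_nbhs_nbhs; split=> //; exact: open_lt.
      by apply: filterS => y yp; rewrite (Yin p).
    by move: ct; rewrite /prop_for /continuous_at -(Yin p) //; apply: cvg_trans; exact: near_eq_cvg.
  have e : \forall y \near x, B y = Y y.
    have : \forall y \near x, dT y x < rho / 2.
      have /cvgrPdist_lt/(_ (rho / 2) (divr_gt0 rho0 (ltr0Sn _ 1))) := @iot_cont x.
      by apply: filterS => y; rewrite distrC.
    apply: filterS => y yx; rewrite Yout // => p pP.
    rewrite leNgt; apply/negP => yp; apply: nx; exists p => //.
    have := ler_distD (iot y) (iot x) (iot p); rewrite [dT x y]distrC; lra.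
  have := cB x; rewrite /continuous_at {1}(nbhs_singleton e); apply: cvg_trans; exact: near_eq_cvg.
have Ynear x : `|Y x - iot x| <= 2 * k.
  have bB : `|B x - iot x| <= k by rewrite /B addrAC subrr add0r.
  have [[p pP xp]|nx] := pselect (exists2 p, p \in Pe ++ Ph & dT x p < rho).
    rewrite (Yin p) //; have [_ _ hs _] := hloc p pP x xp; have [_ _ h3] := hs _ (sc01 (dT x p)).
    have -> : B x + lam (dT x p) *: (Z p x - B x) - iot x =
        (1 - lam (dT x p)) *: (B x - iot x) + lam (dT x p) *: (Z p x - iot x).
      by apply/rowP => i; rewrite !mxE; ring.
    apply: le_trans (ler_normD _ _) _; rewrite !normrZ.
    have l0 := clamp_ge0 ((rho / 2 - dT x p) * (4 / rho)).
    have l1 := clamp_le1 ((rho / 2 - dT x p) * (4 / rho)).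
    rewrite -/(lam _) in l0 l1; rewrite !ger0_norm ?subr_ge0 //.
    have : (1 - lam (dT x p)) * `|B x - iot x| <= 1 * k by apply: ler_pM => //; lra.
    have : lam (dT x p) * `|Z p x - iot x| <= 1 * k by apply: ler_pM => //; exact: ltW.
    lra.
  rewrite Yout; first lra.
  move=> p pP; rewrite leNgt; apply/negP => xp; apply: nx; exists p => //; lra.
pose f x := r (Y x).
have tube x : `|Y x - iot x| < et.
  apply: le_lt_trans (Ynear x) _; have : 1 * (2 * k) <= (N%:R + 1) * (2 * k).
    by rewrite [leRHS]mulrDl lerDr; apply: mulr_ge0 => //; lra.
  by rewrite kN; lra.
have f_cont : continuous f.
  by move=> x; apply: (@continuous_comp _ _ _ Y r); [exact: cY|exact: rc (tube x)].
have f_near x : dT (f x) x < et.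
  rewrite -(subrK (Y x) (iot (f x))) -addrA; apply: le_lt_trans (ler_normD _ _) _.
  rewrite [X in X + _]distrC; have h1 := near (Y x) x; have h2 := Ynear x.
  apply: le_lt_trans (lerD h1 (lexx _)) _.
  have h3 : (N%:R + 1) * `|Y x - iot x| <= (N%:R + 1) * (2 * k) by rewrite ler_wpM2l // ltW.
  by move: h3; rewrite kN mulrDl mul1r; lra.
have fin p x : p \in Pe ++ Ph -> dT x p <= rho / 4 -> f x = ld_eta (ld p) (w p x).
  by move=> pP xp; rewrite /f (Yin p) ?lam1 ?scale1r ?(addrC (B x)) ?subrK ?rK //; lra.
have fixP x : f x = x -> x \in Pe ++ Ph.
  (* At a fixed point the whole displacement before retraction is normal to [T]. *)
  move=> fx; have orthx tau : tanv iot x tau -> dot (Y x - iot x) tau = 0.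
    by move=> ht; have := @orth (Y x) tau; rewrite -/(f x) fx; apply.
  have [[p pP xp]|nx] := pselect (exists2 p, p \in Pe ++ Ph & dT x p < rho); last first.
    apply: contraT => /hX[tau ht]; rewrite Yout in orthx; last first.
      move=> p pP; rewrite leNgt; apply/negP => xp; apply: nx; exists p => //; lra.
    have := orthx tau ht; rewrite /B addrAC subrr add0r dotZl => /eqP.
    by rewrite mulf_eq0 (gt_eqF eps0) /= => /eqP.
  have [->//|xp'] := eqVneq x p.
  have [tx cth hs ht] := hloc p pP x xp.
  have [t8|t8] := leP (rho / 8) (dT x p).
    exfalso; have [|tau [ht1 ht2 ht3]] := ht; first by apply/eqP.
    have := orthx tau ht1; rewrite (Yin p) // /Z /w sc1 //.
    have -> : forall z, B x + lam (dT x p) *: (z - B x) - iot x =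
        (1 - lam (dT x p)) *: (eps *: X x) + lam (dT x p) *: (z - iot x).
      by move=> z; apply/rowP => i; rewrite !mxE; ring.
    rewrite dotDl !dotZl => h0.
    have l0 := clamp_ge0 ((rho / 2 - dT x p) * (4 / rho)).
    have l1 := clamp_le1 ((rho / 2 - dT x p) * (4 / rho)).
    rewrite -/(lam _) in l0 l1.
    have a1 : eps * dot (X x) tau < 0 by rewrite pmulr_rlt0.
    by have := convex_neg l0 l1 a1 ht3; rewrite h0 ltxx.
  exfalso; have := fin p x pP ltac:(lra); rewrite fx => xE.
  have [h1 _ _] := hs _ (sc01 (dT x p)).
  have : ld_theta (ld p) x = w p x by rewrite {1}xE h1.
  have [[tp _ _ _ _] _ fG _] := mod p pP.
  move=> /eqP; rewrite /w /wpt -subr_eq0 opprB addrC subrK => /eqP h2.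
  have : ld_theta (ld p) x - ld_u0 (ld p) = 0.
    by apply: (row_free_inj (fG _ (sc01 (dT x p)))); rewrite h2 mul0mx.
  move=> /eqP; rewrite subr_eq0 => /eqP h3; move: xp' => /eqP; apply.
  by rewrite -tx h3 (chart_eta0 (modc p pP)).
have nbp p e : 0 < e -> \forall x \near p, dT x p < e.
  move=> e0; have /cvgrPdist_lt/(_ e e0) := @iot_cont p.
  by apply: filterS => x; rewrite distrC.
have r16 : 0 < rho / 16 by rewrite divr_gt0.
have inPe p : p \in Pe -> p \in Pe ++ Ph by rewrite mem_cat => ->.
have inPh p : p \in Ph -> p \in Pe ++ Ph by rewrite mem_cat => ->; rewrite orbT.
apply: (@euler_of_displacement R T _ iot r et T_compact iot_cont et0 rK rc f f_cont f_near Pe Ph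
  (fun p t => ld_eta (ld p) (ld_u0 (ld p) + t *: ld_v (ld p)))
  (fun p x => ((ld_theta (ld p) x - ld_u0 (ld p)) *m ld_l (ld p)) 0 0) uniqP fixP).
- move=> p pE; apply: filterS (nbp p _ r16) => x xp.
  rewrite (fin p) ?inPe //; last lra.
  have [_ /(_ pE) G0 _] := hld p.
  by rewrite /w /wpt sc0 ?ltW // G0 mulmx1 subKr (chart_eta0 (modc p (inPe _ pE))).
- by move=> p pH; rewrite scale0r addr0 (chart_eta0 (modc p (inPh _ pH))).
- move=> p pH; have [[_ _ hu _ _] _ _ _] := mod p (inPh _ pH).
  have cl : continuous (fun t : R => ld_u0 (ld p) + t *: ld_v (ld p)).
    move=> t; apply: cont_add; first exact: cont_cst.
    by apply: cont_scale; [exact: cont_id|exact: cont_cst].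
  have : \forall t \near (0 : R), ld_theta (ld p) (ld_eta (ld p) (ld_u0 (ld p) + t *: ld_v (ld p))) = ld_u0 (ld p) + t *: ld_v (ld p) /\ {for ld_u0 (ld p) + t *: ld_v (ld p), continuous (ld_eta (ld p))}.
    apply: (near_cont (F := fun t : R => ld_u0 (ld p) + t *: ld_v (ld p)) (x := 0)
      (Q := fun u => ld_theta (ld p) (ld_eta (ld p) u) = u /\ {for u, continuous (ld_eta (ld p))})).
      exact: cl.
    by rewrite scale0r addr0; exact: hu.
  by apply: filterS => t [_ ct]; apply: (@continuous_comp _ _ _ (fun t : R => ld_u0 (ld p) + t *: ld_v (ld p)) (ld_eta (ld p))) => //; exact: cl.
- move=> p pH; have [[_ hx _ _ _] _ _ _] := mod p (inPh _ pH).
  apply: filterS hx => x [_ ct].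
  apply: cont_entry; apply: mulmx_continuous; last exact: cont_cst.
  by apply: cont_sub => //; exact: cont_cst.
- move=> p pH; have [[_ _ hu _ _] _ _ _] := mod p (inPh _ pH).
  have [_ _ /(_ pH)[vl _]] := hld p.
  have cl : continuous (fun t : R => ld_u0 (ld p) + t *: ld_v (ld p)).
    move=> t; apply: cont_add; first exact: cont_cst.
    by apply: cont_scale; [exact: cont_id|exact: cont_cst].
  have : \forall t \near (0 : R), ld_theta (ld p) (ld_eta (ld p) (ld_u0 (ld p) + t *: ld_v (ld p))) = ld_u0 (ld p) + t *: ld_v (ld p) /\ {for ld_u0 (ld p) + t *: ld_v (ld p), continuous (ld_eta (ld p))}.
    apply: (near_cont (F := fun t : R => ld_u0 (ld p) + t *: ld_v (ld p)) (x := 0)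
      (Q := fun u => ld_theta (ld p) (ld_eta (ld p) u) = u /\ {for u, continuous (ld_eta (ld p))})).
      exact: cl.
    by rewrite scale0r addr0; exact: hu.
  apply: filterS => t [-> _]; rewrite (addrC (ld_u0 _)) addrK -scalemxAl vl.
  by rewrite !mxE mulr1.
move=> p pH; apply: filterS (nbp p _ r16) => x xp.
rewrite (fin p) ?inPh //; last lra.
have [_ _ /(_ pH)[vl G0]] := hld p; congr (ld_eta _ _).
have gen (P Q K : 'rV[R]_d) : P - ((P - Q) - K) = Q + K by apply/rowP => i; rewrite !mxE; ring.
rewrite /w /wpt sc0 ?ltW // G0 mulmxBr mulmx1 gen; congr (_ + _).
rewrite -scalemxAr mulmxA; set a := _ *m ld_l _.
by rewrite {1}[a]mx11_scalar mul_scalar_mx scalerA.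
Qed.

End PoincareHopf.

(** * Quadratic remainders of holomorphic functions *)

Local Open Scope complex_scope.

Section ComplexAbs.
Context {R : realType}.
Implicit Types z w : R[i].

(** Equivalent to the modulus, but real-valued, whereas the norm of [R[i]] takes values in
    [R[i]]. *)
Definition cabs z : R := `|complex.Re z| + `|complex.Im z|.

Lemma cabs_ge0 z : 0 <= cabs z. Proof. by rewrite addr_ge0. Qed.
Lemma cabsN z : cabs (- z) = cabs z. Proof. by case: z => a b; rewrite /cabs /= !normrN. Qed.
Lemma cabsD z w : cabs (z + w) <= cabs z + cabs w.
Proof.
case: z w => [a b] [c d]; rewrite /cabs /=; have := ler_normD a c; have := ler_normD b d; lra.
Qed.
Lemma cabsB z w : cabs (z - w) <= cabs z + cabs w.
Proof. by rewrite -(cabsN w); exact: cabsD. Qed.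
Lemma cabs_distC z w : cabs (z - w) = cabs (w - z).
Proof. by rewrite -cabsN opprB. Qed.
Lemma cabsM z w : cabs (z * w) <= cabs z * cabs w.
Proof.
case: z w => [a b] [c d]; rewrite /cabs /=.
have := ler_normB (a * c) (b * d); have := ler_normD (a * d) (b * c).
by rewrite !normrM mulrDl !mulrDr; lra.
Qed.
Lemma cabs0 : cabs 0 = 0. Proof. by rewrite /cabs /= !normr0 addr0. Qed.
Lemma cabs_eq0 z : (cabs z == 0) = (z == 0).
Proof. by case: z => a b; rewrite /cabs paddr_eq0 // !normr_eq0 eq_complex. Qed.
Lemma cabs_gt0 z : (0 < cabs z) = (z != 0).
Proof. by rewrite lt_def cabs_ge0 andbT cabs_eq0. Qed.
Lemma cabsR (a : R) : cabs a%:C = `|a|. Proof. by rewrite /cabs /= normr0 addr0. Qed.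
Lemma cabs_i : cabs 'i = 1. Proof. by rewrite /cabs /= normr0 normr1 add0r. Qed.
Lemma cabs_Re z : `|complex.Re z| <= cabs z. Proof. by rewrite lerDl. Qed.
Lemma cabs_Im z : `|complex.Im z| <= cabs z. Proof. by rewrite lerDr. Qed.
Lemma cabsZ (a : R) z : cabs (a%:C * z) = `|a| * cabs z.
Proof. by case: z => c d; rewrite /cabs /= !mul0r subr0 addr0 !normrM mulrDr. Qed.

Lemma cabsV z : cabs z^-1 <= 2 / cabs z.
Proof.
have [->|z0] := eqVneq z 0; first by rewrite invr0 cabs0 invr0 mulr0.
have := z0; rewrite -cabs_gt0 => c0; rewrite ler_pdivlMr //.
case: z z0 c0 => a b z0; rewrite /cabs /= => c0.
have n0 : 0 < a ^+ 2 + b ^+ 2.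
  rewrite lt_def addr_ge0 ?sqr_ge0 // andbT paddr_eq0 ?sqr_ge0 // !sqrf_eq0.
  by move: z0; rewrite eq_complex.
rewrite normrN !normrM normfV (gtr0_norm n0) -mulrDl mulrAC ler_pdivrMr //.
have a2 : `|a| ^+ 2 = a ^+ 2 by rewrite real_normK ?num_real.
have b2 : `|b| ^+ 2 = b ^+ 2 by rewrite real_normK ?num_real.
have := sqr_ge0 (`|a| - `|b|); rewrite sqrrB a2 b2 mulrDl !mulrDr -!expr2 a2 b2.
rewrite mulrC -mulr_natl; lra.
Qed.

End ComplexAbs.

Section ComplexPrimitive.
Context {R : realType}.

Definition cder (F : R -> R[i]) (t : R) (l : R[i]) : Prop :=
  is_derive t 1 (fun t => complex.Re (F t)) (complex.Re l) /\
  is_derive t 1 (fun t => complex.Im (F t)) (complex.Im l).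

Lemma mvt_bound (f g f' g' : R -> R) (a b e : R) : a <= b ->
  (forall t, a <= t <= b -> is_derive t 1 f (f' t)) -> (forall t, a <= t <= b -> is_derive t 1 g (g' t)) ->
  (forall t, a <= t <= b -> `|f' t - g' t| <= e) -> `|(f b - f a) - (g b - g a)| <= e * (b - a).
Proof.
move=> ab hf hg he.
have hd t : a <= t <= b -> is_derive t 1 (f - g) (f' t - g' t).
  by move=> tab; have := hf t tab; have := hg t tab => ? ?; exact: is_deriveB.
have [||c cab] := @MVT_segment R (f - g) (fun t => f' t - g' t) a b ab.
- by move=> t; rewrite in_itv /= => /andP[h1 h2]; apply: hd; rewrite !ltW.
- apply: derivable_within_continuous => t; rewrite in_itv /= => tab.
  by have := hd t tab => -[].
rewrite !fctE => h; have -> : f b - f a - (g b - g a) = f b - g b - (f a - g a) by ring.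
rewrite h normrM (@ger0_norm _ (b - a)) ?subr_ge0 // ler_wpM2r ?subr_ge0 //; apply: he.
by move: cab; rewrite in_itv.
Qed.

Lemma is_derive_quad (p q t : R) : is_derive t 1 (fun t => p * t + q * t ^+ 2 / 2) (p + q * t).
Proof.
pose P : {poly R} := p *: 'X + (q / 2) *: 'X^2.
have -> : (fun t => p * t + q * t ^+ 2 / 2) = horner P.
  by apply/funext => u; rewrite /P hornerD !hornerZ hornerX hornerXn; field.
have -> : p + q * t = (P^`()).[t].
  by rewrite /P derivD !derivZ derivX derivXn hornerD !hornerZ hornerMn hornerXn -[1]/(1%:P) hornerC /=; field.
by apply: DeriveDef; [exact: derivable_horner|rewrite derivE derive1E].
Qed.

Lemma le_of_eq (x y : R) : x = y -> x <= y. Proof. by move=> ->. Qed.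
Lemma norm_eq_le (x y : R) : x = y -> `|x| <= `|y|. Proof. by move=> ->. Qed.

(** Estimate of the integral of a nearly affine function, stated through a primitive. The mean value
    theorem is applied to real and imaginary parts, whence the factor 2. *)
Lemma cmvt (F F' : R -> R[i]) (p q : R[i]) (a b e : R) : a <= b -> (forall t, a <= t <= b -> cder F t (F' t)) ->
  (forall t, a <= t <= b -> cabs (F' t - (p + q * t%:C)) <= e) ->
  cabs (F b - F a - (p * (b - a)%:C + q * ((b ^+ 2 - a ^+ 2) / 2)%:C)) <= 2 * e * (b - a).
Proof.
move=> ab hF he.
have h1 := @mvt_bound (fun t => complex.Re (F t)) (fun t => complex.Re p * t + complex.Re q * t ^+ 2 / 2)
  (fun t => complex.Re (F' t)) (fun t => complex.Re p + complex.Re q * t) a b e ab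
  (fun t tab => (hF t tab).1) (fun t _ => is_derive_quad _ _ t) _.
have h2 := @mvt_bound (fun t => complex.Im (F t)) (fun t => complex.Im p * t + complex.Im q * t ^+ 2 / 2)
  (fun t => complex.Im (F' t)) (fun t => complex.Im p + complex.Im q * t) a b e ab
  (fun t tab => (hF t tab).2) (fun t _ => is_derive_quad _ _ t) _.
have {}h1 := h1 (fun t tab => le_trans _ (he t tab)).
have {}h2 := h2 (fun t tab => le_trans _ (he t tab)).
rewrite mulrDl -addrA; rewrite [X in _ <= X](_ : _ = e * (b - a) + e * (b - a)); last ring.
case: p q h1 h2 {he} => [p1 p2] [q1 q2] /= h1 h2; case: (F b) (F a) h1 h2 => [b1 b2] [a1 a2] /= h1 h2.
rewrite /cabs /=; apply: lerD.
  apply: le_trans (h1 _); first by apply: norm_eq_le; field.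
  by move=> t; apply: le_trans (cabs_Re _); case: (F' t) => x y; apply: norm_eq_le => /=; ring.
apply: le_trans (h2 _); first by apply: norm_eq_le; field.
by move=> t; apply: le_trans (cabs_Im _); case: (F' t) => x y; apply: norm_eq_le => /=; ring.
Qed.

Lemma primitive_exists (f : R -> R) (A : R) : continuous f ->
  exists F : R -> R, forall x, A < x -> is_derive x 1 F (f x).
Proof.
move=> cf; exists (fun x => (\int[lebesgue_measure]_(t in [set` `[A, x]]) (f t))%R) => x Ax.
have xu : x < x + 1 by rewrite ltrDl.
have [|d1 d2] := @continuous_FTC1_closed R f A x (x + 1) xu _ Ax (cf x).
  by apply: continuous_compact_integrable; [exact: segment_compact|exact: continuous_subspaceT].
by apply: DeriveDef; [exact: d1|rewrite -derive1E; exact: d2].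
Qed.

Lemma cprimitive_exists (f : R -> R[i]) (A : R) : continuous (fun x => complex.Re (f x)) ->
  continuous (fun x => complex.Im (f x)) -> exists F : R -> R[i], forall x, A < x -> cder F x (f x).
Proof.
move=> /(primitive_exists A)[F1 h1] /(primitive_exists A)[F2 h2].
by exists (fun x => F1 x +i* F2 x) => x Ax; split=> /=; [exact: h1|exact: h2].
Qed.

End ComplexPrimitive.

Lemma nested_intervals (R : realType) (x u : nat -> R) : (forall n, x n <= x n.+1) ->
  (forall n, x n.+1 + u n.+1 <= x n + u n) -> (forall n, 0 <= u n) ->
  exists z, forall n, x n <= z <= x n + u n.
Proof.
move=> hx hu u0.
have mono n k : x n <= x (n + k)%N /\ x (n + k)%N + u (n + k)%N <= x n + u n.
  elim: k => [|k [h1 h2]]; first by rewrite addn0.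
  by rewrite addnS; split; [exact: le_trans h1 (hx _)|exact: le_trans (hu _) h2].
have ub n m : x m <= x n + u n.
  have [nm|mn] := leqP n m.
    have [_ h] := mono n (m - n)%N; rewrite subnKC // in h.
    by apply: le_trans h; rewrite lerDl.
  have [h _] := mono m (n - m)%N; rewrite subnKC ?(ltnW mn) // in h.
  by apply: le_trans h _; rewrite lerDl.
have hs : has_sup (range x).
  by split; [exists (x 0%N); exists 0%N|exists (x 0%N + u 0%N) => _ [m _ <-]; exact: ub].
exists (sup (range x)) => n; apply/andP; split.
  by apply: ub_le_sup; [case: hs|exists n].
by apply: ge_sup; [case: hs|move=> _ [m _ <-]; exact: ub].
Qed.

(** * Goursat's lemma on rectangles *)

Section Goursat.
Context {R : realType}.
Variables (G P Q : R -> R -> R[i]).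

(** The contour integral of [G] around a rectangle, written with primitives [P y] on horizontal
    lines and [Q x] on vertical ones. *)
Definition loop (x y u v : R) : R[i] := P y (x + u) - P y x - (P (y + v) (x + u) - P (y + v) x) +
  'i * (Q (x + u) (y + v) - Q (x + u) y - (Q x (y + v) - Q x y)).

Lemma loop_split x y u v : loop x y u v = loop x y (u / 2) (v / 2) + loop (x + u / 2) y (u / 2) (v / 2) +
  (loop x (y + v / 2) (u / 2) (v / 2) + loop (x + u / 2) (y + v / 2) (u / 2) (v / 2)).
Proof.
rewrite /loop -!addrA; have e t : t / 2 + t / 2 = t :> R by field.
by rewrite !e; ring.
Qed.

Definition box (x y u v : R) s t := x <= s <= x + u /\ y <= t <= y + v.

(** A complex affine function has zero contour integral, so only the error term contributes, along
    the perimeter. *)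
Lemma loop_small x y u v x0 y0 G0 l e : 0 <= u -> 0 <= v ->
  (forall s t, box x y u v s t -> cder (P t) s (G s t) /\ cder (Q s) t (G s t)) ->
  (forall s t, box x y u v s t -> cabs (G s t - (G0 + l * ((s - x0)%:C + 'i * (t - y0)%:C))) <= e) ->
  cabs (loop x y u v) <= 4 * e * (u + v).
Proof.
move=> u0 v0 hd he.
have xu : x <= x + u by rewrite lerDl.
have yv : y <= y + v by rewrite lerDl.
have yb : y <= y <= y + v by rewrite lexx. have yt : y <= y + v <= y + v by rewrite lexx yv.
have xl : x <= x <= x + u by rewrite lexx. have xr : x <= x + u <= x + u by rewrite lexx xu.
have hor t : y <= t <= y + v -> cabs (P t (x + u) - P t x - ((G0 - l * x0%:C + l * 'i * (t - y0)%:C) * (x + u - x)%:C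
     + l * (((x + u) ^+ 2 - x ^+ 2) / 2)%:C)) <= 2 * e * (x + u - x).
  move=> ht; apply: (cmvt xu (F' := fun s => G s t)) => s hs; first by have [] := hd s t (conj hs ht).
  by apply: le_trans (he s t (conj hs ht)); apply: le_of_eq; congr cabs; congr (_ - _); rewrite rmorphB; ring.
have ver s : x <= s <= x + u -> cabs (Q s (y + v) - Q s y - ((G0 + l * (s - x0)%:C - l * 'i * y0%:C) * (y + v - y)%:C
     + l * 'i * (((y + v) ^+ 2 - y ^+ 2) / 2)%:C)) <= 2 * e * (y + v - y).
  move=> hs; apply: (cmvt yv (F' := fun t => G s t)) => t ht; first by have [] := hd s t (conj hs ht).
  by apply: le_trans (he s t (conj hs ht)); apply: le_of_eq; congr cabs; congr (_ - _); rewrite rmorphB; ring.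
have h1 := hor y yb; have h2 := hor (y + v) yt; have h3 := ver (x + u) xr; have h4 := ver x xl.
rewrite !(addrC x) !(addrC y) !addrK -!(addrC x) -!(addrC y) in h1 h2 h3 h4.
have -> : loop x y u v =
  (P y (x + u) - P y x - ((G0 - l * x0%:C + l * 'i * (y - y0)%:C) * u%:C + l * (((x + u) ^+ 2 - x ^+ 2) / 2)%:C))
  - (P (y + v) (x + u) - P (y + v) x - ((G0 - l * x0%:C + l * 'i * (y + v - y0)%:C) * u%:C + l * (((x + u) ^+ 2 - x ^+ 2) / 2)%:C))
  + 'i * ((Q (x + u) (y + v) - Q (x + u) y - ((G0 + l * (x + u - x0)%:C - l * 'i * y0%:C) * v%:C + l * 'i * (((y + v) ^+ 2 - y ^+ 2) / 2)%:C))
   - (Q x (y + v) - Q x y - ((G0 + l * (x - x0)%:C - l * 'i * y0%:C) * v%:C + l * 'i * (((y + v) ^+ 2 - y ^+ 2) / 2)%:C))).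
  rewrite /loop; move: (((x + u) ^+ 2 - x ^+ 2) / 2)%:C (((y + v) ^+ 2 - y ^+ 2) / 2)%:C => A B.
  by rewrite !rmorphB !rmorphD /=; ring.
apply: le_trans (cabsD _ _) _; apply: le_trans (lerD (cabsB _ _) (cabsM _ _)) _.
rewrite cabs_i mul1r; apply: le_trans (lerD (lexx _) (cabsB _ _)) _.
by move: h1 h2 h3 h4; lra.
Qed.

Variables (a c w h : R).
Hypothesis w0 : 0 < w.
Hypothesis h0 : 0 < h.
Hypothesis hd : forall s t, box a c w h s t -> cder (P t) s (G s t) /\ cder (Q s) t (G s t).
Hypothesis hG : forall x0 y0, box a c w h x0 y0 -> exists l, forall e, 0 < e -> exists2 d, 0 < d &
  forall s t, box a c w h s t -> `|s - x0| < d -> `|t - y0| < d ->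
    cabs (G s t - (G x0 y0 + l * ((s - x0)%:C + 'i * (t - y0)%:C))) <= e * (`|s - x0| + `|t - y0|).

(** Bisection: some quarter keeps at least a quarter of the integral. At the limit point
    differentiability bounds the integral over the [n]-th rectangle by a small multiple of
    [4^-n]. *)
Theorem goursat : loop a c w h = 0.
Proof.
apply/eqP; rewrite -cabs_eq0; apply: contraT => L0.
have Lp : 0 < cabs (loop a c w h) by rewrite lt_def L0 cabs_ge0.
have step (q : R * R * (R * R)) : exists p : R * R,
    [/\ p.1 = q.1.1 \/ p.1 = q.1.1 + q.2.1 / 2, p.2 = q.1.2 \/ p.2 = q.1.2 + q.2.2 / 2 &
     cabs (loop q.1.1 q.1.2 q.2.1 q.2.2) <= 4 * cabs (loop p.1 p.2 (q.2.1 / 2) (q.2.2 / 2))].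
  case: q => [[x y] [u v]] /=; set X := cabs (loop x y u v).
  have hX : X <= cabs (loop x y (u / 2) (v / 2)) + cabs (loop (x + u / 2) y (u / 2) (v / 2)) +
     (cabs (loop x (y + v / 2) (u / 2) (v / 2)) + cabs (loop (x + u / 2) (y + v / 2) (u / 2) (v / 2))).
    by rewrite /X loop_split; apply: le_trans (cabsD _ _) _; apply: lerD; exact: cabsD.
  have [h1|h1] := leP X (4 * cabs (loop x y (u / 2) (v / 2))); first by exists (x, y); split => //=; left.
  have [h2|h2] := leP X (4 * cabs (loop (x + u / 2) y (u / 2) (v / 2))).
    by exists (x + u / 2, y); split => //=; [right|left].
  have [h3|h3] := leP X (4 * cabs (loop x (y + v / 2) (u / 2) (v / 2))).
    by exists (x, y + v / 2); split => //=; [left|right].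
  by exists (x + u / 2, y + v / 2); split => //=; [right|right|lra].
have /choice[nx hnx] := step.
pose un n : R := w / 2 ^+ n; pose vn n : R := h / 2 ^+ n.
pose sq := fix sq n : R * R := if n is k.+1 then nx (sq k, (un k, vn k)) else (a, c).
have unS n : un n.+1 = un n / 2 by rewrite /un exprSr invfM mulrA.
have vnS n : vn n.+1 = vn n / 2 by rewrite /vn exprSr invfM mulrA.
have un0 n : 0 < un n by rewrite divr_gt0 // exprn_gt0.
have vn0 n : 0 < vn n by rewrite divr_gt0 // exprn_gt0.
have hs n : [/\ (sq n.+1).1 = (sq n).1 \/ (sq n.+1).1 = (sq n).1 + un n / 2,
     (sq n.+1).2 = (sq n).2 \/ (sq n.+1).2 = (sq n).2 + vn n / 2 &
     cabs (loop (sq n).1 (sq n).2 (un n) (vn n)) <= 4 * cabs (loop (sq n.+1).1 (sq n.+1).2 (un n.+1) (vn n.+1))].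
  by have := hnx (sq n, (un n, vn n)); rewrite /= -unS -vnS.
have [x0 hx0] : exists z, forall n, (sq n).1 <= z <= (sq n).1 + un n.
  apply: nested_intervals => n; last exact: ltW.
    by have [[->|->] _ _] := hs n; rewrite // lerDl divr_ge0 // ltW.
  by have := un0 n; rewrite unS; have [[->|->] _ _] := hs n; lra.
have [y0 hy0] : exists z, forall n, (sq n).2 <= z <= (sq n).2 + vn n.
  apply: nested_intervals => n; last exact: ltW.
    by have [_ [->|->] _] := hs n; rewrite // lerDl divr_ge0 // ltW.
  by have := vn0 n; rewrite vnS; have [_ [->|->] _] := hs n; lra.
have sub n s t : box (sq n).1 (sq n).2 (un n) (vn n) s t -> box a c w h s t.
  elim: n s t => [|n IH] s t; first by rewrite /un /vn !expr0 !divr1.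
  move=> [/andP[s1 s2] /andP[t1 t2]]; apply: IH; have := un0 n; have := vn0 n.
  rewrite unS in s2; rewrite vnS in t2; have [hh1 hh2 _] := hs n => v1 u1.
  by split; apply/andP; split; case: hh1 => E1; case: hh2 => E2; rewrite ?E1 ?E2 in s1 s2 t1 t2; lra.
have grow n : cabs (loop a c w h) <= 4 ^+ n * cabs (loop (sq n).1 (sq n).2 (un n) (vn n)).
  elim: n => [|n IH]; first by rewrite expr0 mul1r /un /vn !expr0 !divr1.
  apply: le_trans IH _; rewrite exprSr -mulrA ler_wpM2l ?exprn_ge0 //.
  by have [_ _ ] := hs n.
have [l hl] := hG (sub 0%N x0 y0 (conj (hx0 0%N) (hy0 0%N))).
(* With this precision the final bound is half of the quantity being bounded. *)
pose e := cabs (loop a c w h) / (8 * (w + h) ^+ 2).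
have wh : 0 < w + h by rewrite addr_gt0.
have e0 : 0 < e by rewrite divr_gt0 // mulr_gt0 // exprn_gt0.
have [d d0 hd'] := hl e e0.
have [n hn] : exists n : nat, (w + h) / 2 ^+ n < d.
  have [n hn] : exists n : nat, (w + h) / d < n%:R.
    by exists (Num.trunc ((w + h) / d)).+1; exact: truncnS_gt.
  exists n; rewrite ltr_pdivrMr ?exprn_gt0 // mulrC -ltr_pdivrMr //; apply: lt_le_trans hn _.
  by rewrite -natrX ler_nat ltnW // ltn_expl.
have uv : un n + vn n = (w + h) / 2 ^+ n by rewrite /un /vn mulrDl.
have bnd : cabs (loop (sq n).1 (sq n).2 (un n) (vn n)) <= 4 * (e * (un n + vn n)) * (un n + vn n).
  apply: (@loop_small _ _ _ _ x0 y0 (G x0 y0) l); [exact: ltW|exact: ltW|by move=> s t /sub; exact: hd|].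
  move=> s t /[dup] bst [st tt]; have := hx0 n; have := hy0 n; move: st tt => /andP[s1 s2] /andP[t1 t2] /andP[y1 y2] /andP[x1 x2].
  have sx : `|s - x0| <= un n by rewrite ler_norml; lra.
  have ty : `|t - y0| <= vn n by rewrite ler_norml; lra.
  have := un0 n; have := vn0 n => v1 u1; rewrite -uv in hn.
  apply: le_trans (hd' s t (sub n _ _ bst) ltac:(lra) ltac:(lra)) _.
  by rewrite ler_wpM2l ?(ltW e0) // lerD.
have := le_trans (grow n) (ler_wpM2l (exprn_ge0 n (ler0n R 4)) bnd).
have -> : 4 ^+ n * (4 * (e * (un n + vn n)) * (un n + vn n)) = cabs (loop a c w h) / 2.
  have -> : 4 ^+ n = 2 ^+ n * 2 ^+ n :> R by rewrite -exprMn; congr (_ ^+ _); ring.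
  rewrite uv /e; have : 2 ^+ n != 0 :> R by rewrite expf_neq0.
  move: (2 ^+ n) => k k0; field; rewrite k0 /= -?expr2; have := wh; move=> /gt_eqF wh0; rewrite wh0 //.
lra.
Qed.
End Goursat.

(** * Mean values and Cauchy estimates *)

Section EpsilonDerivatives.
Context {R : realType}.

Lemma deriv_eps (f : R -> R) (x l : R) : is_derive x 1 f l ->
  forall e, 0 < e -> exists2 d, 0 < d & forall h, `|h| < d -> `|f (x + h) - f x - l * h| <= e * `|h|.
Proof.
move=> [df dl] e e0.
have : (fun h => h^-1 *: ((f \o shift x) (h *: 1) - f x)) @ 0^' --> l by rewrite -dl; exact: df.
move=> /cvgrPdist_le/(_ e e0)[d /= d0 hd]; exists d => // h hd'.
have [->|h0] := eqVneq h 0; first by rewrite addr0 mulr0 !subrr normr0 mulr0.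
have := hd h; rewrite /= sub0r normrN => /(_ hd' h0).
rewrite /GRing.scale /= mulr1 addrC (addrC h) => H.
have -> : f (x + h) - f x - l * h = - ((l + - (h^-1 * (f (x + h) - f x))) * h) by field.
by rewrite normrN normrM ler_wpM2r // addrC.
Qed.

Lemma eps_deriv (f : R -> R) (x l : R) :
  (forall e, 0 < e -> exists2 d, 0 < d & forall h, `|h| < d -> `|f (x + h) - f x - l * h| <= e * `|h|) ->
  is_derive x 1 f l.
Proof.
move=> hf; have H : (fun h => h^-1 *: ((f \o shift x) (h *: 1) - f x)) @ 0^' --> l.
  apply/cvgrPdist_le => e e0; have [d d0 hd] := hf e e0; exists d => // h /=.
  rewrite sub0r normrN => hd' h0; rewrite /GRing.scale /= mulr1 (addrC h).
  have -> : l - h^-1 * (f (x + h) - f x) = - ((f (x + h) - f x - l * h) / h) by field.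
  rewrite normrN normrM normfV ler_pdivrMr ?normr_gt0 //; exact: hd.
apply: DeriveDef; first by apply/cvg_ex; exists l.
exact: (cvg_lim _ H).
Qed.

Definition cexp (x y : R) : R[i] := (expR x * cos y) +i* (expR x * sin y).

Lemma cexpD x h y k : cexp (x + h) (y + k) = cexp x y * cexp h k.
Proof.
by apply/eqP; rewrite eq_complex /= expRD cosD sinD; apply/andP; split; apply/eqP; ring.
Qed.

Lemma cexp_near0 e : 0 < e -> exists2 d, 0 < d & forall h k, `|h| < d -> `|k| < d ->
  cabs (cexp h k - 1 - (h%:C + 'i * k%:C)) <= e * (`|h| + `|k|).
Proof.
move=> e0; pose e1 := Num.min (e / 8) (1 / 2).
have e10 : 0 < e1 by rewrite lt_min !divr_gt0.
have e1e : e1 <= e / 8 by rewrite ge_min lexx.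
have e12 : e1 <= 1 / 2 by rewrite ge_min lexx orbT.
have [d1 d10 h1] := deriv_eps (is_derive_expR (0 : R)) e10.
have [d2 d20 h2] := deriv_eps (is_derive_cos (0 : R)) e10.
have [d3 d30 h3] := deriv_eps (is_derive_sin (0 : R)) e10.
clearbody e1.
exists (Num.min (Num.min d1 d2) (Num.min d3 (e1 / 2))); first by rewrite !lt_min d10 d20 d30 divr_gt0.
move=> h k; rewrite !lt_min => /andP[/andP[a1 a2] /andP[a3 a4]] /andP[/andP[b1 b2] /andP[b3 b4]].
have {}h1 := h1 h a1; have {}h2 := h2 k b2; have {}h3 := h3 k b3.
rewrite add0r expR0 mul1r in h1; rewrite add0r cos0 sin0 oppr0 mul0r subr0 in h2.
rewrite add0r sin0 cos0 subr0 mul1r in h3.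
rewrite /cabs /cexp /=; move: h1 h2 h3; move: (expR h) (cos k) (sin k) => E c s h1 h2 h3.
have hE : `|E - 1| <= e1.
  rewrite -(subrK h (E - 1)); apply: le_trans (ler_normD _ _) _.
  have : e1 * `|h| <= 1 / 2 * `|h| by rewrite ler_wpM2r.
  lra.
have hE2 : `|E| <= 2 by rewrite -(subrK 1 E); apply: le_trans (ler_normD _ _) _; rewrite normr1; lra.
have -> : E * c - 1 - (h + (0 * k - 1 * 0)) = (E - 1 - h) + E * (c - 1) by ring.
have -> : E * s - 0 - (0 + (0 * 0 + 1 * k)) = E * (s - k) + (E - 1) * k by ring.
have q1 : `|E * (c - 1)| <= 2 * (e1 * `|k|) by rewrite normrM ler_pM.
have q2 : `|E * (s - k)| <= 2 * (e1 * `|k|) by rewrite normrM ler_pM.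
have q3 : `|(E - 1) * k| <= e1 * `|k| by rewrite normrM ler_wpM2r.
have q4 := ler_normD (E - 1 - h) (E * (c - 1)); have q5 := ler_normD (E * (s - k)) ((E - 1) * k).
have q6 : e1 * `|h| <= e / 8 * `|h| by rewrite ler_wpM2r.
have q7 : e1 * `|k| <= e / 8 * `|k| by rewrite ler_wpM2r.
have q8 : 0 <= e * `|h| by rewrite mulr_ge0 // ltW.
have q9 : 0 <= e * `|k| by rewrite mulr_ge0 // ltW.
lra.
Qed.

Lemma cexp_bounds x y : expR x <= cabs (cexp x y) <= 2 * expR x.
Proof.
rewrite /cabs /= !normrM (gtr0_norm (expR_gt0 x)) -mulrDr.
have e0 := expR_gt0 x; have c1 := cos_max y; have s1 := sin_max y.
have cs : 1 <= `|cos y| + `|sin y|.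
  have c2 : cos y ^+ 2 <= `|cos y| by rewrite -(@real_normK _ (cos y)) ?num_real // expr2 ler_piMl.
  have s2 : sin y ^+ 2 <= `|sin y| by rewrite -(@real_normK _ (sin y)) ?num_real // expr2 ler_piMl.
  by have := cos2Dsin2 y; lra.
by apply/andP; split; [rewrite ler_peMr // ltW|rewrite mulrC ler_pM2r //; lra].
Qed.

Definition cdiff (g : R[i] -> R[i]) (t l : R[i]) : Prop := forall e, 0 < e ->
  exists2 d, 0 < d & forall t', cabs (t' - t) < d -> cabs (g t' - g t - l * (t' - t)) <= e * cabs (t' - t).

Definition ccont (g : R[i] -> R[i]) (t : R[i]) : Prop := forall e, 0 < e ->
  exists2 d, 0 < d & forall t', cabs (t' - t) < d -> cabs (g t' - g t) < e.

Lemma cdiff_ccont g t l : cdiff g t l -> ccont g t.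
Proof.
move=> hg e e0; have [d d0 h] := hg 1 ltr01.
pose K := cabs l + 1; have K0 : 0 < K by rewrite ltr_wpDl ?cabs_ge0.
exists (Num.min d (e / K)); first by rewrite lt_min d0 divr_gt0.
move=> t'; rewrite lt_min ltr_pdivlMr // => /andP[td te].
rewrite -(subrK (l * (t' - t)) (g t' - g t)); apply: le_lt_trans (cabsD _ _) _.
have := h t' td; have := cabsM l (t' - t); rewrite /K mulrDr mulr1 in te; lra.
Qed.

Lemma cdiff_line g z0 z (a : R) l : cdiff g (z0 + a%:C * z) l -> cder (fun s => g (z0 + s%:C * z)) a (l * z).
Proof.
move=> hg; have H e : 0 < e -> exists2 d, 0 < d & forall h, `|h| < d ->
    cabs (g (z0 + (a + h)%:C * z) - g (z0 + a%:C * z) - l * z * h%:C) <= e * `|h|.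
  move=> e0; pose K := cabs z + 1; have K0 : 0 < K by rewrite ltr_wpDl ?cabs_ge0.
  have [d d0 hd] := hg (e / K) (divr_gt0 e0 K0); exists (d / K) => [|h]; first by rewrite divr_gt0.
  rewrite ltr_pdivlMr // => hK.
  have E : z0 + (a + h)%:C * z - (z0 + a%:C * z) = h%:C * z by rewrite rmorphD; ring.
  have hz : cabs (h%:C * z) <= `|h| * K by rewrite cabsZ ler_wpM2l // lerDl.
  have := hd (z0 + (a + h)%:C * z); rewrite E => /(_ (le_lt_trans hz hK)).
  have -> : l * z * h%:C = l * (h%:C * z) by ring.
  move=> h1; apply: le_trans h1 _.
  by rewrite mulrAC ler_pdivrMr // -mulrA ler_wpM2l // ltW.
split; apply: eps_deriv => e e0; have [d d0 hd] := H e e0; exists d => // h /hd; apply: le_trans.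
  by apply: le_trans (cabs_Re _); apply: norm_eq_le; case: (g _) (g _) (l * z) => [? ?] [? ?] [? ?] /=; ring.
by apply: le_trans (cabs_Im _); apply: norm_eq_le; case: (g _) (g _) (l * z) => [? ?] [? ?] [? ?] /=; ring.
Qed.

Lemma ccont_comp (g : R[i] -> R[i]) (c : R -> R[i]) (x : R) : ccont g (c x) ->
  continuous_at x (fun x => complex.Re (c x)) -> continuous_at x (fun x => complex.Im (c x)) ->
  continuous_at x (fun x => complex.Re (g (c x))) /\ continuous_at x (fun x => complex.Im (g (c x))).
Proof.
move=> hg cr ci.
have H e : 0 < e -> \forall y \near x, cabs (g (c x) - g (c y)) < e.
  move=> e0; have [d d0 hd] := hg e e0; have d2 : 0 < d / 2 by rewrite divr_gt0.
  have /cvgrPdist_lt/(_ _ d2) h1 := cr; have /cvgrPdist_lt/(_ _ d2) h2 := ci.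
  apply: filterS (filterI h1 h2) => y [y1 y2]; rewrite cabs_distC; apply: hd.
  by move: y1 y2; rewrite cabs_distC /cabs; case: (c x) (c y) => [? ?] [? ?] /=; lra.
split; apply/cvgrPdist_lt => e e0; apply: filterS (H e e0) => y; apply: le_lt_trans.
  by apply: le_trans (cabs_Re _); apply: norm_eq_le; case: (g _) (g _) => [? ?] [? ?].
by apply: le_trans (cabs_Im _); apply: norm_eq_le; case: (g _) (g _) => [? ?] [? ?].
Qed.

(** A single choice for all functions: equal functions receive the same primitive, so periodicity
    passes to primitives. *)
Lemma primitive_choice (A : R) : exists pr : (R -> R[i]) -> R -> R[i], forall f : R -> R[i],
  continuous (fun x : R => complex.Re (f x)) -> continuous (fun x : R => complex.Im (f x)) ->
  forall x, A < x -> cder (pr f) x (f x).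
Proof.
have /choice[pr hpr] : forall f : R -> R[i], exists F, continuous (fun x : R => complex.Re (f x)) ->
    continuous (fun x : R => complex.Im (f x)) -> forall x, A < x -> cder F x (f x).
  move=> f; have [[h1 h2]|h] := pselect (continuous (fun x : R => complex.Re (f x)) /\ continuous (fun x : R => complex.Im (f x))).
    by have [F hF] := cprimitive_exists A h1 h2; exists F.
  by exists (fun=> 0) => h1 h2; case: h.
by exists pr.
Qed.

(** Mean value property. In the coordinates [t = s + exp (x + i y)], Goursat's lemma on a rectangle
    of height [2 pi] shows that means over circles do not depend on the radius, and they tend to
    [g s]. At [s] itself only continuity is available, as is the case for a difference quotient. *)
Lemma center_estimate g s r M : 0 < r -> ccont g s ->
  (forall t, 0 < cabs (t - s) <= 2 * r -> exists l, cdiff g t l) ->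
  (forall t, r <= cabs (t - s) <= 2 * r -> cabs (g t) <= M) -> cabs (g s) <= 2 * M.
Proof.
move=> r0 gc gd gM; pose X := ln r.
have eX : expR X = r by rewrite lnK // posrE.
(* Truncation keeps all circles inside the domain, so the integrands are continuous on the whole
   line. *)
pose m (x : R) := Num.min x X.
have mX x : expR (m x) <= r by rewrite -eX ler_expR ge_min lexx orbT.
pose c x y := s + cexp (m x) y.
have cs x y : c x y - s = cexp (m x) y by rewrite /c addrC addKr.
have dist x y : expR (m x) <= cabs (c x y - s) <= 2 * expR (m x) by rewrite cs cexp_bounds.
have dc x y : exists l, cdiff g (c x y) l.
  apply: gd; have /andP[h1 h2] := dist x y; have := expR_gt0 (m x); have := mX x; lra.
pose G x y := g (c x y).
have cm : continuous m.
  move=> x; apply/cvgrPdist_lt => e e0.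
  have h : \forall b \near x, `|x - b| < e by exact: (@cvgr_dist_lt _ _ _ (nbhs x) _ id x).
  apply: filterS h => b; apply: le_lt_trans; rewrite /m.
  have [h1|h1] := leP x X; have [h2|h2] := leP b X => //; first by rewrite !ler_norml; have := ler_norm (x - b); have := lerNnormlW (lexx `|x - b|); lra.
    by rewrite !ler_norml; have := ler_norm (x - b); have := lerNnormlW (lexx `|x - b|); lra.
  by rewrite subrr normr0.
have ce : continuous (fun x => expR (m x)).
  by move=> x; apply: (@continuous_comp _ _ _ m expR); [exact: cm|exact: continuous_expR].
have contx y : continuous (fun x => complex.Re (G x y)) /\ continuous (fun x => complex.Im (G x y)).
  have h (x : R) : continuous_at x (fun x => complex.Re (G x y)) /\ continuous_at x (fun x => complex.Im (G x y)).
    have [l /cdiff_ccont hl] := dc x y; apply: (ccont_comp (c := fun x => c x y) hl); rewrite /c; case: (s) => s1 s2 /=.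
      apply: (@continuousD _ _ _ (fun=> s1) (fun x => expR (m x) * cos y)); first exact: cst_continuous.
      by apply: (@continuousM _ _ (fun x => expR (m x)) (fun=> cos y)); [exact: ce|exact: cst_continuous].
    apply: (@continuousD _ _ _ (fun=> s2) (fun x => expR (m x) * sin y)); first exact: cst_continuous.
    by apply: (@continuousM _ _ (fun x => expR (m x)) (fun=> sin y)); [exact: ce|exact: cst_continuous].
  by split=> x; have [] := h x.
have conty x : continuous (fun y => complex.Re (G x y)) /\ continuous (fun y => complex.Im (G x y)).
  have h (y : R) : continuous_at y (fun y => complex.Re (G x y)) /\ continuous_at y (fun y => complex.Im (G x y)).
    have [l /cdiff_ccont hl] := dc x y; apply: (ccont_comp (c := fun y => c x y) hl); rewrite /c; case: (s) => s1 s2 /=.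
      apply: (@continuousD _ _ _ (fun=> s1) (fun y => expR (m x) * cos y)); first exact: cst_continuous.
      by apply: (@continuousM _ _ (fun=> expR (m x)) cos); [exact: cst_continuous|exact: continuous_cos].
    apply: (@continuousD _ _ _ (fun=> s2) (fun y => expR (m x) * sin y)); first exact: cst_continuous.
    by apply: (@continuousM _ _ (fun=> expR (m x)) sin); [exact: cst_continuous|exact: continuous_sin].
  by split=> y; have [] := h y.
have pi0 : 0 < pi *+ 2 :> R by rewrite mulrn_wgt0 // pi_gt0.
suff H e : 0 < e -> cabs (g s) <= 2 * M + 2 * e.
  by apply/ler_addgt0Pl => e e0; have := H (e / 2) (divr_gt0 e0 (ltr0Sn _ 1)); lra.
move=> e0; have [d d0 hd] := gc e e0.
(* The inner circle must lie where continuity at [s] gives the precision [e]; the sum norm on it is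
   at most twice the radius, hence at most [d / 2]. *)
pose x1 := Num.min (X - 1) (ln (d / 4)).
have x1X : x1 < X by rewrite gt_min; apply/orP; left; rewrite ltrBlDr ltrDl.
have ex1 : expR x1 <= d / 4.
  by rewrite -[leRHS]lnK ?posrE ?divr_gt0 // ler_expR ge_min lexx orbT.
have prim A := @primitive_choice A.
have [pr1 hp1] := prim (x1 - 1); have [pr2 hp2] := prim (-1).
pose P y := pr1 (fun x => G x y); pose Q x := pr2 (fun y => G x y).
have w0 : 0 < X - x1 by rewrite subr_gt0.
have bx x y : box x1 0 (X - x1) (pi *+ 2) x y -> [/\ x1 - 1 < x, -1 < y & m x = x].
  by move=> [/andP[h1 h2] /andP[h3 h4]]; split; rewrite /m ?min_l; lra.
have hd1 x y : box x1 0 (X - x1) (pi *+ 2) x y -> cder (P y) x (G x y) /\ cder (Q x) y (G x y).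
  move=> /bx[h1 h2 _]; have [c1 c2] := contx y; have [c3 c4] := conty x.
  by split; [exact: hp1|exact: hp2].
have hG1 x0 y0 : box x1 0 (X - x1) (pi *+ 2) x0 y0 -> exists l, forall e, 0 < e -> exists2 d, 0 < d &
    forall x y, box x1 0 (X - x1) (pi *+ 2) x y -> `|x - x0| < d -> `|y - y0| < d ->
    cabs (G x y - (G x0 y0 + l * ((x - x0)%:C + 'i * (y - y0)%:C))) <= e * (`|x - x0| + `|y - y0|).
  move=> /bx[_ _ mx0]; have [l hl] := dc x0 y0; set E := cexp x0 y0.
  exists (l * E) => e' e'0; pose K := cabs E + 1; pose L := cabs l + 1.
  have K0 : 0 < K by rewrite ltr_wpDl ?cabs_ge0.
  have L0 : 0 < L by rewrite ltr_wpDl ?cabs_ge0.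
  pose e1 := e' / (4 * K); have e10 : 0 < e1 by rewrite divr_gt0 // mulr_gt0.
  pose e2 := Num.min 1 (e' / (2 * (L * K))); have e20 : 0 < e2 by rewrite lt_min ltr01 divr_gt0 // !mulr_gt0.
  have e21 : e2 <= 1 by rewrite ge_min lexx.
  have e2K : L * (K * e2) <= e' / 2.
    have : e2 <= e' / (2 * (L * K)) by rewrite ge_min lexx orbT.
    by rewrite ler_pdivlMr ?mulr_gt0 //; lra.
  have e1K : e1 * (2 * K) = e' / 2 by rewrite /e1; field; rewrite gt_eqF.
  clearbody e1 e2.
  have [d1 d10 h1] := hl e1 e10; have [d2 d20 h2] := cexp_near0 e20.
  exists (Num.min d2 (d1 / (4 * K))); first by rewrite lt_min d20 divr_gt0 // mulr_gt0.
  move=> x y /bx[_ _ mx]; rewrite !lt_min !ltr_pdivlMr ?mulr_gt0 // => /andP[x2 x3] /andP[y2 y3].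
  set h := x - x0; set k := y - y0; set D := h%:C + 'i * k%:C.
  have h3 := h2 h k x2 y2; rewrite -/D in h3; set N := `|h| + `|k| in h3 *.
  have N0 : 0 <= N by rewrite addr_ge0.
  have cxy : c x y - c x0 y0 = E * D + E * (cexp h k - 1 - D).
    rewrite /c mx mx0; have -> : cexp x y = E * cexp h k by rewrite -cexpD /h /k !subrKC.
    by rewrite -/E; ring.
  have DN : cabs D <= N by rewrite /D; apply: le_trans (cabsD _ _) _; apply: lerD; rewrite ?cabsR // -[X in _ <= X]mul1r -cabs_i -cabsR; exact: cabsM.
  have EK : cabs E <= K by rewrite lerDl.
  have LL : cabs l <= L by rewrite lerDl.
  have q1 : cabs (E * (cexp h k - 1 - D)) <= K * (e2 * N).
    by apply: le_trans (cabsM _ _) _; apply: ler_pM; rewrite ?cabs_ge0.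
  have q2 : cabs (E * D) <= K * N by apply: le_trans (cabsM _ _) _; apply: ler_pM; rewrite ?cabs_ge0.
  have q3 : cabs (c x y - c x0 y0) <= 2 * K * N.
    rewrite cxy; apply: le_trans (cabsD _ _) _; have : K * (e2 * N) <= K * (1 * N) by rewrite ler_pM2l // ler_wpM2r.
    lra.
  have q4 : cabs (c x y - c x0 y0) < d1.
    by apply: le_lt_trans q3 _; rewrite /N; move: x3 y3; rewrite -/h -/k; lra.
  have q5 := h1 _ q4; rewrite -/(G x y) -/(G x0 y0) in q5.
  have -> : G x y - (G x0 y0 + l * E * D) = (G x y - G x0 y0 - l * (c x y - c x0 y0)) + l * (E * (cexp h k - 1 - D)).
    by rewrite cxy; ring.
  apply: le_trans (cabsD _ _) _.
  have q6 : e1 * cabs (c x y - c x0 y0) <= e1 * (2 * K * N) by rewrite ler_wpM2l // ltW.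
  have q7 : cabs (l * (E * (cexp h k - 1 - D))) <= L * (K * (e2 * N)).
    by apply: le_trans (cabsM _ _) _; apply: ler_pM; rewrite ?cabs_ge0.
  have q8 : L * (K * (e2 * N)) <= e' / 2 * N by rewrite !mulrA ler_wpM2r // -!mulrA.
  have q9 : e1 * (2 * K * N) = e' / 2 * N by rewrite mulrA e1K.
  lra.
have := goursat w0 pi0 hd1 hG1; rewrite /loop add0r (addrC x1) subrK.
(* The horizontal sides cancel, since the two integrands are the same function. *)
have -> : P (pi *+ 2) = P 0.
  by rewrite /P; congr pr1; apply/funext => x; rewrite /G /c /cexp cos2pi sin2pi cos0 sin0.
rewrite subrr add0r => /eqP; rewrite mulf_eq0 => /orP[/eqP /(congr1 (@complex.Im R)) /= /eqP|].
  by rewrite oner_eq0.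
rewrite subr_eq0 => /eqP QQ.
have pge : 0 <= pi *+ 2 :> R by exact: ltW.
have z1 := @cmvt _ (Q x1) (fun y => G x1 y) (g s) 0 0 (pi *+ 2) e pge _ _.
have z2 := @cmvt _ (Q X) (fun y => G X y) 0 0 0 (pi *+ 2) M pge _ _.
have b1 y : 0 <= y <= pi *+ 2 -> box x1 0 (X - x1) (pi *+ 2) x1 y.
  by move=> hy; split; [rewrite lexx /=; lra|rewrite add0r].
have b2 y : 0 <= y <= pi *+ 2 -> box x1 0 (X - x1) (pi *+ 2) X y.
  by move=> hy; split; [rewrite (ltW x1X) /=; lra|rewrite add0r].
have {}z1 := z1 (fun y hy => (hd1 x1 y (b1 y hy)).2).
have {}z2 := z2 (fun y hy => (hd1 X y (b2 y hy)).2).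
have {}z1 : cabs (Q x1 (pi *+ 2) - Q x1 0 - g s * (pi *+ 2)%:C) <= 2 * e * (pi *+ 2).
  have := z1 _; rewrite !mul0r !addr0 !subr0; apply => y _; rewrite mul0r addr0; apply: ltW; apply: hd.
  have /andP[_ h2] := dist x1 y; rewrite /m min_l ?(ltW x1X) // in h2; lra.
have {}z2 : cabs (Q X (pi *+ 2) - Q X 0) <= 2 * M * (pi *+ 2).
  have := z2 _; rewrite !mul0r !addr0 !subr0; apply => y _; rewrite mul0r addr0 subr0; apply: gM.
  by have := dist X y; rewrite /m min_l // eX.
have z3 : cabs (g s * (pi *+ 2)%:C) <= 2 * M * (pi *+ 2) + 2 * e * (pi *+ 2).
  rewrite -[X in cabs X](subKr (Q x1 (pi *+ 2) - Q x1 0)); apply: le_trans (cabsB _ _) _.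
  by apply: lerD => //; rewrite -QQ.
by rewrite mulrC cabsZ (gtr0_norm pi0) -mulrDl mulrC ler_pM2r // in z3.
Qed.

Lemma cdiff_eq (f g : R[i] -> R[i]) t l d : 0 < d -> (forall t', cabs (t' - t) < d -> f t' = g t') ->
  cdiff f t l -> cdiff g t l.
Proof.
move=> d0 fg hf e e0; have [d' d'0 h] := hf e e0; exists (Num.min d d'); first by rewrite lt_min d0.
move=> t'; rewrite lt_min => /andP[h1 h2]; rewrite -!fg //; first exact: h.
by rewrite subrr cabs0.
Qed.

Lemma cdiffM f g t lf lg : cdiff f t lf -> cdiff g t lg -> cdiff (fun x => f x * g x) t (lf * g t + f t * lg).
Proof.
move=> hf hg e e0.
have [K [K1 fK gK lK]] : exists K, [/\ 1 <= K, cabs (f t) <= K, cabs (g t) <= K & cabs lf <= K].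
  exists (cabs (f t) + cabs (g t) + cabs lf + 1).
  by have := cabs_ge0 (f t); have := cabs_ge0 (g t); have := cabs_ge0 lf; split; lra.
have K0 : 0 < K by lra.
have e1 : 0 < e / (4 * K) by rewrite divr_gt0 // mulr_gt0.
have e3 : 0 < Num.min 1 (e / (4 * K)) by rewrite lt_min ltr01.
have [d1 d10 h1] := hf _ e1; have [d2 d20 h2] := hg _ e1.
have [d3 d30 h3] := cdiff_ccont hg e3.
exists (Num.min d1 (Num.min d2 d3)) => [|t']; first by rewrite !lt_min d10 d20.
rewrite !lt_min => /and3P[/h1 {}h1 /h2 {}h2 /h3 {}h3].
move: h3; rewrite lt_min => /andP[h3 h4].
set D := t' - t in h1 h2 *; set N := cabs D in h1 h2 *.
have e4 : e / (4 * K) * K = e / 4 by field; rewrite gt_eqF.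
have -> : f t' * g t' - f t * g t - (lf * g t + f t * lg) * D =
   (f t' - f t - lf * D) * g t + f t * (g t' - g t - lg * D) +
   ((f t' - f t - lf * D) * (g t' - g t) + (lf * D) * (g t' - g t)) by ring.
have N0 : 0 <= N by exact: cabs_ge0.
move: (e / (4 * K)) e1 e4 h1 h2 h4 => e' e1 e4 h1 h2 h4.
have e'N : e' * N * K = e / 4 * N by rewrite mulrAC e4.
have q1 : cabs ((f t' - f t - lf * D) * g t) <= e' * N * K.
  by apply: le_trans (cabsM _ _) _; apply: ler_pM; rewrite ?cabs_ge0.
have q2 : cabs (f t * (g t' - g t - lg * D)) <= K * (e' * N).
  by apply: le_trans (cabsM _ _) _; apply: ler_pM; rewrite ?cabs_ge0.
have q3 : cabs ((f t' - f t - lf * D) * (g t' - g t)) <= e' * N * K.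
  by apply: le_trans (cabsM _ _) _; apply: ler_pM; rewrite ?cabs_ge0 //; lra.
have q4 : cabs (lf * D * (g t' - g t)) <= K * N * e'.
  apply: le_trans (cabsM _ _) _; apply: ler_pM; rewrite ?cabs_ge0 //; last exact: ltW.
  by apply: le_trans (cabsM _ _) _; rewrite ler_wpM2r.
apply: le_trans (cabsD _ _) _; apply: le_trans (lerD (cabsD _ _) (cabsD _ _)) _; lra.
Qed.

Lemma cdiff_cst (b t : R[i]) : cdiff (fun=> b) t 0.
Proof. by move=> e e0; exists 1 => // t' _; rewrite subrr mul0r subr0 cabs0 mulr_ge0 ?cabs_ge0 // ltW. Qed.

Lemma cdiffB f g t lf lg : cdiff f t lf -> cdiff g t lg -> cdiff (fun x => f x - g x) t (lf - lg).
Proof.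
move=> hf hg e e0; have e2 : 0 < e / 2 by rewrite divr_gt0.
have [d1 d10 h1] := hf _ e2; have [d2 d20 h2] := hg _ e2.
exists (Num.min d1 d2) => [|t']; first by rewrite lt_min d10.
rewrite lt_min => /andP[/h1 {}h1 /h2 {}h2].
have -> : f t' - g t' - (f t - g t) - (lf - lg) * (t' - t) = (f t' - f t - lf * (t' - t)) - (g t' - g t - lg * (t' - t)) by ring.
by apply: le_trans (cabsB _ _) _; lra.
Qed.

Lemma cdiff_shift f t h l : cdiff f (t + h) l -> cdiff (fun x => f (x + h)) t l.
Proof.
move=> hf e e0; have [d d0 hd] := hf e e0; exists d => // t' ht.
have E : t' + h - (t + h) = t' - t by ring.
by have := hd (t' + h); rewrite E; apply.
Qed.

Lemma cdiff_inv (s t : R[i]) : t != s -> exists l, cdiff (fun x => (x - s)^-1) t l.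
Proof.
rewrite -subr_eq0 => ts; exists (- ((t - s) ^- 2)) => e e0; have c0 : 0 < cabs (t - s) by rewrite cabs_gt0.
set c := cabs (t - s) in c0; pose K := 4 / c * (2 / c) ^+ 2.
have K0 : 0 < K by rewrite mulr_gt0 ?exprn_gt0 ?divr_gt0.
exists (Num.min (c / 2) (e / K)) => [|t']; first by rewrite lt_min !divr_gt0.
rewrite lt_min ltr_pdivlMr // => /andP[h1 h2].
have h3 : c / 2 <= cabs (t' - s).
  have : c <= cabs (t' - s) + cabs (t' - t).
    have -> : c = cabs ((t' - s) - (t' - t)) by rewrite /c; congr cabs; ring.
    exact: cabsB.
  lra.
have ts' : t' - s != 0 by rewrite -cabs_gt0; lra.
have -> : (t' - s)^-1 - (t - s)^-1 - - ((t - s) ^- 2) * (t' - t) = (t' - t) * ((t' - t) * ((t' - s)^-1 * ((t - s)^-1 * (t - s)^-1))) by field; rewrite ts ts'.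
have i1 : cabs (t' - s)^-1 <= 4 / c.
  apply: le_trans (cabsV _) _; rewrite ler_pdivrMr; last by lra.
  by rewrite mulrAC ler_pdivlMr //; lra.
have i2 : cabs ((t - s)^-1 * (t - s)^-1) <= (2 / c) ^+ 2.
  by apply: le_trans (cabsM _ _) _; rewrite expr2; apply: ler_pM; rewrite ?cabs_ge0 //; exact: cabsV.
have i3 : cabs ((t' - s)^-1 * ((t - s)^-1 * (t - s)^-1)) <= K.
  by apply: le_trans (cabsM _ _) _; apply: ler_pM; rewrite ?cabs_ge0.
apply: le_trans (cabsM _ _) _; rewrite mulrC ler_wpM2r ?cabs_ge0 //.
rewrite ltr_pdivlMr // in h2; apply: le_trans (cabsM _ _) _; apply: le_trans (ltW h2).
by rewrite ler_wpM2l ?cabs_ge0.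
Qed.

(** The difference quotient at [s], completed by [g' s], is continuous at [s] and bounded by
    [4 M / r] on the annulus. *)
Lemma cauchy_derivative g g' s r M : 0 < r ->
  (forall t, cabs (t - s) <= 2 * r -> cdiff g t (g' t) /\ cabs (g t) <= M) -> cabs (g' s) <= 8 * M / r.
Proof.
move=> r0 hg; pose k t := if t == s then g' s else (g t - g s) * (t - s)^-1.
have s0 : cabs (s - s) <= 2 * r by rewrite subrr cabs0; lra.
have [gs Ms] := hg s s0.
have -> : g' s = k s by rewrite /k eqxx.
have -> : 8 * M / r = 2 * (4 * M / r) by field; rewrite gt_eqF.
apply: (center_estimate (r := r)) => //.
- move=> e e0; have e4 : 0 < e / 4 by rewrite divr_gt0.
  have [d d0 hd] := gs (e / 4) e4; exists d => // t td; rewrite /k eqxx.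
  have [_|ts] := eqVneq t s; first by rewrite subrr cabs0.
  have c0 : 0 < cabs (t - s) by rewrite cabs_gt0 subr_eq0.
  have tne : t - s != 0 by rewrite subr_eq0.
  have -> : (g t - g s) * (t - s)^-1 - g' s = (g t - g s - g' s * (t - s)) * (t - s)^-1 by field.
  apply: le_lt_trans (cabsM _ _) _.
  apply: (@le_lt_trans _ _ (e / 4 * cabs (t - s) * (2 / cabs (t - s)))).
    by apply: ler_pM; rewrite ?cabs_ge0 ?cabsV // hd.
  have -> : e / 4 * cabs (t - s) * (2 / cabs (t - s)) = e / 2 by field; rewrite gt_eqF.
  lra.
- move=> t /andP[t0 t2]; have ts : t != s by rewrite -subr_eq0 -cabs_gt0.
  have [gt _] := hg t t2; have [l hl] := cdiff_inv ts.
  have h := cdiffM (cdiffB gt (cdiff_cst (g s) t)) hl.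
  exists ((g' t - 0) * (t - s)^-1 + (g t - g s) * l).
  apply: (cdiff_eq t0 _ h) => t' ht'; rewrite /k ifF //.
  by apply: contraTF ht' => /eqP ->; rewrite cabs_distC ltxx.
move=> t /andP[t1 t2]; have [_ Mt] := hg t t2.
rewrite /k ifF; last by apply: contraTF t1 => /eqP ->; rewrite subrr cabs0 -ltNge.
have c0 : 0 < cabs (t - s) by lra.
apply: le_trans (cabsM _ _) _.
have q1 : cabs (g t - g s) <= 2 * M by apply: le_trans (cabsB _ _) _; lra.
have q2 : cabs (t - s)^-1 <= 2 / r.
  apply: le_trans (cabsV _) _; rewrite ler_pdivrMr // mulrAC ler_pdivlMr //; lra.
have -> : 4 * M / r = 2 * M * (2 / r) by field; rewrite gt_eqF.
by apply: ler_pM; rewrite ?cabs_ge0.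
Qed.

Lemma cdiff_increment (g g' : R[i] -> R[i]) t t' p e :
  (forall a : R, 0 <= a <= 1 -> cdiff g (t + a%:C * (t' - t)) (g' (t + a%:C * (t' - t))) /\
     cabs (g' (t + a%:C * (t' - t)) * (t' - t) - p) <= e) -> cabs (g t' - g t - p) <= 2 * e.
Proof.
move=> h; have := @cmvt _ (fun a : R => g (t + a%:C * (t' - t))) (fun a => g' (t + a%:C * (t' - t)) * (t' - t)) p 0 0 1 e ler01 _ _.
have e1 : t + 1%:C * (t' - t) = t' by rewrite rmorph1; ring.
have e0 : t + 0%:C * (t' - t) = t by rewrite rmorph0; ring.
have e2 : p * (1 - 0)%:C + 0 * ((1 ^+ 2 - 0 ^+ 2) / 2)%:C = p by rewrite subr0 rmorph1; ring.
rewrite e1 e0 e2 subr0 mulr1; apply => a ha.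
  by apply: cdiff_line; case: (h a ha).
by rewrite mul0r addr0; case: (h a ha).
Qed.

(** The Lipschitz bound on [g'] comes from two Cauchy estimates: the first bounds the quotient
    [(g (t + h) - g t) / h], and the second, applied to this quotient as a function of [t], bounds
    [(g' h - g' 0) / h]. *)
Theorem holomorphic_quadratic_remainder g g' rho M : 0 < rho ->
  (forall t, cabs t <= rho -> cdiff g t (g' t) /\ cabs (g t) <= M) ->
  forall t, cabs t <= rho / 8 -> cabs (g t - g 0 - g' 0 * t) <= 2 * (8 * (4 * (8 * M / (rho / 16))) / (rho / 16)) * cabs t ^+ 2.
Proof.
move=> rho0 hg; have r0 : 0 < rho / 16 by rewrite divr_gt0.
set r := rho / 16 in r0 *; set K := 8 * M / r; set Kq := 8 * (4 * K) / r.
have rr : rho = 16 * r by rewrite /r; field.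
have bd t : cabs t <= 8 * r -> cabs (g' t) <= K.
  move=> ht; apply: cauchy_derivative => // t' ht'; apply: hg.
  by have := cabsD (t' - t) t; rewrite subrK; lra.
have M0 : 0 <= M by have [|_ h] := hg 0; [rewrite cabs0; lra|apply: le_trans h; exact: cabs_ge0].
have K0 : 0 <= K by rewrite divr_ge0 ?mulr_ge0 // ltW.
have seg (t t' : R[i]) (a u : R) : 0 <= a <= 1 -> cabs t <= u -> cabs t' <= u -> cabs (t + a%:C * (t' - t)) <= u.
  move=> /andP[a0 a1] h1 h2; have -> : t + a%:C * (t' - t) = (1 - a)%:C * t + a%:C * t' by rewrite rmorphB; ring.
  apply: le_trans (cabsD _ _) _; rewrite !cabsZ !ger0_norm ?subr_ge0 //.
  have := ler_wpM2l a0 h2; have a1' : 0 <= 1 - a by lra.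
  by have := ler_wpM2l a1' h1; lra.
have lip t t' : cabs t <= 8 * r -> cabs t' <= 8 * r -> cabs (g t' - g t) <= 2 * (K * cabs (t' - t)).
  move=> ht ht'; rewrite -[g t' - g t]subr0; apply: (cdiff_increment (g' := g')) => a ha.
  have ua := seg _ _ a _ ha ht ht'; split; first by have [] := hg (t + a%:C * (t' - t)) ltac:(lra).
  by rewrite subr0; apply: le_trans (cabsM _ _) _; rewrite ler_wpM2r ?cabs_ge0 // bd.
have lip' h : cabs h <= 2 * r -> cabs (g' h - g' 0) <= Kq * cabs h.
  move=> hr; have [->|h0] := eqVneq h 0; first by rewrite subrr cabs0 mulr0.
  have c0 : 0 < cabs h by rewrite cabs_gt0.
  pose q t := h^-1 * (g (t + h) - g t - 0).
  have := @cauchy_derivative q (fun t => 0 * (g (t + h) - g t - 0) + h^-1 * (g' (t + h) - g' t - 0)) 0 r (4 * K) r0 _.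
  rewrite mul0r add0r add0r subr0 -/Kq => hq.
  have {}hq := hq _.
  have -> : g' h - g' 0 = h * (h^-1 * (g' h - g' 0)) by rewrite mulVKf.
  apply: le_trans (cabsM _ _) _; rewrite mulrC ler_wpM2r ?cabs_ge0 //; apply: hq => t; rewrite subr0 => ht.
  have th : cabs (t + h) <= 4 * r by have := cabsD t h; lra.
  split.
    apply: cdiffM; first exact: cdiff_cst.
    apply: cdiffB; last exact: cdiff_cst.
    by apply: cdiffB; [apply: cdiff_shift; have [] := hg (t + h) ltac:(lra)|have [] := hg t ltac:(lra)].
  rewrite /q subr0; apply: le_trans (cabsM _ _) _.
  apply: (@le_trans _ _ (2 / cabs h * (2 * (K * cabs h)))).
    apply: ler_pM; rewrite ?cabs_ge0 ?cabsV //.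
    by have := lip t (t + h) ltac:(lra) ltac:(lra); rewrite (_ : t + h - t = h) //; ring.
  by apply: le_of_eq; field; rewrite gt_eqF.
have Kq0 : 0 <= Kq by apply: divr_ge0; [apply: mulr_ge0; [done|exact: mulr_ge0]|exact: ltW].
move: lip' Kq0; move: Kq => {}Kq lip' Kq0.
move=> t ht; have := @cdiff_increment g g' 0 t (g' 0 * t) (Kq * cabs t * cabs t).
rewrite !subr0 => hh; apply: le_trans (hh _) _; last by apply: le_of_eq; ring.
move=> a ha; have ua : cabs (0 + a%:C * t) <= cabs t.
  by have := seg 0 t a (cabs t) ha; rewrite subr0 cabs0; apply => //; exact: cabs_ge0.
split; first by have [] := hg (0 + a%:C * t) ltac:(lra).
rewrite -mulrBl; apply: le_trans (cabsM _ _) _; rewrite ler_wpM2r ?cabs_ge0 //.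
apply: le_trans (lip' _ _) _; first by lra.
by rewrite ler_wpM2l.
Qed.
End EpsilonDerivatives.

(** * Normal sections *)

Section MoreContinuity.
Context {R : realType} {X : topologicalType}.

Lemma cont_inv (k : X -> R) x : continuous_at x k -> k x != 0 -> continuous_at x (fun y => (k y)^-1).
Proof. by move=> ck k0; exact: (@cvgV _ _ (nbhs x) _ _ (k x) k0 ck). Qed.

Lemma cont_sum (I : Type) (s : seq I) (F : I -> X -> R) x : (forall i, continuous_at x (F i)) ->
  continuous_at x (fun y => \sum_(i <- s) F i y).
Proof. by move=> h; exact: (@continuous_sumf R X R I s F x h). Qed.

Lemma cont_prod (I : Type) (s : seq I) (F : I -> X -> R) x : (forall i, continuous_at x (F i)) ->
  continuous_at x (fun y => \prod_(i <- s) F i y).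
Proof.
move=> h; elim: s => [|i s IH].
  by rewrite (_ : (fun y => _) = fun=> 1); [exact: cont_cst|apply/funext => y; rewrite big_nil].
rewrite (_ : (fun y => _) = fun y => F i y * \prod_(j <- s) F j y); first exact: cont_mul.
by apply/funext => y; rewrite big_cons.
Qed.

Lemma cont_det n (F : X -> 'M[R]_n) x : (forall i j, continuous_at x (fun y => F y i j)) ->
  continuous_at x (fun y => \det (F y)).
Proof.
move=> h; apply: cont_sum => s; apply: cont_mul; first exact: cont_cst.
by apply: cont_prod => i.
Qed.

Lemma cont_mx m n (F : X -> 'M[R]_(m, n)) x : (forall i j, continuous_at x (fun y => F y i j)) ->
  continuous_at x F.
Proof.
move=> h; apply/cvgrPdist_lt => e e0.
have H (ij : 'I_m * 'I_n) : \forall y \near x, `|F x ij.1 ij.2 - F y ij.1 ij.2| < e / 2.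
  by have /cvgrPdist_lt := h ij.1 ij.2; apply; rewrite divr_gt0.
have : \forall y \near x, forall ij, `|F x ij.1 ij.2 - F y ij.1 ij.2| < e / 2.
  exact: filter_forall.
apply: filterS => y hy; apply: (@le_lt_trans _ _ (e / 2)); last lra.
by apply: norm_mx_le => [|i j]; [lra|rewrite !mxE; exact/ltW/(hy (i, j))].
Qed.

Lemma cont_dot N (F G : X -> 'rV[R]_N) x : continuous_at x F -> continuous_at x G ->
  continuous_at x (fun y => dot (F y) (G y)).
Proof. by move=> cF cG; exact: dot_continuous. Qed.

Lemma cont_eps (V : normedModType R) (F : X -> V) x :
  (forall e : R, 0 < e -> \forall y \near x, `|F x - F y| < e) -> continuous_at x F.
Proof. by move=> h; apply/cvgrPdist_lt. Qed.

Lemma eq_near_cont (Y : topologicalType) (F G : X -> Y) x :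
  (\forall z \near x, G z = F z) -> continuous_at x G -> continuous_at x F.
Proof.
move=> e c; rewrite /continuous_at -(nbhs_singleton e); apply: cvg_trans c; apply: near_eq_cvg.
by apply: filterS e => z ->.
Qed.

Lemma cont_sqrt (F : X -> R) x : continuous_at x F -> continuous_at x (fun y => Num.sqrt (F y)).
Proof. by move=> cF; exact: (@continuous_comp _ _ _ F (@Num.sqrt R) x cF (@sqrt_continuous R _)). Qed.

Lemma cont_cofactor n (F : X -> 'M[R]_n) x i j : (forall i j, continuous_at x (fun y => F y i j)) ->
  continuous_at x (fun y => cofactor (F y) i j).
Proof.
move=> h; apply: cont_mul; first exact: cont_cst.
by apply: cont_det => k l; rewrite (_ : (fun y => _) = fun y => F y (fintype.lift i k) (fintype.lift j l)) //; apply/funext => y; rewrite !mxE.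
Qed.

End MoreContinuity.

Lemma dot_mulmx (R : realType) N (u v : 'rV[R]_N) : u *m v^T = (dot u v)%:M.
Proof. by apply/rowP => i; rewrite ord1 !mxE eqxx mulr1n; apply: eq_bigr => k _; rewrite mxE. Qed.

(** * Vector product of a frame and a normal *)

Section Cross.
Context {R : realType} {d : nat}.
Local Notation N := (d + (1 + 1))%N.
Implicit Types (M : 'M[R]_(d, N)) (v w : 'rV[R]_N).

Definition fmat M v w : 'M[R]_N := col_mx M (col_mx v w).
Definition ilast : 'I_N := rshift d (rshift 1 ord0).
(** The vector representing the functional that sends [w] to the determinant with rows [M], [v],
    [w]. *)
Definition cross M v : 'rV[R]_N := \row_j cofactor (fmat M v 0) ilast j.

Lemma fmat_last M v w j : fmat M v w ilast j = w 0 j.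
Proof. by rewrite /fmat !col_mxEd. Qed.

Lemma fmat_cofactor M v w j : cofactor (fmat M v w) ilast j = cofactor (fmat M v 0) ilast j.
Proof.
congr (_ * \det _); apply/matrixP => i k; rewrite !mxE.
have := neq_lift ilast i; case: splitP => // i'; rewrite !mxE; case: splitP => // i'' E1 E2 /eqP[].
by apply: ord_inj; rewrite E2 E1 ord1.
Qed.

Lemma det_fmat M v w : \det (fmat M v w) = dot (cross M v) w.
Proof.
rewrite (expand_det_row _ ilast); apply: eq_bigr => j _.
by rewrite fmat_last fmat_cofactor mxE mulrC.
Qed.

Lemma cross_v M v : dot (cross M v) v = 0.
Proof.
rewrite -det_fmat; apply: (@determinant_alternate _ _ _ (rshift d (lshift 1 ord0)) ilast).
  by rewrite -val_eqE /= eqn_add2l.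
by move=> j; rewrite fmat_last /fmat col_mxEd col_mxEu.
Qed.

Lemma cross_M M v k : dot (cross M v) (k *m M) = 0.
Proof.
have row0 i : dot (cross M v) (row i M) = 0.
  rewrite -det_fmat; apply: (@determinant_alternate _ _ _ (lshift (1 + 1) i) ilast).
    by rewrite -val_eqE /= neq_ltn ltn_addr ?ltn_ord.
  by move=> j; rewrite fmat_last /fmat col_mxEu mxE.
rewrite mulmx_sum_row; elim/big_ind: _ => [|x y hx hy|i _]; first exact: dot0r.
  by rewrite dotDr hx hy addr0.
by rewrite dotZr row0 mulr0.
Qed.

Lemma dot_ext v v' : (forall w, dot v w = dot v' w) -> v = v'.
Proof.
move=> h; apply/eqP; rewrite -subr_eq0 -dot_eq0; apply/eqP.
by rewrite dotDl dotNl h subrr.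
Qed.

(** Here orientation enters: a change of frame with positive determinant changes the product by a
    positive factor only. *)
Lemma cross_mul (J : 'M[R]_d) M v : cross (J *m M) v = \det J *: cross M v.
Proof.
apply: dot_ext => w; rewrite dotZl -!det_fmat.
have -> : fmat (J *m M) v w = block_mx J 0 0 1%:M *m fmat M v w.
  by rewrite /fmat mul_block_col !mul0mx addr0 add0r mul1mx.
by rewrite det_mulmx det_ublock det1 mulr1.
Qed.

Lemma cross_neq0 M v : row_free M -> v != 0 -> (forall k, dot v (k *m M) = 0) -> cross M v != 0.
Proof.
move=> fM v0 vM; have fA : row_free (col_mx M v).
  apply/row_freeP; have /row_freeP[K KM] := fM.
  pose a : 'cV[R]_N := (dot v v)^-1 *: v^T.
  have va : v *m a = 1%:M.
    by rewrite /a -scalemxAr dot_mulmx scale_scalar_mx mulVf // dot_eq0.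
  have Ma : M *m a = 0.
    apply/row_matrixP => i; rewrite row_mul row0 /a -scalemxAr dot_mulmx dotC.
    by rewrite rowE vM raddf0 scaler0.
  exists (row_mx (K - a *m (v *m K)) a).
  rewrite mul_col_row !mulmxBr (mulmxA M a) Ma mul0mx subr0 KM (mulmxA v a) va mul1mx subrr.
  by rewrite -scalar_mx_block.
have [w hw] : exists w : 'rV[R]_N, ~~ (w <= col_mx M v)%MS.
  have : ~~ row_full (col_mx M v).
    by rewrite /row_full (eqP fA) eqn_add2l.
  rewrite -sub1mx => /row_subPn[i hi]; by exists (row i 1%:M).
have : \det (fmat M v w) != 0.
  rewrite -unitfE -unitmxE -row_free_unit /row_free eqn_leq rank_leq_row /=.
  have E : (fmat M v w :=: col_mx M v + w)%MS.
    apply: eqmx_trans (eqmx_sym (addsmxE _ _)) _.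
    apply: eqmx_trans (adds_eqmx (eqmx_refl _) (eqmx_sym (addsmxE _ _))) _.
    by rewrite addsmxA; apply: adds_eqmx; [exact: addsmxE|exact: eqmx_refl].
  rewrite E; have : (col_mx M v < col_mx M v + w)%MS.
    by rewrite ltmxE addsmxSl /=; apply: contra hw; apply: submx_trans; exact: addsmxSr.
  by rewrite ltmxErank => /andP[_ hr]; have e := eqP fA; lia.
by rewrite det_fmat; apply: contraNneq => ->; rewrite dot0l.
Qed.
End Cross.

Lemma norm_tri (R : realType) m n (x y z : 'M[R]_(m, n)) e : `|x - y| < e / 2 -> `|y - z| < e / 2 -> `|x - z| < e.
Proof. by move=> h1 h2; have := ler_distD y x z; lra. Qed.

(** Discrete parallel transport along the ray from the origin: the vector is projected at each
    fraction [k/m] of the way, with steps too short for a projection to kill it. *)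
Lemma transport (R : realType) (N K : nat) (P : 'rV[R]_N -> 'M[R]_K) (v0 : 'rV[R]_K) (B : R) :
  0 <= B -> continuous P -> (forall y, P y *m P y = P y) -> v0 != 0 -> v0 *m P 0 = v0 ->
  exists2 nu : 'rV[R]_N -> 'rV[R]_K, continuous nu &
    forall x, `|x| <= B -> nu x != 0 /\ nu x *m P x = nu x.
Proof.
(* A vector killed in one step would satisfy [|v| <= K c |v|], while [K c < 1]. *)
move=> B0 cP idP v00 v0P; pose c : R := (2 * (K%:R + 1))^-1.
have KK : 0 < 2 * (K%:R + 1) :> R by rewrite mulr_gt0 // ltr_wpDl.
have c0 : 0 < c by rewrite invr_gt0.
have cK : [set v : 'rV[R]_N | forall i, `[- B, B]%classic (v ord0 i)] `<=>` [set x | `|x| <= B].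
  split=> x /= h; last first.
    by move=> i; rewrite in_itv /= -ler_norml; apply: le_trans h; exact: norm_mx_entry.
  by apply: norm_mx_le => // i j; rewrite ord1 ler_norml; have := h j; rewrite in_itv.
have compB : compact [set x : 'rV[R]_N | `|x| <= B].
  move/seteqP: cK => <-; apply: (@rV_compact _ N (fun=> `[- B, B]%classic)) => _; exact: segment_compact.
have [e e0 he] : exists2 e, 0 < e & forall x : 'rV[R]_N, `|x| <= B -> forall y, `|y - x| < e -> `|P y - P x| < c.
  apply: (compact_uniform_pos compB) => [x e e' h e'0 ee y hy|x _]; first exact/h/(lt_le_trans hy).
  have /cvgrPdist_lt/(_ (c / 2)) := @cP x; rewrite divr_gt0 // => /(_ isT).
  move/(proj1 (@near_normP R 'rV[R]_N x _)) => [e e0 h]; exists (e / 2); first by rewrite divr_gt0.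
  apply: (proj2 (@near_normP R 'rV[R]_N x _)); exists (e / 2) => [|y yx _ z zy]; first by rewrite divr_gt0.
  have h1 := h y ltac:(lra); have h2 : `|z - x| < e.
    exact: norm_tri zy yx.
  have h3 := h z h2; rewrite distrC in h3; exact: norm_tri h3 h1.
pose m := (Num.bound ((B + 1) / e)).+1.
have mB : B / m%:R < e.
  have m0 : 0 < m%:R :> R by rewrite ltr0n.
  rewrite ltr_pdivrMr // mulrC -ltr_pdivrMr //; apply: le_lt_trans (_ : (B + 1) / e < _).
    by rewrite ler_wpM2r ?lerDl // invr_ge0 ltW.
  apply: lt_trans (archi_boundP _) _; last by rewrite ltr_nat.
  by rewrite divr_ge0 ?addr_ge0 // ltW.
pose w := fix w k x := if k is k'.+1 then w k' x *m P ((k'.+1%:R / m%:R) *: x) else v0.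
exists (w m) => [x|x xB].
  suff : forall k, continuous (w k) by [].
  elim=> [|k IH] y; first exact: cont_cst.
  apply: mulmx_continuous; first exact: IH.
  apply: cont_comp; last exact: cP.
  by apply: cont_scale; [exact: cont_cst|exact: cont_id].
have m0 : m%:R != 0 :> R by rewrite pnatr_eq0.
suff : forall k, (k <= m)%N -> w k x != 0 /\ w k x *m P ((k%:R / m%:R) *: x) = w k x.
  by move=> /(_ m (leqnn m)); rewrite divff // scale1r.
elim=> [|k IH] km; first by rewrite mul0r scale0r.
have [w0 wP] := IH (ltnW km); split; last by rewrite /= -mulmxA idP.
move=> /=; move: (w k x) w0 wP => v v1 vP; apply/eqP => v2.
set x' := (k%:R / m%:R) *: x in vP; set y := _ *: x in v2.
have xB' : `|x'| <= B.
  rewrite normrZ ger0_norm ?divr_ge0 // -[leRHS]mul1r ler_pM ?divr_ge0 //.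
  by rewrite ler_pdivrMr ?ltr0n // mul1r ler_nat ltnW.
have yx : `|y - x'| < e.
  rewrite /y /x' -scalerBl -mulrBl -natrB // subSnn div1r normrZ ger0_norm ?invr_ge0 // mulrC.
  by apply: le_lt_trans mB; rewrite ler_wpM2r ?invr_ge0.
have hP := he x' xB' y yx; have : `|v| <= K%:R * (`|v| * c).
  have E : v = v *m (P x' - P y) by rewrite mulmxBr vP v2 subr0.
  rewrite {1}E; apply: le_trans (norm_mulmx _ _) _; rewrite ler_wpM2l // ler_wpM2l //.
  by rewrite distrC ltW.
have nv : 0 < `|v| by rewrite normr_gt0.
rewrite mulrCA -[leLHS]mulr1 ler_pM2l // /c; apply/negP; rewrite -ltNge ltr_pdivrMr //.
by have : 0 <= K%:R :> R by []; lra.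
Qed.

Lemma pair_proj (R : realType) K (E F : 'rV[R]_K) q : q != 0 -> dot E E = q -> dot F F = q -> dot E F = 0 ->
  let P := q^-1 *: (E^T *m E + F^T *m F) in P *m P = P /\ E *m P = E.
Proof.
move=> q0 EE FF EF P; have FE : dot F E = 0 by rewrite dotC.
have h1 : E *m P = E.
  by rewrite -scalemxAr mulmxDr !mulmxA !dot_mulmx EE EF raddf0 mul0mx addr0 mul_scalar_mx scalerA mulVf // scale1r.
have h2 : F *m P = F.
  by rewrite -scalemxAr mulmxDr !mulmxA !dot_mulmx FF FE raddf0 mul0mx add0r mul_scalar_mx scalerA mulVf // scale1r.
by split=> //; rewrite {1}/P -scalemxAl mulmxDl -!mulmxA h1 h2.
Qed.

Lemma dot_row_mx (R : realType) m n (a c : 'rV[R]_m) (b d : 'rV[R]_n) :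
  dot (row_mx a b) (row_mx c d) = dot a c + dot b d.
Proof. by rewrite /dot big_split_ord /=; congr (_ + _); apply: eq_bigr => i _; rewrite ?row_mxEl ?row_mxEr. Qed.

(** * A plane bundle over the ambient space extending the normal bundle *)

Section Normal.
Context {R : realType} {d : nat} {T : topologicalType}.
Local Notation N := (d + (1 + 1))%N.
Implicit Types (M : 'M[R]_(d, N)) (v w n : 'rV[R]_N).

(** For a normal [n], its quarter turn in the oriented normal plane, with the same length. *)
Definition perp M n : 'rV[R]_N := (Num.sqrt (dot n n) / Num.sqrt (dot (cross M n) (cross M n))) *: cross M n.

Lemma perp_mul (J : 'M[R]_d) M n : 0 < \det J -> perp (J *m M) n = perp M n.
Proof.
move=> J0; rewrite /perp cross_mul dotZl dotZr mulrA -expr2 sqrtrM ?sqr_ge0 // sqrtr_sqr gtr0_norm //.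
by rewrite scalerA invfM mulrA mulrAC divfK ?gt_eqF.
Qed.

Lemma perp_dot M n : cross M n != 0 -> dot (perp M n) (perp M n) = dot n n.
Proof.
move=> c0; rewrite /perp dotZl dotZr mulrA -expr2 exprMn exprVn !sqr_sqrtr ?dot_ge0 //.
by rewrite divfK // dot_eq0.
Qed.

Definition nproj M : 'M[R]_N := 1%:M - M^T *m invmx (M *m M^T) *m M.

Lemma gram_unit M : row_free M -> M *m M^T \in unitmx.
Proof.
move=> fM; rewrite -row_free_unit -kermx_eq0; apply/eqP/row_matrixP => i; rewrite row0.
set z := row i _; have zG : z *m (M *m M^T) = 0.
  by apply/eqP; rewrite -sub_kermx row_sub.
have : dot (z *m M) (z *m M) = 0.
  have := congr1 (fun A : 'M[R]_1 => A 0 0) (dot_mulmx (z *m M) (z *m M)).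
  by rewrite trmx_mul mulmxA -(mulmxA z) zG mul0mx !mxE eqxx mulr1n.
move/eqP; rewrite dot_eq0 => /eqP zM.
by apply: (row_free_inj fM); rewrite zM mul0mx.
Qed.

Lemma nproj_M M : row_free M -> M *m nproj M = 0.
Proof. by move=> fM; rewrite mulmxBr mulmx1 !mulmxA mulmxV ?gram_unit // mul1mx subrr. Qed.
Lemma M_nproj M : row_free M -> nproj M *m M^T = 0.
Proof. by move=> fM; rewrite mulmxBl mul1mx -!mulmxA mulVmx ?gram_unit // mulmx1 subrr. Qed.
Lemma nproj_id M v : (forall k, dot v (k *m M) = 0) -> v *m nproj M = v.
Proof.
move=> vM; rewrite mulmxBr mulmx1 !mulmxA (_ : v *m M^T = 0) ?mul0mx ?subr0 //.
apply/rowP => i; rewrite !mxE -[RHS](vM (delta_mx 0 i)) -rowE; apply: eq_bigr => j _.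
by rewrite !mxE.
Qed.
Lemma nproj_idem M : row_free M -> nproj M *m nproj M = nproj M.
Proof. move=> fM.
have h : (1%:M - M^T *m invmx (M *m M^T) *m M) *m nproj M = nproj M.
  by rewrite mulmxBl mul1mx -!mulmxA nproj_M // !mulmx0 subr0.
exact: h. Qed.

Lemma nproj_mul (J : 'M[R]_d) M : 0 < \det J -> row_free M -> row_free (J *m M) -> nproj (J *m M) = nproj M.
Proof.
move=> J0 fM fJM; have uJ : J \in unitmx by rewrite unitmxE unitfE gt_eqF.
have h1 : nproj (J *m M) *m nproj M = nproj M.
  by rewrite {1}/nproj mulmxBl mul1mx -!mulmxA nproj_M // !mulmx0 subr0.
have h2 : nproj (J *m M) *m M^T = 0.
  have := M_nproj fJM; rewrite trmx_mul mulmxA => /(congr1 (mulmx^~ (invmx J^T))).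
  by rewrite mul0mx -!mulmxA mulmxV ?unitmx_tr // mulmx1.
rewrite -[RHS]h1; transitivity (nproj (J *m M) *m (1%:M - M^T *m invmx (M *m M^T) *m M)) => //.
by rewrite mulmxBr mulmx1 !mulmxA h2 !mul0mx subr0.
Qed.

Variables (iot : T -> 'rV[R]_N) (r : 'rV[R]_N -> T) (et : R) (fr : T -> 'M[R]_(d, N) -> Prop).
Hypothesis T_compact : compact [set: T].
Hypothesis iot_cont : continuous iot.
Hypothesis et0 : 0 < et.
Hypothesis rK : forall x, r (iot x) = x.
Hypothesis rc : forall x (y : 'rV[R]_N), `|y - iot x| < et -> {for y, continuous r}.
Hypothesis orth : forall y M k, fr (r y) M -> dot (y - iot (r y)) (k *m M) = 0.
Hypothesis hmin : forall y x, dist2 iot y (r y) <= dist2 iot y x.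
Hypothesis fr_loc : forall p : T, exists Dm : T -> 'M[R]_(d, N),
  \forall x \near p, [/\ fr x (Dm x), row_free (Dm x) & continuous_at x Dm].
Hypothesis fr_tr : forall x M M', fr x M -> fr x M' -> exists2 J, 0 < \det J & M = J *m M'.

Let s2 y := dist2 iot y (r y).
Let nv y := y - iot (r y).
(** Where the squared distance to [T] is below this value, the retraction is continuous. *)
Let c1 : R := et ^+ 2.
Let c10 : 0 < c1. Proof. by rewrite exprn_gt0. Qed.

Lemma fr_ex x : exists2 M, fr x M & row_free M.
Proof. by have [Dm /nbhs_singleton[h1 h2 _]] := fr_loc x; exists (Dm x). Qed.

Lemma fr_free x M : fr x M -> row_free M.
Proof.
have [M' h1 f1] := fr_ex x => /fr_tr/(_ h1)[J J0 ->]; have /row_freeP[K KM] := f1.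
apply/row_freeP; exists (K *m invmx J); rewrite -!mulmxA (mulmxA M') KM mul1mx mulmxV //.
by rewrite unitmxE unitfE gt_eqF.
Qed.

(** The squared distance is continuous even where the nearest point jumps: each value is compared
    with the distance to the nearest point of the other. *)
Lemma s2_cont : continuous s2.
Proof.
have [B B0 hB] : exists2 B : R, 0 < B & forall x, `|iot x| <= B.
  have cN : {within [set: T], continuous (fun x => `|iot x|)}.
    by apply: continuous_subspaceT => x; apply: cont_norm; exact: iot_cont.
  have [|c _ hc] := compact_EVT_max _ T_compact cN; first by exists (r 0).
  exists (`|iot c| + 1) => [|x]; first by rewrite ltr_wpDl.
  by apply: le_trans (hc x _) _; rewrite ?in_setT // lerDl.
have key y y' : s2 y' - s2 y <= N%:R * (`|y' - y| * (`|y' - y| + 2 * (`|y| + B))).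
  have := hmin y' (r y); rewrite -/(s2 y') => h; apply: le_trans (lerB h (lexx _)) _.
  rewrite /s2 /dist2; set x := iot (r y).
  have -> : dot (y' - x) (y' - x) - dot (y - x) (y - x) = dot (y' - y) ((y' - y) + (2 : R) *: (y - x)).
    have -> : y' - x = (y' - y) + (y - x) by rewrite addrA subrK.
    by move: (y' - y) (y - x) => p q; rewrite !dotDl !dotDr dotZr (dotC q p); ring.
  apply: le_trans (ler_norm _) _; apply: le_trans (dot_norm _ _) _; rewrite ler_wpM2l // ler_wpM2l //.
  apply: le_trans (ler_normD _ _) _; rewrite lerD2l normrZ ger0_norm // ler_wpM2l //.
  by apply: le_trans (ler_normB _ _) _; rewrite lerD2l; exact: hB.
move=> y; apply: cont_eps => e e0.
pose K : R := N%:R * (1 + 2 * (`|y| + 1 + B)) + 1.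
have K0 : 0 < K by rewrite ltr_wpDl // mulr_ge0 // addr_ge0 // mulr_ge0 // !addr_ge0 // ltW.
have d0 : 0 < Num.min 1 (e / K) by rewrite lt_min ltr01 divr_gt0.
apply: (proj2 (@near_normP R 'rV[R]_N y _)); exists (Num.min 1 (e / K)) => // y'.
rewrite lt_min ltr_pdivlMr // => /andP[y1 yK]; apply: le_lt_trans yK.
have yy : `|y'| <= `|y| + 1.
  by rewrite -(subrK y y'); apply: le_trans (ler_normD _ _) _; rewrite addrC lerD2l ltW.
have bd (z : 'rV[R]_N) : `|z| <= `|y| + 1 -> N%:R * (`|y' - y| * (`|y' - y| + 2 * (`|z| + B))) <= `|y' - y| * K.
  move=> hz; rewrite mulrCA ler_wpM2l // /K; apply: (@le_trans _ _ (N%:R * (1 + 2 * (`|y| + 1 + B)))); last lra.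
  by rewrite ler_wpM2l //; lra.
rewrite ler_norml; have k1 := key y y'; have k2 := key y' y.
have b1 := bd y ltac:(lra); have b2 := bd y' yy; rewrite (distrC y y') in k2.
by apply/andP; split; lra.
Qed.

Lemma s2_lt y c : s2 y < c -> \forall z \near y, s2 z < c.
Proof. by move=> h; apply: (near_cont (Q := fun t => t < c) (@s2_cont y)); exact: lt_nbhsl. Qed.

Lemma s2_gt y c : c < s2 y -> \forall z \near y, c < s2 z.
Proof. by move=> h; apply: (near_cont (Q := fun t => c < t) (@s2_cont y)); exact: lt_nbhsr. Qed.

Lemma s2_tube y : s2 y < c1 -> {for y, continuous r}.
Proof.
move=> h; apply: (rc (x := r y)); rewrite -(@ltr_pXn2r _ 2) ?nnegrE ?(ltW et0) //.
exact: le_lt_trans (norm_dot _) h.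
Qed.

Lemma fr_near y : s2 y < c1 -> exists Dm : T -> 'M[R]_(d, N),
  \forall z \near y, [/\ fr (r z) (Dm (r z)), row_free (Dm (r z)) & continuous_at z (fun z => Dm (r z))].
Proof.
move=> h; have [Dm hD] := fr_loc (r y); exists Dm.
have near1 : \forall z \near y, s2 z < c1.
  exact: s2_lt.
have near2 := near_cont (s2_tube h) hD.
apply: filterS (filterI near1 near2) => z [z1 [h1 h2 h3]]; split=> //.
by apply: cont_comp; [exact: s2_tube|].
Qed.

Let frm x := projT1 (cid2 (fr_ex x)).
Let frmP x : fr x (frm x). Proof. by rewrite /frm; case: cid2. Qed.
Let np y := perp (frm (r y)) (nv y).

Lemma np_eq y M : fr (r y) M -> np y = perp M (nv y).
Proof. by move=> /(fr_tr (frmP (r y)))[J J0 E]; rewrite /np E perp_mul. Qed.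

Lemma nv_neq0 y : 0 < s2 y -> nv y != 0.
Proof. by apply: contraTneq => h; rewrite /s2 /dist2 -/(nv y) h dot0l ltxx. Qed.

Lemma crossn y M : 0 < s2 y -> fr (r y) M -> cross M (nv y) != 0.
Proof. by move=> /nv_neq0 n0 hM; apply: cross_neq0 => // [|k]; [exact: fr_free hM|exact: orth]. Qed.

Lemma nv_cont y : s2 y < c1 -> continuous_at y nv.
Proof. by move=> h; apply: cont_sub; [exact: cont_id|apply: cont_comp; [exact: s2_tube|exact: iot_cont]]. Qed.

Lemma cross_cont (X : topologicalType) (F : X -> 'M[R]_(d, N)) (G : X -> 'rV[R]_N) x :
  continuous_at x F -> continuous_at x G -> continuous_at x (fun y => cross (F y) (G y)).
Proof.
move=> cF cG; apply: cont_mx => i j; rewrite (_ : (fun y => _) = fun y => cofactor (fmat (F y) (G y) 0) ilast j); last first.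
  by apply/funext => y; rewrite mxE.
apply: cont_cofactor => k l; rewrite /fmat; case: (split_ordP k) => k' ->.
  rewrite (_ : (fun y => _) = fun y => F y k' l); first exact: cont_entry.
  by apply/funext => y; rewrite col_mxEu.
case: (split_ordP k') => k'' ->.
  rewrite (_ : (fun y => _) = fun y => G y k'' l); first exact: cont_entry.
  by apply/funext => y; rewrite col_mxEd col_mxEu.
rewrite (_ : (fun y => _) = fun=> 0); first exact: cont_cst.
by apply/funext => y; rewrite !col_mxEd mxE.
Qed.

Lemma np_cont y : 0 < s2 y -> s2 y < c1 -> continuous_at y np.
Proof.
move=> h0 h1; have [Dm hD] := fr_near h1; have [f1 f2 f3] := nbhs_singleton hD.
have cn := nv_cont h1; have cc := cross_cont f3 cn.
have cp : continuous_at y (fun z => perp (Dm (r z)) (nv z)).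
  apply: cont_scale => //; apply: cont_mul.
    by apply: (@cont_sqrt _ _ (fun z => dot (nv z) (nv z))); exact: cont_dot.
  apply: cont_inv; last by rewrite sqrtr_eq0 -ltNge dot_gt0 // crossn.
  by apply: (@cont_sqrt _ _ (fun z => dot (cross (Dm (r z)) (nv z)) (cross (Dm (r z)) (nv z)))); exact: cont_dot.
have e : \forall z \near y, perp (Dm (r z)) (nv z) = np z.
  by apply: filterS hD => z [h _ _]; rewrite (np_eq h).
exact: eq_near_cont e cp.
Qed.

Lemma np_norm y : 0 < s2 y -> [/\ dot (np y) (np y) = s2 y, dot (nv y) (np y) = 0 &
  forall M k, fr (r y) M -> dot (np y) (k *m M) = 0].
Proof.
move=> h0; split.
- by rewrite (np_eq (frmP _)) perp_dot // crossn.
- by rewrite (np_eq (frmP _)) /perp dotZr dotC cross_v mulr0.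
by move=> M k hM; rewrite (np_eq hM) /perp dotZl cross_M mulr0.
Qed.

(** Cut-offs for gluing: [af] vanishes where the retraction may be discontinuous, [bf] vanishes near
    [T], and they are never both zero. *)
Let af y := Num.max 0 (c1 - s2 y).
Let bf y := Num.max 0 (s2 y - c1 / 2).
Let E1 y : 'rV[R]_(N + 2) := row_mx (af y *: nv y) (bf y *: delta_mx 0 0).
Let E2 y : 'rV[R]_(N + 2) := row_mx (af y *: np y) (bf y *: delta_mx 0 1).
Let qf y := af y ^+ 2 * s2 y + bf y ^+ 2.
(** Projections onto planes in a space with two extra axes: the normal plane near [T], the plane of
    the new axes far away, and in between the span of [E1] and [E2], which are orthogonal and of
    equal length. *)
Let P y : 'M[R]_(N + 2) := if s2 y < c1 / 2 then block_mx (nproj (frm (r y))) 0 0 0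
  else (qf y)^-1 *: ((E1 y)^T *m E1 y + (E2 y)^T *m E2 y).

Let Pf y : 'M[R]_(N + 2) := (qf y)^-1 *: ((E1 y)^T *m E1 y + (E2 y)^T *m E2 y).

Lemma qf_gt0 y : 0 < s2 y -> 0 < qf y.
Proof.
move=> h0; rewrite /qf /af /bf; case: (ltP (s2 y) c1) => h.
  rewrite (max_idPr _) ?subr_ge0 ?(ltW h) // ltr_wpDr ?sqr_ge0 // mulr_gt0 // exprn_gt0 // subr_gt0 //.
have : 0 < s2 y - c1 / 2 by have := c10; lra.
move=> hb; rewrite (max_idPr (ltW hb)) ltr_wpDl ?exprn_gt0 // mulr_ge0 ?sqr_ge0 // ltW //.
Qed.

Lemma outer_scale (a : R) n : (a *: n)^T *m (a *: n) = a ^+ 2 *: (n^T *m n).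
Proof. by apply/matrixP => i j; rewrite !mxE !big_ord1 !mxE; ring. Qed.

Lemma E_dot (a b : R) n m (i j : 'I_2) :
  dot (row_mx (a *: n) (b *: (delta_mx 0 i : 'rV[R]_2))) (row_mx (a *: m) (b *: (delta_mx 0 j : 'rV[R]_2))) =
  a ^+ 2 * dot n m + b ^+ 2 * (i == j)%:R.
Proof.
rewrite dot_row_mx !dotZl !dotZr !mulrA -!expr2; congr (_ + _ * _).
rewrite /dot (bigD1 i) //= big1 ?addr0 => [|k ki]; first by rewrite !mxE !eqxx mul1r.
by rewrite !mxE (negbTE ki) andbF mul0r.
Qed.

Lemma E_dots y : 0 < s2 y -> [/\ dot (E1 y) (E1 y) = qf y, dot (E2 y) (E2 y) = qf y & dot (E1 y) (E2 y) = 0].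
Proof.
move=> h0; have [h1 h2 _] := np_norm h0; rewrite !E_dot; split.
- by rewrite eqxx mulr1.
- by rewrite h1 eqxx mulr1.
- by rewrite h2 /= !mulr0 addr0.
Qed.

(** Where [bf] vanishes both formulas are the orthogonal projection onto the normal plane; they are
    compared on the basis made of the frame, [nv y] and [np y]. *)
Lemma Pf_eq y : 0 < s2 y -> P y = Pf y.
Proof.
move=> h0; rewrite /P; case: ltP => // h1; have [a1 a2 a3] := np_norm h0.
have ha : 0 < af y by rewrite /af lt_max subr_gt0; apply/orP; right; have := c10; lra.
have hb : bf y = 0 by rewrite /bf (max_idPl _) // subr_le0 ltW.
have fM := frmP (r y); set M := frm (r y) in fM *; have frM := fr_free fM.
have -> : Pf y = block_mx ((s2 y)^-1 *: ((nv y)^T *m nv y + (np y)^T *m np y)) 0 0 0.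
  rewrite /Pf /E1 /E2 /qf hb !scale0r !tr_row_mx !mul_col_row !trmx0 !mul0mx !mulmx0 add_block_mx !addr0.
  rewrite scale_block_mx !scaler0; congr (block_mx _ 0 0 0).
  rewrite !outer_scale -scalerDr scalerA; congr (_ *: _).
  by field; rewrite !gt_eqF.
congr (block_mx _ 0 0 0); have uA : fmat M (nv y) (np y) \in unitmx.
  rewrite unitmxE unitfE det_fmat (np_eq fM) /perp dotZr mulf_neq0 ?mulf_neq0 ?dot_eq0 ?crossn //.
    by rewrite sqrtr_eq0 -ltNge.
  by rewrite invr_eq0 sqrtr_eq0 -ltNge dot_gt0 // crossn.
suff E : fmat M (nv y) (np y) *m nproj M = fmat M (nv y) (np y) *m ((s2 y)^-1 *: ((nv y)^T *m nv y + (np y)^T *m np y)).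
  by rewrite -[LHS](mulKmx uA) E mulKmx.
have o1 k : dot (nv y) (k *m M) = 0 by exact: orth.
have o2 k : dot (np y) (k *m M) = 0 by exact: a3.
have Mv v : (forall k, dot v (k *m M) = 0) -> M *m v^T = 0.
  by move=> h; apply/row_matrixP => i; rewrite row_mul row0 dot_mulmx dotC rowE h raddf0.
have np0 : dot (np y) (nv y) = 0 by rewrite dotC.
have s0 : s2 y != 0 by rewrite gt_eqF.
have nn : dot (nv y) (nv y) = s2 y by [].
rewrite /fmat !mul_col_mx; congr (col_mx _ (col_mx _ _)).
- by rewrite nproj_M // -scalemxAr mulmxDr !mulmxA !Mv // !mul0mx addr0 scaler0.
- by rewrite nproj_id // -scalemxAr mulmxDr !mulmxA !dot_mulmx a2 nn raddf0 mul0mx addr0 mul_scalar_mx scalerA mulVf // scale1r.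
- by rewrite nproj_id // -scalemxAr mulmxDr !mulmxA !dot_mulmx np0 a1 raddf0 mul0mx add0r mul_scalar_mx scalerA mulVf // scale1r.
Qed.

Lemma nproj_frm y M : fr (r y) M -> nproj (frm (r y)) = nproj M.
Proof.
move=> hM; have [J J0 E] := fr_tr (frmP (r y)) hM; rewrite E nproj_mul //; first exact: fr_free hM.
by rewrite -E; exact: fr_free (frmP _).
Qed.

Lemma P_idem y : P y *m P y = P y.
Proof.
have [h0|h0] := ltP 0 (s2 y).
  rewrite Pf_eq //; have [a1 a2 a3] := E_dots h0.
  by have [] := pair_proj (lt0r_neq0 (qf_gt0 h0)) a1 a2 a3.
rewrite /P; case: (ltP (s2 y) (c1 / 2)) => [_|hc]; last by exfalso; have := c10; lra.
by rewrite mulmx_block !mul0mx !mulmx0 !addr0 nproj_idem //; exact: fr_free (frmP _).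
Qed.

Lemma cont_row_mx (X : topologicalType) m k (F : X -> 'rV[R]_m) (G : X -> 'rV[R]_k) x :
  continuous_at x F -> continuous_at x G -> continuous_at x (fun y => row_mx (F y) (G y)).
Proof.
move=> cF cG; apply: cont_mx => i j; case: (split_ordP j) => l ->.
  by rewrite (_ : (fun y => _) = fun y => F y i l); [exact: cont_entry|apply/funext => y; rewrite row_mxEl].
by rewrite (_ : (fun y => _) = fun y => G y i l); [exact: cont_entry|apply/funext => y; rewrite row_mxEr].
Qed.

Lemma cont_tr (X : topologicalType) m k (F : X -> 'M[R]_(m, k)) x :
  continuous_at x F -> continuous_at x (fun y => (F y)^T).
Proof. by move=> cF; apply: cont_mx => i j; rewrite (_ : (fun y => _) = fun y => F y j i); [exact: cont_entry|apply/funext => y; rewrite mxE]. Qed.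

Lemma cont_max0 (X : topologicalType) (F : X -> R) x : continuous_at x F -> continuous_at x (fun y => Num.max 0 (F y)).
Proof. by move=> cF; apply: (@continuous_max _ _ (fun=> 0) F x) => //; exact: cont_cst. Qed.

(** Where [s2 y] is at least [c1] the vector [g] may jump, but it stays locally bounded and its
    factor [af] tends to zero. *)
Lemma af_scale_cont (g : 'rV[R]_N -> 'rV[R]_N) y : 0 < s2 y ->
  (forall z, 0 < s2 z -> dot (g z) (g z) = s2 z) -> (s2 y < c1 -> continuous_at y g) ->
  continuous_at y (fun z => af z *: g z).
Proof.
move=> h0 gn gc; have ca : continuous_at y af.
  by apply: cont_max0; apply: cont_sub; [exact: cont_cst|exact: s2_cont].
have [h1|h1] := ltP (s2 y) c1; first by apply: cont_scale => //; exact: gc.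
have a0 : af y = 0 by rewrite /af (max_idPl _) // subr_le0.
apply: cont_eps => e e0.
have n1 : \forall z \near y, 0 < s2 z.
  exact: s2_gt.
have k0 : 0 < e / (s2 y + 2) by rewrite divr_gt0 // addr_gt0.
have n2 : \forall z \near y, s2 z < s2 y + 1.
  by apply: s2_lt; rewrite ltrDl.
have /cvgrPdist_lt/(_ _ k0) n3 := ca.
apply: filterS (filterI n1 (filterI n2 n3)) => z [z1 [z2]]; rewrite a0 sub0r normrN scale0r sub0r normrN => z3.
have sy : 0 < s2 y + 2 by rewrite addr_gt0.
rewrite normrZ; apply: le_lt_trans (_ : `|af z| * (s2 y + 2) < e); last by rewrite -ltr_pdivlMr.
rewrite ler_wpM2l //; have := norm_dot (g z); rewrite gn // => hh; have : 0 <= `|g z| by []; nra.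
Qed.

Lemma P_cont : continuous P.
Proof.
move=> y; have [h1|h1] := ltP (s2 y) (c1 / 2).
  have [|Dm hD] := fr_near (y := y); first by have := c10; lra.
  have [_ _ f3] := nbhs_singleton hD.
  apply: (@eq_near_cont _ _ _ (fun z => block_mx (1%:M - (Dm (r z))^T *m invmx (Dm (r z) *m (Dm (r z))^T) *m Dm (r z)) 0 0 0)).
    have near1 : \forall z \near y, s2 z < c1 / 2.
      exact: s2_lt.
    by apply: filterS (filterI hD near1) => z [[z1 z2 z3] z4]; rewrite /P z4 (nproj_frm z1).
  have cn : continuous_at y (fun z => 1%:M - (Dm (r z))^T *m invmx (Dm (r z) *m (Dm (r z))^T) *m Dm (r z)).
    apply: cont_sub; first exact: cont_cst.
    apply: mulmx_continuous => //; apply: mulmx_continuous; first exact: cont_tr.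
    have [_ f2 _] := nbhs_singleton hD.
    have cG : continuous_at y (fun z => Dm (r z) *m (Dm (r z))^T) by apply: mulmx_continuous => //; exact: cont_tr.
    apply: cont_mx => i j.
    apply: (@eq_near_cont _ _ _ (fun z => (\det (Dm (r z) *m (Dm (r z))^T))^-1 * cofactor (Dm (r z) *m (Dm (r z))^T) j i)).
      by apply: filterS hD => z [_ z2 _]; rewrite /invmx gram_unit // !mxE.
    have ce k l := cont_entry (i := k) (j := l) cG.
    apply: cont_mul; last exact: cont_cofactor.
    by apply: cont_inv; [exact: cont_det|have := gram_unit f2; rewrite unitmxE unitfE].
  apply: cont_mx => i j; case: (split_ordP i) => i' ->; case: (split_ordP j) => j' ->.
  - rewrite (_ : (fun z => _) = fun z => (1%:M - (Dm (r z))^T *m invmx (Dm (r z) *m (Dm (r z))^T) *m Dm (r z)) i' j'); first exact: cont_entry.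
    by apply/funext => z; rewrite block_mxEul.
  - by rewrite (_ : (fun z => _) = fun=> 0); [exact: cont_cst|apply/funext => z; rewrite block_mxEur mxE].
  - by rewrite (_ : (fun z => _) = fun=> 0); [exact: cont_cst|apply/funext => z; rewrite block_mxEdl mxE].
  - by rewrite (_ : (fun z => _) = fun=> 0); [exact: cont_cst|apply/funext => z; rewrite block_mxEdr mxE].
have h0 : 0 < s2 y by have := c10; lra.
apply: (@eq_near_cont _ _ _ Pf).
  have n1 : \forall z \near y, 0 < s2 z.
    exact: s2_gt.
  by apply: filterS n1 => z z1; rewrite Pf_eq.
have ca : continuous_at y af by apply: cont_max0; apply: cont_sub; [exact: cont_cst|exact: s2_cont].
have cb : continuous_at y bf by apply: cont_max0; apply: cont_sub; [exact: s2_cont|exact: cont_cst].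
have cE1 : continuous_at y E1.
  apply: cont_row_mx; last by apply: cont_scale => //; exact: cont_cst.
  by apply: af_scale_cont => // h; exact: nv_cont.
have cE2 : continuous_at y E2.
  apply: cont_row_mx; last by apply: cont_scale => //; exact: cont_cst.
  by apply: af_scale_cont => // [z z0|h]; [have [] := np_norm z0|exact: np_cont].
apply: cont_scale; last by apply: cont_add; apply: mulmx_continuous => //; exact: cont_tr.
apply: cont_inv; last by rewrite gt_eqF // qf_gt0.
by apply: cont_add; [apply: cont_mul; [exact: cont_mul|exact: s2_cont]|exact: cont_mul].
Qed.

Lemma P_fix : exists2 v : 'rV[R]_(N + 2), v != 0 & v *m P 0 = v.
Proof.
have [h0|h0] := ltP 0 (s2 0).
  have [a1 a2 a3] := E_dots h0; exists (E1 0); first by rewrite -dot_eq0 a1 gt_eqF // qf_gt0.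
  by rewrite Pf_eq //; have [] := pair_proj (lt0r_neq0 (qf_gt0 h0)) a1 a2 a3.
have fM := frmP (r 0); have frM := fr_free fM.
have [i hi] : exists i, row i (nproj (frm (r 0))) != 0.
  apply: contrapT => hn; have z : nproj (frm (r 0)) = 0.
    by apply/row_matrixP => i; rewrite row0; apply: contrapT => h; apply: hn; exists i; exact/eqP.
  have : (\rank (1%:M : 'M[R]_N) <= d)%N.
    move/eqP: z; rewrite /nproj subr_eq0 => /eqP ->.
    by apply: leq_trans (mxrankM_maxr _ _) _; exact: rank_leq_row.
  by rewrite mxrank1; lia.
exists (row_mx (row i (nproj (frm (r 0)))) 0).
  by apply: contra hi => /eqP/(congr1 lsubmx); rewrite row_mxKl linear0 => ->.
rewrite /P; case: (ltP (s2 0) (c1 / 2)) => [_|hc]; last by exfalso; have := c10; lra.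
by rewrite mul_row_block !mulmx0 ?mul0mx !addr0 -row_mul nproj_idem.
Qed.

(** On [T] the projection is the normal one with zero on the new axes, so a transported nonzero
    vector fixed by it is a normal vector. *)
Theorem normal_section : exists nu : T -> 'rV[R]_N, [/\ continuous nu, (forall x, nu x != 0) &
  forall x M k, fr x M -> dot (nu x) (k *m M) = 0].
Proof.
have [v v0 vP] := P_fix.
have [B B0 hB] : exists2 B : R, 0 <= B & forall x, `|iot x| <= B.
  have cN : {within [set: T], continuous (fun x => `|iot x|)}.
    by apply: continuous_subspaceT => x; apply: cont_norm; exact: iot_cont.
  have [|c _ hc] := compact_EVT_max _ T_compact cN; first by exists (r 0).
  by exists `|iot c| => // x; apply: hc; rewrite in_setT.
have [w cw hw] := transport B0 P_cont P_idem v0 vP.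
have nui x : w (iot x) = row_mx (lsubmx (w (iot x))) 0 /\ lsubmx (w (iot x)) *m nproj (frm x) = lsubmx (w (iot x)).
  have [_] := hw _ (hB x); rewrite /P; have -> : s2 (iot x) = 0 by rewrite /s2 rK /dist2 subrr dot0l.
  rewrite divr_gt0 // rK -{1 2}[w (iot x)]hsubmxK mul_row_block !mulmx0 !addr0 => E.
  have [E1' E2'] := eq_row_mx E; split; last by [].
  by rewrite -[LHS]hsubmxK -E2'.
exists (fun x => lsubmx (w (iot x))); split.
- move=> x; apply: cont_mx => i j; rewrite (_ : (fun y => _) = fun y => w (iot y) i (lshift 2 j)).
    by apply: cont_entry; apply: cont_comp; [exact: iot_cont|exact: cw].
  by apply/funext => y; rewrite mxE.
- move=> x; have [h _] := hw _ (hB x); apply: contra h => /eqP h.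
  by have [-> _] := nui x; rewrite h row_mx0.
move=> x M k hM; have [_ <-] := nui x; have := nproj_frm (y := iot x) (M := M); rewrite rK => -> //.
have : (lsubmx (w (iot x)) *m nproj M) *m (k *m M)^T = 0.
  by rewrite trmx_mul !mulmxA -(mulmxA _ (nproj M)) M_nproj ?mulmx0 ?mul0mx //; exact: fr_free hM.
by rewrite dot_mulmx => /(congr1 (fun A : 'M[R]_1 => A 0 0)); rewrite !mxE eqxx mulr1n.
Qed.
End Normal.

(** The dimension [n + n] of the application equals [d + 2] only up to a proof, hence the
    restatement with an equation. *)
Theorem normal_section_gen (R : realType) (d N : nat) (eN : N = (d + (1 + 1))%N) (T : topologicalType)
  (iot : T -> 'rV[R]_N) (r : 'rV[R]_N -> T) (et : R) (fr : T -> 'M[R]_(d, N) -> Prop) :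
  compact [set: T] -> continuous iot -> 0 < et -> (forall x, r (iot x) = x) ->
  (forall x (y : 'rV[R]_N), `|y - iot x| < et -> {for y, continuous r}) ->
  (forall y M k, fr (r y) M -> dot (y - iot (r y)) (k *m M) = 0) ->
  (forall y x, dist2 iot y (r y) <= dist2 iot y x) ->
  (forall p : T, exists Dm : T -> 'M[R]_(d, N),
    \forall x \near p, [/\ fr x (Dm x), row_free (Dm x) & continuous_at x Dm]) ->
  (forall x M M', fr x M -> fr x M' -> exists2 J, 0 < \det J & M = J *m M') ->
  exists nu : T -> 'rV[R]_N, [/\ continuous nu, (forall x, nu x != 0) &
  forall x M k, fr x M -> dot (nu x) (k *m M) = 0].
Proof. by subst N => *; exact: (normal_section (r := r) (et := et)). Qed.

(** * Submanifolds of complex space *)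

Import complex.ComplexField.

(** * Complex space as a real normed space *)

Section Realification.
Context {R : realType}.
Implicit Types (c z : R[i]).

Lemma norm_le_cabs c : `|c| <= (cabs c)%:C.
Proof.
rewrite normc_def lecR -[leRHS]ger0_norm ?cabs_ge0 // -sqrtr_sqr ler_sqrt ?sqr_ge0 //.
case: c => a b /=; rewrite /cabs /= sqrrD -!normrX !(ger0_norm (sqr_ge0 _)).
by rewrite lerD2r lerDl mulrn_wge0 // mulr_ge0.
Qed.

Lemma cabs_le_norm c (e : R) : `|c| <= e%:C -> cabs c <= 2 * e.
Proof.
rewrite normc_def lecR => h.
have hb (x y : R) : x ^+ 2 <= x ^+ 2 + y ^+ 2 by rewrite lerDl sqr_ge0.
have h1 : `|complex.Re c| <= e.
  by apply: le_trans h; rewrite -sqrtr_sqr ler_sqrt ?addr_ge0 ?sqr_ge0.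
have h2 : `|complex.Im c| <= e.
  by apply: le_trans h; rewrite -sqrtr_sqr ler_sqrt ?addr_ge0 ?sqr_ge0 // addrC.
by rewrite /cabs; lra.
Qed.

Context {n : nat}.

Definition cplx (y : 'rV[R]_(n + n)) : 'rV[C R]_n := \row_j Complex (y 0 (lshift n j)) (y 0 (rshift n j)).

Lemma realifyK : cancel (@realify R n) cplx.
Proof.
move=> z; apply/rowP => j; rewrite mxE /realify row_mxEl row_mxEr !mxE.
by case: (z 0 j).
Qed.

Lemma cplxK : cancel cplx (@realify R n).
Proof.
move=> y; apply/rowP => j; rewrite /realify; case: (split_ordP j) => k ->.
  by rewrite row_mxEl !mxE.
by rewrite row_mxEr !mxE.
Qed.

Lemma realify_inj : injective (@realify R n). Proof. exact: can_inj realifyK. Qed.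

Lemma realifyB (z w : 'rV[C R]_n) : realify (z - w) = realify z - realify w.
Proof.
by rewrite /realify opp_row_mx add_row_mx; congr row_mx; apply/rowP => k; rewrite !mxE;
  case: (z 0 k) => ? ?; case: (w 0 k).
Qed.

Lemma realify_cabs (z w : 'rV[C R]_n) j : cabs (z 0 j - w 0 j) <= 2 * `|realify z - realify w|.
Proof.
rewrite -realifyB; have h1 := norm_mx_entry (realify (z - w)) 0 (lshift n j).
have h2 := norm_mx_entry (realify (z - w)) 0 (rshift n j).
move: h1 h2; rewrite {1 3}/realify row_mxEl row_mxEr ![map_mx _ _ _ _]mxE !mxE => h1 h2.
by rewrite /cabs; lra.
Qed.

(** Passage from balls with radii in [R[i]] to real radii. *)
Lemma nbhsCP (p : 'rV[C R]_n) (P : 'rV[C R]_n -> Prop) :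
  (\forall z \near p, P z) <-> exists2 e : R, 0 < e & forall z : 'rV[C R]_n, `|realify z - realify p| < e -> P z.
Proof.
split=> [/nbhs_ballP[e /= e0 he]|[e e0 he]].
  have [a a0 ea] : exists2 a : R, 0 < a & e = a%:C.
    by case: e e0 {he} => a b; rewrite ltcE /= => /andP[/eqP -> a0]; exists a.
  exists (a / 2) => [|z hz]; first by rewrite divr_gt0.
  apply: he; split=> [|i j]; first by rewrite ea ltcR.
  rewrite ord1 ea; apply: le_lt_trans (norm_le_cabs _) _; rewrite ltcR.
  by apply: le_lt_trans (realify_cabs _ _ _) _; rewrite distrC; lra.
apply/nbhs_ballP; exists (e / 2)%:C; first by rewrite /= ltcR divr_gt0.
move=> z [_ hz]; apply: he; apply: (@le_lt_trans _ _ (e / 2)); last lra.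
have hz' j : `|z 0 j - p 0 j| < (e / 2)%:C by rewrite distrC; exact: (hz 0 j).
rewrite -realifyB; apply: norm_mx_le => [|i j]; first lra.
rewrite ord1 /realify; case: (split_ordP j) => k ->.
  rewrite row_mxEl !mxE -lecR; apply: le_trans (normc_ge_Re _) _; exact: ltW (hz' k).
rewrite row_mxEr !mxE -lecR; apply: le_trans (ltW (hz' k)); rewrite normc_def lecR -sqrtr_sqr.
by rewrite ler_sqrt ?addr_ge0 ?sqr_ge0 // lerDr sqr_ge0.
Qed.
End Realification.

Lemma near_forall (X : topologicalType) (I : finType) (x : X) (P : I -> X -> Prop) :
  (forall i, \forall y \near x, P i y) -> \forall y \near x, forall i, P i y.
Proof. by move=> h; exact: filter_forall. Qed.

Section Smoothness.
Context {R : realType} {d N : nat}.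

Lemma diff_eps (K : numFieldType) (V W : normedModType K) (f : V -> W) a : differentiable f a ->
  forall e : K, 0 < e -> \forall h \near (0 : V), `|f (h + a) - (f a + 'd f a h)| <= e * `|h|.
Proof. by move=> /diff_locally/eqaddoP h e e0; exact: (h e e0). Qed.

Lemma line_derive (f : 'rV[R]_d -> 'rV[R]_N) x h j : differentiable f x ->
  is_derive (0 : R) 1 (fun t => f (x + t *: h) 0 j) ('D_h f x 0 j).
Proof.
move=> df; apply: eps_deriv => e e0.
have e1 : 0 < e / (`|h| + 1) by rewrite divr_gt0 // ltr_wpDl.
have /(proj1 (@near_normP R 'rV[R]_d 0 _))[r r0 hr] := diff_eps df e1.
exists (r / (`|h| + 1)) => [|s sr]; first by rewrite divr_gt0 // ltr_wpDl.
have h1 : 0 < `|h| + 1 by rewrite ltr_wpDl.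
have sh : `|s *: h - 0| < r.
  rewrite subr0 normrZ; apply: le_lt_trans (_ : `|s| * (`|h| + 1) < _).
    by rewrite ler_wpM2l // lerDl.
  by rewrite -ltr_pdivlMr.
have := hr _ sh; rewrite linearZ /= -deriveE // => hh.
rewrite add0r scale0r addr0.
have -> : f (x + s *: h) 0 j - f x 0 j - 'D_h f x 0 j * s = (f (s *: h + x) - (f x + s *: 'D_h f x)) 0 j.
  by rewrite !mxE (addrC x); ring.
apply: le_trans (norm_mx_entry _ 0 j) _; apply: le_trans hh _.
rewrite normrZ (_ : e / (`|h| + 1) * (`|s| * `|h|) = (e * `|s|) * (`|h| / (`|h| + 1))); last by ring.
by rewrite -[leRHS]mulr1 ler_wpM2l ?mulr_ge0 ?(ltW e0) // ler_pdivrMr // mul1r lerDl.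
Qed.

Lemma segment_bound (f : 'rV[R]_d -> 'rV[R]_N) x h v k : 0 <= k ->
  (forall s, 0 <= s <= 1 -> differentiable f (x + s *: h) /\ `|'D_h f (x + s *: h) - v| <= k) ->
  `|f (x + h) - f x - v| <= k.
Proof.
move=> k0 hs; apply: norm_mx_le => // i j; rewrite ord1.
have hf (t : R) : 0 <= t <= 1 -> is_derive t (1 : R) (fun t : R => f (x + t *: h) 0 j) ('D_h f (x + t *: h) 0 j).
  move=> t01; have [df _] := hs t t01; apply: eps_deriv => e e0.
  have [r r0 hr] := deriv_eps (line_derive h j df) e0; exists r => // s sr.
  have := hr s sr; rewrite add0r scale0r addr0.
  by rewrite (_ : x + t *: h + s *: h = x + (t + s) *: h) // scalerDl addrA.
have hg (t : R) : 0 <= t <= 1 -> is_derive t (1 : R) (fun t : R => v 0 j * t) (v 0 j).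
  move=> _; apply: eps_deriv => e e0; exists 1 => // s _.
  by rewrite (_ : _ - _ - _ = 0) ?normr0 ?mulr_ge0 ?(ltW e0) //; ring.
have := mvt_bound (e := k) ler01 hf hg; rewrite scale1r scale0r addr0 mulr1 mulr0 !subr0 mulr1 => H.
rewrite !mxE; apply: H => t t01; have [_ hD] := hs t t01.
by apply: le_trans hD; have := norm_mx_entry ('D_h f (x + t *: h) - v) 0 j; rewrite !mxE.
Qed.

(** Second partial derivatives are continuous, hence bounded near [u0]. The mean value inequality
    makes the first ones Lipschitz and, used again, gives the remainder. *)
Lemma Ck2_uqr (W : set 'rV[R]_d) (f : 'rV[R]_d -> 'rV[R]_N) u0 : open W -> W u0 -> Ck 2 W f ->
  uqr f (fun u => jacobian f u) u0.
Proof.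
move=> oW Wu [df hD].
have near0 : \forall u \near u0, W u /\ forall ij : 'I_d * 'I_d,
    `|'D_(delta_mx 0 ij.1) (fun x => 'D_(delta_mx 0 ij.2) f x) u| <
    `|'D_(delta_mx 0 ij.1) (fun x => 'D_(delta_mx 0 ij.2) f x) u0| + 1.
  apply: filterI; first exact: open_nbhs_nbhs.
  have H (ij : 'I_d * 'I_d) : \forall u \near u0, `|'D_(delta_mx 0 ij.1) (fun x => 'D_(delta_mx 0 ij.2) f x) u| <
    `|'D_(delta_mx 0 ij.1) (fun x => 'D_(delta_mx 0 ij.2) f x) u0| + 1; last exact: (@near_forall 'rV[R]_d _ u0).
  case: ij => i j /=.
  have [_ /(_ (delta_mx 0 i)) /(_ u0 Wu) c] := hD (delta_mx 0 j).
  apply: (near_cont (Q := fun t => t < _) (cont_norm c)); apply: lt_nbhsl; by rewrite ltrDl.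
have /(proj1 (@near_normP R 'rV[R]_d u0 _))[e e0 he] := near0.
pose M := \big[Num.max/0]_(ij : 'I_d * 'I_d) (`|'D_(delta_mx 0 ij.1) (fun x => 'D_(delta_mx 0 ij.2) f x) u0| + 1).
have M0 : 0 <= M by apply: bigmax_ge_id.
have hM i j u : `|u - u0| < e -> `|'D_(delta_mx 0 i) (fun x => 'D_(delta_mx 0 j) f x) u| <= M.
  move=> /he[_ /(_ (i, j)) h]; apply: le_trans (ltW h) _.
  exact: (le_bigmax _ (fun ij : 'I_d * 'I_d => `|'D_(delta_mx 0 ij.1) (fun x => 'D_(delta_mx 0 ij.2) f x) u0| + 1) (i, j)).
have seg (u u' : 'rV[R]_d) s : `|u - u0| < e -> `|u' - u0| < e -> 0 <= s <= 1 -> `|u + s *: (u' - u) - u0| < e.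
  move=> h1 h2 /andP[s0 s1].
  have -> : u + s *: (u' - u) - u0 = (1 - s) *: (u - u0) + s *: (u' - u0).
    by apply/rowP => i; rewrite !mxE; ring.
  apply: le_lt_trans (ler_normD _ _) _; rewrite !normrZ !ger0_norm ?subr_ge0 //.
  have [s1'|s1'] := eqVneq s 1; first by rewrite s1' subrr mul0r add0r mul1r.
  have : 0 < 1 - s by rewrite subr_gt0 lt_neqAle s1' s1.
  by move=> hs; nra.
have sumD (V : normedModType R) (g : 'rV[R]_d -> 'rV[R]_N) (x h : 'rV[R]_d) : differentiable g x ->
    'D_h g x = \sum_i h 0 i *: 'D_(delta_mx 0 i) g x.
  move=> dg; rewrite deriveEjacobian // {1}[h]row_sum_delta mulmx_suml.
  by apply: eq_bigr => i _; rewrite -scalemxAl deriveEjacobian.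
have lipD j (u u' : 'rV[R]_d) : `|u - u0| < e -> `|u' - u0| < e ->
    `|'D_(delta_mx 0 j) f u' - 'D_(delta_mx 0 j) f u| <= (`|u' - u| * M) *+ d.
  move=> h1 h2; have := @segment_bound (fun x => 'D_(delta_mx 0 j) f x) u (u' - u) 0 ((`|u' - u| * M) *+ d).
  rewrite (addrC u) subrK subr0; apply; first by rewrite mulrn_wge0 // mulr_ge0.
  move=> s s01; have hs := seg _ _ _ h1 h2 s01; have [Ws _] := he _ hs.
  have [dDf _] := hD (delta_mx 0 j); have dg := dDf _ Ws; split=> //.
  rewrite subr0 (sumD R) //; apply: le_trans (ler_norm_sum _ _ _) _.
  apply: le_trans (ler_sum _ (_ : forall i, true -> _ <= `|u' - u| * M)) _.
    by move=> i _; rewrite normrZ ler_pM //; [exact: norm_mx_entry|exact: hM].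
  by rewrite sumr_const card_ord.
exists (d%:R * (M *+ d)), e; split=> //; first by rewrite mulr_ge0 // mulrn_wge0.
move=> u u' h1 h2.
have := @segment_bound f u (u' - u) ((u' - u) *m jacobian f u) (d%:R * (M *+ d) * `|u' - u| ^+ 2).
rewrite [u + _]addrC subrK; apply; first by rewrite mulr_ge0 ?sqr_ge0 // mulr_ge0 // mulrn_wge0.
move=> s s01; have hs := seg _ _ _ h1 h2 s01; have [Ws _] := he _ hs; have [Wu' _] := he _ h1.
have dfs := df _ Ws; split=> //; rewrite deriveEjacobian // -mulmxBr.
apply: le_trans (norm_mulmx _ _) _; rewrite -!mulrA ler_wpM2l // expr2 mulrCA ler_wpM2l //.
apply: norm_mx_le => [|i j]; first by rewrite mulr_ge0 // mulrn_wge0.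
have hrow x : W x -> jacobian f x i j = 'D_(delta_mx 0 i) f x 0 j.
  by move=> Wx; rewrite deriveEjacobian; [rewrite -rowE !mxE|exact: df].
have -> : (jacobian f (u + s *: (u' - u)) - jacobian f u) i j =
    ('D_(delta_mx 0 i) f (u + s *: (u' - u)) - 'D_(delta_mx 0 i) f u) 0 j.
  rewrite [LHS]mxE [RHS]mxE; congr (_ + _); first exact: hrow.
  by rewrite [LHS]mxE [RHS]mxE; congr (- _); exact: hrow.
apply: le_trans (norm_mx_entry _ 0 j) _.
apply: le_trans (lipD _ _ _ h1 hs) _.
have -> : u + s *: (u' - u) - u = s *: (u' - u) by rewrite addrC addKr.
rewrite normrZ mulrnAl ler_wMn2r // (mulrC M) ler_wpM2r // -[leRHS]mul1r ler_wpM2r //.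
by case/andP: s01 => s0 s1; rewrite ger0_norm.
Qed.
End Smoothness.

Section SubmanifoldCharts.
Context {R : realType} {n : nat} (S : set 'rV[C R]_n) (d : nat).

Definition embed (x : set_type S) : 'rV[R]_(n + n) := realify (val x).

Lemma embed_inj : injective embed.
Proof. by move=> x y /realify_inj/val_inj. Qed.

Lemma set_type_nbhsP (x : set_type S) (Q : set_type S -> Prop) :
  (\forall y \near x, Q y) <-> exists2 e : R, 0 < e & forall y, `|embed y - embed x| < e -> Q y.
Proof.
split.
  move=> H; have : nbhs x Q by [].
  rewrite nbhsE => -[B [[V oV <-] Bx] BQ].
  have /nbhsCP[e e0 he] : \forall z \near val x, V z by exact: open_nbhs_nbhs.
  by exists e => // y yx; apply: BQ; exact: he.
case=> e e0 he; have cv : continuous_at x (@set_val _ S) by exact: initial_continuous.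
have h : \forall z \near val x, `|realify z - embed x| < e by apply/nbhsCP; exists e.
have hh := near_cont cv h.
by apply: (@filterS _ (nbhs x) (nbhs_filter x) _ _ _ hh) => y hy; exact: he.
Qed.

Lemma embed_cont : continuous embed.
Proof. by move=> x; apply: cont_eps => e e0; apply/set_type_nbhsP; exists e => // y; rewrite distrC. Qed.

Lemma embed_emb (p : set_type S) (Q : set_type S -> Prop) : (\forall x \near p, Q x) ->
  exists2 e : R, 0 < e & forall x, `|embed x - embed p| < e -> Q x.
Proof. by move/set_type_nbhsP. Qed.

Lemma set_type_compact : compact S -> compact [set: set_type S].
Proof.
move=> cS F PF _; have PF' : ProperFilter ((@set_val _ S) @ F) by exact: fmap_proper_filter.
have [|p [Sp cp]] := cS _ PF'.
  by rewrite /= /fmap /=; apply: filterS filterT => x _; exact: set_valP.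
exists (SigSub (mem_set Sp)); split=> // A B FA /set_type_nbhsP[e e0 he].
have FA' : ((@set_val _ S) @ F) (@set_val _ S @` A).
  by rewrite /fmap /=; apply: filterS FA => x Ax; exists x.
have NB : nbhs p (fun z => `|realify z - embed (SigSub (mem_set Sp))| < e).
  by apply/nbhsCP; exists e.
have [z [[x Ax <-] zp]] := cp _ _ FA' NB.
by exists x; split=> //; exact: he.
Qed.

(** Continuity of the inverse comes from the openness clause of a parametrization, the quadratic
    remainder from its first two derivatives. *)
Lemma param_chart (W : set 'rV[R]_d) phi u0 (p : set_type S) :
  local_parametrization S W phi -> W u0 -> phi u0 = val p ->
  exists eta theta, [/\ chart embed p eta theta u0 (fun u => jacobian (realify \o phi) u),
    (forall u, W u -> embed (eta u) = realify (phi u)) &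
    \forall x \near p, [/\ W (theta x), phi (theta x) = val x & {for x, continuous theta}]].
Proof.
move=> [oW smW rfW injW openW] Wu0 pu0.
have SW u : W u -> S (phi u).
  move=> Wu; have [U oU E] := openW W oW (@subset_refl _ W).
  by have [] : (S `&` U) (phi u) by rewrite -E; exists u.
have /choice[eta heta] : forall u, exists x : set_type S, W u -> val x = phi u.
  move=> u; have [Wu|nWu] := pselect (W u); last by exists p.
  by exists (SigSub (mem_set (SW _ Wu))).
have /choice[theta hth] : forall x : set_type S, exists u, (exists2 u', W u' & phi u' = val x) -> W u /\ phi u = val x.
  move=> x; have [[u Wu pu]|nu] := pselect (exists2 u', W u' & phi u' = val x); last by exists u0.
  by exists u.
have nearW u1 : W u1 -> \forall u \near u1, W u by move=> h; exact: open_nbhs_nbhs.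
have nimg (x : set_type S) u1 (W' : set 'rV[R]_d) : open W' -> W' `<=` W -> W' u1 -> phi u1 = val x ->
    \forall y \near x, exists2 u', W' u' & phi u' = val y.
  move=> oW' W'W W'u1 pu1; have [U oU E] := openW W' oW' W'W.
  have Ux : U (val x) by have [] : (S `&` U) (val x) by rewrite -E; exists u1.
  have /nbhsCP[e e0 he] : \forall z \near val x, U z by exact: open_nbhs_nbhs.
  apply/set_type_nbhsP; exists e => // y yx.
  have : (S `&` U) (val y) by split; [exact: set_valP|exact: he].
  by rewrite -E => -[u' Wu' pu']; exists u'.
have near1 : \forall x \near p, [/\ W (theta x), phi (theta x) = val x & {for x, continuous theta}].
  apply: filterS (nimg p u0 W oW (@subset_refl _ W) Wu0 pu0) => x /hth[h1 h2]; split=> //.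
  apply: cont_eps => e e0.
  have W'o : open (W `&` [set u : 'rV[R]_d | `|theta x - u| < e]).
    apply: openI => //; rewrite (_ : [set u | _] = ball (theta x) e); first exact: ball_open.
    by rewrite -ball_normE.
  have h0 : `|theta x - theta x| < e by rewrite subrr normr0.
  have := nimg x (theta x) _ W'o (@subIsetl _ _ _) (conj h1 h0) h2.
  apply: filterS => y [u' [Wu' hu'] pu'].
  have [h3 h4] := hth y (ex_intro2 _ _ u' Wu' pu').
  by rewrite (injW (theta y) u') ?inE // h4.
have emb_eta u : W u -> embed (eta u) = realify (phi u) by move=> Wu; rewrite /embed heta.
have ck := smW 2%N; have uq u : W u -> uqr (realify \o phi) (fun u => jacobian (realify \o phi) u) u.
  by move=> Wu; exact: Ck2_uqr oW Wu ck.
exists eta, theta; split=> //; split.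
- by have [h1 h2 _] := nbhs_singleton near1; apply: injW; rewrite ?inE // h2.
- by apply: filterS near1 => x [h1 h2 h3]; split=> //; apply: val_inj; rewrite heta.
- apply: filterS (nearW _ Wu0) => u Wu; split.
    have [h1 h2] := hth (eta u) (ex_intro2 _ _ u Wu (esym (heta u Wu))).
    by apply: injW; rewrite ?inE // h2 heta.
  move=> A /set_type_nbhsP[e e0 he].
  have [c [r [c0 r0 hc]]] := uqr_lipschitz (uq u Wu).
  have /(proj1 (@near_normP R 'rV[R]_d u _))[r1 r10 hr1] := nearW u Wu.
  apply: (proj2 (@near_normP R 'rV[R]_d u _)).
  have m0 : 0 < Num.min (Num.min r r1) (e / (c + 1)) by rewrite !lt_min r0 r10 divr_gt0 // ltr_wpDl.
  exists (Num.min (Num.min r r1) (e / (c + 1))) => // u'; rewrite !lt_min => /andP[/andP[h1 h2] h3].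
  apply: he; rewrite !emb_eta //; last exact: hr1.
  have [h _] := hc u u' ltac:(by rewrite subrr normr0) h1; apply: le_lt_trans h _.
  rewrite ltr_pdivlMr ?ltr_wpDl // in h3; apply: le_lt_trans h3.
  by rewrite mulrC ler_wpM2l // lerDl.
- have [c [e [c0 e0 he]]] := uq u0 Wu0.
  have /(proj1 (@near_normP R 'rV[R]_d u0 _))[r1 r10 hr1] := nearW u0 Wu0.
  exists c, (Num.min e r1); split=> //; first by rewrite lt_min e0.
  move=> u u'; rewrite !lt_min => /andP[h1 h2] /andP[h3 h4] /=.
  by rewrite !emb_eta; [exact: he|exact: hr1|exact: hr1].
- exact: rfW.
Qed.
End SubmanifoldCharts.

(** * Special complex points *)

Section Asymptotics.
Context {R : realType} {d : nat} (u0 : 'rV[R]_d).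

Definition asym k (p : 'rV[R]_d -> 'rV[R]_k) (P : 'M[R]_(d, k)) := forall e : R, 0 < e ->
  \forall u \near u0, `|p u - (u - u0) *m P| <= e * `|u - u0|.

Lemma near_center (e : R) : 0 < e -> \forall u \near u0, `|u - u0| < e.
Proof. by move=> e0; apply: (proj2 (@near_normP R 'rV[R]_d u0 _)); exists e. Qed.

Lemma near_both (P Q : 'rV[R]_d -> Prop) : (\forall u \near u0, P u) -> (\forall u \near u0, Q u) ->
  \forall u \near u0, P u /\ Q u.
Proof. exact: filterI. Qed.

Lemma near_imp (P Q : 'rV[R]_d -> Prop) : (forall u, P u -> Q u) -> (\forall u \near u0, P u) -> \forall u \near u0, Q u.
Proof. by move=> h; exact: filterS. Qed.

Lemma asym_bound k p P : @asym k p P -> exists2 c, 0 <= c & \forall u \near u0, `|p u| <= c * `|u - u0|.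
Proof.
move=> hp; exists (d%:R * `|P| + 1); first by rewrite addr_ge0 // mulr_ge0.
apply: near_imp (hp 1 ltr01) => u hu; rewrite mulrDl.
rewrite -(subrK ((u - u0) *m P) (p u)) addrC; apply: le_trans (ler_normD _ _) _; apply: lerD => //.
by apply: le_trans (norm_mulmx _ _) _; rewrite -mulrA (mulrC `|P|).
Qed.

Lemma asym_id : asym (fun u => u - u0) 1%:M.
Proof. by move=> e e0; apply: near_imp (near_center ltr01) => u _; rewrite mulmx1 subrr normr0 mulr_ge0 // ltW. Qed.

Lemma asym_mul k l p P (M : 'rV[R]_d -> 'M[R]_(k, l)) : asym p P -> continuous_at u0 M ->
  asym (fun u => p u *m M u) (P *m M u0).
Proof.
move=> hp cM e e0; have [c c0 hc] := asym_bound hp.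
have K0 : 0 < 2 * (k%:R * c + 1) by rewrite mulr_gt0 // ltr_wpDl // mulr_ge0.
have K1 : 0 < 2 * (k%:R * `|M u0| + 1) by rewrite mulr_gt0 // ltr_wpDl // mulr_ge0.
have h1 : \forall u \near u0, `|M u0 - M u| < e / (2 * (k%:R * c + 1)).
  by have /cvgrPdist_lt := cM; apply; rewrite divr_gt0.
have e2 : 0 < e / (2 * (k%:R * `|M u0| + 1)) by rewrite divr_gt0.
have h2 := hp _ e2.
apply: near_imp (near_both hc (near_both h1 h2)) => u [a1 [a2 a3]].
have -> : p u *m M u - (u - u0) *m (P *m M u0) = p u *m (M u - M u0) + (p u - (u - u0) *m P) *m M u0.
  by rewrite mulmxA mulmxBr (mulmxBl (p u)) addrA subrK.
apply: le_trans (ler_normD _ _) _; rewrite (_ : e * _ = e / 2 * `|u - u0| + e / 2 * `|u - u0|); last by field.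
rewrite distrC in a2; have n0 : 0 <= `|u - u0| by [].
apply: lerD; apply: le_trans (norm_mulmx _ _) _.
  apply: le_trans (_ : k%:R * (c * `|u - u0| * (e / (2 * (k%:R * c + 1)))) <= _).
    by rewrite ler_wpM2l // ler_pM // ltW.
  have -> : k%:R * (c * `|u - u0| * (e / (2 * (k%:R * c + 1)))) = (e / 2 * `|u - u0|) * ((k%:R * c) / (k%:R * c + 1)).
    by field; rewrite gt_eqF // ltr_wpDl // mulr_ge0.
  rewrite -[leRHS]mulr1 ler_wpM2l ?mulr_ge0 ?divr_ge0 ?(ltW e0) // ler_pdivrMr ?mul1r ?lerDl //.
  by rewrite ltr_wpDl // mulr_ge0.
apply: le_trans (_ : k%:R * (e / (2 * (k%:R * `|M u0| + 1)) * `|u - u0| * `|M u0|) <= _).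
  by rewrite ler_wpM2l // ler_wpM2r.
have -> : k%:R * (e / (2 * (k%:R * `|M u0| + 1)) * `|u - u0| * `|M u0|) = (e / 2 * `|u - u0|) * ((k%:R * `|M u0|) / (k%:R * `|M u0| + 1)).
  by field; rewrite gt_eqF // ltr_wpDl // mulr_ge0.
rewrite -[leRHS]mulr1 ler_wpM2l ?mulr_ge0 ?divr_ge0 ?(ltW e0) // ler_pdivrMr ?mul1r ?lerDl //.
Qed.

Lemma asym_dot k p P q Q : @asym k p P -> @asym k q Q -> forall e : R, 0 < e ->
  \forall u \near u0, `|dot (p u) (q u) - dot ((u - u0) *m P) ((u - u0) *m Q)| <= e * `|u - u0| ^+ 2.
Proof.
move=> hp hq e e0; have [c c0 hc] := asym_bound hq.
have [c' c'0 hc'] : exists2 c', 0 <= c' & forall u, `|(u - u0) *m P| <= c' * `|u - u0|.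
  by exists (d%:R * `|P|); [rewrite mulr_ge0|move=> u; apply: le_trans (norm_mulmx _ _) _; rewrite -mulrA (mulrC `|P|)].
pose K : R := k%:R * (c + c') + 1; have K0 : 0 < K by rewrite ltr_wpDl // mulr_ge0 // addr_ge0.
have e1 : 0 < e / K by rewrite divr_gt0.
apply: near_imp (near_both hc (near_both (hp _ e1) (hq _ e1))) => u [a1 [a2 a3]].
have a4 := hc' u.
have -> : dot (p u) (q u) - dot ((u - u0) *m P) ((u - u0) *m Q) =
  dot (p u - (u - u0) *m P) (q u) + dot ((u - u0) *m P) (q u - (u - u0) *m Q).
  by rewrite dotDl dotDr dotNl dotNr addrA subrK.
apply: le_trans (ler_normD _ _) _.
apply: le_trans (lerD (dot_norm _ _) (dot_norm _ _)) _; rewrite -mulrDr.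
apply: le_trans (_ : k%:R * ((e / K * `|u - u0|) * (c * `|u - u0|) + (c' * `|u - u0|) * (e / K * `|u - u0|)) <= _).
  by rewrite ler_wpM2l // lerD // ler_pM.
have -> : k%:R * ((e / K * `|u - u0|) * (c * `|u - u0|) + (c' * `|u - u0|) * (e / K * `|u - u0|)) = (e * `|u - u0| ^+ 2) * ((k%:R * (c + c')) / K).
  by field; rewrite gt_eqF.
rewrite -[leRHS]mulr1 ler_wpM2l ?mulr_ge0 ?sqr_ge0 ?(ltW e0) // ler_pdivrMr // mul1r /K lerDl //.
Qed.

Lemma asym_uqr k (f : 'rV[R]_d -> 'rV[R]_k) D : uqr f D u0 -> f u0 = 0 -> asym f (D u0).
Proof.
move=> [c [r [c0 r0 h]]] f0 e e0; have c1 : 0 < c + 1 by rewrite ltr_wpDl.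
have e1 : 0 < e / (c + 1) by rewrite divr_gt0.
apply: near_imp (near_both (near_center r0) (near_center e1)) => u [ur ue].
have := h u0 u ltac:(by rewrite subrr normr0) ur; rewrite f0 subr0 => hh; apply: le_trans hh _.
rewrite expr2 mulrA ler_wpM2r //; rewrite ltr_pdivlMr // in ue; apply: le_trans (ltW ue).
by rewrite mulrC ler_wpM2l // lerDl.
Qed.

Lemma uqr_cont k (f : 'rV[R]_d -> 'rV[R]_k) D : uqr f D u0 -> continuous_at u0 D.
Proof.
move=> /uqr_lipschitz_diff[c [r [c0 r0 h]]]; apply: cont_eps => e e0.
have c1 : 0 < c + 1 by rewrite ltr_wpDl.
have e1 : 0 < e / (c + 1) by rewrite divr_gt0.
apply: near_imp (near_both (near_center r0) (near_center e1)) => u [ur ue]; rewrite distrC.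
apply: le_lt_trans (h u0 u _ ur) _; first by rewrite subrr normr0.
rewrite ltr_pdivlMr // in ue; apply: le_lt_trans ue; by rewrite mulrC ler_wpM2l // lerDl.
Qed.

(** Interpolation between the two bounds. With a step of length [dl * s], the difference quotient of
    [f] is of order [s^2 / dl] and the remainder of order [dl * s]; both are below [e * s] for [dl]
    small and then [s] small. *)
Lemma flat_derivative k (f : 'rV[R]_d -> 'rV[R]_k) D c1 : uqr f D u0 -> 0 <= c1 ->
  (\forall u \near u0, `|f u| <= c1 * `|u - u0| ^+ 3) -> forall e : R, 0 < e ->
  exists2 r : R, 0 < r & forall (u : 'rV[R]_d) (s : R) (h : 'rV[R]_d), `|u - u0| <= s -> 0 < s -> s < r -> `|h *m D u| <= e * s * `|h|.
Proof.
move=> [c [r [c0 r0 hf]]] c10 /(proj1 (@near_normP R 'rV[R]_d u0 _))[r1 r10 h1] e e0.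
pose dl := Num.min 1 (e / (2 * (c + 1))).
have cc : 0 < 2 * (c + 1) by rewrite mulr_gt0 // ltr_wpDl.
have dl0 : 0 < dl by rewrite lt_min ltr01 divr_gt0.
have dl1 : dl <= 1 by rewrite ge_min lexx.
have dlc : c * dl <= e / 2.
  apply: le_trans (_ : c * (e / (2 * (c + 1))) <= _); first by rewrite ler_wpM2l // ge_min lexx orbT.
  have -> : c * (e / (2 * (c + 1))) = e / 2 * (c / (c + 1)) by field; rewrite gt_eqF // ltr_wpDl.
  by rewrite -[leRHS]mulr1 ler_wpM2l ?divr_ge0 ?(ltW e0) // ler_pdivrMr ?ltr_wpDl // mul1r lerDl.
have K0 : 0 < 18 * (c1 + 1) by rewrite mulr_gt0 // ltr_wpDl.
pose r2 := e * dl / (18 * (c1 + 1)); have r20 : 0 < r2 by rewrite divr_gt0 // mulr_gt0.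
exists (Num.min (Num.min (r / 2) (r1 / 2)) r2); first by rewrite !lt_min r20 !divr_gt0.
move=> u s h us s0; rewrite !lt_min => /andP[/andP[sr sr1] sr2].
have [->|h0] := eqVneq h 0; first by rewrite mul0mx !normr0 mulr0.
have hn : 0 < `|h| by rewrite normr_gt0.
pose t := dl * s / `|h|; have t0 : 0 < t by rewrite divr_gt0 // mulr_gt0.
have th : `|t *: h| = dl * s by rewrite normrZ gtr0_norm // /t divfK // gt_eqF.
have ths : `|t *: h| <= s by rewrite th -[leRHS]mul1r ler_wpM2r // ltW.
have u'n : `|u + t *: h - u0| <= 2 * s.
  rewrite addrAC; apply: le_trans (ler_normD _ _) _; lra.
have k1 := hf u (u + t *: h) ltac:(lra) ltac:(lra).
have k2 := h1 u ltac:(lra); have k3 := h1 (u + t *: h) ltac:(lra).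
move: k1; rewrite (addrC u) addrK -scalemxAl th => k1.
have p1 : c1 * `|u - u0| ^+ 3 <= c1 * s ^+ 3 by rewrite ler_wpM2l // lerXn2r // nnegrE // ltW.
have p2 : c1 * `|u + t *: h - u0| ^+ 3 <= c1 * (2 * s) ^+ 3.
  by rewrite ler_wpM2l // lerXn2r // nnegrE // ltW // mulr_gt0.
have p3 : `|t *: (h *m D u)| <= c * (dl * s) ^+ 2 + 9 * c1 * s ^+ 3.
  have -> : t *: (h *m D u) = (f (u + t *: h) - f u) - (f (t *: h + u) - f u - t *: (h *m D u)).
    by rewrite (addrC u); apply/rowP => i; rewrite !mxE; ring.
  apply: le_trans (ler_normB _ _) _; have := ler_normB (f (u + t *: h)) (f u).
  have : (2 * s) ^+ 3 = 8 * s ^+ 3 by ring.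
  by move=> e8; move: p2; rewrite e8 => p2; lra.
move: p3; rewrite normrZ gtr0_norm // /t => p3.
have p4 : `|h *m D u| * (dl * s) <= (e * s * `|h|) * (dl * s).
  have -> : `|h *m D u| * (dl * s) = (dl * s / `|h| * `|h *m D u|) * `|h| by field; rewrite gt_eqF.
  have -> : e * s * `|h| * (dl * s) = (e * dl * s ^+ 2) * `|h| by ring.
  rewrite ler_pM2r //; apply: le_trans p3 _.
  have q1 : c * (dl * s) ^+ 2 <= (e / 2) * (dl * s ^+ 2).
    have -> : c * (dl * s) ^+ 2 = (c * dl) * (dl * s ^+ 2) by ring.
    by rewrite ler_wpM2r // mulr_ge0 ?sqr_ge0 // ltW.
  have q2 : 9 * c1 * s ^+ 3 <= (e / 2) * (dl * s ^+ 2).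
    move: sr2; rewrite /r2 ltr_pdivlMr // => sr2.
    have -> : 9 * c1 * s ^+ 3 = (9 * c1 * s) * s ^+ 2 by ring.
    have -> : e / 2 * (dl * s ^+ 2) = (e * dl / 2) * s ^+ 2 by field.
    by rewrite ler_wpM2r ?sqr_ge0 //; nra.
  lra.
by move: p4; rewrite ler_pM2r // mulr_gt0.
Qed.
End Asymptotics.

Lemma dotE (R : realType) N (u v : 'rV[R]_N) : dot u v = (u *m v^T) 0 0.
Proof. by rewrite dot_mulmx !mxE eqxx mulr1n. Qed.

Lemma dot_mulmxl (R : realType) N M (u : 'rV[R]_N) (A : 'M[R]_(N, M)) v : dot (u *m A) v = dot u (v *m A^T).
Proof. by rewrite !dotE trmx_mul trmxK mulmxA. Qed.

Lemma norm_lsubmx (R : realType) k a b (y : 'M[R]_(k, a + b)) : `|lsubmx y| <= `|y|.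
Proof. by apply: norm_mx_le => // i j; rewrite mxE norm_mx_entry. Qed.

Lemma cont_lsubmx (R : realType) (X : topologicalType) k a b (F : X -> 'M[R]_(k, a + b)) x :
  continuous_at x F -> continuous_at x (fun y => lsubmx (F y)).
Proof. by move=> cF; apply: cont_mx => i j; rewrite (_ : (fun y => _) = fun y => F y i (lshift b j)); [exact: cont_entry|apply/funext => y; rewrite mxE]. Qed.

Lemma near_unit (R : realType) (X : topologicalType) n (F : X -> 'M[R]_n) x : continuous_at x F -> F x \in unitmx ->
  (\forall y \near x, F y \in unitmx) /\ continuous_at x (fun y => invmx (F y)).
Proof.
move=> cF; rewrite unitmxE unitfE => d0.
have cd : continuous_at x (fun y => \det (F y)) by apply: cont_det => i j; exact: cont_entry.
have nu : \forall y \near x, F y \in unitmx.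
  apply: filterS (near_cont (Q := fun t => t != 0) cd _) => [y hy|]; first by rewrite unitmxE unitfE.
  exact: (open_nbhs_nbhs (conj (@open_neq _ _) d0)).
split=> //; apply: cont_mx => i j.
apply: (@eq_near_cont _ _ _ (fun z => (\det (F z))^-1 * cofactor (F z) j i)).
  by apply: filterS nu => z hz; rewrite /invmx hz !mxE.
by apply: cont_mul; [exact: cont_inv|apply: cont_cofactor => k l; exact: cont_entry].
Qed.

(** The segment from [(1, 0)] to [(a, b)] may meet the origin; the bump [s (1 - s) g] pushes it to
    the side of [b]. *)
Lemma punctured_path (R : realType) (a b : R) : a ^+ 2 + b ^+ 2 != 0 -> exists fa fb : R -> R,
  [/\ continuous fa, continuous fb, fa 0 = 1 /\ fb 0 = 0, fa 1 = a /\ fb 1 = b &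
  forall s, 0 <= s <= 1 -> fa s ^+ 2 + fb s ^+ 2 != 0].
Proof.
move=> ab; pose g : R := if 0 <= b then 1 else -1.
exists (fun s => (1 - s) + s * a), (fun s => s * b + s * (1 - s) * g); split.
- have h (s : R) : continuous_at s (fun t : R => (1 - t) + t * a).
    apply: cont_add; first by apply: cont_sub; [exact: cont_cst|exact: cont_id].
    by apply: cont_mul; [exact: cont_id|exact: cont_cst].
  exact: h.
- have h (s : R) : continuous_at s (fun t : R => t * b + t * (1 - t) * g).
    apply: cont_add; first by apply: cont_mul; [exact: cont_id|exact: cont_cst].
    apply: cont_mul; last exact: cont_cst.
    by apply: cont_mul; [exact: cont_id|apply: cont_sub; [exact: cont_cst|exact: cont_id]].
  exact: h.
- by split; ring.
- by split; ring.
move=> s /andP[s0 s1]; apply/negP; rewrite paddr_eq0 ?sqr_ge0 // !sqrf_eq0 => /andP[/eqP h1 /eqP h2].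
have [e1|e1] := eqVneq s 1; first by move: h1 h2 ab; rewrite e1 !(subrr, mul1r, mul0r, add0r, addr0) => -> ->; rewrite expr0n addr0 eqxx.
have [e2|e2] := eqVneq s 0; first by move: h1; rewrite e2; lra.
have s0' : 0 < s by rewrite lt_neqAle eq_sym e2.
have s1' : 0 < 1 - s by rewrite subr_gt0 lt_neqAle e1.
have h3 : b + (1 - s) * g = 0.
  by apply: (mulfI e2); rewrite mulr0 mulrDr mulrA.
by move: h3; rewrite /g; case: (leP 0 b) => hb; lra.
Qed.

(** * Sign of the field at a special point *)

Section SpecialModel.
Context {R : realType} {T : topologicalType} {m : nat}.
Local Notation d := (m + m)%N.
Local Notation N := (m + m + 2)%N.
Variables (iot : T -> 'rV[R]_N) (J : 'M[R]_N) (nu : T -> 'rV[R]_N) (p : T).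
Variables (eta : 'rV[R]_d -> T) (theta : T -> 'rV[R]_d) (u0 : 'rV[R]_d) (D : 'rV[R]_d -> 'M[R]_(d, N)).
Variables (Phi : 'rV[R]_N -> 'rV[R]_N) (D' : 'rV[R]_N -> 'M[R]_N) (lam : 'I_m -> R) (L : 'M[R]_d) (mu : R).
Hypothesis iot_cont : continuous iot.
Hypothesis ch : chart iot p eta theta u0 D.
Hypothesis JT : J^T = - J.
Hypothesis nu_cont : continuous nu.
Hypothesis nu0 : nu p != 0.
Hypothesis nu_perp : \forall u \near u0, forall k, dot (nu (eta u)) (k *m D u) = 0.
Hypothesis hPhi : uqr Phi D' (iot p).
Hypothesis Phi0 : Phi (iot p) = 0.

Definition rot (k : nat) : 'M[R]_(k + k) := block_mx 0 1%:M (- 1%:M) 0.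
Definition rot2 : 'M[R]_2 := delta_mx 0 1 - delta_mx 1 0.

Hypothesis D'J : \forall y \near iot p, J *m D' y = D' y *m block_mx (rot m) 0 0 rot2.
Hypothesis D'u : D' (iot p) \in unitmx.

(** With [z_j = x_j + i y_j], the form [|z_j|^2 + lam_j Re z_j^2] is
    [(1 + lam_j) x_j^2 + (1 - lam_j) y_j^2]. *)
Definition qdiag : 'M[R]_d := diag_mx (row_mx (\row_j (1 + lam j)) (\row_j (1 - lam j))).
Local Notation La := qdiag.
Local Notation de0 := (delta_mx 0 0 : 'rV[R]_2).
Local Notation de1 := (delta_mx 0 1 : 'rV[R]_2).

Hypothesis graph : exists2 c : R, 0 <= c & \forall x \near p,
  `|rsubmx (Phi (iot x)) - dot (lsubmx (Phi (iot x)) *m La) (lsubmx (Phi (iot x))) *: de0| <=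
  c * `|lsubmx (Phi (iot x))| ^+ 3.
Hypothesis mu0 : 0 < mu.
Hypothesis L_pos : forall z, mu * dot z z <= dot (z *m La) (z *m L).
Hypothesis Lu : L \in unitmx.

Let q (z : 'rV[R]_d) := dot (z *m La) z.
(** Defining function of the model quadric in the coordinates [(z, w)], with derivative [DP]; along
    the manifold it vanishes to third order. *)
Let P (y : 'rV[R]_N) : 'rV[R]_2 := rsubmx y - q (lsubmx y) *: de0.
Let DP (y : 'rV[R]_N) : 'M[R]_(N, 2) := col_mx (- (2 *: (La *m (lsubmx y)^T *m de0))) 1%:M.

Lemma rot_sq k : rot k *m rot k = - 1%:M.
Proof.
rewrite /rot mulmx_block !mulmx0 !mul0mx !mul1mx !addr0 !add0r mulmx1 -[RHS]raddfN /= (scalar_mx_block _ _ (- 1)).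
by rewrite -raddfN.
Qed.

Lemma La_sym (a b : 'rV[R]_d) : dot (a *m La) b = dot (b *m La) a.
Proof. by rewrite dot_mulmxl tr_diag_mx dotC. Qed.

Lemma DP_mul k y : k *m DP y = rsubmx k - (2 * dot (lsubmx y *m La) (lsubmx k)) *: de0.
Proof.
rewrite /DP -{1}(hsubmxK k) mul_row_col mulmx1 mulmxN -scalemxAr !mulmxA.
have -> : lsubmx k *m La *m (lsubmx y)^T = (dot (lsubmx y *m La) (lsubmx k))%:M by rewrite dot_mulmx La_sym.
by rewrite mul_scalar_mx scalerA addrC.
Qed.

Lemma P_uqr y0 : uqr P DP y0.
Proof.
exists (d%:R * (d%:R * `|La|)), 1; split=> [||y y' _ _]; [by rewrite ?mulr_ge0|by []|].
have -> : P y' - P y - (y' - y) *m DP y = - (q (lsubmx (y' - y)) *: de0).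
  rewrite DP_mul /P !linearB /=; set a := lsubmx y'; set b := lsubmx y.
  have -> : q (a - b) = q a - q b - 2 * dot (b *m La) (a - b).
    rewrite /q mulmxBl !(dotDl, dotDr, dotNl, dotNr) (La_sym a b); ring.
  by apply/rowP => i; rewrite !mxE; ring.
rewrite normrN normrZ; apply: le_trans (_ : `|q (lsubmx (y' - y))| * 1 <= _).
  rewrite ler_wpM2l //; apply: norm_mx_le => // i j; rewrite !mxE.
  by case: (_ && _) => /=; rewrite ?normr1 ?normr0.
rewrite mulr1 /q; apply: le_trans (dot_norm _ _) _.
have h := norm_lsubmx (y' - y); have h' := norm_mulmx (lsubmx (y' - y)) La.
rewrite -mulrA ler_wpM2l //; apply: le_trans (ler_wpM2r _ h') _ => //.
rewrite -!mulrA ler_wpM2l // mulrCA [in leRHS]expr2 mulrCA; rewrite [leRHS]mulrCA.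
rewrite [leLHS](_ : _ = `|La| * (`|lsubmx (y' - y)| * `|lsubmx (y' - y)|)); last by ring.
by rewrite [leRHS](_ : _ = `|La| * (`|y' - y| * `|y' - y|)); [rewrite ler_wpM2l // ler_pM|ring].
Qed.

Let A (u : 'rV[R]_d) := D' (iot (eta u)).
Let B u := D u *m A u.
Let Bz u := lsubmx (B u).
Let Bw u := rsubmx (B u).
Let ps u := Phi (iot (eta u)).
Let ze u := lsubmx (ps u).
Let F u := P (ps u).
Let DF u := B u *m DP (ps u).

Let eta0 : eta u0 = p. Proof. exact: chart_eta0 ch. Qed.
Let chu : uqr (iot \o eta) D u0. Proof. by case: ch. Qed.
Let fD : row_free (D u0). Proof. by case: ch. Qed.
Let eta_cont : continuous_at u0 eta.
Proof. by case: ch => _ _ /nbhs_singleton[]. Qed.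
Let psu : uqr ps B u0.
Proof. by apply: (uqr_comp chu); rewrite /= eta0. Qed.
Let ps0 : ps u0 = 0. Proof. by rewrite /ps eta0. Qed.
Let ie_cont : continuous_at u0 (fun u => iot (eta u)).
Proof. by apply: cont_comp => //; exact: iot_cont. Qed.
Let A_cont : continuous_at u0 A.
Proof. by apply: cont_comp => //; rewrite eta0; exact: uqr_cont hPhi. Qed.
Let B_cont : continuous_at u0 B. Proof. exact: uqr_cont psu. Qed.
Let Fu : uqr F DF u0. Proof. exact: (uqr_comp psu (P_uqr _)). Qed.
Let A_unit : (\forall u \near u0, A u \in unitmx) /\ continuous_at u0 (fun u => invmx (A u)).
Proof. by apply: near_unit; rewrite ?/A ?eta0. Qed.

Let F_flat : forall e : R, 0 < e ->
  exists2 r : R, 0 < r & forall (u : 'rV[R]_d) (s : R) (h : 'rV[R]_d), `|u - u0| <= s -> 0 < s -> s < r -> `|h *m DF u| <= e * s * `|h|.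
Proof.
have [c c0 hc] := graph; have [c' c'0 hc'] := asym_bound (asym_uqr psu ps0).
apply: (flat_derivative Fu (c1 := c * c' ^+ 3)); first by rewrite mulr_ge0 // exprn_ge0.
have hc2 : \forall u \near u0, `|F u| <= c * `|ze u| ^+ 3.
  by have := near_cont eta_cont; rewrite eta0 => /(_ _ hc).
apply: near_imp (near_both hc2 hc') => u [h1 h2]; apply: le_trans h1 _.
rewrite -mulrA ler_wpM2l // -exprMn lerXn2r ?nnegrE ?mulr_ge0 //.
by apply: le_trans h2; exact: norm_lsubmx.
Qed.

Let DF0 : DF u0 = 0.
Proof.
apply/row_matrixP => i; rewrite row0 rowE; set k := delta_mx 0 i.
apply/eqP; rewrite -normr_eq0; apply/negP => /negP h0.
have hp : 0 < `|k *m DF u0| by rewrite lt_def h0 /=.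
have [r r0 hr] := F_flat ltr01.
pose s := Num.min (r / 2) (`|k *m DF u0| / (2 * (`|k| + 1))).
have k1 : 0 < `|k| + 1 by rewrite ltr_wpDl.
have s0 : 0 < s by rewrite lt_min !divr_gt0 // mulr_gt0.
have := hr u0 s k; rewrite subrr normr0 mul1r => /(_ (ltW s0) s0).
have sr : s < r by apply: le_lt_trans (_ : r / 2 < r); [rewrite ge_min lexx|lra].
move=> /(_ sr); apply/negP; rewrite -ltNge.
have : s * (`|k| + 1) <= `|k *m DF u0| / 2.
  rewrite -ler_pdivlMr //; apply: le_trans (_ : `|k *m DF u0| / (2 * (`|k| + 1)) <= _); first by rewrite ge_min lexx orbT.
  by rewrite invfM mulrA.
by rewrite mulrDr mulr1; lra.
Qed.

(** At the point [dw] vanishes on tangent vectors, so a tangent vector killed by [dz] would be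
    killed by the invertible derivative of the coordinates. *)
Let Bz_unit : Bz u0 \in unitmx.
Proof.
rewrite -row_free_unit -kermx_eq0; apply/eqP/row_matrixP => i; rewrite row0.
set k := row i _; have kz : k *m Bz u0 = 0 by apply/eqP; rewrite -sub_kermx row_sub.
have kB : k *m B u0 = 0.
  have E : k *m Bw u0 = 0.
    have := congr1 (mulmx k) DF0; rewrite mulmx0 /DF mulmxA DP_mul ps0 linear0 mul0mx dot0l mulr0 scale0r subr0.
    by rewrite -mulmx_rsub.
  by rewrite -[B u0]hsubmxK mul_mx_row -/(Bz u0) -/(Bw u0) kz E row_mx0.
apply: (row_free_inj fD); rewrite mul0mx.
have uA : A u0 \in unitmx by exact: nbhs_singleton A_unit.1.
by rewrite -[LHS](mulmxK uA) -(mulmxA k) -/(B u0) kB mul0mx.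
Qed.

Let Bz_near : (\forall u \near u0, Bz u \in unitmx) /\ continuous_at u0 (fun u => invmx (Bz u)).
Proof. by apply: near_unit => //; exact: (cont_lsubmx B_cont). Qed.

Let e0 u : 'rV[R]_N := row_mx 0 de0 *m invmx (A u).
Let e1 u : 'rV[R]_N := row_mx 0 de1 *m invmx (A u).
Let g0 u := dot (nu (eta u)) (e0 u).
Let g1 u := dot (nu (eta u)) (e1 u).
Let ga (u : 'rV[R]_d) (w : 'rV[R]_2) := w 0 0 * g0 u + w 0 1 * g1 u.

Let nue_cont : continuous_at u0 (fun u => nu (eta u)).
Proof. by apply: cont_comp => //; exact: nu_cont. Qed.
Let g0_cont : continuous_at u0 g0.
Proof. by apply: cont_dot => //; apply: mulmx_continuous; [exact: cont_cst|exact: A_unit.2]. Qed.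
Let g1_cont : continuous_at u0 g1.
Proof. by apply: cont_dot => //; apply: mulmx_continuous; [exact: cont_cst|exact: A_unit.2]. Qed.

(** [nu] vanishes on tangent vectors, so it sees only the [dw] part of [y] after subtraction of the
    tangent vector with the same [dz] part; [g0] and [g1] are its two coefficients. *)
Let conormal u y : A u \in unitmx -> Bz u \in unitmx -> (forall k, dot (nu (eta u)) (k *m D u) = 0) ->
  dot (nu (eta u)) y = ga u (rsubmx (y *m A u) - lsubmx (y *m A u) *m invmx (Bz u) *m Bw u).
Proof.
move=> uA uB np; set k := lsubmx (y *m A u) *m invmx (Bz u); set w := _ - _.
have E : y = k *m D u + (w 0 0 *: e0 u + w 0 1 *: e1 u).
  rewrite -[LHS](mulmxK uA) /e0 /e1 !scalemxAl -mulmxDl.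
  have -> : w 0 0 *: row_mx 0 de0 + w 0 1 *: row_mx 0 de1 = row_mx (0 : 'rV[R]_d) w.
    rewrite !scale_row_mx !scaler0 add_row_mx addr0; congr row_mx.
    rewrite [RHS]row_sum_delta big_ord_recl big_ord_recl big_ord0 addr0.
    by rewrite (_ : fintype.lift ord0 ord0 = 1) //; apply: val_inj.
  rewrite -[k *m D u](mulmxK uA) -mulmxDl; congr (_ *m _).
  rewrite -mulmxA -/(B u) -[B u]hsubmxK -/(Bz u) -/(Bw u) mul_mx_row add_row_mx addr0.
  by rewrite /w addrC subrK /k mulmxKV // hsubmxK.
by rewrite {1}E dotDr np add0r dotDr !dotZr.
Qed.

Let g_neq0 : g1 u0 ^+ 2 + g0 u0 ^+ 2 != 0.
Proof.
apply/negP; rewrite paddr_eq0 ?sqr_ge0 // !sqrf_eq0 => /andP[/eqP h1 /eqP h0].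
have : nu p = 0.
  apply: dot_ext => y; rewrite dot0l -eta0 (conormal (u := u0)) /ga ?h0 ?h1 ?mulr0 ?addr0 //.
    exact: nbhs_singleton A_unit.1.
  exact: nbhs_singleton nu_perp.
by apply/eqP.
Qed.

Let D'J_near : \forall u \near u0, J *m A u = A u *m block_mx (rot m) 0 0 rot2.
Proof. by apply: (near_cont ie_cont (Q := fun y => J *m D' y = D' y *m _)); rewrite eta0. Qed.

Let de_rot : de0 *m rot2 = de1 /\ de1 *m rot2 = - de0.
Proof.
split; rewrite mulmxBr !mul_delta_mx_cond /= ?mulr1n ?mulr0n ?subr0 ?sub0r //.
Qed.

(** Multiplication by [i] acts separately on the [dz] and [dw] parts. A tangent vector fails to
    remain tangent by the derivative of the quadratic form, up to terms in [DF], which are of higher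
    order. *)
Let tangent_rot u (h : 'rV[R]_d) : J *m A u = A u *m block_mx (rot m) 0 0 rot2 ->
  A u \in unitmx -> Bz u \in unitmx -> (forall k, dot (nu (eta u)) (k *m D u) = 0) ->
  let a := h *m Bz u in
  dot (nu (eta u)) (h *m D u *m J) = 2 * dot (ze u *m La) (a *m (g1 u *: 1%:M - g0 u *: rot m)) +
    ga u (h *m DF u *m rot2 - a *m rot m *m invmx (Bz u) *m DF u).
Proof.
move=> hJ uA uB np a; rewrite (conormal _ uA uB np).
have hB : h *m B u = row_mx a (h *m Bw u) by rewrite -{1}[B u]hsubmxK mul_mx_row.
have -> : h *m D u *m J *m A u = row_mx (a *m rot m) (h *m Bw u *m rot2).
  rewrite -mulmxA hJ mulmxA -(mulmxA h) -/(B u) hB mul_row_block !mulmx0 addr0 add0r //.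
rewrite row_mxKl row_mxKr; set k := a *m rot m *m invmx (Bz u).
have kB : k *m B u = row_mx (a *m rot m) (k *m Bw u) by rewrite -{1}[B u]hsubmxK mul_mx_row -/(Bz u) /k mulmxKV.
have E1 : h *m Bw u = h *m DF u + (2 * dot (ze u *m La) a) *: de0.
  by rewrite /DF mulmxA DP_mul hB row_mxKl row_mxKr subrK.
have E2 : k *m Bw u = k *m DF u + (2 * dot (ze u *m La) (a *m rot m)) *: de0.
  by rewrite /DF mulmxA DP_mul kB row_mxKl row_mxKr subrK.
rewrite E1 E2 mulmxDl -scalemxAl de_rot.1 (mulmxBr a) -!scalemxAr mulmx1 dotDr dotNr !dotZr.
move: (h *m DF u *m rot2) (k *m DF u) (dot _ a) (dot _ (a *m rot m)) => r s x y.
by rewrite /ga !mxE /=; ring.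
Qed.

(** To second order the pairing of [X] with [tau] is minus the polarised quadratic form, with one
    argument multiplied by the complex number [g1 - g0 rot]. The path [K] starts at the identity and
    ends at the inverse of this number, so [G 1] makes the pairing definite while [G 0] is conjugate
    to [L]. *)
Theorem special_model : exists2 Bm : 'M[R]_d, Bm \in unitmx & forall l v, exists qd : locdata,
  [/\ model iot (fun x => nu x *m J) p qd, ld_G qd 0 = Bm *m L *m invmx Bm, ld_l qd = l & ld_v qd = v].
Proof.
pose rho := g1 u0 ^+ 2 + g0 u0 ^+ 2; have rho0 : rho != 0 := g_neq0.
(* [al + be rot] is the inverse of [g1 - g0 rot] at [u0]. *)
pose al := g1 u0 / rho; pose be := g0 u0 / rho.
have ab : al ^+ 2 + be ^+ 2 != 0.
  have -> : al ^+ 2 + be ^+ 2 = rho^-1 by rewrite /al /be -/rho /rho; field.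
  by rewrite invr_eq0.
have [fa [fb [cfa cfb [fa0 fb0] [fa1 fb1] hfab]]] := punctured_path ab.
pose K s : 'M[R]_d := fa s *: 1%:M + fb s *: rot m.
pose G s := Bz u0 *m L *m K s *m invmx (Bz u0).
have rr := rot_sq m.
have KK (a b c e : R) : (a *: 1%:M + b *: rot m) *m (c *: 1%:M + e *: rot m) = (a * c - b * e) *: 1%:M + (a * e + b * c) *: rot m.
  rewrite mulmxDl !mulmxDr -!scalemxAl -!scalemxAr !mulmx1 !mul1mx rr !scalerA scalerN.
  by apply/matrixP => i j; rewrite !mxE; ring.
have Ku s : 0 <= s <= 1 -> K s \in unitmx.
  move=> s01; have h := hfab s s01.
  have : K s *m ((fa s ^+ 2 + fb s ^+ 2)^-1 *: (fa s *: 1%:M + (- fb s) *: rot m)) = 1%:M.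
    rewrite -scalemxAr KK scalerDr !scalerA.
    have -> : fa s * - fb s + fb s * fa s = 0 by ring.
    rewrite mulr0 scale0r addr0 (_ : _ * _ = 1) ?scale1r //.
    by field.
  by move=> /mulmx1_unit[].
exists (Bz u0) => // l v; exists (LocData eta theta u0 D G l v); split=> //=; last first.
  by rewrite /G /K fa0 fb0 scale1r scale0r addr0 mulmx1.
split=> //=.
- move=> s; apply: mulmx_continuous; last exact: cont_cst.
  apply: mulmx_continuous; first exact: cont_cst.
  by apply: cont_add; apply: cont_scale; try exact: cont_cst; [exact: cfa|exact: cfb].
- by move=> s s01; rewrite row_free_unit /G !unitmx_mul Bz_unit Lu Ku // unitmx_inv Bz_unit.
pose a u := (u - u0) *m G 1 *m Bz u.
have Bz_cont : continuous_at u0 Bz := cont_lsubmx B_cont.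
have G1 : G 1 *m Bz u0 = Bz u0 *m L *m K 1 by rewrite /G mulmxKV.
have asT : asym u0 (fun u => (u - u0) *m G 1) (G 1).
  have cG : continuous_at u0 (fun _ : 'rV[R]_d => G 1) by exact: cont_cst.
  by have := asym_mul (@asym_id R d u0) cG; rewrite mul1mx.
have asA : asym u0 a (Bz u0 *m L *m K 1) by rewrite -G1; exact: asym_mul asT Bz_cont.
have asZ0 : asym u0 ze (Bz u0).
  move=> e e_gt0; apply: near_imp (asym_uqr psu ps0 e_gt0) => u; apply: le_trans.
  by rewrite /ze /Bz mulmx_lsub -linearB; exact: norm_lsubmx.
have asZ : asym u0 (fun u => ze u *m La) (Bz u0 *m La) by apply: asym_mul; [exact: asZ0|exact: cont_cst].
have asM : asym u0 (fun u => a u *m (g1 u *: 1%:M - g0 u *: rot m)) (Bz u0 *m L).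
  have -> : Bz u0 *m L = Bz u0 *m L *m K 1 *m (g1 u0 *: 1%:M - g0 u0 *: rot m).
    rewrite -mulmxA -scaleNr KK fa1 fb1 /al /be.
    have -> : g1 u0 / rho * g1 u0 - g0 u0 / rho * - g0 u0 = 1 by rewrite /rho; field.
    have -> : g1 u0 / rho * - g0 u0 + g0 u0 / rho * g1 u0 = 0 by ring.
    by rewrite scale0r addr0 scale1r mulmx1.
  apply: asym_mul; first exact: asA.
  by apply: cont_sub; apply: cont_scale; [exact: g1_cont|exact: cont_cst|exact: g0_cont|exact: cont_cst].
have [c_h ch0 hch] := asym_bound asT.
have asK : asym u0 (fun u => a u *m rot m *m invmx (Bz u)) (Bz u0 *m L *m K 1 *m rot m *m invmx (Bz u0)).
  apply: asym_mul; last exact: Bz_near.2.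
  by apply: asym_mul; [exact: asA|exact: cont_cst].
have [c_k ck0 hck] := asym_bound asK.
have bdd (g : 'rV[R]_d -> R) : continuous_at u0 g -> \forall u \near u0, `|g u| <= `|g u0| + 1.
  move=> cg; apply: near_imp (near_cont (Q := fun t => t < `|g u0| + 1) (cont_norm cg) _).
    by move=> u /ltW.
  by apply: lt_nbhsl; rewrite ltrDl.
pose M := `|g0 u0| + 1 + (`|g1 u0| + 1).
have M0 : 0 <= M by rewrite !addr_ge0.
pose cz : R := d%:R * `|invmx (Bz u0)| + 1; have cz0 : 0 < cz by rewrite ltr_wpDl // mulr_ge0.
have hcz u : `|u - u0| <= cz * `|(u - u0) *m Bz u0|.
  rewrite -{1}(mulmxK Bz_unit (u - u0)); apply: le_trans (norm_mulmx _ _) _.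
  by rewrite (mulrC `|_ *m _|) mulrA ler_wpM2r // /cz lerDl.
(* The definite part is at least [2 ep |u - u0|^2] and occurs twice, which outweighs the errors, at
   most [3 ep |u - u0|^2] in total. *)
pose ep := mu / (2 * cz ^+ 2); have ep0 : 0 < ep by rewrite divr_gt0 // mulr_gt0 // exprn_gt0.
pose Kc := (2 * (c_h * `|rot2|) + c_k) * M + 1.
have Kc0 : 0 < Kc by rewrite ltr_wpDl // mulr_ge0 // addr_ge0 // mulr_ge0 // mulr_ge0.
have ek0 : 0 < ep / Kc by rewrite divr_gt0.
have [r r0 hr] := F_flat ek0.
have h1 := near_both (near_center u0 r0) (near_both (near_both (bdd _ g0_cont) (bdd _ g1_cont)) (near_both hch hck)).
have h2 := near_both (asym_dot asZ asM ep0) (near_both D'J_near (near_both A_unit.1 (near_both Bz_near.1 nu_perp))).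
apply: near_imp (near_both h1 h2) => u [[ur [[b0 b1] [b2 b3]]] [b4 [b5 [b6 [b7 b8]]]]] uu0.
rewrite dot_mulmxl JT mulmxN dotNr oppr_lt0.
rewrite (tangent_rot _ b5 b6 b7 b8) -/(a u); set k := a u *m rot m *m _ in b3 *; set h := _ *m G 1 in b2 *.
have t0 : 0 < `|u - u0| by rewrite normr_gt0 subr_eq0; exact/eqP.
have d1 := hr u `|u - u0| h (lexx _) t0 ur; have d2 := hr u `|u - u0| k (lexx _) t0 ur.
set w := h *m DF u *m rot2 - k *m DF u.
have dw : `|w| <= (ep / Kc * (2 * (c_h * `|rot2|) + c_k)) * `|u - u0| ^+ 2.
  apply: le_trans (ler_normB _ _) _.
  have l1 : `|h *m DF u *m rot2| <= 2 * ((ep / Kc * `|u - u0| * (c_h * `|u - u0|)) * `|rot2|).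
    apply: le_trans (norm_mulmx _ _) _; rewrite ler_wpM2l // ler_wpM2r //; apply: le_trans d1 _.
    by rewrite ler_wpM2l // mulr_ge0 // ltW.
  have l2 : `|k *m DF u| <= ep / Kc * `|u - u0| * (c_k * `|u - u0|).
    by apply: le_trans d2 _; rewrite ler_wpM2l // mulr_ge0 // ltW.
  apply: le_trans (lerD l1 l2) _; rewrite le_eqVlt; apply/orP; left; apply/eqP; ring.
have dg : `|ga u w| <= ep * `|u - u0| ^+ 2.
  have l1 : `|ga u w| <= `|w| * M.
    rewrite /ga; apply: le_trans (ler_normD _ _) _; rewrite !normrM /M mulrDr.
    by apply: lerD; apply: ler_pM => //; exact: norm_mx_entry.
  apply: le_trans l1 _; apply: le_trans (ler_wpM2r M0 dw) _.
  have -> : ep / Kc * (2 * (c_h * `|rot2|) + c_k) * `|u - u0| ^+ 2 * M = (ep * `|u - u0| ^+ 2) * (((2 * (c_h * `|rot2|) + c_k) * M) / Kc).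
    by field; rewrite gt_eqF.
  apply: ler_piMr; first by rewrite mulr_ge0 ?sqr_ge0 // ltW.
  by rewrite ler_pdivrMr // mul1r /Kc lerDl.
have dz : mu * dot ((u - u0) *m Bz u0) ((u - u0) *m Bz u0) <= dot ((u - u0) *m (Bz u0 *m La)) ((u - u0) *m (Bz u0 *m L)).
  by rewrite !mulmxA; exact: L_pos.
have dn := norm_dot ((u - u0) *m Bz u0); have dt := hcz u.
have dt2 : `|u - u0| ^+ 2 <= cz ^+ 2 * `|(u - u0) *m Bz u0| ^+ 2.
  by rewrite -exprMn lerXn2r ?nnegrE ?mulr_ge0 // ltW.
have fin : ep * `|u - u0| ^+ 2 <= mu / 2 * dot ((u - u0) *m Bz u0) ((u - u0) *m Bz u0).
  apply: le_trans (_ : ep * (cz ^+ 2 * `|(u - u0) *m Bz u0| ^+ 2) <= _); first by rewrite ler_wpM2l // ltW.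
  have -> : ep * (cz ^+ 2 * `|(u - u0) *m Bz u0| ^+ 2) = mu / 2 * `|(u - u0) *m Bz u0| ^+ 2.
    by rewrite /ep; field; rewrite gt_eqF.
  by rewrite ler_wpM2l // divr_ge0 // ltW.
have tp : 0 < ep * `|u - u0| ^+ 2 by rewrite mulr_gt0 // exprn_gt0.
move: dg b4; rewrite !ler_norml => /andP[f1 f2] /andP[f3 f4].
move: (dot (ze u *m La) _) (ga u w) (dot ((u - u0) *m (Bz u0 *m La)) _) (dot ((u - u0) *m Bz u0) _) (ep * _) dz fin tp f1 f2 f3 f4 => x1 x2 x3 x4 x5 *.
by lra.
Qed.
End SpecialModel.

(** * Holomorphic coordinates in real terms *)

Section HolomorphicCoordinates.
Context {R : realType} {n : nat}.
Local Notation m := n.-1.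
Local Notation CZ := ('rV[C R]_m * (C R))%type.

Definition pair2 (w : C R) : 'rV[R]_2 := complex.Re w *: delta_mx 0 0 + complex.Im w *: delta_mx 0 1.
Definition reR (v : CZ) : 'rV[R]_(m + m + 2) := row_mx (realify v.1) (pair2 v.2).

Lemma pair2E w : pair2 w 0 0 = complex.Re w /\ pair2 w 0 1 = complex.Im w.
Proof. by rewrite /pair2 !mxE /= !mulr1 !mulr0 addr0 add0r. Qed.

Lemma linear_mx a b (f : 'rV[R]_a -> 'rV[R]_b) : (forall c x y, f (c *: x + y) = c *: f x + f y) ->
  forall k, k *m (\matrix_i f (delta_mx 0 i)) = f k.
Proof.
move=> lf k; have f0 : f 0 = 0.
  by have := lf (-1) 0 0; rewrite scaler0 addr0 scaleN1r addNr.
rewrite mulmx_sum_row [in RHS](row_sum_delta k).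
elim/big_rec2: _ => [|i x y _ ->]; first by rewrite f0.
by rewrite lf rowK.
Qed.

Lemma realifyZD (k : nat) (c : R) (z w : 'rV[C R]_k) : realify (c%:C *: z + w) = c *: realify z + realify w.
Proof.
rewrite /realify scale_row_mx add_row_mx; congr row_mx; apply/rowP => j; rewrite !mxE;
  case: (z 0 j) => ? ?; case: (w 0 j) => ? ? /=; ring.
Qed.

Lemma reRZD (c : R) (v w : CZ) : reR (c%:C *: v + w) = c *: reR v + reR w.
Proof.
rewrite /reR scale_row_mx add_row_mx realifyZD; congr row_mx; rewrite /pair2.
case: v w => v1 [a b] [w1 [a' b']] /=; apply/rowP => j; rewrite !mxE; ring.
Qed.

Lemma cplxZD (c : R) (y y' : 'rV[R]_(n + n)) : cplx (c *: y + y') = c%:C *: cplx y + cplx y'.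
Proof. by apply: realify_inj; rewrite realifyZD !cplxK. Qed.

Lemma realify_i k (z : 'rV[C R]_k) : realify ('i *: z) = realify z *m rot k.
Proof.
rewrite /rot /realify mul_row_block !mulmx0 add0r addr0 mulmx1 mulmxN mulmx1; congr row_mx.
  by apply/rowP => j; rewrite !mxE; case: (z 0 j) => ? ? /=; ring.
by apply/rowP => j; rewrite !mxE; case: (z 0 j) => ? ? /=; ring.
Qed.

Lemma realify_scale k t (z : 'rV[C R]_k) :
  realify (t *: z) = complex.Re t *: realify z + complex.Im t *: (realify z *m rot k).
Proof.
rewrite -realify_i /realify !scale_row_mx add_row_mx; congr row_mx; apply/rowP => j; rewrite !mxE;
  case: t => ? ?; case: (z 0 j) => ? ? /=; ring.
Qed.

Lemma norm_rot k (y : 'rV[R]_(k + k)) : `|y *m rot k| <= `|y|.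
Proof.
apply: norm_mx_le => // i j; rewrite ord1 -{1}(hsubmxK y) /rot mul_row_block !mulmx0 add0r addr0 mulmx1 mulmxN mulmx1.
case: (split_ordP j) => l ->; first by rewrite row_mxEl !mxE normrN norm_mx_entry.
by rewrite row_mxEr mxE norm_mx_entry.
Qed.

Lemma realify_scale_le k t (z : 'rV[C R]_k) : `|realify (t *: z)| <= cabs t * `|realify z|.
Proof.
rewrite realify_scale; apply: le_trans (ler_normD _ _) _; rewrite !normrZ /cabs mulrDl lerD2l ler_wpM2l //.
exact: norm_rot.
Qed.

Lemma reR_i (v : CZ) : reR ('i *: v) = reR v *m block_mx (rot m) 0 0 rot2.
Proof.
rewrite /reR mul_row_block !mulmx0 addr0 add0r realify_i; congr row_mx.
rewrite /pair2 mulmxDl -!scalemxAl /rot2 !mulmxBr !mul_delta_mx_cond /= !mulr1n !mulr0n subr0 sub0r.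
by case: v.2 => ? ? /=; apply/rowP => j; rewrite !mxE; ring.
Qed.

Lemma rot_tr k : (rot k)^T = - rot k :> 'M[R]_(k + k).
Proof. by rewrite /rot tr_block_mx !trmx0 !trmx1 linearN /= trmx1 opp_block_mx !oppr0 opprK. Qed.

Lemma norm_lt_rV k (z : 'rV[C R]_k) (e : R) : 0 < e -> 2 * `|realify z| < e -> `|z| < e%:C.
Proof.
move=> e0 h; have : ball (0 : 'rV[C R]_k) e%:C z.
  split=> [|i j]; first by rewrite ltcR.
  rewrite ord1 mxE; apply: le_lt_trans (norm_le_cabs _) _; rewrite ltcR; apply: le_lt_trans h.
  have := realify_cabs z 0 j; rewrite mxE (_ : realify 0 = 0) ?subr0; last first.
    by rewrite -[0 in LHS](subrr z) realifyB subrr.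
  by rewrite sub0r cabsN.
by rewrite -ball_normE /= sub0r normrN.
Qed.

Lemma norm_le_rV k (z : 'rV[C R]_k) : `|z| <= (4 * `|realify z|)%:C.
Proof.
have [->|z0] := eqVneq z 0; first by rewrite normr0 lecR mulr_ge0.
have h : 0 < `|realify z|.
  rewrite normr_gt0; apply: contra z0 => /eqP h; apply/eqP/realify_inj; rewrite h.
  by rewrite -[0 in RHS](subrr z) realifyB subrr.
by apply/ltW/norm_lt_rV; [rewrite mulr_gt0|rewrite ltr_pM2r // ltr_nat].
Qed.

Lemma reR_lt (v : CZ) (e : R) : `|v| < e%:C -> `|reR v| <= e.
Proof.
move=> h; have : ball (0 : CZ) e%:C v by rewrite -ball_normE /= sub0r normrN.
case=> -[e0 h1] h2; have e0' : 0 <= e by move: e0; rewrite ltcR => /ltW.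
have c1 w : `|0 - w| < e%:C -> `|complex.Re w| <= e /\ `|complex.Im w| <= e.
  rewrite sub0r normrN normc_def ltcR => /ltW hw; split; apply: le_trans hw; rewrite -sqrtr_sqr.
    by rewrite ler_sqrt ?addr_ge0 ?sqr_ge0 // lerDl sqr_ge0.
  by rewrite ler_sqrt ?addr_ge0 ?sqr_ge0 // lerDr sqr_ge0.
apply: norm_mx_le => // i j; rewrite ord1 /reR; case: (split_ordP j) => k ->.
  rewrite row_mxEl /realify; case: (split_ordP k) => l ->.
    by rewrite row_mxEl mxE; have := h1 0 l; rewrite mxE => /c1[].
  by rewrite row_mxEr mxE; have := h1 0 l; rewrite mxE => /c1[].
rewrite row_mxEr; have [p0 p1] := pair2E v.2; have [q0 q1] := c1 _ h2.
case: k => [[|[|//]] hk].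
  by rewrite (_ : Ordinal hk = 0) ?p0 //; apply: val_inj.
by rewrite (_ : Ordinal hk = 1) ?p1 //; apply: val_inj.
Qed.

Lemma diff_eps_real (f : 'rV[C R]_n -> CZ) x : differentiable f x -> forall e : R, 0 < e ->
  exists2 dl : R, 0 < dl & forall h : 'rV[C R]_n, `|realify h| < dl ->
    `|reR (f (h + x) - (f x + 'd f x h))| <= e * `|realify h|.
Proof.
move=> df e e0; have e5 : 0 < (e / 5)%:C :> C R by rewrite ltcR divr_gt0.
have /nbhsCP[dl dl0 hdl] := diff_eps df e5.
have r0 : realify (0 : 'rV[C R]_n) = 0 by rewrite -[0 in LHS](subrr 0) realifyB subrr.
exists dl => // h hh; have := hdl h; rewrite r0 subr0 => /(_ hh) hv.
have [h0|h0] := eqVneq (realify h) 0.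
  have -> : h = 0 by apply: realify_inj; rewrite h0 r0.
  rewrite add0r linear0 addr0 subrr.
  have -> : reR 0 = 0 by have := reRZD (-1) 0 0; rewrite rmorphN1 scaleN1r addNr scaleN1r addNr.
  by rewrite normr0 mulr_ge0 // ltW.
have hp : 0 < `|realify h| by rewrite normr_gt0.
apply: reR_lt; apply: le_lt_trans hv _.
apply: le_lt_trans (_ : (e / 5)%:C * (4 * `|realify h|)%:C < _).
  by rewrite ler_wpM2l ?(ltW e5) // norm_le_rV.
rewrite -rmorphM ltcR.
have -> : e / 5 * (4 * `|realify h|) = (4 / 5) * (e * `|realify h|) by field.
by rewrite gtr_pMl ?mulr_gt0 //; lra.
Qed.

(** Complex linear functionals controlled by the real norm; the estimates in one variable are
    applied to each of them. *)
Definition component (comp : CZ -> C R) := [/\ forall v w, comp (v - w) = comp v - comp w,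
  forall a v, comp (a *: v) = a * comp v & forall v, cabs (comp v) <= 2 * `|reR v|].

Lemma component1 j : component (fun v : CZ => v.1 0 j).
Proof.
split=> [v w|a v|v]; rewrite ?mxE // /cabs.
have h1 := norm_mx_entry (reR v) 0 (lshift 2 (lshift m j)).
have h2 := norm_mx_entry (reR v) 0 (lshift 2 (rshift m j)).
have q1 : reR v 0 (lshift 2 (lshift m j)) = complex.Re (v.1 0 j) by rewrite /reR row_mxEl /realify row_mxEl mxE.
have q2 : reR v 0 (lshift 2 (rshift m j)) = complex.Im (v.1 0 j) by rewrite /reR row_mxEl /realify row_mxEr mxE.
by rewrite q1 in h1; rewrite q2 in h2; lra.
Qed.

Lemma component2 : component (fun v : CZ => v.2).
Proof.
split=> // v; rewrite /cabs; have [p0 p1] := pair2E v.2; rewrite -p0 -p1.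
have h1 := norm_mx_entry (reR v) 0 (rshift (m + m) 0).
have h2 := norm_mx_entry (reR v) 0 (rshift (m + m) 1).
by move: h1 h2; rewrite {1 3}/reR !row_mxEr; lra.
Qed.

Lemma reR_components (v : CZ) (c : R) : 0 <= c -> (forall comp, component comp -> cabs (comp v) <= c) -> `|reR v| <= c.
Proof.
move=> c0 h; apply: norm_mx_le => // i j; rewrite ord1 /reR; case: (split_ordP j) => k ->.
  rewrite row_mxEl /realify; case: (split_ordP k) => l ->.
    by rewrite row_mxEl mxE; apply: le_trans (cabs_Re _) _; exact: h (component1 l).
  by rewrite row_mxEr mxE; apply: le_trans (cabs_Im _) _; exact: h (component1 l).
rewrite row_mxEr; have [p0 p1] := pair2E v.2; have h2 := h _ component2.
case: k => [[|[|//]] hk].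
  by rewrite (_ : Ordinal hk = 0) ?p0; [apply: le_trans (cabs_Re _) h2|apply: val_inj].
by rewrite (_ : Ordinal hk = 1) ?p1; [apply: le_trans (cabs_Im _) h2|apply: val_inj].
Qed.

Lemma special_Q_real (lam : 'I_m -> R) z : special_Q lam z = (dot (realify z *m qdiag lam) (realify z))%:C.
Proof.
rewrite /dot big_split_ord /= -big_split /= rmorph_sum; apply: eq_bigr => j _.
have e1 : (realify z *m qdiag lam) 0 (lshift m j) = complex.Re (z 0 j) * (1 + lam j).
  by rewrite /qdiag mul_mx_diag mxE /realify !row_mxEl !mxE.
have e2 : (realify z *m qdiag lam) 0 (rshift m j) = complex.Im (z 0 j) * (1 - lam j).
  by rewrite /qdiag mul_mx_diag mxE /realify !row_mxEr !mxE.
have e3 : realify z 0 (lshift m j) = complex.Re (z 0 j) by rewrite /realify row_mxEl mxE.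
have e4 : realify z 0 (rshift m j) = complex.Im (z 0 j) by rewrite /realify row_mxEr mxE.
rewrite e1 e2 e3 e4.
by case: (z 0 j) => a b; apply/eqP; rewrite eq_complex /=; apply/andP; split; apply/eqP; ring.
Qed.

Variables (p : 'rV[C R]_n) (U : set 'rV[C R]_n) (Phi : 'rV[C R]_n -> CZ).
Hypothesis U_open : open U.
Hypothesis Up : U p.
Hypothesis Phi_hol : holomorphic U Phi.
Hypothesis Phi_p : Phi p = (0, 0).

Definition PhiR (y : 'rV[R]_(n + n)) := reR (Phi (cplx y)).
Definition dPhiR (y : 'rV[R]_(n + n)) : 'M[R]_(n + n, m + m + 2) :=
  \matrix_i reR ('d Phi (cplx y) (cplx (delta_mx 0 i))).

Lemma dPhiR_mul y k : k *m dPhiR y = reR ('d Phi (cplx y) (cplx k)).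
Proof.
apply: (linear_mx (f := fun k => reR ('d Phi (cplx y) (cplx k)))) => c a b.
by rewrite cplxZD linearD linearZ /= reRZD.
Qed.

Lemma dPhiR_rot y : rot n *m dPhiR y = dPhiR y *m block_mx (rot m) 0 0 rot2.
Proof.
apply/row_matrixP => i; rewrite !rowE; set k := delta_mx 0 i.
rewrite !mulmxA !dPhiR_mul -reR_i; congr reR.
have -> : cplx (k *m rot n) = 'i *: cplx k by apply: realify_inj; rewrite realify_i !cplxK.
by rewrite linearZ.
Qed.

Lemma Phi_small (e : R) : 0 < e -> \forall z \near p, U z /\ `|reR (Phi z)| <= e.
Proof.
move=> e0; apply: filterI; first exact: open_nbhs_nbhs.
have cP : {for p, continuous Phi} by apply: differentiable_continuous; exact: Phi_hol.
have : \forall v \near Phi p, `|reR v| <= e.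
  apply/nbhs_ballP; exists e%:C => /=; first by rewrite ltcR.
  move=> v; rewrite Phi_p => hv; apply: reR_lt; move: hv; rewrite -ball_normE /=.
  by rewrite -[(0, 0)]/(0 : CZ) sub0r normrN.
exact: cP.
Qed.

(** Restriction to the complex line through [y] and [y'], reached at [t = 1]. The line stays in the
    domain for [t] up to a radius of order [1 / |y' - y|], and the remainder, of order the inverse
    square of this radius, is quadratic in the increment. *)
Lemma PhiR_uqr : uqr PhiR dPhiR (realify p).
Proof.
have nb := Phi_small ltr01.
have /nbhsCP[e e0 he] := nb.
(* The constant of [holomorphic_quadratic_remainder] for the bound 2 and the radius
   [e / (4 * |de|)], with the factor [|de|^2] taken out. *)
pose K : R := 2 * 8 * 4 * 8 * 2 * 256 * 16 / e ^+ 2.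
exists K, (e / 64); split; [by rewrite divr_ge0 ?sqr_ge0|by rewrite divr_gt0|] => y y' hy hy'.
set de := y' - y; have -> : PhiR y' - PhiR y - de *m dPhiR y = reR (Phi (cplx y') - Phi (cplx y) - 'd Phi (cplx y) (cplx de)).
  rewrite dPhiR_mul /PhiR.
  have rB v w : reR (v - w) = reR v - reR w by have := reRZD (-1) w v; rewrite rmorphN1 !scaleN1r addrC => ->; rewrite addrC.
  by rewrite !rB.
have [de0|de0] := eqVneq de 0.
  have -> : cplx y' = cplx y by congr cplx; apply/eqP; rewrite -subr_eq0 -/de de0.
  have -> : cplx de = 0 by rewrite de0; apply: realify_inj; rewrite cplxK -[0 in RHS](subrr 0) realifyB subrr.
  rewrite linear0 subr0 subrr.
  have -> : reR 0 = 0 by have := reRZD (-1) 0 0; rewrite rmorphN1 scaleN1r addNr scaleN1r addNr.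
  by rewrite normr0 mulr_ge0 ?sqr_ge0 // divr_ge0 ?sqr_ge0.
have dp : 0 < `|de| by rewrite normr_gt0.
have dle : `|de| <= e / 32.
  have -> : de = (y' - realify p) - (y - realify p) by rewrite /de opprB addrA subrK.
  by apply: le_trans (ler_normB _ _) _; lra.
apply: reR_components => [|comp [cB cZ cb]]; first by rewrite mulr_ge0 ?sqr_ge0 // divr_ge0 ?sqr_ge0.
pose rho := e / (4 * `|de|); have rho0 : 0 < rho by rewrite divr_gt0 // mulr_gt0.
pose pt (t : C R) := cplx y + t *: cplx de.
have hpt t : cabs t <= rho -> `|realify (pt t) - realify p| < e.
  move=> ht; have l1 : `|realify (pt t) - y| <= cabs t * `|de|.
    rewrite -{1}(cplxK y) -realifyB /pt addrAC subrr add0r.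
    by apply: le_trans (realify_scale_le _ _) _; rewrite cplxK.
  have -> : realify (pt t) - realify p = (realify (pt t) - y) + (y - realify p) by rewrite addrA subrK.
  apply: le_lt_trans (ler_normD _ _) _; have : cabs t * `|de| <= e / 4.
    by apply: le_trans (ler_wpM2r (ltW dp) ht) _; rewrite /rho invfM mulrA divfK // gt_eqF.
  lra.
have H := @holomorphic_quadratic_remainder R (fun t => comp (Phi (pt t))) (fun t => comp ('d Phi (pt t) (cplx de))) rho 2 rho0.
have A1 t : cabs t <= rho -> cdiff (fun t => comp (Phi (pt t))) t (comp ('d Phi (pt t) (cplx de))) /\ cabs (comp (Phi (pt t))) <= 2.
  move=> ht; have [Ut bt] := he _ (hpt t ht); split; last by apply: le_trans (cb _) _; lra.
  move=> e1 e10; have e2 : 0 < e1 / (2 * `|de|) by rewrite divr_gt0 // mulr_gt0.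
  have [dl dl0 hdl] := diff_eps_real (Phi_hol Ut) e2.
  exists (dl / `|de|) => [|t' ht']; first by rewrite divr_gt0.
  pose h := (t' - t) *: cplx de.
  have hh : `|realify h| <= cabs (t' - t) * `|de| by apply: le_trans (realify_scale_le _ _) _; rewrite cplxK.
  have hh' : `|realify h| < dl by apply: le_lt_trans hh _; rewrite -ltr_pdivlMr.
  have -> : comp (Phi (pt t')) - comp (Phi (pt t)) - comp ('d Phi (pt t) (cplx de)) * (t' - t) =
      comp (Phi (h + pt t) - (Phi (pt t) + 'd Phi (pt t) h)).
    have -> : h + pt t = pt t' by rewrite /h /pt addrCA -scalerDl subrK.
    by rewrite opprD addrA !cB /h [X in _ = _ - comp X]linearZ /= cZ mulrC.
  apply: le_trans (cb _) _; apply: le_trans (ler_wpM2l _ (hdl _ hh')) _ => //.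
  apply: le_trans (_ : 2 * (e1 / (2 * `|de|) * (cabs (t' - t) * `|de|)) <= _).
    by rewrite ler_wpM2l // ler_wpM2l // ltW.
  by rewrite le_eqVlt; apply/orP; left; apply/eqP; field; rewrite gt_eqF.
have A2 : cabs (1 : R[i]) <= rho / 8.
  by rewrite -[1]/(1%:C) cabsR normr1 ler_pdivlMr // mul1r /rho ler_pdivlMr ?mulr_gt0 //; lra.
have := H A1 1 A2.
rewrite -[1]/(1%:C) cabsR normr1 expr1n !mulr1 /pt scale0r addr0 scale1r.
have -> : cplx y + cplx de = cplx y'.
  by have := cplxZD 1 y de; rewrite !scale1r => <-; rewrite /de addrC subrK.
rewrite !cB; move=> H1; apply: le_trans H1 _; rewrite le_eqVlt; apply/orP; left; apply/eqP.
by rewrite /K /rho; field; rewrite !gt_eqF.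
Qed.

Lemma reR_eq0 (v : CZ) : reR v = 0 -> v = 0.
Proof.
move=> v0; have h comp : component comp -> comp v = 0.
  move=> [_ _ /(_ v)]; rewrite v0 normr0 mulr0 => hv; apply/eqP; rewrite -cabs_eq0.
  by rewrite eq_le hv cabs_ge0.
case: v h {v0} => v1 v2 h; congr pair; last exact: h component2.
by apply/rowP => j; rewrite mxE; exact: h (component1 j).
Qed.

(** A vector killed by the derivative of [Phi] is killed by that of [Psi \o Phi], which is the
    identity near [p]. *)
Lemma dPhiR_free (U' : set CZ) (Psi : CZ -> 'rV[C R]_n) : holomorphic U' Psi ->
  (forall x, U x -> U' (Phi x) /\ Psi (Phi x) = x) -> row_free (dPhiR (realify p)).
Proof.
move=> hPsi inv; rewrite -kermx_eq0; apply/eqP/row_matrixP => i; rewrite row0.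
set k := row i _; have : k *m dPhiR (realify p) = 0 by apply/eqP; rewrite -sub_kermx row_sub.
rewrite dPhiR_mul realifyK => /reR_eq0 dk; have [U'p Pp] := inv p Up.
have dP := Phi_hol Up; have dQ := hPsi _ U'p.
have dc : differentiable (Psi \o Phi) p by exact: differentiable_comp.
have dz : 'd (Psi \o Phi) p (cplx k) = 0 by rewrite diff_comp //= dk linear0.
have half : 0 < (1 / 2)%:C :> C R by rewrite ltcR divr_gt0.
have /nbhsCP[e1 e10 he1] := diff_eps dc half.
have /nbhsCP[e2 e20 he2] : \forall z \near p, U z by exact: open_nbhs_nbhs.
pose t : R := Num.min e1 e2 / (2 * (`|k| + 1)).
have k1 : 0 < `|k| + 1 by rewrite ltr_wpDl.
have em : 0 < Num.min e1 e2 by rewrite lt_min e10.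
have t0 : 0 < t by rewrite divr_gt0 // mulr_gt0.
have rt : realify (t%:C *: cplx k) = t *: k.
  by have := realifyZD t (cplx k) 0; rewrite addr0 cplxK (_ : realify 0 = 0) ?addr0 // -[0 in LHS](subrr 0) realifyB subrr.
have nt : `|t *: k| < Num.min e1 e2.
  rewrite normrZ gtr0_norm //; apply: le_lt_trans (_ : t * (`|k| + 1) < _).
    by rewrite ler_wpM2l ?(ltW t0) // lerDl.
  have -> : t * (`|k| + 1) = Num.min e1 e2 / 2 by rewrite /t; field; rewrite gt_eqF.
  lra.
have r00 : realify (0 : 'rV[C R]_n) = 0 by rewrite -[0 in LHS](subrr 0) realifyB subrr.
move: nt; rewrite lt_min => /andP[n1 n2].
have Uh : U (t%:C *: cplx k + p).
  by apply: he2; rewrite -realifyB addrK rt.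
have := he1 (t%:C *: cplx k); rewrite r00 subr0 rt => /(_ n1).
rewrite linearZ /= dz scaler0 addr0; have [_ ->] := inv _ Uh; rewrite Pp addrK => hn.
have : `|t%:C *: cplx k| = 0.
  apply/eqP; rewrite eq_le normr_ge0 andbT; move: hn; set N1 := `|_|.
  have e : (1 / 2)%:C - 1 = - (1 / 2)%:C :> C R.
    by apply/eqP; rewrite eq_complex /=; apply/andP; split; apply/eqP; lra.
  by rewrite -{1}(mul1r N1) -subr_ge0 -mulrBl e mulNr oppr_ge0 pmulr_rle0.
move/eqP; rewrite normr_eq0 scaler_eq0 => /orP[/eqP ht|/eqP hk].
  by move: t0; have := congr1 (@complex.Re R) ht => /= ->; rewrite ltxx.
by rewrite -(cplxK k) hk r00.
Qed.

End HolomorphicCoordinates.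

Section SpecialPoint.
Context {R : realType} {n : nat}.
Local Notation m := n.-1.
Local Notation CZ := ('rV[C R]_m * (C R))%type.

(** On [S] the coordinate [w] equals [f z], so the cubic remainder of [f] bounds the defining
    function along [S]; constants come from comparing complex and real norms. *)
Lemma local_equation_graph (S : set 'rV[C R]_n) (x0 : set_type S) (lam : 'I_m -> R) :
  local_equation S (val x0) (special_Q lam) ->
  exists (Phi : 'rV[R]_(n + n) -> 'rV[R]_(m + m + 2)) D', [/\ uqr Phi D' (embed x0), Phi (embed x0) = 0,
    forall y, rot n *m D' y = D' y *m block_mx (rot m) 0 0 rot2, row_free (D' (embed x0)) &
    exists2 c : R, 0 <= c & \forall x \near x0,
    `|rsubmx (Phi (embed x)) - dot (lsubmx (Phi (embed x)) *m qdiag lam) (lsubmx (Phi (embed x))) *: delta_mx 0 0| <=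
     c * `|lsubmx (Phi (embed x))| ^+ 3].
Proof.
move=> [U [U' [Phi [Psi [f [[oU Up oU' Phip [hPhi hPsi inv _]] im fO]]]]]].
exists (PhiR Phi), (dPhiR Phi); split.
- exact: PhiR_uqr oU Up hPhi Phip.
- rewrite /PhiR /embed realifyK Phip -[(0, 0)]/(0 : CZ).
  by have := reRZD (R := R) (n := n) (-1) 0 0; rewrite rmorphN1 scaleN1r addNr scaleN1r addNr.
- exact: dPhiR_rot.
- by first [exact: (dPhiR_free oU Up hPhi Phip hPsi inv) | exact: (dPhiR_free oU Up hPhi hPsi inv)].
have /eqO_exP[k k0 hk] := fO.
have [kr kr0 kE] : exists2 a : R, 0 < a & k = a%:C.
  by case: k k0 {hk} => a b; rewrite ltcE /= => /andP[/eqP -> a0]; exists a.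
have /nbhsCP[dl dl0 hdl] := hk; have d2 : 0 < dl / 2 by rewrite divr_gt0.
have /nbhsCP[e e0 he] := Phi_small oU Up hPhi Phip d2.
exists (2 * (kr * 64)); first by rewrite !mulr_ge0 // ltW.
apply/set_type_nbhsP; exists e => // x xe; have [Ux sx] := he (val x) xe.
rewrite /PhiR /embed realifyK; set v := Phi (val x) in sx *.
have lv : lsubmx (reR v) = realify v.1 by rewrite /reR row_mxKl.
have rv : rsubmx (reR v) = pair2 v.2 by rewrite /reR row_mxKr.
rewrite lv rv; have : (U' `&` [set y | y.2 = f y.1]) v.
  by rewrite -im; exists (val x) => //; split=> //; exact: set_valP.
move=> [_ /= vf]; have small : `|realify v.1 - realify 0| < dl.
  rewrite -realifyB subr0 -lv; apply: le_lt_trans (norm_lsubmx _) _; lra.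
have := hdl v.1 small; rewrite -vf special_Q_real kE normrX normr_id => hv.
set qq := dot _ _ in hv *.
have nb : `|v.2 - qq%:C| <= (kr * (4 * `|realify v.1|) ^+ 3)%:C.
  apply: le_trans hv _; rewrite rmorphM rmorphXn /= ler_wpM2l ?lecR ?(ltW kr0) //.
  by rewrite lerXn2r ?nnegrE ?lecR ?mulr_ge0 // norm_le_rV.
have cb := cabs_le_norm nb.
apply: le_trans (_ : cabs (v.2 - qq%:C) <= _); last first.
  by apply: le_trans cb _; rewrite exprMn le_eqVlt; apply/orP; left; apply/eqP; ring.
apply: norm_mx_le => [|i j]; first exact: cabs_ge0.
rewrite ord1; have [p0 p1] := pair2E v.2.
case: j => [[|[|//]] hj].
  rewrite (_ : Ordinal hj = 0); last exact: val_inj.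
  apply: le_trans (cabs_Re _).
  have -> : (pair2 v.2 - qq *: delta_mx 0 0) 0 0 = complex.Re v.2 - qq by rewrite mxE p0 !mxE /= mulr1.
  by case: v.2.
rewrite (_ : Ordinal hj = 1); last exact: val_inj.
apply: le_trans (cabs_Im _).
have -> : (pair2 v.2 - qq *: delta_mx 0 0) 0 1 = complex.Im v.2 by rewrite mxE p1 !mxE /= mulr0 subr0.
by case: v.2 => ? ? /=; rewrite subr0.
Qed.

(** In the elliptic case the form is positive and [L] is the identity. In the hyperbolic case
    [1 - lam j0] is the only negative coefficient, and [L] reflects the corresponding imaginary
    axis. *)
Lemma special_model_gen (T : topologicalType) (k d N : nat) (eN : N = (k + k + 2)%N) (ed : d = (k + k)%N)
  (iot : T -> 'rV[R]_N) (J : 'M[R]_N) (nu : T -> 'rV[R]_N) (p : T) (eta : 'rV[R]_d -> T) theta u0 (D : 'rV[R]_d -> 'M[R]_(d, N))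
  (Phi : 'rV[R]_N -> 'rV[R]_(k + k + 2)) D' (lam : 'I_k -> R) :
  continuous iot -> chart iot p eta theta u0 D -> J^T = - J -> continuous nu -> nu p != 0 ->
  (\forall u \near u0, forall k, dot (nu (eta u)) (k *m D u) = 0) ->
  uqr Phi D' (iot p) -> Phi (iot p) = 0 -> (forall y, J *m D' y = D' y *m block_mx (rot k) 0 0 rot2) ->
  row_free (D' (iot p)) ->
  (exists2 c : R, 0 <= c & \forall x \near p,
    `|rsubmx (Phi (iot x)) - dot (lsubmx (Phi (iot x)) *m qdiag lam) (lsubmx (Phi (iot x))) *: delta_mx 0 0| <=
     c * `|lsubmx (Phi (iot x))| ^+ 3) ->
  (forall j, 0 <= lam j) ->
  ((forall j, lam j < 1) -> exists2 q : @locdata R T N d, model iot (fun x => nu x *m J) p q & ld_G q 0 = 1%:M) /\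
  (forall j0, 1 < lam j0 -> (forall j, j != j0 -> lam j < 1) -> exists q : @locdata R T N d,
    [/\ model iot (fun x => nu x *m J) p q, ld_v q *m ld_l q = 1%:M &
        ld_G q 0 = 1%:M - 2 *: (ld_l q *m ld_v q)]).
Proof.
subst N d => ci ch JT cn n0 np hP P0 PJ Pf gr lam0; rewrite row_free_unit in Pf.
have PJ' : \forall y \near iot p, J *m D' y = D' y *m block_mx (rot k) 0 0 rot2.
  by apply: (proj2 (@near_normP R 'rV[R]_(k + k + 2) (iot p) _)); exists 1.
have pos (w : 'I_(k + k) -> R) : (forall i, 0 < w i) -> exists2 mu, 0 < mu & forall z : 'rV[R]_(k + k), mu * dot z z <= \sum_i w i * (z 0 i * z 0 i).
  move=> w0; have [e e0 he] := @seq_uniform_pos R _ (enum 'I_(k + k)) (fun i e => e <= w i)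
    (fun i e e' h _ h' => le_trans h' h) (fun i _ => ex_intro2 _ _ (w i) (w0 i) (lexx _)).
  exists e => // z; rewrite /dot mulr_sumr; apply: ler_sum => i _.
  by rewrite ler_wpM2r -?expr2 ?sqr_ge0 // he // mem_enum.
pose ll := row_mx (\row_j (1 + lam j)) (\row_j (1 - lam j)) : 'rV[R]_(k + k).
have zL (z : 'rV[R]_(k + k)) i : (z *m qdiag lam) 0 i = z 0 i * ll 0 i by rewrite /qdiag mul_mx_diag mxE.
split=> [lam1|j0 lj0 lj].
  have [mu mu0 hmu] : exists2 mu, 0 < mu & forall z : 'rV[R]_(k + k), mu * dot z z <= dot (z *m qdiag lam) (z *m 1%:M).
    have [|mu mu0 h] := pos (fun i => ll 0 i).
      move=> i; rewrite /ll; case: (split_ordP i) => j ->; rewrite ?row_mxEl ?row_mxEr mxE.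
        by rewrite ltr_pwDl.
      by rewrite subr_gt0.
    exists mu => // z; apply: le_trans (h z) _; rewrite mulmx1 le_eqVlt; apply/orP; left; apply/eqP.
    by apply: eq_bigr => i _; rewrite zL; ring.
  have [Bm uB hB] := special_model ci ch JT cn n0 np hP P0 PJ' Pf gr mu0 hmu (unitmx1 _ _).
  have [q [mq qG _ _]] := hB 0 0; exists q => //; by rewrite qG mulmx1 mulmxV.
pose i0 := rshift k j0; pose E : 'M[R]_(k + k) := delta_mx i0 i0; pose L := 1%:M - 2 *: E.
have EE : E *m E = E by rewrite /E mul_delta_mx.
have Lu : L \in unitmx.
  have : L *m L = 1%:M.
    rewrite /L mulmxBl mul1mx mulmxBr mulmx1 -!scalemxAl -!scalemxAr EE scalerA.
    by apply/matrixP => i j; rewrite !mxE; ring.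
  by move=> /mulmx1_unit[].
have [mu mu0 hmu] : exists2 mu, 0 < mu & forall z : 'rV[R]_(k + k), mu * dot z z <= dot (z *m qdiag lam) (z *m L).
  have [|mu mu0 h] := pos (fun i => ll 0 i * (1 - 2 * (i == i0)%:R)).
    move=> i; rewrite /ll; case: (split_ordP i) => j ->; rewrite ?row_mxEl ?row_mxEr mxE /i0.
      by rewrite eq_lrshift mulr0 subr0 mulr1 ltr_pwDl.
    rewrite eq_rshift; case: eqVneq => [->|jj] /=; first by have := lj0; nra.
    by have := lj _ jj; nra.
  exists mu => // z; apply: le_trans (h z) _; rewrite le_eqVlt; apply/orP; left; apply/eqP.
  apply: eq_bigr => i _; rewrite zL.
  have -> : (z *m L) 0 i = z 0 i * (1 - 2 * (i == i0)%:R).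
    rewrite /L mulmxBr mulmx1 -scalemxAr !mxE (bigD1 i0) //= big1 ?addr0 => [|j ji].
      rewrite mxE eqxx /=; case: eqVneq => [->|_] /=; ring.
    by rewrite mxE (negbTE ji) mulr0.
  ring.
have [Bm uB hB] := special_model ci ch JT cn n0 np hP P0 PJ' Pf gr mu0 hmu Lu.
pose de : 'rV[R]_(k + k) := delta_mx 0 i0.
(* Conjugated by [Bm], the reflection [1 - 2 E] has the form [1 - 2 l v] with these [l] and [v]. *)
have [q [mq qG ql qv]] := hB (Bm *m de^T) (de *m invmx Bm); exists q; split=> //.
  rewrite ql qv mulmxA mulmxKV // /de trmx_delta mul_delta_mx.
  by apply/matrixP => i j; rewrite !ord1 !mxE.
have -> : ld_l q *m ld_v q = Bm *m E *m invmx Bm.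
  by rewrite ql qv mulmxA -(mulmxA Bm de^T de) /de trmx_delta mul_delta_mx.
rewrite qG /L.
by rewrite mulmxBr mulmx1 mulmxBl mulmxV // -scalemxAr -scalemxAl.
Qed.
End SpecialPoint.

(** * Even-dimensional spheres *)

Section EvenSphere.
Context {R : realType} {T : topologicalType} {k : nat}.
Local Notation d := (k + k)%N.
Local Notation N := (1 + (k + k))%N.
Hypothesis T_compact : compact [set: T].
Variables (f0 : T -> set_type (sphere R d)) (g0 : set_type (sphere R d) -> T).
Hypothesis f0_cont : continuous f0.
Hypothesis g0_cont : continuous g0.
Hypothesis f0K : cancel f0 g0.
Hypothesis g0K : cancel g0 f0.

Lemma cont_set_type (X V : topologicalType) (B : set V) (F : X -> set_type B) x :
  continuous_at x (fun y => val (F y)) -> continuous_at x F.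
Proof.
move=> c Q; rewrite nbhsE => -[Q' [[V0 oV <-] Vx] QQ].
have hV : nbhs (val (F x)) V0 by exact: open_nbhs_nbhs.
by apply: (@filterS _ (nbhs x) (nbhs_filter x) _ _ _ (c _ hV)) => y Vy; exact: QQ.
Qed.

Let iot (x : T) : 'rV[R]_N := val (f0 x).
Let nrm (y : 'rV[R]_N) := (Num.sqrt (dot y y))^-1 *: y.
Let n1 : R := N%:R.
Let n10 : 1 <= n1. Proof. by rewrite /n1 ler1n. Qed.

Lemma sphereP (x : set_type (sphere R d)) : dot (val x : 'rV[R]_N) (val x) = 1.
Proof. by have := set_valP x; rewrite /= => E; rewrite -[RHS]E; apply: eq_bigr => i _; rewrite expr2. Qed.

Lemma iot_sphere x : dot (iot x) (iot x) = 1. Proof. exact: sphereP. Qed.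

Lemma iot_norm x : `|iot x| <= 1 /\ n1^-1 <= `|iot x|.
Proof.
have h1 := norm_dot (iot x); have h2 := dot_norm (iot x) (iot x).
rewrite iot_sphere in h1 h2; rewrite normr1 -/n1 in h2; have h0 : 0 <= `|iot x| by [].
have h3 : `|iot x| <= 1 by nra.
split=> //; rewrite -div1r ler_pdivrMr; first by have := n10; nra.
by have := n10; lra.
Qed.

Lemma dot_sphere (y : 'rV[R]_N) : dot y y = 1 -> sphere R d y.
Proof. by move=> E; rewrite /sphere /= -[RHS]E; apply: eq_bigr => i _; exact: expr2. Qed.

Lemma nrm_sphere y : y != 0 -> sphere R d (nrm y).
Proof.
move=> y0; have d0 : 0 < dot y y by rewrite dot_gt0.
apply: dot_sphere; rewrite /nrm dotZl dotZr mulrA -expr2 exprVn sqr_sqrtr ?dot_ge0 // mulVf //.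
by rewrite gt_eqF.
Qed.

Lemma exP (x0 : set_type (sphere R d)) : exists P : 'rV[R]_N -> set_type (sphere R d), forall y, y != 0 -> val (P y) = nrm y.
Proof.
have /choice[P hP] : forall y, exists x : set_type (sphere R d), y != 0 -> val x = nrm y.
  move=> y; have [y0|y0] := eqVneq y 0; first by exists x0.
  by exists (SigSub (mem_set (nrm_sphere y0))).
by exists P.
Qed.

Let pole (s : R) : 'rV[R]_N := row_mx s%:M 0.

Lemma pole_sphere s : s ^+ 2 = 1 -> sphere R d (pole s).
Proof.
move=> s1; apply: dot_sphere.
by rewrite dot_row_mx dot0l addr0 /dot big_ord1 !mxE eqxx mulr1n -expr2.
Qed.

(** The displacement theorem with two elliptic points and no arc. Even dimension provides the
    rotation [rot k] around the axis; a slight turn fixes only the poles, and the cut-off [al] makes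
    the map constant near them. *)
Lemma euler_even_sphere_aux : euler_characteristic R T = 2.
Proof.
have pP : sphere R d (pole 1) by apply: pole_sphere; rewrite expr1n.
have pM : sphere R d (pole (-1)) by apply: pole_sphere; rewrite sqrrN expr1n.
pose NP : set_type (sphere R d) := SigSub (mem_set pP); pose SP : set_type (sphere R d) := SigSub (mem_set pM).
have [P hP] := exP NP.
pose eta := n1^-1; have n1p : 0 < n1 by apply: lt_le_trans n10.
have eta0 : 0 < eta by rewrite invr_gt0.
have iot_cont : continuous iot by move=> x; apply: cont_comp; [exact: f0_cont|exact: initial_continuous].
have nrm1 y : dot y y = 1 -> nrm y = y by rewrite /nrm => ->; rewrite sqrtr1 invr1 scale1r.
have y1 y : dot y y = 1 -> y != 0 by apply: contra_eqN => /eqP ->; rewrite dot0l eq_sym oner_eq0.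
pose r y := g0 (P y).
have rK x : r (iot x) = x.
  rewrite /r -[RHS]f0K; congr g0; apply: val_inj; rewrite hP ?y1 ?iot_sphere // nrm1 ?iot_sphere //.
have Pc (y : 'rV[R]_N) : y != 0 -> continuous_at y P.
  move=> y0; apply: cont_set_type; apply: (@eq_near_cont _ _ _ nrm).
    have h : \forall z \near y, 0 < `|z|.
      have cn : continuous_at y (fun z : 'rV[R]_N => `|z|) by apply: cont_norm; exact: cont_id.
      by apply: (near_cont (Q := fun t : R => 0 < t) cn); apply: lt_nbhsr; rewrite normr_gt0.
    by apply: filterS h => z; rewrite normr_gt0 => /hP.
  apply: cont_scale; last exact: cont_id.
  apply: cont_inv; last by rewrite sqrtr_eq0 -ltNge dot_gt0.
  by apply: cont_sqrt; apply: cont_dot; exact: cont_id.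
have rc x (y : 'rV[R]_N) : `|y - iot x| < eta -> {for y, continuous r}.
  move=> h; apply: (@cont_comp _ _ _ P g0); last exact: g0_cont.
  apply: Pc; apply: contraTneq h => ->; rewrite sub0r normrN -leNgt.
  by have [] := iot_norm x.
(* The displacement is at most [(9 n1 + 3) del], which this value makes a quarter of [eta]. *)
pose del : R := (12 * n1 * (3 * n1 + 1))^-1.
have c0 : 0 < 12 * n1 * (3 * n1 + 1) by rewrite !mulr_gt0 // addr_gt0 // mulr_gt0.
have del0 : 0 < del by rewrite invr_gt0.
have delE : 12 * n1 * (3 * n1 + 1) * del = 1 by rewrite mulfV // gt_eqF.
have del1 : del < 1 / 12 by have := n10; nra.
have deln : n1 * del < 1 / 12 by have := n10; nra.
pose mm (s : R) : R := Num.max 0 (s / del - 1); have mm0 s : 0 <= mm s by rewrite /mm le_max lexx.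
pose al (s : R) : R := 1 - Num.max 0 (1 - mm s).
have al01 s : 0 <= al s <= 1.
  by rewrite /al subr_ge0 ge_max ler01 /= gerBl mm0 gerBl le_max lexx.
have al0 s : s <= del -> al s = 0.
  move=> h; have -> : al s = 1 - Num.max 0 (1 - mm s) by [].
  have -> : mm s = 0 by rewrite /mm (max_idPl _) // subr_le0 ler_pdivrMr // mul1r.
  by rewrite subr0 (max_idPr ler01) subrr.
have al1 s : 2 * del <= s -> al s = 1.
  move=> h; rewrite /al (max_idPl _) ?subr0 // subr_le0 /mm le_max; apply/orP; right.
  by rewrite lerBrDr ler_pdivlMr //; lra.
have alp s : del < s -> 0 < al s.
  move=> h; rewrite /al subr_gt0 gt_max ltr01 /= gtrBl /mm lt_max; apply/orP; right.
  by rewrite subr_gt0 ltr_pdivlMr // mul1r.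
pose Z (y : 'rV[R]_N) := rsubmx y : 'rV[R]_d; pose tt (y : 'rV[R]_N) := lsubmx y : 'rV[R]_1.
pose V (z : 'rV[R]_d) := z + del *: (z *m rot k).
pose Y y : 'rV[R]_N := row_mx (tt y) (al `|Z y| *: V (Z y)).
have zJ (z : 'rV[R]_d) : dot z (z *m rot k) = 0.
  have : dot (z *m rot k) z = - dot z (z *m rot k) by rewrite dot_mulmxl rot_tr mulmxN dotNr.
  by rewrite dotC; lra.
have rJ (z : 'rV[R]_d) : z *m rot k = 0 -> z = 0.
  by move=> /(congr1 (mulmx^~ (rot k))); rewrite mul0mx -mulmxA rot_sq mulmxN mulmx1 => /eqP; rewrite oppr_eq0 => /eqP.
have ysp y : dot y y = dot (tt y) (tt y) + dot (Z y) (Z y) by rewrite -{1 2}(hsubmxK y) dot_row_mx.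
have Zle y : `|Z y| <= `|y| by apply: norm_mx_le => // i j; rewrite mxE norm_mx_entry.
have Y0 y : dot y y = 1 -> Y y != 0.
  move=> ys; apply/eqP => E; have := congr1 lsubmx E; have := congr1 rsubmx E.
  rewrite row_mxKl row_mxKr !linear0 => h2 h1; have [hz|hz] := leP `|Z y| del.
    have := ysp y; rewrite ys h1 dot0l add0r => e1.
    have := dot_norm (Z y) (Z y); rewrite -e1 normr1 => e2; have e0 : 0 <= `|Z y| by [].
    have e3 : d%:R <= n1 by rewrite /n1 ler_nat.
    have e4 : d%:R * (`|Z y| * `|Z y|) <= n1 * (del * del) by rewrite ler_pM // ?mulr_ge0 // ler_pM.
    by have := deln; nra.
  move/eqP: h2; rewrite scaler_eq0 gt_eqF ?alp //= => /eqP h2.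
  have := congr1 (dot (Z y)) h2; rewrite /V dotDr dotZr zJ mulr0 addr0 dot0r => /eqP; rewrite dot_eq0 => /eqP z0.
  by move: hz; rewrite z0 normr0 ltNge ltW.
have al_cont (s : R) : continuous_at s al.
  apply: cont_sub; first exact: cont_cst.
  apply: cont_max0; apply: cont_sub; first exact: cont_cst.
  apply: cont_max0; apply: cont_sub; last exact: cont_cst.
  by apply: cont_mul; [exact: cont_id|exact: cont_cst].
have Zc (y : 'rV[R]_N) : continuous_at y Z.
  by apply: cont_mx => i j; rewrite (_ : (fun y => _) = fun y : 'rV[R]_N => y i (rshift 1 j)); [apply: cont_entry; exact: cont_id|apply/funext => z; rewrite mxE].
have tc (y : 'rV[R]_N) : continuous_at y tt by apply: cont_lsubmx; exact: cont_id.
have Yc (y : 'rV[R]_N) : continuous_at y Y.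
  apply: cont_row_mx; first exact: tc.
  apply: cont_scale; first by apply: (@cont_comp _ _ _ (fun y => `|Z y|) al); [apply: cont_norm; exact: Zc|exact: al_cont].
  apply: cont_add; first exact: Zc.
  by apply: cont_scale; [exact: cont_cst|apply: mulmx_continuous; [exact: Zc|exact: cont_cst]].
pose f x := r (Y (iot x)).
have iotf x : iot (f x) = nrm (Y (iot x)) by rewrite /iot /f /r g0K hP // Y0 // iot_sphere.
have f_cont : continuous f.
  move=> x; apply: (@cont_comp _ _ _ (fun x => P (Y (iot x))) g0); last exact: g0_cont.
  apply: (@cont_comp _ _ _ (fun x => Y (iot x)) P); last by apply: Pc; rewrite Y0 // iot_sphere.
  by apply: cont_comp; [exact: iot_cont|exact: Yc].
have f_near x : `|iot (f x) - iot x| < eta.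
  rewrite iotf; set y := iot x; have ys : dot y y = 1 by exact: iot_sphere.
  have [ny _] := iot_norm x; have YY := Y0 _ ys.
  have kap : `|Y y - y| <= 3 * del.
    have -> : Y y - y = row_mx 0 (al `|Z y| *: V (Z y) - Z y).
      by rewrite -{2}(hsubmxK y) /Y opp_row_mx add_row_mx subrr.
    have -> : `|row_mx (0 : 'rV[R]_1) (al `|Z y| *: V (Z y) - Z y)| <= 3 * del = true; last by [].
    apply: norm_mx_le => [|i j]; first lra.
    rewrite ord1; case: (split_ordP j) => l ->; first by rewrite row_mxEl mxE normr0; lra.
    rewrite row_mxEr; apply: le_trans (norm_mx_entry _ 0 l) _.
    have -> : al `|Z y| *: V (Z y) - Z y = (al `|Z y| * del) *: (Z y *m rot k) - (1 - al `|Z y|) *: Z y.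
      by rewrite /V; move: (Z y *m rot k) => w; apply/rowP => i'; rewrite !mxE; ring.
    apply: le_trans (ler_normB _ _) _; rewrite normrZ [X in _ + X <= _]normrZ.
    have [a0 a1] := andP (al01 `|Z y|).
    have l1 : `|al `|Z y| * del| * `|Z y *m rot k| <= del.
      rewrite ger0_norm ?mulr_ge0 ?(ltW del0) // -[leRHS]mulr1 ler_pM // ?mulr_ge0 ?(ltW del0) //.
        by rewrite ler_piMl // ltW.
      by apply: le_trans (norm_rot _) _; apply: le_trans (Zle _) ny.
    have l2 : `|1 - al `|Z y| | * `|Z y| <= 2 * del.
      rewrite ger0_norm ?subr_ge0 //; have [hz|hz] := leP (2 * del) `|Z y|.
        by rewrite al1 // subrr mul0r; lra.
      by apply: le_trans (_ : 1 * `|Z y| <= _); [rewrite ler_wpM2r //; lra|rewrite mul1r ltW].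
    lra.
  set rho := Num.sqrt (dot (Y y) (Y y)).
  have rho0 : 0 < rho by rewrite sqrtr_gt0 dot_gt0.
  have rho2 : rho ^+ 2 = dot (Y y) (Y y) by rewrite sqr_sqrtr // dot_ge0.
  have Yrho : `|Y y| <= rho.
    have := norm_dot (Y y); rewrite -rho2 => h; rewrite -(@ler_pXn2r _ 2) ?nnegrE //; exact: ltW.
  have dd : `|rho ^+ 2 - 1| <= n1 * (3 * del * 3).
    have : dot (Y y - y) (Y y + y) = dot (Y y) (Y y) - dot y y.
      by rewrite !(dotDl, dotDr, dotNl) (dotC y (Y y)); ring.
    rewrite ys -rho2 => <-; apply: le_trans (dot_norm _ _) _; rewrite ler_wpM2l ?(ltW n1p) // ler_pM //.
    apply: le_trans (ler_normD _ _) _; have := ler_normD (Y y - y) y; rewrite subrK => h.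
    by lra.
  have dr : `|1 - rho| <= n1 * (3 * del * 3).
    apply: le_trans dd; have -> : rho ^+ 2 - 1 = - ((1 - rho) * (1 + rho)) by ring.
    rewrite normrN normrM ler_peMr //; rewrite ger0_norm; lra.
  have -> : nrm (Y y) - y = ((1 - rho) / rho) *: Y y + (Y y - y).
    by rewrite /nrm -/rho; move: (Y y) => w; apply/rowP => i; rewrite !mxE; field; rewrite gt_eqF.
  apply: le_lt_trans (ler_normD _ _) _; rewrite normrZ normrM normfV (gtr0_norm rho0).
  have : `|1 - rho| / rho * `|Y y| <= `|1 - rho|.
    by rewrite -mulrA ler_piMr // mulrC ler_pdivrMr // mul1r.
  move=> l3; apply: le_lt_trans (lerD l3 kap) _; rewrite /eta -[n1^-1]div1r ltr_pdivlMr //.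
  apply: le_lt_trans (ler_wpM2r (ltW n1p) (lerD dr (lexx (3 * del)))) _.
  have -> : (n1 * (3 * del * 3) + 3 * del) * n1 = (12 * n1 * (3 * n1 + 1) * del) / 4 by field.
  by rewrite delE; lra.
have poles y : dot y y = 1 -> Z y = 0 -> y = pole 1 \/ y = pole (-1).
  move=> ys z0; have := ysp y; rewrite ys z0 dot0l addr0 /dot big_ord1 -expr2 => /esym/eqP.
  have yE s : tt y 0 0 = s -> y = pole s.
    move=> h; rewrite -(hsubmxK y) -/(tt y) -/(Z y) z0 /pole; congr row_mx.
    by rewrite [LHS]mx11_scalar h.
  by rewrite sqrf_eq1 => /orP[]/eqP/yE; [left|right].
have fixP x : f x = x -> x \in [:: g0 NP; g0 SP] ++ [::].
  move=> /(congr1 iot); rewrite iotf; set y := iot x => E.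
  have ys : dot y y = 1 by exact: iot_sphere.
  have rho0 : Num.sqrt (dot (Y y) (Y y)) != 0 by rewrite sqrtr_eq0 -ltNge dot_gt0 // Y0.
  have z0 : Z y = 0.
    have E2 : al `|Z y| *: V (Z y) = Num.sqrt (dot (Y y) (Y y)) *: Z y.
      have := congr1 rsubmx E; rewrite /nrm linearZ /= row_mxKr => E3.
      transitivity (Num.sqrt (dot (Y y) (Y y)) *: ((Num.sqrt (dot (Y y) (Y y)))^-1 *: (al `|Z y| *: V (Z y)))).
        by rewrite [RHS]scalerA mulfV // scale1r.
      by rewrite E3.
    have [a0|a0] := eqVneq (al `|Z y|) 0.
      by move: E2; rewrite a0 scale0r => /esym/eqP; rewrite scaler_eq0 (negbTE rho0) => /eqP.
    (* Pairing with the rotated vector isolates the rotation term, which forces [Z y] to vanish. *)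
    have := congr1 (dot^~ (Z y *m rot k)) E2; rewrite /V !dotZl dotDl dotZl zJ add0r mulr0 => /eqP.
    by rewrite !mulf_eq0 (negbTE a0) (gt_eqF del0) /= dot_eq0 => /eqP/rJ.
  rewrite cats0 !inE; have [yp|ym] := poles y ys z0.
    by apply/orP; left; apply/eqP; rewrite -(f0K x); congr g0; apply: val_inj; exact: yp.
  by apply/orP; right; apply/eqP; rewrite -(f0K x); congr g0; apply: val_inj; exact: ym.
have he1 (s : R) (Q : set_type (sphere R d)) : s ^+ 2 = 1 -> val Q = pole s -> \forall x \near g0 Q, f x = g0 Q.
  move=> s1 Qs; have iQ : iot (g0 Q) = pole s by rewrite /iot g0K.
  have c1 : continuous_at (g0 Q) (fun x => `|Z (iot x)|).
    by apply: cont_norm; apply: cont_comp; [exact: iot_cont|exact: Zc].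
  have c2 : continuous_at (g0 Q) (fun x => s * tt (iot x) 0 0).
    by apply: cont_mul; [exact: cont_cst|apply: cont_entry; apply: cont_comp; [exact: iot_cont|exact: tc]].
  have h1 : \forall x \near g0 Q, `|Z (iot x)| < del.
    by apply: (near_cont (Q := fun t => t < del) c1); apply: lt_nbhsl; rewrite iQ /Z row_mxKr normr0.
  have h2 : \forall x \near g0 Q, 0 < s * tt (iot x) 0 0.
    apply: (near_cont (Q := fun t : R => 0 < t) c2); apply: lt_nbhsr.
    by rewrite iQ /tt row_mxKl mxE eqxx mulr1n -expr2 s1.
  apply: filterS (filterI h1 h2) => x [x1 x2]; rewrite /f /r; congr g0; apply: val_inj.
  rewrite hP ?Y0 ?iot_sphere // Qs /nrm /Y al0 ?(ltW x1) // scale0r dot_row_mx dot0l addr0.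
  have E : `|tt (iot x) 0 0|^-1 *: tt (iot x) = s%:M.
    rewrite [LHS]mx11_scalar mxE; congr (_%:M); move: (tt (iot x) 0 0) x2 => t st.
    have t0 : t != 0 by apply: contraTneq st => ->; rewrite mulr0 ltxx.
    have st1 : `|t| = s * t.
      have e : `|s| = 1 by apply/eqP; rewrite -sqrp_eq1 // real_normK ?num_real // s1.
      by rewrite -(gtr0_norm st) normrM e mul1r.
    have s0 : s != 0 by apply: contraTneq st => ->; rewrite mul0r ltxx.
    by rewrite st1 invfM -mulrA mulVf // mulr1; apply: (mulfI s0); rewrite mulfV // -expr2 s1.
  by rewrite /dot big_ord1 -expr2 sqrtr_sqr scale_row_mx scaler0 E.
have := @euler_of_displacement R T 'rV[R]_N iot r eta T_compact iot_cont eta0 rK rc f f_cont f_near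
  [:: g0 NP; g0 SP] [::] (fun p _ => p) (fun _ _ => 0).
rewrite /= subr0; apply=> //.
- rewrite inE andbT; apply/eqP => /(congr1 f0); rewrite !g0K => /(congr1 val) /= /(congr1 (fun y => tt y 0 0)).
  by rewrite /tt /pole !row_mxKl !mxE !eqxx !mulr1n; lra.
- move=> p; rewrite !inE => /orP[]/eqP ->; first by apply: (he1 1); rewrite ?expr1n.
  by apply: (he1 (-1)); rewrite ?sqrrN ?expr1n.
Qed.
End EvenSphere.

Theorem euler_even_sphere (R : realType) (T : topologicalType) k d : d = (k + k)%N -> compact [set: T] ->
  homeomorphic T (set_type (sphere R d)) -> euler_characteristic R T = 2.
Proof. by move=> -> cT [f [g [cf cg fK gK]]]; exact: (euler_even_sphere_aux cT cf cg fK gK). Qed.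

(** * Complex points *)

Section Hyperplane.
Context {R : realType} {n : nat}.

(** The complex linear form with real part [dot nu]; its imaginary part is then
    [dot (nu *m rot n)]. *)
Definition conj_form (nu : 'rV[R]_(n + n)) : 'cV[C R]_n :=
  \col_j Complex (nu 0 (lshift n j)) (- nu 0 (rshift n j)).

Lemma Re_sum (I : Type) (s : seq I) (F : I -> R[i]) : complex.Re (\sum_(i <- s) F i) = \sum_(i <- s) complex.Re (F i).
Proof. by elim: s => [|i s IH]; rewrite ?big_nil // !big_cons -IH; case: (F i) => ? ?; case: (\sum_(_ <- _) _). Qed.

Lemma Im_sum (I : Type) (s : seq I) (F : I -> R[i]) : complex.Im (\sum_(i <- s) F i) = \sum_(i <- s) complex.Im (F i).
Proof. by elim: s => [|i s IH]; rewrite ?big_nil // !big_cons -IH; case: (F i) => ? ?; case: (\sum_(_ <- _) _). Qed.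

Lemma rot_mul (nu : 'rV[R]_(n + n)) j : (nu *m rot n) 0 (lshift n j) = - nu 0 (rshift n j) /\
  (nu *m rot n) 0 (rshift n j) = nu 0 (lshift n j).
Proof.
have -> : nu *m rot n = row_mx (- rsubmx nu) (lsubmx nu).
  by rewrite -{1}(hsubmxK nu) /rot mul_row_block !mulmx0 add0r addr0 mulmx1 mulmxN mulmx1.
by rewrite row_mxEl row_mxEr !mxE.
Qed.

Lemma conj_form_mul nu (v : 'rV[C R]_n) :
  v *m conj_form nu = 0 <-> dot nu (realify v) = 0 /\ dot (nu *m rot n) (realify v) = 0.
Proof.
have r1 j : realify v 0 (lshift n j) = complex.Re (v 0 j) by rewrite /realify row_mxEl mxE.
have r2 j : realify v 0 (rshift n j) = complex.Im (v 0 j) by rewrite /realify row_mxEr mxE.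
have h : (v *m conj_form nu) 0 0 = Complex (dot nu (realify v)) (dot (nu *m rot n) (realify v)).
  rewrite mxE; apply/eqP; rewrite eq_complex Re_sum Im_sum /dot !big_split_ord /= -!big_split /=.
  apply/andP; split; apply/eqP; apply: eq_bigr => j _; have [m1 m2] := rot_mul nu j;
    rewrite ?m1 ?m2 r1 r2 !mxE; case: (v 0 j) => a b /=; ring.
split=> [h0|[h1 h2]].
  by move: h; rewrite h0 mxE => -[<- <-].
by apply/matrixP => i j; rewrite !ord1 h h1 h2 mxE.
Qed.

Lemma conj_form_neq0 nu : nu != 0 -> conj_form nu != 0.
Proof.
apply: contra => /eqP h; apply/eqP/rowP => j; case: (split_ordP j) => k ->; rewrite mxE.
  by have := congr1 (fun A : 'cV_n => complex.Re (A k 0)) h; rewrite !mxE.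
have := congr1 (fun A : 'cV_n => complex.Im (A k 0)) h; rewrite !mxE /= => /eqP.
by rewrite oppr_eq0 => /eqP.
Qed.

Lemma dot_rot (nu w : 'rV[R]_(n + n)) : dot (nu *m rot n) w = - dot nu (w *m rot n).
Proof. by rewrite dot_mulmxl rot_tr mulmxN dotNr. Qed.

Lemma dot_rot_self (nu : 'rV[R]_(n + n)) : dot (nu *m rot n) nu = 0.
Proof. by have := dot_rot nu nu; rewrite (dotC nu); lra. Qed.

Lemma rot_neq0 (nu : 'rV[R]_(n + n)) : nu != 0 -> nu *m rot n != 0.
Proof.
apply: contra => /eqP h; have := congr1 (mulmx^~ (rot n)) h.
by rewrite -mulmxA rot_sq mul0mx mulmxN mulmx1 => /eqP; rewrite oppr_eq0.
Qed.
End Hyperplane.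

(** Dimension count: the rows of [M] and the two orthogonal normals form a basis, in which [w] has
    no normal coordinates. *)
Lemma orth_span (R : realType) d N (eN : N = (d + (1 + 1))%N) (M : 'M[R]_(d, N)) (a b w : 'rV[R]_N) :
  row_free M -> a != 0 -> b != 0 -> dot a b = 0 -> (forall k, dot a (k *m M) = 0) -> (forall k, dot b (k *m M) = 0) ->
  dot a w = 0 -> dot b w = 0 -> (w <= M)%MS.
Proof.
move=> fM a0 b0 ab aM bM aw bw.
have comb (k : 'rV[R]_(d + (1 + 1))) : k *m col_mx M (col_mx a b) =
    lsubmx k *m M + (lsubmx (rsubmx k) 0 0 *: a + rsubmx (rsubmx k) 0 0 *: b).
  rewrite -{1}(hsubmxK k) -{1}(hsubmxK (rsubmx k)) !mul_row_col.
  by rewrite (mx11_scalar (lsubmx (rsubmx k))) (mx11_scalar (rsubmx (rsubmx k))) !mul_scalar_mx !mxE /= !mulr1n.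
have cs (k : 'rV[R]_(d + (1 + 1))) w' : dot a w' = 0 -> dot b w' = 0 -> w' = k *m col_mx M (col_mx a b) ->
    w' = lsubmx k *m M.
  move=> h1 h2; rewrite comb => E; move: h1 h2; rewrite {1 2}E !dotDr !dotZr aM bM ab (dotC b) ab !mulr0 !add0r addr0.
  move=> /eqP; rewrite mulf_eq0 dot_eq0 (negbTE a0) orbF => /eqP z1.
  move=> /eqP; rewrite mulf_eq0 dot_eq0 (negbTE b0) orbF => /eqP z2.
  by rewrite E z1 z2 !scale0r !addr0.
have fB : row_free (col_mx M (col_mx a b)).
  rewrite -kermx_eq0; apply/eqP/row_matrixP => i; rewrite row0.
  set k := row i _; have kB : k *m col_mx M (col_mx a b) = 0 by apply/eqP; rewrite -sub_kermx row_sub.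
  have k1 : lsubmx k = 0.
    by apply: (row_free_inj fM); rewrite mul0mx -(cs k 0) ?dot0r.
  move: kB; rewrite comb k1 mul0mx add0r => E.
  have := congr1 (dot a) E; have := congr1 (dot b) E.
  rewrite !dotDr !dotZr ab (dotC b) ab !dot0r !mulr0 add0r addr0.
  move=> /eqP; rewrite mulf_eq0 dot_eq0 (negbTE b0) orbF => /eqP z2.
  move=> /eqP; rewrite mulf_eq0 dot_eq0 (negbTE a0) orbF => /eqP z1.
  rewrite -(hsubmxK k) k1 -(hsubmxK (rsubmx k)) (mx11_scalar (lsubmx _)) (mx11_scalar (rsubmx (rsubmx k))) z1 z2.
  by rewrite !raddf0 !row_mx0.
have : (w <= col_mx M (col_mx a b))%MS.
  by apply: submx_full; rewrite /row_full (eqP fB) eN.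
by move=> /submxP[k E]; apply/submxP; exists (lsubmx k); exact: cs.
Qed.

(** * Counting the complex points *)

Section Complex.
Context {R : realType} {n : nat} (hn : (3 <= n)%N) (S : set 'rV[C R]_n)
  (A : set (set 'rV[R]_(2 * n - 2) * ('rV[R]_(2 * n - 2) -> 'rV[C R]_n))).
Hypothesis S_oriented : orientation S A.
Hypothesis S_compact : compact S.
Hypothesis S_points : forall p, complex_point S p -> flat S p /\ (special_elliptic S p \/ special_1hyperbolic S p).
Local Notation T := (set_type S).
Local Notation d := (2 * n - 2)%N.
Local Notation iot := (@embed R n S).

(** Frames come from the oriented atlas only, so that two of them at a point differ by a positive
    determinant. *)
Definition frame (x : T) (M : 'M[R]_(d, n + n)) := exists W phi u,
  [/\ A (W, phi), W u, phi u = val x & M = jacobian (realify \o phi) u].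

Lemma eN : (n + n = d + (1 + 1))%N. Proof. by lia. Qed.

Let orP := S_oriented.

Lemma frame_chart (x0 : T) : exists W phi u0 eta theta, [/\ A (W, phi), W u0, phi u0 = val x0,
  chart iot x0 eta theta u0 (fun u => jacobian (realify \o phi) u) &
  (forall u, W u -> frame (eta u) (jacobian (realify \o phi) u)) /\
  \forall x \near x0, [/\ W (theta x), phi (theta x) = val x & {for x, continuous theta}]].
Proof.
have [h1 h2 _] := orP; have [|W [phi [AW [u0 Wu0 pu0]]]] := h2 (val x0); first exact: set_valP.
have [eta [theta [ch em nr]]] := param_chart (h1 _ _ AW) Wu0 pu0.
exists W, phi, u0, eta, theta; split=> //; split=> // u Wu; exists W, phi, u; split=> //.
by apply: realify_inj; rewrite -em.
Qed.

Lemma param_tanv W phi u0 (x : T) k : local_parametrization (d := d) S W phi -> W u0 -> phi u0 = val x ->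
  tanv iot x (k *m jacobian (realify \o phi) u0).
Proof.
move=> lp Wu pu; have [eta [theta [ch _ _]]] := param_chart lp Wu pu.
have [e e0 he] := chart_tanv ch; rewrite -{1}(chart_eta0 ch).
by apply: he; rewrite subrr normr0.
Qed.

Lemma frame_tanv x M k : frame x M -> tanv iot x (k *m M).
Proof. by move=> [W [phi [u [AW Wu pu ->]]]]; have [h1 _ _] := orP; exact: param_tanv (h1 _ _ AW) Wu pu. Qed.

Lemma frame_free x M : frame x M -> row_free M.
Proof. by move=> [W [phi [u [AW Wu pu ->]]]]; have [h1 _ _] := orP; have [_ _ h _ _] := h1 _ _ AW; exact: h. Qed.

Lemma frame_loc (p : T) : exists Dm : T -> 'M[R]_(d, n + n),
  \forall x \near p, [/\ frame x (Dm x), row_free (Dm x) & continuous_at x Dm].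
Proof.
have [W [phi [u0 [eta [theta [AW Wu0 pu0 ch [hf nr]]]]]]] := frame_chart p.
exists (fun x => jacobian (realify \o phi) (theta x)).
apply: (@filterS _ (nbhs p) (nbhs_filter p) _ _ _ nr) => x [h1 h2 h3].
have fx : frame x (jacobian (realify \o phi) (theta x)) by exists W, phi, (theta x).
split=> //; first exact: frame_free fx.
have [lp _ _] := orP; have [oW sm _ _ _] := lp _ _ AW.
apply: (@cont_comp _ _ _ theta (fun u => jacobian (realify \o phi) u)) => //.
exact: uqr_cont (Ck2_uqr oW h1 (sm 2%N)).
Qed.

Lemma frame_tr x M M' : frame x M -> frame x M' -> exists2 J, 0 < \det J & M = J *m M'.
Proof.
move=> [W [phi [u [AW Wu pu ->]]]] [W' [psi [v [AW' Wv pv ->]]]]; have [_ _ h] := orP.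
by apply: (h W phi W' psi) => //; rewrite pu pv.
Qed.

Lemma all_charts (p : T) : exists eta theta u0 (D : 'rV[R]_d -> 'M[R]_(d, n + n)), chart iot p eta theta u0 D.
Proof.
have [W [phi [u0 [eta [theta [_ _ _ ch _]]]]]] := frame_chart p.
by exists eta, theta, u0, (fun u => jacobian (realify \o phi) u).
Qed.

Let T_compact := set_type_compact S_compact.

Lemma normal_field (x0 : T) : exists nu : T -> 'rV[R]_(n + n), [/\ continuous nu, (forall x, nu x != 0) &
  forall x M k, frame x M -> dot (nu x) (k *m M) = 0].
Proof.
have [r [et [et0 rK rc orth hmin]]] := nearest_point_retraction T_compact (@embed_cont R n S) (@embed_emb R n S) (@embed_inj R n S)
  (fun p => let: ex_intro eta (ex_intro theta (ex_intro u0 (ex_intro D C))) := all_charts p in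
     chart_tan_approx (@embed_emb R n S) (@embed_cont R n S) C) x0.
apply: (normal_section_gen eN T_compact (@embed_cont R n S) et0 rK rc (fr := frame)) => //.
- by move=> y M k fM; apply: orth; exact: frame_tanv.
- exact: frame_loc.
- exact: frame_tr.
Qed.

Variable nu : T -> 'rV[R]_(n + n).
Hypothesis nu_cont : continuous nu.
Hypothesis nu_neq0 : forall x, nu x != 0.
Hypothesis nu_perp : forall x M k, frame x M -> dot (nu x) (k *m M) = 0.
Let X x := nu x *m rot n.

Lemma X_cont : continuous X.
Proof. by move=> x; apply: mulmx_continuous; [exact: nu_cont|exact: cont_cst]. Qed.

Lemma nu_tanv x tau : tanv iot x tau -> dot (nu x) tau = 0.
Proof.
have [W [phi [u0 [eta [theta [AW Wu0 pu0 ch [hf _]]]]]]] := frame_chart x.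
have [e e0 he] := chart_perp_tanv (@embed_emb R n S) (@embed_cont R n S) ch => ht.
have ex := chart_eta0 ch; apply: (he u0); rewrite ?subrr ?normr0 ?ex // => k.
by rewrite -ex; apply: nu_perp; exact: hf.
Qed.

(** A complex tangent space is stable under [i], and [nu] is normal to it. Conversely, tangent
    vectors orthogonal to both [nu] and its multiple by [i] lie in the kernel of [conj_form (nu x)],
    and dimension gives equality. *)
Lemma complex_pointP (x : T) : complex_point S (val x) <-> forall tau, tanv iot x tau -> dot (X x) tau = 0.
Proof.
have [W [phi [u0 [eta [theta [AW Wu0 pu0 ch [hf _]]]]]]] := frame_chart x.
have ex := chart_eta0 ch; have fx := hf u0 Wu0; rewrite ex in fx.
set M := jacobian _ _ in fx; have fM := frame_free fx.
have [lp _ _] := orP; split=> [[_ [l l0 El]] tau ht|hx].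
  have span w : tanv iot x w -> (w <= M)%MS -> dot (X x) w = 0.
    move=> hw wM; rewrite /X dot_rot.
    have : tangent_space d S (val x) (cplx w).
      by exists W, phi, u0; apply: And4; [exact: (lp _ _ AW)|exact: Wu0|exact: pu0|rewrite cplxK; exact: wM].
    rewrite El /= => wl; have : tangent_space d S (val x) ('i *: cplx w).
      by rewrite El /= -scalemxAl wl scaler0.
    move=> [W' [psi [v [lp' Wv pv /submxP[k Ek]]]]].
    have tv := param_tanv k lp' Wv pv.
    by have := nu_tanv tv; rewrite -Ek realify_i cplxK => ->; rewrite oppr0.
  have [->|dtau] := eqVneq (dot (X x) tau) 0 => //; exfalso.
  have [e e0 he] := chart_perp_tanv (@embed_emb R n S) (@embed_cont R n S) ch.
  move/eqP: dtau; apply; apply: (he u0); rewrite ?subrr ?normr0 ?ex // => k.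
  by apply: span; [exact: frame_tanv fx|exact: submxMl].
split; first exact: set_valP.
exists (conj_form (nu x)); first exact: conj_form_neq0.
apply/seteqP; split=> v /=.
  move=> [W' [psi [u [lp' Wu pu /submxP[k Ek]]]]]; apply/conj_form_mul.
  have tv := param_tanv k lp' Wu pu; rewrite Ek; split; first exact: nu_tanv.
  exact: hx.
move=> /conj_form_mul[v1 v2]; exists W, phi, u0; apply: And4; [exact: (lp _ _ AW)|exact: Wu0|exact: pu0|].
apply: (orth_span eN fM (nu_neq0 x) (rot_neq0 (nu_neq0 x))) => //.
- by rewrite dotC dot_rot_self.
- by move=> k; apply: nu_perp.
- by move=> k; apply: hx; exact: frame_tanv fx.
Qed.

Lemma noncomplex_tanv x : ~ complex_point S (val x) -> exists2 tau, tanv iot x tau & dot (X x) tau <> 0.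
Proof.
move=> nc; apply: contrapT => h; apply: nc; apply/complex_pointP => tau ht.
by apply: contrapT => h'; apply: h; exists tau.
Qed.

Lemma special_complex p lam : special S p lam -> complex_point S p.
Proof. by case=> -[]. Qed.

Lemma special_models (p : T) (lam : 'I_n.-1 -> R) : special S (val p) lam ->
  ((forall j, lam j < 1) -> exists2 q : @locdata R T (n + n) d, model iot X p q & ld_G q 0 = 1%:M) /\
  (forall j0, 1 < lam j0 -> (forall j, j != j0 -> lam j < 1) -> exists q : @locdata R T (n + n) d,
    [/\ model iot X p q, ld_v q *m ld_l q = 1%:M & ld_G q 0 = 1%:M - 2 *: (ld_l q *m ld_v q)]).
Proof.
move=> [_ lam0 le]; have [Phi [D' [h1 h2 h3 h4 h5]]] := local_equation_graph le.
have [W [phi [u0 [eta [theta [AW Wu0 pu0 ch [hf _]]]]]]] := frame_chart p.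
have [lp _ _] := orP; have [oW _ _ _ _] := lp _ _ AW.
have e1 : (n + n = n.-1 + n.-1 + 2)%N by lia.
have e2 : (d = n.-1 + n.-1)%N by lia.
apply: (special_model_gen e1 e2 (@embed_cont R n S) ch (rot_tr n) nu_cont (nu_neq0 p) _ h1 h2 h3 h4 h5 lam0).
have : \forall u \near u0, W u by exact: open_nbhs_nbhs.
by apply: filterS => u Wu k; apply: nu_perp; exact: hf.
Qed.

Lemma complex_model (p : T) : complex_point S (val p) -> exists q : @locdata R T (n + n) d, model iot X p q.
Proof.
move=> /S_points[_ [[lam sp l1]|[lam sp [j0 l1 l2]]]]; have [h1 h2] := special_models sp.
  by have [q mq _] := h1 l1; exists q.
by have [q [mq _ _]] := h2 _ l1 l2; exists q.
Qed.

(** Around a complex point the local model pairs [X] negatively with some tangent vector at every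
    other nearby point; around any other point, nonzero pairing is an open condition. *)
Lemma complex_isolated (x : T) : \forall y \near x, complex_point S (val y) -> y = x.
Proof.
have [cx|ncx] := pselect (complex_point S (val x)).
  have [[eta theta u0 D G l v] [/= ch cG fG neg]] := complex_model cx.
  have [tp near1 near2 _ _] := ch; have [e e0 he] := chart_tanv ch.
  have nd : \forall u \near u0, `|u - u0| < e by exact: near_center.
  have n1 := chart_near ch nd; have n2 := chart_near ch neg.
  apply: (@filterS _ (nbhs x) (nbhs_filter x) _ _ _ (filterI near1 (filterI n1 n2))) => y [[ey _] [y1 y2]] cy.
  apply: contrapT => yx; have : theta y <> u0.
    by move=> E; apply: yx; rewrite -ey E; exact: chart_eta0 ch.
  move=> /y2; rewrite ey => hneg; have := he _ ((theta y - u0) *m G 1) y1.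
  by rewrite ey => /((complex_pointP y).1 cy) hz; rewrite /X in hz; rewrite hz ltxx in hneg.
have [Dm hD] := frame_loc x; have [f1 f2 f3] := nbhs_singleton hD.
have [k hk] : exists k, dot (X x) (k *m Dm x) <> 0.
  apply: contrapT => h; apply: ncx; apply/complex_pointP => tau ht.
  have [W [phi [u0 [eta [theta [AW Wu0 pu0 ch [hf _]]]]]]] := frame_chart x.
  have [e e0 he] := chart_perp_tanv (@embed_emb R n S) (@embed_cont R n S) ch.
  have ex := chart_eta0 ch; apply: (he u0); rewrite ?subrr ?normr0 ?ex // => k.
  have fx := hf _ Wu0; rewrite ex in fx; have [J _ ->] := frame_tr fx f1.
  by rewrite mulmxA; apply: contrapT => h'; apply: h; exists (k *m J).
have cd : continuous_at x (fun y => dot (X y) (k *m Dm y)).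
  by apply: cont_dot; [exact: X_cont|apply: mulmx_continuous; [exact: cont_cst|]].
have nz : \forall y \near x, dot (X y) (k *m Dm y) != 0.
  apply: (near_cont (Q := fun t => t != 0) cd).
  by apply: (open_nbhs_nbhs (conj (@open_neq _ _) _)); apply/eqP.
apply: (@filterS _ (nbhs x) (nbhs_filter x) _ _ _ (filterI hD nz)) => y [[y1 _ _] /eqP y2] cy.
by exfalso; apply: y2; apply: (complex_pointP y).1 => //; exact: frame_tanv y1.
Qed.

(** By compactness one radius isolates complex points uniformly, so each ball of a finite net
    contains at most one. *)
Lemma complex_finite : exists s : seq T, uniq s /\ forall x, x \in s <-> complex_point S (val x).
Proof.
have cl (x : T) : setT x -> exists2 e : R, 0 < e & \forall y \near x, setT y -> forall z z' : T, complex_point S (val z) -> complex_point S (val z') ->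
    `|iot z - iot y| < e -> `|iot z' - iot y| < e -> z = z'.
  move=> _; have /set_type_nbhsP[e e0 he] := complex_isolated x; exists (e / 2); first by rewrite divr_gt0.
  apply/set_type_nbhsP; exists (e / 2); first by rewrite divr_gt0.
  move=> y yx _ z z' cz cz' zy z'y.
  by rewrite (he z (norm_tri zy yx) cz) (he z' (norm_tri z'y yx) cz').
have [e e0 he] := compact_uniform_pos (Q := fun (y : T) (e : R) => forall z z' : T, complex_point S (val z) -> complex_point S (val z') ->
    `|iot z - iot y| < e -> `|iot z' - iot y| < e -> z = z') T_compact
    (fun x e e' h _ ee z z' c c' h1 h2 => h z z' c c' (lt_le_trans h1 ee) (lt_le_trans h2 ee)) cl.
have [s hs] := finite_net T_compact (@embed_cont R n S) e0.
have /choice[g hg] : forall q : T, exists z, (exists2 z', complex_point S (val z') & `|iot z' - iot q| < e) ->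
    complex_point S (val z) /\ `|iot z - iot q| < e.
  move=> q; have [[z cz zq]|nz] := pselect (exists2 z', complex_point S (val z') & `|iot z' - iot q| < e).
    by exists z.
  by exists q.
exists (undup [seq x <- map g s | `[<complex_point S (val x)>]]); split; first exact: undup_uniq.
move=> x; rewrite mem_undup mem_filter; split=> [/andP[/asboolP]//|cx].
apply/andP; split; first exact/asboolP.
have [q qs qx] := hs x; rewrite distrC in qx.
have [c1 c2] := hg q (ex_intro2 _ _ x cx qx).
by apply/mapP; exists q => //; exact: he q I x (g q) cx c1 qx c2.
Qed.

Theorem special_count : exists s : seq T, [/\ uniq s, forall x, x \in s <-> complex_point S (val x) &
  (count (fun x => `[<special_elliptic S (val x)>]) s)%:Z - (count (fun x => `[<special_1hyperbolic S (val x)>]) s)%:Z =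
  euler_characteristic R T].
Proof.
have [s [us hs]] := complex_finite; exists s; split=> //.
pose ell x := `[<special_elliptic S (val (x : T))>]; pose hyp x := `[<special_1hyperbolic S (val (x : T))>].
have ph (a : pred T) : (forall x, x \in s -> a x -> ell x) -> (forall x, x \in s -> ~~ a x -> hyp x) ->
    euler_characteristic R T = (size (seq.filter a s))%:Z - (size (seq.filter (predC a) s))%:Z.
  move=> hE hH; apply: (poincare_hopf T_compact (@embed_cont R n S) (@embed_emb R n S) (@embed_inj R n S) all_charts X_cont).
  - by rewrite (perm_uniq (permEl (perm_filterC a s))).
  - move=> x; rewrite (perm_mem (permEl (perm_filterC a s))) => xs; apply: noncomplex_tanv => cx.
    by move/negP: xs; apply; apply/hs.
  - move=> p; rewrite mem_filter => /andP[ap ps]; have /asboolP[lam sp l1] := hE p ps ap.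
    by have [h1 _] := special_models sp; exact: h1.
  move=> p; rewrite mem_filter => /andP[/= ap ps]; have /asboolP[lam sp [j0 l1 l2]] := hH p ps ap.
  by have [_ h2] := special_models sp; exact: h2 l1 l2.
have dich x : x \in s -> ell x \/ hyp x.
  by move=> /hs/S_points[_ [h|h]]; [left|right]; exact/asboolP.
(* The formula is applied to two partitions: elliptic points against the others, and others against
   hyperbolic points. As every complex point has at least one type, equality of the two results
   forces the types to be disjoint. *)
have P1 := ph ell (fun x _ h => h) (fun x xs => ltac:(by case: (dich x xs) => ->)).
have P2 : euler_characteristic R T = (size (seq.filter (predC hyp) s))%:Z - (size (seq.filter (predC (predC hyp)) s))%:Z.
  apply: ph => [x xs|x xs]; last by rewrite /= negbK.
  by rewrite /=; case: (dich x xs) => [//|->].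
move: P1 P2; rewrite !size_filter.
have := count_predC ell s; have := count_predC hyp s; have := count_predC (predC hyp) s.
have -> : count (predC (predC hyp)) s = count hyp s by apply: eq_count => x; rewrite /= negbK.
rewrite -/ell -/hyp; move: (euler_characteristic R T) (count ell s) (count hyp s) (count (predC ell) s) (count (predC hyp) s) (size s).
by move=> *; lia.
Qed.
End Complex.

Lemma card_set_seq (V : choiceType) (B : set V) (l : seq V) : uniq l -> (forall p, B p <-> p \in l) ->
  finite_set B /\ #|` fset_set B| = size l.
Proof.
move=> ul hB; have E : B = [set` l] by apply/seteqP; split=> p /=; move/hB.
have fB : finite_set B by rewrite E; exact: finite_seq.
split=> //; have -> : fset_set B = [fset x in l]%fset.
  apply/fsetP => p; rewrite in_fset_set // !inE.
  by apply/idP/idP => [/set_mem/hB|/hB/mem_set].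
by rewrite card_fseq undup_id.
Qed.

Theorem proposition9 (R : realType) (n : nat) (hn : (3 <= n)%N)
  (S : set 'rV[C R]_n)
  (A : set (set 'rV[R]_(2 * n - 2) * ('rV[R]_(2 * n - 2) -> 'rV[C R]_n)))
  (S_submanifold : submanifold (2 * n - 2) S)
  (S_oriented : orientation S A)
  (S_compact : compact S)
  (S_points : forall p, complex_point S p ->
     flat S p /\ (special_elliptic S p \/ special_1hyperbolic S p)) :
  let E := [set p | special_elliptic S p] in
  let H := [set p | special_1hyperbolic S p] in
  [/\ finite_set E, finite_set H,
      #|` fset_set E|%:Z - #|` fset_set H|%:Z = euler_characteristic R S &
      (homeomorphic S (sphere R (2 * n - 2)) ->
         #|` fset_set E|%:Z - #|` fset_set H|%:Z = 2)].
Proof.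
move=> E H.
have [s [us hs cs]] : exists s : seq (set_type S), [/\ uniq s, forall x, x \in s <-> complex_point S (val x) &
    (count (fun x : set_type S => `[<special_elliptic S (val x)>]) s)%:Z -
    (count (fun x : set_type S => `[<special_1hyperbolic S (val x)>]) s)%:Z = euler_characteristic R (set_type S)].
  (* The nearest point retraction takes a base point; for an empty [S] both sides are zero. *)
  have [[x0 _]|S0] := pselect (exists x : set_type S, True).
    have [nu [cn n0 np]] := normal_field hn S_oriented S_compact x0.
    exact: (special_count hn S_oriented S_compact S_points cn n0 np).
  have S0' (x : set_type S) : False by apply: S0; exists x.
  by exists [::]; split=> [//|x|]; [case: (S0' x)|rewrite euler_empty].
have card (B : 'rV[C R]_n -> Prop) : (forall p, B p -> complex_point S p) ->
    finite_set [set p | B p] /\ #|` fset_set [set p | B p]| = count (fun x : set_type S => `[<B (val x)>]) s.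
  move=> hB; pose l := map val (seq.filter (fun x : set_type S => `[<B (val x)>]) s).
  have <- : size l = count (fun x : set_type S => `[<B (val x)>]) s by rewrite size_map size_filter.
  apply: card_set_seq.
    by rewrite map_inj_uniq ?filter_uniq //; exact: val_inj.
  move=> p /=; split=> [Bp|/mapP[x]]; last by rewrite mem_filter => /andP[/asboolP Bx _] ->.
  have cp := hB p Bp; have Sp : S p by case: cp.
  apply/mapP; exists (SigSub (mem_set Sp)) => //; rewrite mem_filter; apply/andP; split; first exact/asboolP.
  exact/hs.
have [fE cE] := card (special_elliptic S) (fun p h => let: ex_intro2 lam sp _ := h in special_complex sp).
have [fH cH] := card (special_1hyperbolic S) (fun p h => let: ex_intro2 lam sp _ := h in special_complex sp).
have EH : #|` fset_set E|%:Z - #|` fset_set H|%:Z = euler_characteristic R S by rewrite /E /H cE cH.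
(* The dimension [2 * n - 2] is twice [n - 1], hence even. *)
split=> // hS; rewrite EH; apply: (euler_even_sphere (k := n.-1)) hS; first by lia.
exact: set_type_compact.
Qed.
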